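(* Let $w$ be an admissible weight on $[0,1)$ with associated weighted Bergman space $A^2_w$ and densities $D_w^{\pm}$ (as defined in the context). (I) A sequence $\Lambda$ of distinct points in $\mathbb{D}$ is an interpolating sequence for $A^2_w$ if and only if it is separated and $D_w^+(\Lambda)<(\log 2)/2$. (S) A separated sequence $\Lambda$ in $\mathbb{D}$ is a sampling sequence for $A^2_w$ if and only if $D_w^+(\Lambda)<\infty$ and $D_w^-(\Lambda)>(\log 2)/2$.
   Context: $\mathbb{D}$ is the open unit disk in $\mathbb{C}$ and $\sigma$ is Lebesgue area measure on $\mathbb{D}$. Admissible weight: $w$ is a positive continuous function on $[0,1)$ with $\int_0^1 w(x)\,dx=1$, for which there is a constant $c>0$ such that $w(1-t)\ge c\,w(1-2t)$ whenever $0<t\le 1/2$. The radii $0\le r_n<1$ are defined by $\int_{r_n}^1 w(x)\,dx=2^{-n}$ for every integer $n\ge 0$ (so $r_0=0$). For $z\in\mathbb{D}$, $n(z)$ denotes the nonnegative integer with $r_{n(z)}\le|z|<r_{n(z)+1}$. $A^2_w$ is the Hilbert space of all functions $f$ analytic in $\mathbb{D}$ with $\int_{\mathbb{D}}|f(z)|^2 w(|z|)\,d\sigma(z)<\infty$, equipped with the (equivalent) norm $$\|f\|_w^2=\sum_{n=1}^\infty 2^{-n}\int_0^{2\pi}|f(r_ne^{it})|^2\,\frac{dt}{2\pi}.$$ $K_z$ denotes the reproducing kernel of $A^2_w$ at $z\in\mathbb{D}$. A sequence $\Lambda=(\lambda_j)$ of distinct points in $\mathbb{D}$ is an interpolating sequence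 for $A^2_w$ if for every sequence $(a_j)$ of complex numbers with $\sum_j |a_j|^2/K_{\lambda_j}(\lambda_j)<\infty$ there is $f\in A^2_w$ with $f(\lambda_j)=a_j$ for all $j$. It is a sampling sequence for $A^2_w$ if there are constants $A,B>0$ such that $$A\|f\|_w^2\le\sum_j\frac{|f(\lambda_j)|^2}{K_{\lambda_j}(\lambda_j)}\le B\|f\|_w^2\qquad\text{for every } f\in A^2_w.$$ The pseudohyperbolic distance is $\varrho(z,\zeta)=\left|\frac{z-\zeta}{1-\overline{\zeta}z}\right|$, and $\Lambda=(\lambda_j)$ is separated if $\inf_{j\ne l}\varrho(\lambda_j,\lambda_l)>0$. For a separated sequence $\Lambda$, $$D_w^{+}(\Lambda)=\limsup_{m\to\infty}\frac1m\sup_{|z|<1}\ \sum_{|\lambda_j|\le r_{n(z)+m}}(1-\varrho(z,\lambda_j)),$$ $$D_w^{-}(\Lambda)=\liminf_{m\to\infty}\frac1m\inf_{|z|<1}\ \sum_{|\lambda_j|< r_{n(z)+m}}(1-\varrho(z,\lambda_j)).$$ *)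

(* Defs.v *)
From HB Require Import structures.
From mathcomp Require Import all_boot all_order all_algebra.
From mathcomp Require Import all_classical all_reals all_analysis.
From mathcomp Require Import complex.

Set Implicit Arguments.
Unset Strict Implicit.
Unset Printing Implicit Defensive.

Import Order.TTheory GRing.Theory Num.Theory.
Import numFieldNormedType.Exports.

Local Open Scope classical_set_scope.
Local Open Scope ring_scope.
Local Open Scope complex_scope.

Section weighted_bergman.
Context {R : realType}.
Implicit Types (w : R -> R) (z u : R[i]) (f g k : R[i] -> R[i]).
Implicit Types (J : set nat) (lam : nat -> R[i]).

(* The modulus as an element of R; `|z| itself lives in R[i]. *)
Definition cabs z : R := complex.Re `|z|.

Definition disc : set R[i] := [set z | cabs z < 1].

(* Only the values of f on the disc matter, here and in every definition below.
   R[i]^o carries the normed-module structure over the field R[i], so that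
   derivability in the direction 1 is complex differentiability. *)
Definition analytic_on_disc f : Prop :=
  forall z, disc z -> derivable (f : R[i]^o -> R[i]^o) z 1.

(* Only the values of w on [0, 1[ matter. *)
Definition admissible w : Prop :=
  [/\ forall x, 0 <= x < 1 -> 0 < w x,
      {within `[0, 1[, continuous w},
      (\int[lebesgue_measure]_(x in `[0%R, 1%R[) (w x)%:E = 1)%E &
      exists2 c : R, 0 < c &
        forall t, 0 < t <= 2^-1 -> c * w (1 - 2 * t) <= w (1 - t)].

(* For an admissible w there is exactly one such radius r. *)
Definition radius w (n : nat) : R := get [set r : R | 0 <= r < 1 /\
  (\int[lebesgue_measure]_(x in `[r, 1%R[) (w x)%:E = (2^-1 ^+ n)%:E)%E].

Definition ring_index w z : nat :=
  get [set n | radius w n <= cabs z < radius w n.+1].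

Definition bergman w : set (R[i] -> R[i]) := [set f | analytic_on_disc f /\
  (\int[(lebesgue_measure \x lebesgue_measure)%E]_(p in
      [set p : R * R | disc (p.1 +i* p.2)])
    (cabs (f (p.1 +i* p.2)) ^+ 2 * w (cabs (p.1 +i* p.2)))%:E < +oo)%E].

Definition on_circle (r t : R) : R[i] := (r * cos t) +i* (r * sin t).

Definition norm2 w f : \bar R :=
  (\sum_(1 <= n <oo) (2^-1 ^+ n)%:E *
    \int[lebesgue_measure]_(t in `[0%R, (2 * pi)%R])
      (cabs (f (on_circle (radius w n) t)) ^+ 2 / (2 * pi))%:E)%E.

Definition circle_mean (r : R) f : R[i] :=
  (\int[lebesgue_measure]_(t in `[0, 2 * pi])
     (complex.Re (f (on_circle r t)) / (2 * pi))) +i*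
  (\int[lebesgue_measure]_(t in `[0, 2 * pi])
     (complex.Im (f (on_circle r t)) / (2 * pi))).

(* The inner product inducing norm2 (by polarization), linear in f. *)
Definition inner_w w f g : R[i] :=
  limn (fun N => \sum_(1 <= n < N)
    (2^-1 ^+ n) * circle_mean (radius w n) (fun z => f z * (g z)^*) : R[i]^o).

(* k is determined on the disc by this property. *)
Definition reproducing_at w z k : Prop :=
  bergman w k /\ forall f, bergman w f -> f z = inner_w w f k.

Definition rkernel w z : R[i] -> R[i] := xget (fun=> 0) (reproducing_at w z).

(* K_z(z) is a positive real number. *)
Definition kernel_diag w z : R := complex.Re (rkernel w z z).

(* A finite or infinite sequence is a family lam indexed by a set J of
   natural numbers; the values of lam outside J are irrelevant. *)
Definition distinct_points_of_disc J lam : Prop :=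
  (forall j, J j -> disc (lam j)) /\ set_inj J lam.

Definition interpolating w J lam : Prop :=
  forall a : nat -> R[i],
  (\esum_(j in J) (cabs (a j) ^+ 2 / kernel_diag w (lam j))%:E < +oo)%E ->
  exists2 f, bergman w f & forall j, J j -> f (lam j) = a j.

Definition sampling w J lam : Prop :=
  exists A B : R, [/\ 0 < A, 0 < B & forall f, bergman w f ->
    let S := \esum_(j in J)
      (cabs (f (lam j)) ^+ 2 / kernel_diag w (lam j))%:E in
    (A%:E * norm2 w f <= S)%E /\ (S <= B%:E * norm2 w f)%E].

Definition pseudohyp z u : R := cabs ((z - u) / (1 - u^* * z)).

(* The infimum is +oo when J has at most one element. *)
Definition separated_points J lam : Prop :=
  (0 < ereal_inf [set (pseudohyp (lam p.1) (lam p.2))%:E |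
         p in [set p : nat * nat | [/\ J p.1, J p.2 & p.1 <> p.2]]])%E.

Definition upper_density w J lam : \bar R :=
  limn_esup (fun m => ((m%:R^-1 : R)%:E * ereal_sup [set
    \esum_(j in [set j | J j /\
                  (cabs (lam j) <= radius w (ring_index w z + m))%R])
      (1 - pseudohyp z (lam j))%:E | z in disc])%E).

Definition lower_density w J lam : \bar R :=
  limn_einf (fun m => ((m%:R^-1 : R)%:E * ereal_inf [set
    \esum_(j in [set j | J j /\
                  (cabs (lam j) < radius w (ring_index w z + m))%R])
      (1 - pseudohyp z (lam j))%:E | z in disc])%E).

End weighted_bergman.

(* Main.v *)
(** Let Q_n(f) be the mean of |f|^2 over the circle |z| = r_n, so that the squared norm is
    the sum of 2^-n Q_n(f), and K_z(z) is comparable with 2^n(z) / (1 - |z|^2).  Up to bounded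
    terms the logarithm of a Blaschke product at z is minus the sum of 1 - rho(z, l), because
    points with rho(z, l) small are bounded in number on each ring; both density conditions
    compare such a product over the next m rings with the factor 2^(-m/2) that the norm allows.

    Interpolation.  If the upper density is small, the data on the n-th ring are interpolated
    by z^(M_n) F_n, where F_n is a Hardy space interpolant vanishing at all points of modulus
    at most r_(n+m) outside that ring and M_n of order 1 / (1 - r_n) localises to it; the
    density makes the errors on the later rings sum to a fraction of the data, and one
    iterates.  Conversely, a gliding hump makes the interpolation constant uniform, which
    yields for each z a function h with h(z) = 1, vanishing on the points away from z, of the
    smallest possible norm.  Dividing out its zeros on |z| = r_N bounds the sum of
    log 1/rho(z, l) over |l| < r_N by (N - n(z)) log(2)/2; choosing N among m candidates gains
    log(m)/2, and the maximum principle applied to inverse Blaschke products propagates the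
    gain from one block of rings to the next.

    Sampling.  For necessity, f is the Blaschke product of the points of modulus less than r_N
    divided by 1 - z^* u; its zeros are divided out on a well chosen circle r_k with
    N - m <= k < N.  For sufficiency, f is interpolated on the rings n, ..., n + m - 1 by P,
    and f - P is a Blaschke product, small on |z| = r_n by the density, times a function
    controlled by Q_(n+m+3p)(f); summing over n, that term is absorbed in the norm. *)

Require Import Defs.
From mathcomp Require Import all_boot all_order all_algebra.
From mathcomp Require Import all_classical all_reals all_analysis.
From mathcomp Require Import complex ring lra measurable_realfun.
From mathcomp Require Import zify.

Set Implicit Arguments.
Unset Strict Implicit.
Unset Printing Implicit Defensive.
Set Bullet Behavior "Strict Subproofs".

Import Order.TTheory GRing.Theory Num.Theory.
Import numFieldNormedType.Exports.

Local Open Scope classical_set_scope.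
Local Open Scope ring_scope.
Local Open Scope complex_scope.

Local Notation Re := complex.Re.
Local Notation Im := complex.Im.
Local Notation "x ^*" := (conjc x) : ring_scope.
Local Notation radius := Defs.radius.

(** * The modulus and complex derivatives *)

Section modulus.
Context {R : realType}.
Implicit Types (z u v : R[i]).

(** Functions of the space have no boundary values, so Hardy space tools are applied on a circle |z|
    = r_K after rescaling to the unit disc. This changes every pseudohyperbolic distance, and the
    method rests on the distortion of a whole Blaschke product being a bounded factor when z is well
    inside: it is at most exp (24 p A), where p rings halve the distance to the unit circle and A
    bounds the Carleson sums of single rings. Of the weight the function theory uses only the radii
    and this halving. The critical value comes from the weights 2^-n: squared Blaschke products over
    m rings are compared with 2^-m, so sums of logarithms with m (log 2)/2. Extremal functions by
    themselves give only the non-strict inequality at that value. Both necessity proofs reach the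
    strict one by choosing, among m consecutive circles, one on which the norm is at most its
    average; this is worth a factor m, which beats all constants once m is large. Points are handled
    through finite lists, so every constant must be independent of the list; this is why the
    Carleson, interpolation and division estimates carry explicit constants. *)

Lemma ReD z u : Re (z + u) = Re z + Re u. Proof. by case: z u => a b [c d]. Qed.
Lemma ImD z u : Im (z + u) = Im z + Im u. Proof. by case: z u => a b [c d]. Qed.
Lemma ReN z : Re (- z) = - Re z. Proof. by case: z => a b. Qed.
Lemma ImN z : Im (- z) = - Im z. Proof. by case: z => a b. Qed.
Lemma ReM z u : Re (z * u) = Re z * Re u - Im z * Im u.
Proof. by case: z u => a b [c d]. Qed.
Lemma ImM z u : Im (z * u) = Re z * Im u + Im z * Re u.
Proof. by case: z u => a b [c d]. Qed.
Lemma ReC (x : R) : Re x%:C = x. Proof. by []. Qed.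
Lemma Re1 : Re (1 : R[i]) = 1. Proof. by []. Qed.
Lemma Im1 : Im (1 : R[i]) = 0. Proof. by []. Qed.
Lemma ReJ z : Re z^* = Re z. Proof. by case: z. Qed.
Lemma ImJ z : Im z^* = - Im z. Proof. by case: z. Qed.
Definition ReImE := (ReD, ImD, ReN, ImN, ReM, ImM, Re1, Im1, ReJ, ImJ).

Lemma eq_complex_ReIm z u : Re z = Re u -> Im z = Im u -> z = u.
Proof. by case: z u => a b [c d] /= -> ->. Qed.

Lemma Re_sum (I : Type) (s : seq I) (P : pred I) (F : I -> R[i]) :
  Re (\sum_(i <- s | P i) F i) = \sum_(i <- s | P i) Re (F i).
Proof. by elim/big_rec2: _ => // i x y _ <-; rewrite ReD. Qed.

Lemma cabsE z : cabs z = Num.sqrt (Re z ^+ 2 + Im z ^+ 2).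
Proof. by case: z. Qed.

Lemma cabs_normE z : (cabs z)%:C = `|z|.
Proof. by case: z => a b; rewrite /cabs normc_def. Qed.

Lemma cabs2E z : cabs z ^+ 2 = Re z ^+ 2 + Im z ^+ 2.
Proof. by rewrite cabsE sqr_sqrtr // addr_ge0 // sqr_ge0. Qed.

Lemma cabs_ge0 z : 0 <= cabs z. Proof. by rewrite cabsE sqrtr_ge0. Qed.
Hint Resolve cabs_ge0 : core.

Lemma complexI_R : injective (fun x : R => x%:C).
Proof. by move=> x y [->]. Qed.

Lemma cabs0 : cabs (0 : R[i]) = 0.
Proof. by apply: complexI_R; rewrite cabs_normE normr0. Qed.
Lemma cabs1 : cabs (1 : R[i]) = 1.
Proof. by apply: complexI_R; rewrite cabs_normE normr1. Qed.
Lemma cabsM z u : cabs (z * u) = cabs z * cabs u.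
Proof. by apply: complexI_R; rewrite rmorphM !cabs_normE normrM. Qed.
Lemma cabsN z : cabs (- z) = cabs z.
Proof. by apply: complexI_R; rewrite !cabs_normE normrN. Qed.
Lemma cabsJ z : cabs z^* = cabs z.
Proof. by rewrite !cabsE ReJ ImJ sqrrN. Qed.
Lemma cabs_distC z u : cabs (z - u) = cabs (u - z).
Proof. by rewrite -cabsN opprB. Qed.
Lemma cabsV z : cabs z^-1 = (cabs z)^-1.
Proof. by apply: complexI_R; rewrite fmorphV !cabs_normE normfV. Qed.
Lemma cabs_div z u : cabs (z / u) = cabs z / cabs u.
Proof. by rewrite cabsM cabsV. Qed.
Lemma cabsX z n : cabs (z ^+ n) = cabs z ^+ n.
Proof. by elim: n => [|n IH]; rewrite ?cabs1 // !exprS cabsM IH. Qed.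
Lemma cabsC (x : R) : cabs x%:C = `|x|.
Proof. by rewrite cabsE /= expr0n addr0 sqrtr_sqr. Qed.
Lemma cabsi : cabs ('i : R[i]) = 1.
Proof. by rewrite cabsE /= expr0n expr1n add0r sqrtr1. Qed.
Lemma cabs_eq0 z : (cabs z == 0) = (z == 0).
Proof. by rewrite -(inj_eq complexI_R) cabs_normE normr_eq0. Qed.
Lemma cabs_gt0 z : (0 < cabs z) = (z != 0).
Proof. by rewrite lt_def cabs_ge0 andbT cabs_eq0. Qed.
Lemma cabsD z u : cabs (z + u) <= cabs z + cabs u.
Proof. by rewrite -lecR rmorphD !cabs_normE ler_normD. Qed.
Lemma cabsB z u : cabs (z - u) <= cabs z + cabs u.
Proof. by rewrite -(cabsN u) cabsD. Qed.
Lemma cabs_distD v z u : cabs (z - u) <= cabs (z - v) + cabs (v - u).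
Proof. by rewrite (le_trans _ (cabsD _ _)) // addrA subrK. Qed.
Lemma lerB_cabs z u : cabs z - cabs u <= cabs (z - u).
Proof. by rewrite lerBlDr (le_trans _ (cabsD _ _)) // subrK. Qed.
Lemma cabs_sum (I : Type) (s : seq I) (P : pred I) (F : I -> R[i]) :
  cabs (\sum_(i <- s | P i) F i) <= \sum_(i <- s | P i) cabs (F i).
Proof.
elim/big_rec2: _ => [|i y x _ H]; first by rewrite cabs0.
by rewrite (le_trans (cabsD _ _)) // lerD2l.
Qed.
Lemma cabs_prod (I : Type) (s : seq I) (P : pred I) (F : I -> R[i]) :
  cabs (\prod_(i <- s | P i) F i) = \prod_(i <- s | P i) cabs (F i).
Proof. by elim/big_rec2: _ => [|i y x _ <-]; rewrite ?cabs1 ?cabsM. Qed.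
Lemma Re_le z : `|Re z| <= cabs z.
Proof.
rewrite cabsE -sqrtr_sqr ler_wsqrtr // lerDl; exact: sqr_ge0.
Qed.
Lemma Im_le z : `|Im z| <= cabs z.
Proof.
rewrite cabsE -sqrtr_sqr ler_wsqrtr // lerDr; exact: sqr_ge0.
Qed.
Lemma ler_sqr2 (x y : R) : 0 <= y -> x ^+ 2 <= y ^+ 2 -> x <= y.
Proof.
move=> y0; case: (lerP x 0) => [x0 _|x0]; first exact: le_trans y0.
by rewrite ler_sqr ?nnegrE // ltW.
Qed.

Lemma cabs_le_ReIm z : cabs z <= `|Re z| + `|Im z|.
Proof.
apply: ler_sqr2; first by rewrite addr_ge0.
rewrite cabs2E sqrrD !real_normK ?num_real //.
have := mulr_ge0 (normr_ge0 (Re z)) (normr_ge0 (Im z)); lra.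
Qed.
Lemma mulJ z : z * z^* = (cabs z ^+ 2)%:C.
Proof. by rewrite cabs2E; apply: eq_complex_ReIm; rewrite !ReImE /=; ring. Qed.

Lemma cabs_small_eq z u : (forall e, 0 < e -> cabs (z - u) <= e) -> z = u.
Proof.
move=> H; apply/eqP; rewrite -subr_eq0 -cabs_eq0 eq_le cabs_ge0 andbT.
by apply/ler_addgt0Pl => e e0; rewrite addr0 H.
Qed.

Lemma cabsD_sqr z u : cabs (z + u) ^+ 2 <= 2 * (cabs z ^+ 2 + cabs u ^+ 2).
Proof.
rewrite !cabs2E !ReImE; have := sqr_ge0 (Re z - Re u).
by have := sqr_ge0 (Im z - Im u); nra.
Qed.

(** The first-order remainder form has no quotient, so [h = 0] needs no separate case, and [e] and
    [r] stay real although the norm of R[i] is complex-valued. *)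
Definition cderiv (f : R[i] -> R[i]) z d :=
  forall e : R, 0 < e -> exists2 r : R, 0 < r &
    forall h, cabs h < r -> cabs (f (z + h) - f z - d * h) <= e * cabs h.

Lemma complex_pos (e : R[i]) : 0 < e -> e = (Re e)%:C /\ 0 < Re e.
Proof. by case: e => a b; rewrite ltcE /= => /andP[/eqP-> ?]. Qed.

Lemma derivable_cderiv f z : derivable (f : R[i]^o -> R[i]^o) z 1 ->
  exists d, cderiv f z d.
Proof.
move=> /cvg_ex[/= d Hd]; exists d => e e0.
have e0' : (0 : R[i]) < e%:C by rewrite ltcR.
move/cvgrPdist_le: Hd => /(_ _ e0') [r /= r0 Hr].
have [er r0'] := complex_pos r0.
exists (Re r) => // h hr; case: (eqVneq h 0) => [->|h0].
  by rewrite addr0 subrr mulr0 subr0 cabs0 mulr0.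
have := Hr h; rewrite /ball_ /= sub0r normrN -cabs_normE er ltcR => /(_ hr h0).
rewrite -cabs_normE lecR.
have -> : h *: (1 : R[i]^o) + z = z + h by rewrite addrC /GRing.scale /= mulr1.
move=> H; have hp : 0 < cabs h by rewrite cabs_gt0.
rewrite -ler_pdivrMr // -cabs_div; apply: le_trans H.
rewrite cabs_distC; suff -> : (f (z + h) - f z - d * h) / h =
  h^-1 *: (f (z + h) - f z : R[i]^o) - d by [].
by rewrite /GRing.scale /=; field.
Qed.

Lemma cderiv_derivable f z d : cderiv f z d ->
  derivable (f : R[i]^o -> R[i]^o) z 1.
Proof.
move=> H; apply/cvg_ex; exists d; apply/cvgrPdist_le => e e0.
have [-> e0'] := complex_pos e0.
have [r r0 Hr] := H _ e0'.
have r0' : (0 : R[i]) < r%:C by rewrite ltcR.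
exists r%:C => //= h; rewrite /ball_ /= sub0r normrN -cabs_normE ltcR => hr h0.
rewrite -cabs_normE lecR cabs_distC.
have -> : h *: (1 : R[i]^o) + z = z + h by rewrite addrC /GRing.scale /= mulr1.
have hp : 0 < cabs h by rewrite cabs_gt0.
have := Hr _ hr; rewrite -ler_pdivrMr // -cabs_div.
suff -> : (f (z + h) - f z - d * h) / h =
  h^-1 *: (f (z + h) - f z : R[i]^o) - d by [].
by rewrite /GRing.scale /=; field.
Qed.
End modulus.
#[global] Hint Extern 0 (is_true (@Order.le _ _ _ (cabs _))) => exact: cabs_ge0 : core.

(** * Integrals of continuous real functions over segments *)

Section integral.
Context {R : realType}.
Implicit Types (g h : R -> R) (a b : R).
Local Notation mu := (@lebesgue_measure R).

Lemma continuous_dist g : (forall t (e : R), 0 < e -> exists2 d : R, 0 < d &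
    forall s, `|s - t| < d -> `|g s - g t| <= e) -> continuous g.
Proof.
move=> H t; apply/cvgrPdist_le => e e0.
have [d d0 Hd] := H t e e0; near=> s.
rewrite distrC; apply: Hd; rewrite distrC; near: s.
exact: cvgr_dist_lt.
Unshelve. all: by end_near. Qed.

Lemma dist_continuous g : continuous g -> forall t (e : R), 0 < e ->
  exists2 d : R, 0 < d & forall s, `|s - t| < d -> `|g s - g t| <= e.
Proof.
move=> H t e e0; have /cvgrPdist_le /(_ e e0) := H t.
move=> [d /= d0 Hd]; exists d => // s hs.
by rewrite distrC; apply: Hd; rewrite /= distrC.
Qed.

Definition rint a b g : R := \int[mu]_(t in `[a, b]) g t.
Arguments rint : simpl never.

Lemma continuous_integrable a b g : continuous g ->
  mu.-integrable `[a, b] (EFin \o g).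
Proof.
move=> cg; apply: continuous_compact_integrable; first exact: segment_compact.
by apply: continuous_subspaceT.
Qed.

Lemma rintD a b g h : continuous g -> continuous h ->
  rint a b (fun t => g t + h t) = rint a b g + rint a b h.
Proof. by move=> cg ch; rewrite /rint RintegralD //; exact: continuous_integrable. Qed.

Lemma rintZ a b c g : continuous g -> rint a b (fun t => c * g t) = c * rint a b g.
Proof. by move=> cg; rewrite /rint RintegralZl //; exact: continuous_integrable. Qed.

Lemma rintB a b g h : continuous g -> continuous h ->
  rint a b (fun t => g t - h t) = rint a b g - rint a b h.
Proof. by move=> cg ch; rewrite /rint RintegralB //; exact: continuous_integrable. Qed.

Lemma eq_rint a b g h : (forall t, a <= t <= b -> g t = h t) ->
  rint a b g = rint a b h.
Proof.
move=> H; apply: eq_Rintegral => t; rewrite inE /= in_itv /=; exact: H.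
Qed.

Lemma rint_cst a b (c : R) : a <= b -> rint a b (fun=> c) = c * (b - a).
Proof.
move=> ab; rewrite /rint Rintegral_cst //= lebesgue_measure_itv /= lte_fin.
case: ltP => //= ba; have -> : b = a by apply/le_anti; rewrite ab ba.
by rewrite subrr.
Qed.

Lemma ler_rint a b g h : continuous g -> continuous h ->
  (forall t, a <= t <= b -> g t <= h t) -> rint a b g <= rint a b h.
Proof.
move=> cg ch H; apply: le_Rintegral; [by []|exact: continuous_integrable..|].
by move=> t; rewrite /= in_itv /=; exact: H.
Qed.

Lemma rint_split a c b g : continuous g -> a <= c -> c <= b ->
  rint a b g = rint a c g + rint c b g.
Proof.
move=> cg ac cb; apply/eqP; rewrite -subr_eq addrC -subr_eq0; apply/eqP.
rewrite /rint -(@Rintegral_itv_obnd_cbnd _ c).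
  rewrite -(@Rintegral_itvB _ g (BLeft a) (BRight b) c) ?bnd_simp //.
    by ring.
  exact: continuous_integrable.
apply: integrableS (continuous_integrable c b cg) => //.
by apply: subset_itv_oc_cc.
Qed.

Lemma rint_FTC a b (F : R -> R) g : a <= b -> continuous g ->
  (forall t, is_derive t (1 : R) F (g t)) -> rint a b g = F b - F a.
Proof.
rewrite le_eqVlt => /predU1P[-> _ _|ab cg dF].
  by rewrite /rint set_itv1 Rintegral_set1 subrr.
have cF : continuous F.
  move=> t; apply: differentiable_continuous; apply/derivable1_diffP.
  by have [] := dF t.
rewrite /rint /Rintegral (@continuous_FTC2 _ g F) //.
- by apply: continuous_subspaceT.
- split.
  + by move=> t _; have [] := dF t.
  + by apply: cvg_at_right_filter; apply: cF.
  + by apply: cvg_at_left_filter; apply: cF.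
- by move=> t _; rewrite derive1E; have [_ ->] := dF t.
Qed.

Lemma EFin_rint a b g : continuous g ->
  (\int[mu]_(t in `[a, b]) (g t)%:E)%E = (rint a b g)%:E.
Proof.
move=> cg; rewrite /rint /Rintegral fineK //.
by apply: integrable_fin_num => //; exact: continuous_integrable.
Qed.
End integral.

(** * Integrals of continuous complex-valued functions over segments *)

Section complex_integral.
Context {R : realType}.
Implicit Types (g h : R -> R[i]) (a b : R).

(** Continuity is asked of the real and imaginary parts, so that real integration and the real
    fundamental theorem of calculus apply componentwise; [ccontP] recovers the metric form. *)
Definition ccont g := continuous (fun t => Re (g t)) /\ continuous (fun t => Im (g t)).

Lemma ccont_re g : ccont g -> continuous (fun t => Re (g t)). Proof. by case. Qed.
Lemma ccont_im g : ccont g -> continuous (fun t => Im (g t)). Proof. by case. Qed.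
Local Hint Resolve ccont_re ccont_im : core.

Lemma ccont_eq g h : g =1 h -> ccont g -> ccont h. Proof. by move=> /funext ->. Qed.

Lemma ccontP g : ccont g <-> (forall t (e : R), 0 < e -> exists2 d : R, 0 < d &
    forall s, `|s - t| < d -> cabs (g s - g t) <= e).
Proof.
split.
  move=> [c1 c2] t e e0; have e2 : 0 < e / 2 by rewrite divr_gt0.
  have [d d0 H] := dist_continuous c1 t e2.
  have [d' d0' H'] := dist_continuous c2 t e2.
  exists (Num.min d d'); first by rewrite lt_min d0.
  move=> s; rewrite lt_min => /andP[h1 h2].
  rewrite (le_trans (cabs_le_ReIm _)) // (splitr e).
  by rewrite lerD // ?ReImE; [apply: H|apply: H'].
move=> H; split; apply: continuous_dist => t e e0;
  have [d d0 Hd] := H t e e0; exists d => // s hs; have := Hd s hs.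
  by apply: le_trans; have := Re_le (g s - g t); rewrite !ReImE.
by apply: le_trans; have := Im_le (g s - g t); rewrite !ReImE.
Qed.

Lemma ccont_cst z : ccont (fun=> z).
Proof. by split; move=> t; exact: cvg_cst. Qed.
Lemma ccontD g h : ccont g -> ccont h -> ccont (fun t => g t + h t).
Proof.
move=> [g1 g2] [h1 h2]; split.
  rewrite (_ : (fun t => _) = (fun t => Re (g t) + Re (h t))); last first.
    by apply/funext => t; rewrite ReD.
  by move=> t; apply: cvgD; [exact: g1|exact: h1].
rewrite (_ : (fun t => _) = (fun t => Im (g t) + Im (h t))); last first.
  by apply/funext => t; rewrite ImD.
by move=> t; apply: cvgD; [exact: g2|exact: h2].
Qed.
Lemma ccontM g h : ccont g -> ccont h -> ccont (fun t => g t * h t).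
Proof.
move=> [g1 g2] [h1 h2]; split.
  rewrite (_ : (fun t => _) =
    (fun t => Re (g t) * Re (h t) - Im (g t) * Im (h t))); last first.
    by apply/funext => t; rewrite ReM.
  by move=> t; apply: cvgB; apply: cvgM;
    [exact: g1|exact: h1|exact: g2|exact: h2].
rewrite (_ : (fun t => _) =
  (fun t => Re (g t) * Im (h t) + Im (g t) * Re (h t))); last first.
  by apply/funext => t; rewrite ImM.
by move=> t; apply: cvgD; apply: cvgM;
  [exact: g1|exact: h2|exact: g2|exact: h1].
Qed.
Lemma ccontN g : ccont g -> ccont (fun t => - g t).
Proof.
move=> cg; apply: ccont_eq (ccontM (ccont_cst (-1)) cg) => t; ring.
Qed.
Lemma ccontB g h : ccont g -> ccont h -> ccont (fun t => g t - h t).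
Proof. by move=> cg ch; apply: ccontD => //; exact: ccontN. Qed.
Lemma ccontX g n : ccont g -> ccont (fun t => g t ^+ n).
Proof.
move=> cg; elim: n => [|n IH].
  by apply: ccont_eq (ccont_cst 1) => t; rewrite expr0.
by apply: ccont_eq (ccontM cg IH) => t; rewrite exprS.
Qed.
Lemma ccont_real (g : R -> R) : continuous g -> ccont (fun t => (g t)%:C).
Proof. by move=> cg; split => //= t; exact: cvg_cst. Qed.
Lemma ccontJ g : ccont g -> ccont (fun t => (g t)^*).
Proof.
move=> [g1 g2]; split.
  by rewrite (_ : (fun t => _) = (fun t => Re (g t))) //; apply/funext => t; rewrite ReJ.
rewrite (_ : (fun t => _) = (fun t => - Im (g t))); last first.
  by apply/funext => t; rewrite ImJ.
by move=> t; apply: cvgN; exact: g2.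
Qed.
Lemma ccont_sum (I : Type) (s : seq I) (P : pred I) (F : I -> R -> R[i]) :
  (forall i, ccont (F i)) -> ccont (fun t => \sum_(i <- s | P i) F i t).
Proof.
move=> H; elim: s => [|i s IH].
  by apply: ccont_eq (ccont_cst 0) => t; rewrite big_nil.
case Pi : (P i); last by apply: ccont_eq IH => t; rewrite big_cons Pi.
by apply: ccont_eq (ccontD (H i) IH) => t; rewrite big_cons Pi.
Qed.
Lemma continuous_cabs2 g : ccont g -> continuous (fun t => cabs (g t) ^+ 2).
Proof.
move=> [g1 g2]; rewrite (_ : (fun t => _) =
    (fun t => Re (g t) * Re (g t) + Im (g t) * Im (g t))); last first.
  by apply/funext => t; rewrite cabs2E !expr2.
by move=> t; apply: cvgD; apply: cvgM; [exact: g1|exact: g1|exact: g2|exact: g2].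
Qed.
Lemma ccontV g : (forall t, g t != 0) -> ccont g -> ccont (fun t => (g t)^-1).
Proof.
move=> g0 cg.
have cn : continuous (fun t => (cabs (g t) ^+ 2)^-1).
  move=> t; apply: cvgV; last exact: continuous_cabs2.
  by rewrite sqrf_eq0 cabs_eq0.
apply: ccont_eq (ccontM (ccont_real cn) (ccontJ cg)) => t.
have e : ((cabs (g t) ^+ 2)^-1)%:C = (g t * (g t)^*)^-1 :> R[i] by rewrite mulJ fmorphV.
rewrite e invfM -mulrA mulVf ?mulr1 //.
by rewrite -cabs_eq0 cabsJ cabs_eq0.
Qed.

Definition cconv (f : R[i] -> R[i]) z := forall e : R, 0 < e ->
  exists2 d : R, 0 < d & forall u, cabs (u - z) < d -> cabs (f u - f z) <= e.

Lemma ccont_comp f g : (forall t, cconv f (g t)) -> ccont g ->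
  ccont (fun t => f (g t)).
Proof.
move=> cf /ccontP cg; apply/ccontP => t e e0.
have [d d0 Hd] := cf t e e0; have d2 : 0 < d / 2 by rewrite divr_gt0.
have [d' d0' Hd'] := cg t _ d2; exists d' => // s hs; apply: Hd.
by rewrite (le_lt_trans (Hd' _ hs)) // ltr_pdivrMr // ltr_pMr // ltr1n.
Qed.

Lemma cderiv_cconv (f : R[i] -> R[i]) z d : cderiv f z d -> cconv f z.
Proof.
move=> H e e0; have [r r0 Hr] := H 1 ltr01.
have K0 : 0 < 1 + cabs d by have := cabs_ge0 d; lra.
exists (Num.min r (e / (1 + cabs d))).
  by rewrite lt_min r0 divr_gt0.
move=> u; rewrite lt_min => /andP[h1 h2]; have := Hr _ h1.
rewrite addrCA subrr addr0 mul1r => H1.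
rewrite ltr_pdivlMr // in h2; apply: le_trans (ltW h2).
rewrite mulrDr mulr1 mulrC -cabsM.
have -> : f u - f z = (f u - f z - d * (u - z)) + d * (u - z) by ring.
by rewrite (le_trans (cabsD _ _)) // lerD.
Qed.

Definition itg a b g : R[i] :=
  rint a b (fun t => Re (g t)) +i* rint a b (fun t => Im (g t)).

Arguments itg : simpl never.
Lemma Re_itg a b g : Re (itg a b g) = rint a b (fun t => Re (g t)).
Proof. by []. Qed.
Lemma Im_itg a b g : Im (itg a b g) = rint a b (fun t => Im (g t)).
Proof. by []. Qed.

Lemma eq_itg a b g h : (forall t, a <= t <= b -> g t = h t) -> itg a b g = itg a b h.
Proof. by move=> H; congr (_ +i* _); apply: eq_rint => t /H ->. Qed.

Lemma itgD a b g h : ccont g -> ccont h ->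
  itg a b (fun t => g t + h t) = itg a b g + itg a b h.
Proof.
move=> cg ch; apply: eq_complex_ReIm; rewrite (ReD,ImD) !(Re_itg,Im_itg) -rintD; auto.
  by apply: eq_rint => t _; rewrite ReD.
by apply: eq_rint => t _; rewrite ImD.
Qed.

Lemma itgZ a b c g : ccont g -> itg a b (fun t => c * g t) = c * itg a b g.
Proof.
move=> cg; apply: eq_complex_ReIm; rewrite (ReM,ImM) !(Re_itg,Im_itg).
  rewrite -!rintZ -?rintB; auto; first by apply: eq_rint => t _; rewrite ReM.
    by move=> t; apply: cvgM; [exact: cvg_cst|exact: (ccont_re cg)].
  by move=> t; apply: cvgM; [exact: cvg_cst|exact: (ccont_im cg)].
rewrite -!rintZ -?rintD; auto.
- by apply: eq_rint => t _; rewrite ImM.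
- by move=> t; apply: cvgM; [exact: cvg_cst|exact: (ccont_im cg)].
- by move=> t; apply: cvgM; [exact: cvg_cst|exact: (ccont_re cg)].
Qed.

Lemma itgB a b g h : ccont g -> ccont h ->
  itg a b (fun t => g t - h t) = itg a b g - itg a b h.
Proof.
move=> cg ch; rewrite itgD //; last exact: ccontN.
congr (_ + _); rewrite -mulN1r -itgZ //.
by apply: eq_itg => t _; rewrite mulN1r.
Qed.

Lemma itg_sum (I : Type) (s : seq I) (P : pred I) (F : I -> R -> R[i]) a b :
  (forall i, ccont (F i)) ->
  itg a b (fun t => \sum_(i <- s | P i) F i t) = \sum_(i <- s | P i) itg a b (F i).
Proof.
move=> H; elim: s => [|i s IH].
  rewrite big_nil -[RHS](mul0r (itg a b (fun=> 0))) -itgZ; last exact: ccont_cst.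
  by apply: eq_itg => t _; rewrite big_nil mulr0.
rewrite big_cons -IH; case: ifP => Pi.
  rewrite -itgD //; last exact: ccont_sum.
  by apply: eq_itg => t _; rewrite big_cons Pi.
by apply: eq_itg => t _; rewrite big_cons Pi.
Qed.

Lemma itg_split a c b g : ccont g -> a <= c -> c <= b ->
  itg a b g = itg a c g + itg c b g.
Proof.
move=> cg ac cb; apply: eq_complex_ReIm; rewrite (ReD,ImD) !(Re_itg,Im_itg); apply: rint_split; auto.
Qed.

Lemma itg_cst a b c : a <= b -> itg a b (fun=> c) = c * (b - a)%:C.
Proof.
by move=> ab; apply: eq_complex_ReIm; rewrite (Re_itg,Im_itg) rint_cst // !ReImE /=; ring.
Qed.

Lemma itg_FTC a b (F g : R -> R[i]) : a <= b -> ccont g ->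
  (forall t, is_derive t (1 : R) (fun t => Re (F t)) (Re (g t))) ->
  (forall t, is_derive t (1 : R) (fun t => Im (F t)) (Im (g t))) ->
  itg a b g = F b - F a.
Proof.
move=> ab [c1 c2] d1 d2; apply: eq_complex_ReIm; rewrite (Re_itg,Im_itg) !ReImE.
  exact: (@rint_FTC _ a b (fun t => Re (F t)) (fun t => Re (g t))).
exact: (@rint_FTC _ a b (fun t => Im (F t)) (fun t => Im (g t))).
Qed.

Lemma itgJ a b g : ccont g -> itg a b (fun t => (g t)^*) = (itg a b g)^*.
Proof.
move=> cg; apply: eq_complex_ReIm; rewrite ?ReJ ?ImJ !(Re_itg,Im_itg).
  by apply: eq_rint => t _; rewrite ReJ.
rewrite -mulN1r -rintZ; auto.
by apply: eq_rint => t _; rewrite ImJ mulN1r.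
Qed.

Lemma itg_bound a b g (M : R) : a <= b -> ccont g ->
  (forall t, a <= t <= b -> cabs (g t) <= M) -> cabs (itg a b g) <= M * (b - a).
Proof.
move=> ab cg H; set I := itg a b g.
have [I0|I0] := eqVneq I 0.
  rewrite I0 cabs0 mulr_ge0 ?subr_ge0 //.
  by apply: le_trans (cabs_ge0 _) (H a _); rewrite lexx.
(* rotate so that the integral becomes real *)
have : Re (itg a b (fun t => I^* * g t)) <= cabs I * (M * (b - a)).
  rewrite mulrA -rint_cst // Re_itg; apply: ler_rint.
  { exact: ccont_re (ccontM (ccont_cst _) cg). }
  { by move=> t; exact: cvg_cst. }
  move=> t ht; apply: le_trans (ler_norm _) _.
    by apply: (le_trans (Re_le _)); rewrite cabsM cabsJ; exact: ler_wpM2l (cabs_ge0 _) _ _ (H _ ht).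
rewrite itgZ // mulrC mulJ ReC expr2.
by rewrite ler_pM2l // cabs_gt0.
Qed.
End complex_integral.

(** * Means over circles *)

Section circle.
Context {R : realType}.
Implicit Types (g h : R -> R[i]) (f : R[i] -> R[i]) (r t : R) (k n : nat).

Definition cis t : R[i] := cos t +i* sin t.

Lemma on_circleE r t : on_circle r t = r%:C * cis t.
Proof. by apply: eq_complex_ReIm; rewrite !ReImE /=; ring. Qed.

Lemma cabs_cis t : cabs (cis t) = 1.
Proof. by rewrite cabsE /= cos2Dsin2 sqrtr1. Qed.

Lemma cis_neq0 t : cis t != 0.
Proof. by rewrite -cabs_eq0 cabs_cis oner_neq0. Qed.

Lemma cisD t u : cis (t + u) = cis t * cis u.
Proof. by apply: eq_complex_ReIm; rewrite !ReImE /= ?cosD ?sinD; ring. Qed.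

Lemma cisX t k : cis t ^+ k = cis (k%:R * t).
Proof.
elim: k => [|k IH]; first by rewrite mul0r expr0 /cis cos0 sin0.
by rewrite exprS IH -cisD -natr1 mulrDl mul1r addrC.
Qed.

Lemma cisV t : (cis t)^-1 = (cis t)^*.
Proof.
apply: (mulfI (cis_neq0 t)); rewrite mulfV ?cis_neq0 // mulJ cabs_cis expr1n.
by [].
Qed.

Lemma cis_period : cis (2 * pi) = cis 0.
Proof.
by rewrite mulr_natl /cis cos2pi sin2pi cos0 sin0.
Qed.

Lemma ccont_cis : ccont cis.
Proof. by split => /=; [exact: continuous_cos|exact: continuous_sin]. Qed.

Lemma is_derive_coskx (c t : R) :
  is_derive t (1 : R) (fun u => cos (c * u)) (- c * sin (c * t)).
Proof.
have H : is_derive t (1 : R) (fun u => c * u) c.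
  by apply: is_derive_eq; rewrite /GRing.scale /= mulr1 ?addr0 ?mulr0 ?add0r.
have := is_derive1_comp (is_derive_cos (c * t)) H.
by rewrite /GRing.scale /= => H'; apply: is_derive_eq; ring.
Qed.

Lemma is_derive_sinkx (c t : R) :
  is_derive t (1 : R) (fun u => sin (c * u)) (c * cos (c * t)).
Proof.
have H : is_derive t (1 : R) (fun u => c * u) c.
  by apply: is_derive_eq; rewrite /GRing.scale /= mulr1 ?addr0 ?mulr0 ?add0r.
have := is_derive1_comp (is_derive_sin (c * t)) H.
by rewrite /GRing.scale /= => H'; apply: is_derive_eq; ring.
Qed.

Lemma itg_cis (c a b : R) : a <= b ->
  itg a b (fun t => 'i * c%:C * cis (c * t)) = cis (c * b) - cis (c * a).
Proof.
move=> ab; apply: (@itg_FTC _ a b (fun t => cis (c * t))) => //.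
- apply: ccontM; first exact: ccont_cst.
  split => /= t; apply: continuous_comp; try exact: mulrl_continuous.
    exact: continuous_cos.
  exact: continuous_sin.
- move=> t; have := is_derive_coskx c t.
  by rewrite (_ : Re _ = - c * sin (c * t)) // !ReImE /=; ring.
- move=> t; have := is_derive_sinkx c t.
  by rewrite (_ : Im _ = c * cos (c * t)) // !ReImE /=; ring.
Qed.

(** The chord is the integral of the derivative of [cis] over the arc, and that derivative has
    modulus 1. *)
Lemma cis_lip t u : cabs (cis t - cis u) <= `|t - u|.
Proof.
wlog tu : t u / u <= t.
  move=> H; case: (leP u t) => [|/ltW] /H //.
  by rewrite cabs_distC distrC.
have := itg_cis 1 tu; rewrite !mul1r => <-; rewrite ger0_norm ?subr_ge0 //.
rewrite -[X in _ <= X]mul1r; apply: itg_bound => //.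
  apply: ccontM; first exact: ccont_cst.
  by apply: ccont_eq ccont_cis => s; rewrite mul1r.
by move=> s _; rewrite !cabsM cabs_cis cabsi cabs1 !mulr1.
Qed.

Lemma pi2_gt0 : 0 < 2 * pi :> R. Proof. by rewrite mulr_gt0 // pi_gt0. Qed.
Lemma pi2_ge0 : 0 <= 2 * pi :> R. Proof. exact/ltW/pi2_gt0. Qed.

Lemma rint_2pi_cst (c : R) : rint 0 (2 * pi) (fun=> c) = c * (2 * pi).
Proof. by rewrite rint_cst ?pi2_ge0 // subr0. Qed.

Definition mean g : R[i] := ((2 * pi)^-1)%:C * itg 0 (2 * pi) g.

Lemma eq_mean g h : g =1 h -> mean g = mean h.
Proof. by move=> /funext ->. Qed.
Lemma meanD g h : ccont g -> ccont h -> mean (fun t => g t + h t) = mean g + mean h.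
Proof. by move=> cg ch; rewrite /mean itgD // mulrDr. Qed.
Lemma meanB g h : ccont g -> ccont h -> mean (fun t => g t - h t) = mean g - mean h.
Proof. by move=> cg ch; rewrite /mean itgB // mulrBr. Qed.
Lemma meanZ c g : ccont g -> mean (fun t => c * g t) = c * mean g.
Proof. by move=> cg; rewrite /mean itgZ // mulrCA. Qed.
Lemma meanJ g : ccont g -> mean (fun t => (g t)^*) = (mean g)^*.
Proof.
move=> cg; rewrite /mean itgJ //; apply: eq_complex_ReIm; rewrite !ReImE /=; ring.
Qed.
Lemma mean_sum (I : Type) (s : seq I) (P : pred I) (F : I -> R -> R[i]) :
  (forall i, ccont (F i)) ->
  mean (fun t => \sum_(i <- s | P i) F i t) = \sum_(i <- s | P i) mean (F i).
Proof. by move=> H; rewrite /mean itg_sum // mulr_sumr. Qed.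
Lemma mean_cst c : mean (fun=> c) = c.
Proof.
rewrite /mean itg_cst ?subr0 ?pi2_ge0 // mulrCA -rmorphM mulVf ?mulr1 //.
by rewrite gt_eqF // pi2_gt0.
Qed.
Lemma mean_bound g (M : R) : ccont g ->
  (forall t, 0 <= t <= 2 * pi -> cabs (g t) <= M) ->
  cabs (mean g) <= M.
Proof.
move=> cg H; rewrite /mean cabsM cabsC ger0_norm ?invr_ge0 ?pi2_ge0 //.
rewrite ler_pdivrMl ?pi2_gt0 // [2 * pi * M]mulrC.
by have := itg_bound pi2_ge0 cg H; rewrite subr0.
Qed.

Lemma mean_cisX k : (0 < k)%N -> mean (fun t => cis t ^+ k) = 0.
Proof.
move=> k0; have kn0 : 'i * (k%:R : R)%:C != 0 :> R[i].
  rewrite -cabs_eq0 cabsM cabsi mul1r cabsC normr_eq0 pnatr_eq0.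
  by rewrite -lt0n.
apply: (mulfI kn0); rewrite mulr0 -meanZ; last exact/ccontX/ccont_cis.
rewrite /mean; under eq_itg => t _ do rewrite cisX.
rewrite (itg_cis _ pi2_ge0) -!(cisX _ k) cis_period subrr mulr0 //.
Qed.

Lemma mean_cisX_J k : (0 < k)%N -> mean (fun t => (cis t)^* ^+ k) = 0.
Proof.
move=> k0; transitivity ((0 : R[i])^*); last exact: rmorph0.
rewrite -(mean_cisX k0) -meanJ; last first.
  exact/ccontX/ccont_cis.
by apply: eq_mean => t; rewrite rmorphXn.
Qed.

Lemma mean_cis_orth j k :
  mean (fun t => cis t ^+ j * (cis t)^* ^+ k) = (j == k)%:R.
Proof.
have aux m n t : cis t ^+ (m + n) * (cis t)^* ^+ n = cis t ^+ m.
  by rewrite exprD -mulrA -exprMn mulJ cabs_cis !expr1n mulr1.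
case: (ltngtP j k) => [jk|jk|->].
- rewrite [RHS](_ : _ = 0) // -(mean_cisX_J (k := (k - j)%N)) ?subn_gt0 //; apply: eq_mean => t.
  rewrite -{1}(subnK (ltnW jk)) exprD mulrCA -exprMn mulJ cabs_cis.
  by rewrite !expr1n mulr1.
- rewrite [RHS](_ : _ = 0) // -(mean_cisX (k := (j - k)%N)) ?subn_gt0 //; apply: eq_mean => t.
  by rewrite -{1}(subnK (ltnW jk)) aux.
- rewrite -[RHS](mean_cst 1); apply: eq_mean => t.
  by rewrite -{1}[k]add0n aux.
Qed.

(** The mean Q_n(f) of the overview is [circ2 (r n) f]. *)
Definition circ2 r f : R :=
  (2 * pi)^-1 * rint 0 (2 * pi) (fun t => cabs (f (on_circle r t)) ^+ 2).

Lemma circ2_mean r f : ccont (fun t => f (on_circle r t)) ->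
  (circ2 r f)%:C = mean (fun t => f (on_circle r t) * (f (on_circle r t))^*).
Proof.
move=> cf; rewrite /mean /circ2; apply: eq_complex_ReIm; rewrite !ReImE.
  rewrite [Re _%:C]/= (Re_itg 0) mul0r subr0; congr (_ * _); apply: eq_rint => t _.
  by rewrite mulJ.
rewrite (Im_itg 0) mul0r addr0 -[LHS](mulr0 ((2 * pi)^-1)).
congr (_ * _); rewrite -[LHS](mul0r (2 * pi - 0)) -rint_cst ?pi2_ge0 //.
by apply: eq_rint => t _; rewrite mulJ.
Qed.

Lemma circ2_le r (r' : R) f (h : R[i] -> R[i]) (c : R) :
  ccont (fun t => f (on_circle r t)) -> ccont (fun t => h (on_circle r' t)) ->
  (forall t, cabs (f (on_circle r t)) ^+ 2 <= c * cabs (h (on_circle r' t)) ^+ 2) ->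
  circ2 r f <= c * circ2 r' h.
Proof.
move=> cf ch H; rewrite /circ2 mulrCA.
rewrite ler_pM2l ?invr_gt0 ?pi2_gt0 // -rintZ; last exact: continuous_cabs2.
apply: ler_rint => //; first exact: continuous_cabs2.
move=> t; apply: cvgM; first exact: cvg_cst.
exact: (@continuous_cabs2 _ (fun t => h (on_circle r' t))).
Qed.

Lemma circ2_ge0 r f : ccont (fun t => f (on_circle r t)) -> 0 <= circ2 r f.
Proof.
move=> cf; rewrite mulr_ge0 ?invr_ge0 ?pi2_ge0 //.
have := rint_2pi_cst 0; rewrite mul0r => {1}<-; apply: ler_rint.
- by move=> t; exact: cvg_cst.
- exact: continuous_cabs2.
- by move=> *; exact: sqr_ge0.
Qed.

Lemma circ2_bound r f (M : R) : ccont (fun t => f (on_circle r t)) ->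
  (forall t, cabs (f (on_circle r t)) ^+ 2 <= M) -> circ2 r f <= M.
Proof.
move=> cf H; rewrite /circ2 ler_pdivrMl ?pi2_gt0 // [2 * pi * M]mulrC.
rewrite -rint_2pi_cst; apply: ler_rint => //.
  exact: continuous_cabs2.
by move=> t; exact: cvg_cst.
Qed.

Lemma circ2D r f (h : R[i] -> R[i]) : ccont (fun t => f (on_circle r t)) ->
  ccont (fun t => h (on_circle r t)) ->
  circ2 r (fun z => f z + h z) <= 2 * (circ2 r f + circ2 r h).
Proof.
move=> cf ch; rewrite /circ2 -mulrDr mulrCA ler_pM2l ?invr_gt0 ?pi2_gt0 //.
rewrite -rintD; try exact: continuous_cabs2.
rewrite -rintZ; last first.
  by move=> t; apply: cvgD; [exact: (continuous_cabs2 cf)|exact: (continuous_cabs2 ch)].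
apply: ler_rint; first exact: (continuous_cabs2 (ccontD cf ch)).
  move=> t; apply: cvgM; first exact: cvg_cst.
  by apply: cvgD; [exact: (continuous_cabs2 cf)|exact: (continuous_cabs2 ch)].
by move=> t _; exact: cabsD_sqr.
Qed.
End circle.

(** * Cauchy's theorem and power series *)

Section bisection.
Context {R : realType}.
Implicit Types (g : R -> R -> nat -> R) (a b : R).

Lemma nested_point (x l : nat -> R) : (forall k, 0 <= l k) ->
  (forall k, x k <= x k.+1 /\ x k.+1 + l k.+1 <= x k + l k) ->
  exists p, forall k, x k <= p <= x k + l k.
Proof.
move=> l0 H.
have Hx j k : (j <= k)%N -> x j <= x k /\ x k + l k <= x j + l j.
  move=> /subnK <-; elim: (k - j)%N => [|i [H1 H2]]; first by rewrite add0n.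
  have [H3 H4] := H (i + j)%N; rewrite addSn.
  by split; [exact: le_trans H3|exact: le_trans H2].
have ub k : ubound (range x) (x k + l k).
  move=> _ [j _ <-]; case: (leqP j k) => [/Hx[h _]|/ltnW/Hx[_ h]].
    by apply: le_trans h _; rewrite lerDl.
  by apply: le_trans h; rewrite lerDl.
exists (sup (range x)) => k; apply/andP; split.
  by apply: ub_le_sup; [exists (x 0%N + l 0%N); exact: ub|exists k].
by apply: ge_sup; [exists (x 0%N); exists 0%N|exact: ub].
Qed.

(* Goursat's subdivision argument, for an arbitrary function of dyadic rectangles. *)
Lemma quadrisection g (s0 t0 A B eta : R) : 0 <= A -> 0 <= B -> 0 < eta ->
  (forall k s t, s0 <= s -> s + A / 2 ^+ k <= s0 + A ->
     g s t k <= g s t k.+1 + g (s + A / 2 ^+ k.+1) t k.+1 +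
       (g s (t + B / 2 ^+ k.+1) k.+1 +
        g (s + A / 2 ^+ k.+1) (t + B / 2 ^+ k.+1) k.+1)) ->
  (forall s t, s0 <= s <= s0 + A -> exists2 d : R, 0 < d & forall k s' t',
     s0 <= s' -> s' + A / 2 ^+ k <= s0 + A ->
     s' <= s <= s' + A / 2 ^+ k -> t' <= t <= t' + B / 2 ^+ k ->
     (2 ^+ k)^-1 <= d -> g s' t' k < eta / 4 ^+ k) ->
  g s0 t0 0%N < eta.
Proof.
move=> A0 B0 eta0 Hsub Hloc; rewrite ltNge; apply/negP => H0.
have half (C : R) k : C / 2 ^+ k = C / 2 ^+ k.+1 + C / 2 ^+ k.+1.
  by rewrite exprS; field; rewrite expf_neq0.
have ge0 (C : R) k : 0 <= C -> 0 <= C / 2 ^+ k.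
  by move=> C0; rewrite divr_ge0 // exprn_ge0.
(* [P k] says that a rectangle of generation k still carries its share eta / 4^k, [Q k] that the
   rectangle at q lies in the one at p. A counterexample then descends forever, against the local
   estimate at the common point. *)
pose P k (p : R * R) := [/\ s0 <= p.1, p.1 + A / 2 ^+ k <= s0 + A &
  eta / 4 ^+ k <= g p.1 p.2 k].
pose Q k (p q : R * R) := [/\ p.1 <= q.1, q.1 + A / 2 ^+ k.+1 <= p.1 + A / 2 ^+ k,
  p.2 <= q.2 & q.2 + B / 2 ^+ k.+1 <= p.2 + B / 2 ^+ k].
have step k p : exists q, P k p -> P k.+1 q /\ Q k p q.
  have [[h1 h2 h3]|] := pselect (P k p); last by exists p.
  case: p h1 h2 h3 => s t /= h1 h2 h3.
  have a0 := ge0 A k.+1 A0; have b0 := ge0 B k.+1 B0.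
  have eA := half A k; have eB := half B k.
  suff [q [q1 q2 q3]] : exists q : R * R, [/\ q.1 = s \/ q.1 = s + A / 2 ^+ k.+1,
      q.2 = t \/ q.2 = t + B / 2 ^+ k.+1 & eta / 4 ^+ k.+1 <= g q.1 q.2 k.+1].
    exists q => _; split; first by split=> //; case: q1 => ->; lra.
    by split; (case: q1 => -> || idtac); (case: q2 => -> || idtac); rewrite /=; lra.
  apply/not_existsP => Hq.
  have L x y : x = s \/ x = s + A / 2 ^+ k.+1 ->
      y = t \/ y = t + B / 2 ^+ k.+1 -> g x y k.+1 < eta / 4 ^+ k.+1.
    move=> hx hy; rewrite ltNge; apply/negP => h; exact: (Hq (x, y)).
  have := Hsub k s t h1 h2.
  have := L s t (or_introl erefl) (or_introl erefl).
  have := L s _ (or_introl erefl) (or_intror erefl).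
  have := L _ t (or_intror erefl) (or_introl erefl).
  have := L _ _ (or_intror erefl) (or_intror erefl).
  have -> : eta / 4 ^+ k.+1 = eta / 4 ^+ k / 4.
    by rewrite exprS; field; rewrite expf_neq0.
  lra.
pose F := fix F k := if k is j.+1 then projT1 (cid (step j (F j))) else (s0, t0).
have FP k : P k (F k) /\ Q k (F k) (F k.+1).
  have P0 : P k (F k).
    elim: k => [|k IH] /=; first by split=> //=; rewrite ?expr0 ?divr1.
    by have [] := projT2 (cid (step k (F k))) IH.
  by split=> //; have [] := projT2 (cid (step k (F k))) P0.
have [p Hp] : exists p, forall k, (F k).1 <= p <= (F k).1 + A / 2 ^+ k.
  apply: (nested_point (l := fun k => A / 2 ^+ k)) => k; first exact: ge0.
  by have [_ []] := FP k.
have [q Hq] : exists q, forall k, (F k).2 <= q <= (F k).2 + B / 2 ^+ k.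
  apply: (nested_point (l := fun k => B / 2 ^+ k)) => k; first exact: ge0.
  by have [_ []] := FP k.
have hp : s0 <= p <= s0 + A by have := Hp 0%N; rewrite /= expr0 divr1.
have [d d0 Hd] := Hloc p q hp.
have [k Hk] : exists k, (2 ^+ k)^-1 <= d :> R.
  exists (Num.bound d^-1); rewrite -[leRHS]invrK lef_pV2 ?posrE ?invr_gt0 ?exprn_gt0 //.
  by rewrite ltW // upper_nthrootP.
have [[h1 h2 h3] _] := FP k.
have := Hd k _ _ h1 h2 (Hp k) (Hq k) Hk.
by rewrite ltNge h3.
Qed.
End bisection.

Section cauchy.
Context {R : realType}.
Variables (z : R[i]) (rho delta : R).
Hypothesis hz : cabs z < rho.
Hypothesis hd : 0 < delta < 1.
Implicit Types (F : R[i] -> R[i]) (s t a b : R).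

(** Clamping the radial parameter to [delta, 1] makes every integrand continuous on all of R and
    keeps away from the pole at s = 0. *)
Let sg s := Num.max delta (Num.min s 1).
Let zeta t : R[i] := rho%:C * cis t.
(** [Psi] contracts the circle towards z. Since Psi - z = s (zeta - z), the functions [h] and [v]
    below are F(Psi) times the derivatives of log (Psi - z) in s and in t. *)
Let Psi s t := z + (sg s)%:C * (zeta t - z).
Let h F t s := F (Psi s t) / (sg s)%:C.
Let v F s t := F (Psi s t) * ('i * zeta t / (zeta t - z)).
(** The integral of F(u) du / (u - z) along the image of the positively oriented boundary of a
    parameter rectangle. *)
Let G F s1 s2 t1 t2 := itg t1 t2 (v F s2) - itg t1 t2 (v F s1)
  - itg s1 s2 (h F t2) + itg s1 s2 (h F t1).
Let good F := forall u, cabs u <= rho -> cconv F u.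

Let rho_gt0 : 0 < rho. Proof. exact: le_lt_trans (cabs_ge0 z) hz. Qed.
Let cabs_zeta t : cabs (zeta t) = rho.
Proof. by rewrite cabsM cabs_cis mulr1 cabsC gtr0_norm. Qed.
Let zeta_z t : rho - cabs z <= cabs (zeta t - z).
Proof. by rewrite -(cabs_zeta t) lerB_cabs. Qed.
Let zeta_neq t : zeta t - z != 0.
Proof. by rewrite -cabs_gt0 (lt_le_trans _ (zeta_z t)) // subr_gt0. Qed.
Let sgE s : delta <= s <= 1 -> sg s = s.
Proof. by move=> /andP[h1 h2]; rewrite /sg min_l // max_r. Qed.
Let sg_ge s : delta <= sg s. Proof. by rewrite /sg le_max lexx. Qed.
Let sg_gt0 s : 0 < sg s.
Proof. by case/andP: hd => d0 _; exact: lt_le_trans d0 (sg_ge s). Qed.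
Let sg_le1 s : sg s <= 1.
Proof. by case/andP: hd => _ d1; rewrite /sg ge_max ltW //= ge_min lexx orbT. Qed.
Let sg_neq0 s : (sg s)%:C != 0 :> R[i].
Proof. by rewrite -cabs_eq0 cabsC normr_eq0 gt_eqF. Qed.
Let sg_lip s s' : `|sg s - sg s'| <= `|s - s'|.
Proof.
have [n1 n2] : s - s' <= `|s - s'| /\ s' - s <= `|s - s'|.
  by split; [exact: ler_norm|rewrite distrC; exact: ler_norm].
have [m1 m2] : `|Num.min s 1 - Num.min s' 1| <= `|s - s'| /\ true.
  split => //; rewrite ler_norml minEle (minEle s').
  by case: (lerP s 1) => ?; case: (lerP s' 1) => ?; apply/andP; split; lra.
apply: le_trans m1; rewrite /sg; move: (Num.min s 1) (Num.min s' 1) => x y.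
have [n3 n4] : x - y <= `|x - y| /\ y - x <= `|x - y|.
  by split; [exact: ler_norm|rewrite distrC; exact: ler_norm].
rewrite ler_norml maxEle (maxEle delta).
by case: (lerP delta x) => ?; case: (lerP delta y) => ?; apply/andP; split; lra.
Qed.
Let Psi_le s t : cabs (Psi s t) <= rho.
Proof.
have -> : Psi s t = (1 - sg s)%:C * z + (sg s)%:C * zeta t.
  by rewrite /Psi rmorphB rmorph1; ring.
apply: (le_trans (cabsD _ _)).
rewrite (cabsM _ z) (cabsM (sg s)%:C) cabs_zeta !cabsC.
have s0 := sg_gt0 s; have s1 := sg_le1 s.
rewrite (gtr0_norm s0) ger0_norm ?subr_ge0 //.
have := cabs_ge0 z; have := hz; nra.
Qed.
Let ccont_sg : ccont (fun s => (sg s)%:C).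
Proof.
apply: ccont_real; apply: continuous_dist => t e e0; exists e => // s hs.
by rewrite (le_trans (sg_lip _ _)) // ltW.
Qed.
Let ccont_zeta : ccont zeta.
Proof. by apply: ccontM; [exact: ccont_cst|exact: ccont_cis]. Qed.
Let ccont_h F t : good F -> ccont (h F t).
Proof.
move=> gF; apply: ccontM.
  apply: ccont_comp => [s|]; first exact: gF (Psi_le _ _).
  apply: ccontD; first exact: ccont_cst.
  by apply: ccontM; [exact: ccont_sg|exact: ccont_cst].
exact: (ccontV sg_neq0).
Qed.
Let ccont_w : ccont (fun t => 'i * zeta t / (zeta t - z)).
Proof.
apply: ccontM; first by apply: ccontM; [exact: ccont_cst|exact: ccont_zeta].
apply: (ccontV zeta_neq); apply: ccontB; [exact: ccont_zeta|exact: ccont_cst].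
Qed.
Let ccont_v F s : good F -> ccont (v F s).
Proof.
move=> gF; apply: ccontM ccont_w.
apply: ccont_comp => [t|]; first exact: gF (Psi_le _ _).
apply: ccontD; first exact: ccont_cst.
apply: ccontM; first exact: ccont_cst.
apply: ccontB; [exact: ccont_zeta|exact: ccont_cst].
Qed.

(** These are the functions that Goursat's argument subtracts. The part c / (u - z) cancels because
    its integral along an arc does not depend on s and along a ray does not depend on t; the
    constant part d has the primitive d u. *)
Let G_affine (c d : R[i]) s1 s2 t1 t2 : delta <= s1 -> s1 <= s2 -> s2 <= 1 ->
  t1 <= t2 -> G (fun u => c + d * (u - z)) s1 s2 t1 t2 = 0.
Proof.
move=> h1 h2 h3 h4.
have e1 : sg s1 = s1 by apply: sgE; lra.
have e2 : sg s2 = s2 by apply: sgE; lra.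
have vE s : itg t1 t2 (v (fun u => c + d * (u - z)) s) =
    c * itg t1 t2 (fun t => 'i * zeta t / (zeta t - z)) +
    (d * (sg s)%:C * rho%:C) * (cis t2 - cis t1).
  have := itg_cis 1 h4; rewrite !mul1r => <-.
  have cc : ccont (fun t : R => 'i * 1%:C * cis (1 * t)).
    apply: ccontM; first exact: ccont_cst.
    by apply: ccont_eq ccont_cis => t; rewrite mul1r.
  rewrite -!itgZ //.
  rewrite -itgD; last 2 first.
  { by apply: ccontM; [exact: ccont_cst|exact: ccont_w]. }
  { by apply: ccontM; [exact: ccont_cst|exact: cc]. }
  apply: eq_itg => t _; rewrite /v /Psi mul1r rmorph1 mulr1.
  rewrite [z + _ - z]addrAC subrr add0r /zeta; field.
  exact: zeta_neq.
have hE t : itg s1 s2 (h (fun u => c + d * (u - z)) t) =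
    c * itg s1 s2 (fun s => ((sg s)%:C)^-1) +
    d * (zeta t - z) * (s2 - s1)%:C.
  rewrite -itg_cst // -itgZ; last exact: ccontV.
  rewrite -itgD; last 2 first.
  { by apply: ccontM; [exact: ccont_cst|exact: ccontV]. }
  { exact: ccont_cst. }
  apply: eq_itg => s _; rewrite /h /Psi [z + _ - z]addrAC subrr add0r; field.
  exact: sg_neq0.
rewrite /G !vE !hE e1 e2 /zeta rmorphB /=; ring.
Qed.

Let G_bound F (e : R) s1 s2 t1 t2 : good F -> delta <= s1 -> s1 <= s2 -> s2 <= 1 ->
  t1 <= t2 ->
  (forall s t, s1 <= s <= s2 -> t1 <= t <= t2 -> cabs (F (Psi s t)) <= e) ->
  cabs (G F s1 s2 t1 t2) <=
    2 * e * (rho / (rho - cabs z) * (t2 - t1) + (s2 - s1) / delta).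
Proof.
move=> gF h1 h2 h3 h4 H; case/andP: hd => d0 d1.
have e0 : 0 <= e by apply: le_trans (cabs_ge0 _) (H s1 t1 _ _); rewrite lexx.
have k0 : 0 < rho - cabs z by rewrite subr_gt0.
have vB s : s1 <= s <= s2 ->
    cabs (itg t1 t2 (v F s)) <= e * (rho / (rho - cabs z)) * (t2 - t1).
  move=> hs; apply: itg_bound => //; first exact: ccont_v.
  move=> t ht; rewrite /v cabsM; apply: ler_pM (H _ _ hs ht) _ => //.
  rewrite cabs_div cabsM cabsi mul1r cabs_zeta ler_pM2l //.
  by rewrite lef_pV2 ?posrE ?cabs_gt0.
have hB t : t1 <= t <= t2 -> cabs (itg s1 s2 (h F t)) <= e / delta * (s2 - s1).
  move=> ht; apply: itg_bound => //; first exact: ccont_h.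
  move=> s hs; rewrite /h cabs_div; apply: ler_pM (H _ _ hs ht) _ => //.
    by rewrite invr_ge0.
  by rewrite cabsC gtr0_norm // lef_pV2 ?posrE.
have V1 := vB s1; have V2 := vB s2; have H1 := hB t1; have H2 := hB t2.
rewrite /G; apply: (le_trans (cabsD _ _)).
apply: (@le_trans _ _ ((e * (rho / (rho - cabs z)) * (t2 - t1)) +
  (e * (rho / (rho - cabs z)) * (t2 - t1)) + e / delta * (s2 - s1) +
  e / delta * (s2 - s1))).
  apply: lerD; last by apply: H1; rewrite lexx h4.
  apply: (le_trans (cabsB _ _)); apply: lerD; last by apply: H2; rewrite lexx h4.
  apply: (le_trans (cabsB _ _)); apply: lerD; [apply: V2|apply: V1];
  by rewrite lexx h2.
rewrite le_eqVlt; apply/orP; left; apply/eqP; ring.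
Qed.

Let G_split F s1 s2 s3 t1 t2 t3 : good F -> s1 <= s2 -> s2 <= s3 -> t1 <= t2 ->
  t2 <= t3 -> G F s1 s3 t1 t3 =
    G F s1 s2 t1 t2 + G F s2 s3 t1 t2 + (G F s1 s2 t2 t3 + G F s2 s3 t2 t3).
Proof.
move=> gF h1 h2 h3 h4; rewrite /G.
rewrite !(@itg_split _ t1 t2 t3) //; try exact: ccont_v.
rewrite !(@itg_split _ s1 s2 s3) //; try exact: ccont_h.
repeat match goal with |- context [itg ?a ?b ?f] => generalize (itg a b f) end.
by move=> *; ring.
Qed.

Let G_D F F' s1 s2 t1 t2 : good F -> good F' ->
  G (fun u => F u + F' u) s1 s2 t1 t2 = G F s1 s2 t1 t2 + G F' s1 s2 t1 t2.
Proof.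
move=> gF gF'; rewrite /G.
have vD s : itg t1 t2 (v (fun u => F u + F' u) s) =
    itg t1 t2 (v F s) + itg t1 t2 (v F' s).
  by rewrite -itgD; try exact: ccont_v; apply: eq_itg => t _; rewrite /v mulrDl.
have hD t : itg s1 s2 (h (fun u => F u + F' u) t) =
    itg s1 s2 (h F t) + itg s1 s2 (h F' t).
  by rewrite -itgD; try exact: ccont_h; apply: eq_itg => s _; rewrite /h mulrDl.
rewrite !vD !hD.
repeat match goal with |- context [itg ?a ?b ?f] => generalize (itg a b f) end.
by move=> *; ring.
Qed.

Let Psi_lip s s' t t' : cabs (Psi s t - Psi s' t') <= 2 * rho * `|s - s'| + rho * `|t - t'|.
Proof.
have -> : Psi s t - Psi s' t' = (sg s - sg s')%:C * (zeta t - z) +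
    (sg s')%:C * (rho%:C * (cis t - cis t')).
  by rewrite /Psi /zeta rmorphB; ring.
apply: (le_trans (cabsD _ _)); rewrite !cabsM !cabsC; apply: lerD.
  rewrite mulrC; apply: ler_pM (sg_lip _ _) => //.
  by apply: (le_trans (cabsB _ _)); rewrite cabs_zeta; have := hz; lra.
have r0 := rho_gt0; have s0 := sg_gt0 s'.
rewrite (gtr0_norm s0) (gtr0_norm r0) mulrA; apply: ler_pM (cis_lip _ _) => //.
  by rewrite mulr_ge0 // ltW.
by rewrite ler_piMl // ltW.
Qed.

Let cconv_affine (c d u : R[i]) : cconv (fun u => c + d * (u - z)) u.
Proof.
apply: (cderiv_cconv (d := d)) => e e0; exists 1 => // k _.
have -> : c + d * (u + k - z) - (c + d * (u - z)) - d * k = 0 by ring.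
by rewrite cabs0 mulr_ge0 // ltW.
Qed.

(** Quadrisection makes the boundary integral over the whole strip vanish. The radial sides t = 0
    and t = 2 pi coincide and cancel, which leaves the means over the contracted and the original
    circle. *)
Lemma goursat_strip (f : R[i] -> R[i]) :
  (forall u, cabs u <= rho -> exists d, cderiv f u d) ->
  mean (fun t => f (z + delta%:C * (zeta t - z)) * (zeta t / (zeta t - z))) =
  mean (fun t => f (zeta t) * (zeta t / (zeta t - z))).
Proof.
move=> hf; case/andP: hd => d0 d1.
have gf : good f by move=> u /hf[d]; exact: cderiv_cconv.
have k0 : 0 < rho - cabs z by rewrite subr_gt0.
have A0 : 0 <= 1 - delta by rewrite subr_ge0 ltW.
have GP e : 0 < e -> cabs (G f delta (delta + (1 - delta)) 0 (0 + 2 * pi)) < e.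
  move=> e0.
  pose g s t k := cabs (G f s (s + (1 - delta) / 2 ^+ k) t (t + (2 * pi) / 2 ^+ k)).
  suff : g delta 0 0%N < e by rewrite /g expr0 !divr1.
  apply: (@quadrisection _ g delta 0 (1 - delta) (2 * pi)) => //; first exact: pi2_ge0.
    move=> k s t _ _; rewrite /g.
    have half (C : R) : C / 2 ^+ k = C / 2 ^+ k.+1 + C / 2 ^+ k.+1.
      by rewrite exprS; field; rewrite expf_neq0.
    rewrite (half (1 - delta)) (half (2 * pi)) ![t + (_ + _)]addrA ![s + (_ + _)]addrA.
    have T (a b c d : R[i]) : cabs (a + b + (c + d)) <=
      cabs a + cabs b + (cabs c + cabs d).
      by apply: (le_trans (cabsD _ _)); apply: lerD; exact: cabsD.
    have a0 : 0 <= (1 - delta) / 2 ^+ k.+1 by rewrite divr_ge0 // exprn_ge0.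
    have b0 : 0 <= (2 * pi) / 2 ^+ k.+1 :> R by rewrite divr_ge0 ?exprn_ge0 ?pi2_ge0.
    rewrite (@G_split f s (s + (1 - delta) / 2 ^+ k.+1) _ t (t + (2 * pi) / 2 ^+ k.+1))
      ?lerDl //.

  move=> s t hs; have [d Hd] := hf (Psi s t) (Psi_le s t).
  (* [D] bounds the diameter of the image of the whole rectangle, and [K] is the bound of [G_bound]
     there for values of size [D]. In generation k the side lengths and the distance to the tangent
     point both shrink by 2^k, which yields the required 4^k. *)
  pose D := 2 * rho * (1 - delta) + rho * (2 * pi).
  pose K := 2 * D * (rho / (rho - cabs z) * (2 * pi) + (1 - delta) / delta).
  have pi0 := @pi2_gt0 R; have r0 := rho_gt0.
  have D0 : 0 < D.
    apply: ltr_wpDl; last by rewrite mulr_gt0.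
    by rewrite !mulr_ge0 // ltW.
  have K0 : 0 < K.
    apply: mulr_gt0; first by rewrite mulr_gt0.
    apply: ltr_pwDl; first by rewrite mulr_gt0 // divr_gt0.
    by rewrite divr_ge0 // ltW.
  have e1 : 0 < e / (2 * K) by rewrite divr_gt0 // mulr_gt0.
  have [r r_gt0 Hr] := Hd _ e1.
  exists (r / (2 * D)); first by rewrite divr_gt0 // mulr_gt0.
  move=> k s' t' hs1 hs2 hss htt hk.
  have P0 : 0 < (2 ^+ k)^-1 :> R by rewrite invr_gt0 exprn_gt0.
  have hs3 : s' + (1 - delta) / 2 ^+ k <= 1 by move: hs2; lra.
  have a0 : 0 <= (1 - delta) / 2 ^+ k by rewrite divr_ge0 // exprn_ge0.
  have b0 : 0 <= (2 * pi) / 2 ^+ k :> R by rewrite divr_ge0 ?exprn_ge0 ?pi2_ge0.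
  pose E u := f u + (- (f (Psi s t) - d * (Psi s t - z)) + (- d) * (u - z)).
  have gE : good E.
    move=> u hu; have [d' Hd'] := hf u hu.
    apply: (cderiv_cconv (d := d' - d)) => e' e0'.
    have [r' r0' Hr'] := Hd' e' e0'; exists r' => // k' hk'.
    have -> : E (u + k') - E u - (d' - d) * k' = f (u + k') - f u - d' * k'.
      by rewrite /E; ring.
    exact: Hr'.
  have -> : g s' t' k = cabs (G E s' (s' + (1 - delta) / 2 ^+ k) t'
      (t' + (2 * pi) / 2 ^+ k)).
    rewrite /g /E G_D //.
    by rewrite (G_affine _ _ hs1) ?addr0 // lerDl.
  have key s1 t1 : s' <= s1 <= s' + (1 - delta) / 2 ^+ k ->
      t' <= t1 <= t' + (2 * pi) / 2 ^+ k ->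
      cabs (E (Psi s1 t1)) <= e / (2 * K) * (D / 2 ^+ k).
      move=> hs1' ht1'.
      have bd : cabs (Psi s1 t1 - Psi s t) <= D / 2 ^+ k.
        have -> : D / 2 ^+ k = 2 * rho * ((1 - delta) / 2 ^+ k) +
          rho * ((2 * pi) / 2 ^+ k) by rewrite /D; ring.
        apply: (le_trans (Psi_lip _ _ _ _)).
        apply: lerD; rewrite ler_pM2l ?mulr_gt0 //.
          rewrite ler_norml; move: hss hs1'.
          by move=> /andP[? ?] /andP[? ?]; apply/andP; split; lra.
        rewrite ler_norml; move: htt ht1'.
        by move=> /andP[? ?] /andP[? ?]; apply/andP; split; lra.
      have lr : cabs (Psi s1 t1 - Psi s t) < r.
        apply: (le_lt_trans bd); apply: (@le_lt_trans _ _ (D * (r / (2 * D)))).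
          by rewrite ler_pM2l.
        by rewrite (_ : _ * _ = r / 2); [lra|field; rewrite gt_eqF].
      have EE : E (Psi s1 t1) = f (Psi s1 t1) - f (Psi s t) - d * (Psi s1 t1 - Psi s t).
        by rewrite /E; ring.
      have := Hr _ lr; rewrite subrKC -EE.
      by move=> h'; apply: (le_trans h'); apply: ler_pM => //; exact: ltW.
  apply: le_lt_trans (G_bound gE hs1 _ hs3 _ key) _; rewrite ?lerDl //.
  have [K' K0' eK] : exists2 K', 0 < K' & K = K' by exists K.
  rewrite eK.
  rewrite (_ : 2 * _ * _ = e / (2 * K') * K' * ((2 ^+ k)^-1 * (2 ^+ k)^-1)); last first.
    rewrite -[X in _ = _ * X * _]eK /K.
    by move: (e / (2 * K')) => x; ring.
  have -> : 4 ^+ k = 2 ^+ k * 2 ^+ k :> R by rewrite -exprMn -natrM.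
  rewrite -(invfM (2 ^+ k)) ltr_pM2r ?invr_gt0 ?mulr_gt0 ?exprn_gt0 //.
  have -> : e / (2 * K') * K' = e / 2 by field; rewrite gt_eqF.
  by lra.
have G0 : G f delta 1 0 (2 * pi) = 0.
  rewrite -[LHS]subr0; apply/subr0_eq/eqP; rewrite !subr0 -cabs_eq0.
  rewrite eq_le cabs_ge0 andbT; apply/ler_addgt0Pl => e e0; rewrite addr0.
  by have := GP e e0; rewrite addrC subrK add0r => /ltW.
have per : itg delta 1 (h f (2 * pi)) = itg delta 1 (h f 0).
  by apply: eq_itg => s _; rewrite /h /Psi /zeta cis_period.
move: G0; rewrite /G per subrK => /eqP; rewrite subr_eq0 => /eqP G0.
have m s : mean (fun t => f (Psi s t) * (zeta t / (zeta t - z))) =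
    (2 * pi)^-1%:C * (- 'i) * itg 0 (2 * pi) (v f s).
  rewrite -mulrA -itgZ; last exact: ccont_v.
  congr (_ * _); apply: eq_itg => t _; rewrite /v.
  have -> : f (Psi s t) * ('i * zeta t / (zeta t - z)) =
    'i * (f (Psi s t) * (zeta t / (zeta t - z))) by ring.
  have ii : - 'i * 'i = 1 :> R[i] by rewrite mulNr -expr2 sqr_i opprK.
  by rewrite [RHS]mulrA ii mul1r.
have := m delta; have := m 1; rewrite -G0 => <-.
have s1 : sg 1 = 1 by apply: sgE; rewrite lexx ltW.
have s2 : sg delta = delta by apply: sgE; rewrite lexx ltW.
rewrite /Psi s1 s2 => ->; apply: eq_mean => t.
by rewrite rmorph1 mul1r subrKC.
Qed.
End cauchy.

(** * Cauchy's integral formula *)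

Section taylor.
Context {R : realType}.
Implicit Types (f g : R[i] -> R[i]) (z u : R[i]) (r t : R) (k n : nat).

Lemma geom_small (C q e : R) : 0 <= q < 1 -> 0 < e ->
  exists N, forall n, (N <= n)%N -> C * q ^+ n <= e.
Proof.
move=> /andP[q0 q1] e0; have [C0|C0] := lerP C 0.
  by exists 0%N => n _; apply: le_trans (ltW e0); rewrite mulr_le0_ge0 // exprn_ge0.
have qn : `|q| < 1 by rewrite ger0_norm.
have := cvg_geometric C qn; move/cvgrPdist_le => /(_ e e0) [N _ HN].
exists N => n hn; have := HN n hn; rewrite sub0r normrN /geometric /=.
by rewrite ger0_norm // mulr_ge0 ?exprn_ge0 // ltW.
Qed.

Lemma ccont_bounded (g : R -> R[i]) (a b : R) : ccont g ->
  exists M : R, forall t, a <= t <= b -> cabs (g t) <= M.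
Proof.
move=> cg; have [ab|ba] := leP a b; last first.
  by exists 0 => t /andP[h1 h2]; have := le_trans h1 h2; rewrite leNgt ba.
have [c _ H] := EVT_max ab (continuous_subspaceT (continuous_cabs2 cg)).
exists (cabs (g c)) => t ht; apply: ler_sqr2 => //.
by apply: H; rewrite in_itv.
Qed.

Lemma geom_kernel z u n : u != 0 -> u - z != 0 ->
  u / (u - z) = \sum_(k < n) z ^+ k * (u ^+ k)^-1 + (z / u) ^+ n * (u / (u - z)).
Proof.
move=> u0 uz; elim: n => [|n IH]; first by rewrite big_ord0 add0r expr0 mul1r.
rewrite big_ord_recr /= -addrA {1}IH; congr (_ + _).
rewrite [in RHS]exprS expr_div_n; field.
by rewrite expf_neq0 // uz u0.
Qed.

Section fixed_radius.
Variables (f : R[i] -> R[i]) (rho : R).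
Hypothesis rho0 : 0 < rho.
Hypothesis hf : forall u, cabs u <= rho -> exists d, cderiv f u d.

Lemma cabs_on_circle (r : R) t : 0 <= r -> cabs (on_circle r t) = r.
Proof. by move=> r0; rewrite on_circleE cabsM cabs_cis mulr1 cabsC ger0_norm. Qed.

Lemma ccont_on_circle (r : R) : ccont (on_circle r).
Proof.
apply: (@ccont_eq _ (fun t => r%:C * cis t)) => [t|]; first by rewrite on_circleE.
by apply: ccontM; [exact: ccont_cst|exact: ccont_cis].
Qed.

Let zeta := on_circle rho.
Let zeta_neq0 t : zeta t != 0.
Proof. by rewrite -cabs_gt0 cabs_on_circle // ltW. Qed.
Let zeta_neq z t : cabs z < rho -> zeta t - z != 0.
Proof.
move=> hz; rewrite -cabs_gt0 (lt_le_trans _ (lerB_cabs _ _)) // subr_gt0.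
by rewrite cabs_on_circle // ltW.
Qed.
Let dist_zeta z t : rho - cabs z <= cabs (zeta t - z).
Proof. by rewrite -{1}(cabs_on_circle t (ltW rho0)) lerB_cabs. Qed.

Let ccont_zeta : ccont zeta. Proof. exact: ccont_on_circle. Qed.
Let ccont_f : ccont (fun t => f (zeta t)).
Proof.
apply: (ccont_comp _ ccont_zeta) => t; have [|d] := hf (u := zeta t).
  by rewrite cabs_on_circle // ltW.
exact: cderiv_cconv.
Qed.
Let ccont_k z : cabs z < rho -> ccont (fun t => zeta t / (zeta t - z)).
Proof.
move=> hz; apply: ccontM ccont_zeta _; apply: ccontV => [t|]; first exact: zeta_neq.
by apply: ccontB ccont_zeta _; exact: ccont_cst.
Qed.
Let ccont_V k : ccont (fun t => (zeta t ^+ k)^-1).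
Proof.
apply: ccontV => [t|]; first by rewrite expf_neq0.
exact: ccontX.
Qed.

Definition tcoef k := mean (fun t => f (zeta t) * (zeta t ^+ k)^-1).

Lemma kernel_expansion (M : R) : (forall t, 0 <= t <= 2 * pi -> cabs (f (zeta t)) <= M) ->
  forall z n, cabs z < rho ->
  cabs (mean (fun t => f (zeta t) * (zeta t / (zeta t - z))) -
    \sum_(k < n) tcoef k * z ^+ k) <= M * (rho / (rho - cabs z)) * (cabs z / rho) ^+ n.
Proof.
move=> HM z n hz; have kk := ccont_k hz.
have -> : \sum_(k < n) tcoef k * z ^+ k =
    mean (fun t => \sum_(k < n) z ^+ k * (f (zeta t) * (zeta t ^+ k)^-1)).
  rewrite mean_sum => [|k]; last first.
    by apply: ccontM (ccont_cst _) _; apply: ccontM ccont_f _; exact: ccont_V.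
  apply: eq_bigr => k _; rewrite meanZ; first by rewrite mulrC.
  by apply: ccontM ccont_f _; exact: ccont_V.
have cs : ccont (fun t => \sum_(k < n) z ^+ k * (f (zeta t) / zeta t ^+ k)).
  apply: ccont_sum => k; apply: ccontM (ccont_cst _) _.
  by apply: ccontM ccont_f _; exact: ccont_V.
rewrite -meanB //; last exact: ccontM ccont_f kk.
apply: mean_bound; first by apply: ccontB cs; exact: ccontM ccont_f kk.
move=> t ht.
have -> : f (zeta t) * (zeta t / (zeta t - z)) -
    \sum_(k < n) z ^+ k * (f (zeta t) / zeta t ^+ k) =
    f (zeta t) * ((zeta t / (zeta t - z)) * (z / zeta t) ^+ n).
  rewrite {1}(geom_kernel n (zeta_neq0 t) (zeta_neq t hz)) mulrDr mulr_sumr addrAC.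
  rewrite -sumrB big1 ?add0r; first by rewrite (mulrC (_ ^+ n)).
  by move=> k _; ring.
have k0 : 0 < rho - cabs z by rewrite subr_gt0.
rewrite cabsM (cabsM (_ / _)) -mulrA; apply: ler_pM (HM t ht) _ => //.
  by rewrite mulr_ge0.
apply: ler_pM => //.
  rewrite cabs_div cabs_on_circle ?(ltW rho0) // ler_pM2l //.
  by rewrite lef_pV2 ?posrE // cabs_gt0 zeta_neq.
by rewrite cabsX cabs_div cabs_on_circle // ltW.
Qed.

(** Of the geometric expansion of the kernel only the constant term has a nonzero mean. This
    computes the winding number of the circle around z. *)
Lemma mean_kernel1 z : cabs z < rho -> mean (fun t => zeta t / (zeta t - z)) = 1.
Proof.
move=> hz; apply: cabs_small_eq => e e0.
have q01 : 0 <= cabs z / rho < 1.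
  by rewrite divr_ge0 ?ltr_pdivrMr ?mul1r // ltW.
have [N HN] := geom_small (rho / (rho - cabs z)) q01 e0.
have kk := ccont_k hz.
have ez : mean (fun t => \sum_(k < N.+1) z ^+ k * (zeta t ^+ k)^-1) = 1.
  rewrite mean_sum => [|k]; last by apply: ccontM (ccont_cst _) _; exact: ccont_V.
  rewrite big_ord_recl big1 ?addr0 => [|k _].
    by rewrite expr0 -[RHS](mean_cst 1); apply: eq_mean => t; rewrite mul1r expr0 invr1.
  rewrite -(mulr0 (z ^+ (lift ord0 k) * (rho%:C ^+ (lift ord0 k))^-1)).
  rewrite -(@mean_cisX_J R (lift ord0 k)) // -meanZ; last exact/ccontX/ccontJ/ccont_cis.
  apply: eq_mean => t; rewrite /zeta on_circleE exprMn invfM mulrA -(exprVn (cis t)) cisV.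
  by [].
have cs : ccont (fun t => \sum_(k < N.+1) z ^+ k * (zeta t ^+ k)^-1).
  by apply: ccont_sum => k; apply: ccontM (ccont_cst _) _; exact: ccont_V.
rewrite -ez -meanB //; apply: mean_bound; first exact: ccontB.
move=> t _; rewrite {1}(geom_kernel N.+1 (zeta_neq0 t) (zeta_neq t hz)).
rewrite addrAC subrr add0r; apply: le_trans (HN N.+1 (leqnSn _)).
rewrite cabsM mulrC; apply: ler_pM => //; last first.
  by rewrite cabsX cabs_div cabs_on_circle // ltW.
rewrite cabs_div cabs_on_circle ?(ltW rho0) // ler_pM2l //.
by rewrite lef_pV2 ?posrE ?subr_gt0 // cabs_gt0 zeta_neq.
Qed.

(** By [goursat_strip] the mean does not change when the circle is contracted towards z, where f is
    nearly the constant f z; [mean_kernel1] evaluates that constant. *)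
Lemma cauchy_formula z : cabs z < rho ->
  f z = mean (fun t => f (zeta t) * (zeta t / (zeta t - z))).
Proof.
move=> hz; apply: cabs_small_eq => e e0; have kk := ccont_k hz.
have k0 : 0 < rho - cabs z by rewrite subr_gt0.
have e1 : 0 < e / (rho / (rho - cabs z)) by rewrite divr_gt0 // divr_gt0.
have [d0 /cderiv_cconv cz] := hf (ltW hz).
have [d dp Hd] := cz _ e1.
pose delta := Num.min (2^-1) (d / (4 * rho)).
have d1 : delta <= 2^-1 by rewrite ge_min lexx.
have d2 : delta * (2 * rho) < d.
  apply: (@le_lt_trans _ _ (d / (4 * rho) * (2 * rho))).
    by rewrite ler_pM2r ?mulr_gt0 // ge_min lexx orbT.
  by rewrite (_ : _ * _ = d / 2); [lra|field; rewrite gt_eqF].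
have dpos : 0 < delta by rewrite lt_min invr_gt0 ltr0n divr_gt0 // mulr_gt0.
have d01 : 0 < delta < 1 by rewrite dpos /=; lra.
have := goursat_strip hz d01 hf.
rewrite (@eq_mean _ (fun t => f (rho%:C * cis t) * _)
  (fun t => f (zeta t) * (zeta t / (zeta t - z)))); last first.
  by move=> t; rewrite /zeta on_circleE.
move=> <-; have -> : f z = mean (fun t => f z * (zeta t / (zeta t - z))).
  by rewrite meanZ // mean_kernel1 // mulr1.
have dist t : cabs (z + delta%:C * (zeta t - z) - z) < d.
  rewrite addrC addKr cabsM cabsC gtr0_norm //; apply: le_lt_trans d2.
  rewrite ler_pM2l //; apply: (le_trans (cabsB _ _)).
  by rewrite cabs_on_circle ?(ltW rho0) //; have := hz; lra.
have le_rho t : cabs (z + delta%:C * (zeta t - z)) <= rho.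
  have -> : z + delta%:C * (zeta t - z) = (1 - delta)%:C * z + delta%:C * zeta t.
    by rewrite rmorphB rmorph1; ring.
  apply: (le_trans (cabsD _ _)); rewrite !cabsM !cabsC cabs_on_circle ?(ltW rho0) //.
  rewrite !ger0_norm ?ltW //; last by lra.
  have := ltW hz; have := dpos; nra.
have cf : ccont (fun t => f (z + delta%:C * (zeta t - z)) * (zeta t / (zeta t - z))).
  apply: ccontM kk; apply: ccont_comp => [t|].
    by have [d' /cderiv_cconv] := hf (le_rho t).
  apply: ccontD (ccont_cst _) _; apply: ccontM (ccont_cst _) _.
  by apply: ccontB ccont_zeta (ccont_cst _).
rewrite (@eq_mean _ (fun t => _ (_ + _ * (rho%:C * cis t - z)) * _)
  (fun t => f (z + delta%:C * (zeta t - z)) * (zeta t / (zeta t - z)))); last first.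
  by move=> t; rewrite /zeta on_circleE.
rewrite -meanB //; last by apply: ccontM (ccont_cst _) kk.
apply: mean_bound; first by apply: ccontB cf; apply: ccontM (ccont_cst _) kk.
move=> t _; rewrite -mulrBl cabsM cabs_distC.
rewrite -[leRHS](mulfVK (x := rho / (rho - cabs z))); last first.
  by rewrite gt_eqF // divr_gt0.
apply: ler_pM => //; first exact: Hd.
rewrite cabs_div cabs_on_circle ?(ltW rho0) // ler_pM2l //.
by rewrite lef_pV2 ?posrE ?subr_gt0 // cabs_gt0 zeta_neq.
Qed.
End fixed_radius.
End taylor.

(** * Analytic functions on the disc *)

Section analytic.
Context {R : realType}.
Implicit Types (f g h : R[i] -> R[i]) (z u l : R[i]) (r s : R) (k n : nat).

Definition analytic f := forall z, cabs z < 1 -> exists d, cderiv f z d.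

Lemma analyticP f : analytic_on_disc f <-> analytic f.
Proof.
split=> [H z hz|H z /H[d]]; last exact: cderiv_derivable.
by apply: derivable_cderiv; exact: H.
Qed.

Lemma analytic_cconv f z : analytic f -> cabs z < 1 -> cconv f z.
Proof. by move=> af /af[d]; exact: cderiv_cconv. Qed.

Lemma analytic_ccont f r : analytic f -> 0 <= r < 1 -> ccont (fun t => f (on_circle r t)).
Proof.
move=> af /andP[r0 r1]; apply: ccont_comp (ccont_on_circle r) => t.
by apply: analytic_cconv => //; rewrite cabs_on_circle.
Qed.

Lemma cderiv_local f g z d (e : R) : 0 < e ->
  (forall u, cabs (u - z) < e -> f u = g u) -> cderiv g z d -> cderiv f z d.
Proof.
move=> e0 H dg e' e0'; have [r r0 Hr] := dg _ e0'.
exists (Num.min r e); first by rewrite lt_min r0.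
move=> h; rewrite lt_min => /andP[h1 h2].
by rewrite (H (z + h)) ?(H z) ?subrr ?cabs0 ?[z + h]addrC ?addrK //
  [h + z]addrC; exact: Hr.
Qed.

Lemma eq_analytic f g : (forall z, cabs z < 1 -> f z = g z) -> analytic f -> analytic g.
Proof.
move=> H af; move=> z hz.
have [d Hd] := af z hz; exists d.
have e0 : 0 < 1 - cabs z by rewrite subr_gt0.
apply: (cderiv_local e0 _ Hd) => u hu; rewrite H //.
by have := lerB_cabs u z; lra.
Qed.

Lemma analytic_cst (c : R[i]) : analytic (fun=> c).
Proof.
move=> z _; exists 0 => e e0; exists 1 => // h _.
by rewrite subrr mul0r subr0 cabs0 mulr_ge0 // ltW.
Qed.
Lemma analytic_id : analytic (fun z => z).
Proof.
move=> z _; exists 1 => e e0; exists 1 => // h _.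
by rewrite mul1r [z + h]addrC addrK subrr cabs0 mulr_ge0 // ltW.
Qed.
Lemma analyticD f g : analytic f -> analytic g -> analytic (fun z => f z + g z).
Proof.
move=> af ag z hz; have [d1 H1] := af z hz; have [d2 H2] := ag z hz.
exists (d1 + d2) => e e0; have e2 : 0 < e / 2 by rewrite divr_gt0.
have [r r0 Hr] := H1 _ e2; have [r' r0' Hr'] := H2 _ e2.
exists (Num.min r r'); first by rewrite lt_min r0.
move=> h; rewrite lt_min => /andP[h1 h2].
have -> : f (z + h) + g (z + h) - (f z + g z) - (d1 + d2) * h =
  (f (z + h) - f z - d1 * h) + (g (z + h) - g z - d2 * h) by ring.
apply: (le_trans (cabsD _ _)); rewrite (splitr e) mulrDl.
by apply: lerD; [exact: Hr|exact: Hr'].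
Qed.
Lemma cderivM f g z d1 d2 : cderiv f z d1 -> cderiv g z d2 ->
  cderiv (fun z => f z * g z) z (d1 * g z + f z * d2).
Proof.
move=> H1 H2 e e0.
have pos (c : R[i]) : 0 < 1 + cabs c by have := cabs_ge0 c; lra.
have e3 c : 0 < e / (3 * (1 + cabs c)) by rewrite divr_gt0 // mulr_gt0.
have [r r0 Hr] := H1 _ (e3 (g z)); have [r' r0' Hr'] := H2 _ (e3 (f z)).
have [s1 s10 Hs1] := cderiv_cconv H2 ltr01.
have [s2 s20 Hs2] := cderiv_cconv H2 (e3 d1).
exists (Num.min (Num.min r r') (Num.min s1 s2)); first by rewrite !lt_min r0 r0' s10.
move=> h; rewrite !lt_min => /andP[/andP[h1 h2] /andP[h3 h4]].
have := Hs1 (z + h); have := Hs2 (z + h); rewrite [z + h]addrC addrK [h + z]addrC.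
move=> /(_ h4) b2 /(_ h3) b1.
have -> : f (z + h) * g (z + h) - f z * g z - (d1 * g z + f z * d2) * h =
  (f (z + h) - f z - d1 * h) * g (z + h) + d1 * (h * (g (z + h) - g z)) +
  f z * (g (z + h) - g z - d2 * h) by ring.
apply: (le_trans (cabsD _ _)).
have gz : cabs (g (z + h)) <= 1 + cabs (g z).
  by have := lerB_cabs (g (z + h)) (g z); lra.
have third (c : R[i]) (x : R) : x <= 1 + cabs c ->
    e / (3 * (1 + cabs c)) * x <= e / 3.
  move=> hx; have p := pos c; rewrite invfM mulrA -mulrA; apply: ler_piMr.
    by rewrite divr_ge0 // ltW.
  by rewrite ler_pdivrMl // mulr1.
have -> : e * cabs h = e / 3 * cabs h + e / 3 * cabs h + e / 3 * cabs h by field.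
apply: lerD; first (apply: (le_trans (cabsD _ _)); apply: lerD).
- rewrite cabsM; apply: (@le_trans _ _ (e / (3 * (1 + cabs (g z))) * cabs h *
    cabs (g (z + h)))); first by rewrite ler_wpM2r // Hr.
  by rewrite mulrAC ler_wpM2r // third.
- rewrite !cabsM mulrCA; rewrite [X in _ <= X]mulrC ler_wpM2l //.
  apply: (@le_trans _ _ (cabs d1 * (e / (3 * (1 + cabs d1))))).
    by rewrite ler_wpM2l.
  by rewrite mulrC third // lerDr.
- rewrite cabsM; apply: (@le_trans _ _ (cabs (f z) *
    (e / (3 * (1 + cabs (f z))) * cabs h))); first by rewrite ler_wpM2l // Hr'.
  by rewrite mulrA ler_wpM2r // mulrC third // lerDr.
Qed.
Lemma analyticM f g : analytic f -> analytic g -> analytic (fun z => f z * g z).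
Proof.
move=> af ag z hz; have [d1 H1] := af z hz; have [d2 H2] := ag z hz.
by exists (d1 * g z + f z * d2); exact: cderivM.
Qed.
Lemma analyticZ c f : analytic f -> analytic (fun z => c * f z).
Proof. by move=> af; exact: (analyticM (analytic_cst c) af). Qed.
Lemma analyticN f : analytic f -> analytic (fun z => - f z).
Proof.
move=> af; apply: eq_analytic (analyticZ (-1) af) => z _; by rewrite mulN1r.
Qed.
Lemma analyticB f g : analytic f -> analytic g -> analytic (fun z => f z - g z).
Proof. by move=> af ag; apply: analyticD => //; exact: analyticN. Qed.
Lemma analyticX f n : analytic f -> analytic (fun z => f z ^+ n).
Proof.
move=> af; elim: n => [|n IH].
  by apply: eq_analytic (analytic_cst 1) => z _; rewrite expr0.
by apply: eq_analytic (analyticM af IH) => z _; rewrite exprS.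
Qed.
Lemma analytic_sum (I : Type) (s : seq I) (P : pred I) (F : I -> R[i] -> R[i]) :
  (forall i, P i -> analytic (F i)) -> analytic (fun z => \sum_(i <- s | P i) F i z).
Proof.
move=> H; elim: s => [|i s IH].
  by apply: eq_analytic (analytic_cst 0) => z _; rewrite big_nil.
case Pi : (P i); last by apply: eq_analytic IH => z _; rewrite big_cons Pi.
by apply: eq_analytic (analyticD (H i Pi) IH) => z _; rewrite big_cons Pi.
Qed.
Lemma analytic_prod (I : Type) (s : seq I) (P : pred I) (F : I -> R[i] -> R[i]) :
  (forall i, P i -> analytic (F i)) -> analytic (fun z => \prod_(i <- s | P i) F i z).
Proof.
move=> H; elim: s => [|i s IH].
  by apply: eq_analytic (analytic_cst 1) => z _; rewrite big_nil.
case Pi : (P i); last by apply: eq_analytic IH => z _; rewrite big_cons Pi.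
by apply: eq_analytic (analyticM (H i Pi) IH) => z _; rewrite big_cons Pi.
Qed.

Lemma cderivV f z d : f z != 0 -> cderiv f z d ->
  cderiv (fun u => (f u)^-1) z (- d / f z ^+ 2).
Proof.
move=> f0 H e e0; have F0 : 0 < cabs (f z) by rewrite cabs_gt0.
have F2 : 0 < cabs (f z) / 2 by rewrite divr_gt0.
have d1 : 0 < 1 + cabs d by have := cabs_ge0 d; lra.
have e1 : 0 < e * cabs (f z) ^+ 2 / 4 by rewrite divr_gt0 // mulr_gt0 // exprn_gt0.
have e2 : 0 < e * cabs (f z) ^+ 3 / 4 / (1 + cabs d).
  by rewrite !divr_gt0 // mulr_gt0 // exprn_gt0.
have [r r0 Hr] := H _ e1; have [s1 s10 Hs1] := cderiv_cconv H F2.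
have [s2 s20 Hs2] := cderiv_cconv H e2.
exists (Num.min r (Num.min s1 s2)); first by rewrite !lt_min r0 s10.
move=> h; rewrite !lt_min => /and3P[h1 h3 h4].
have := Hs1 (z + h); have := Hs2 (z + h); rewrite [z + h]addrC addrK [h + z]addrC.
move=> /(_ h4) b2 /(_ h3) b1.
have lf : cabs (f z) / 2 <= cabs (f (z + h)).
  by have := lerB_cabs (f z) (f (z + h)); rewrite cabs_distC; lra.
have f1 : f (z + h) != 0 by rewrite -cabs_gt0 (lt_le_trans F2).
have -> : (f (z + h))^-1 - (f z)^-1 - - d / f z ^+ 2 * h =
  (- (f (z + h) - f z - d * h) * f z + d * (h * (f (z + h) - f z))) /
  (f z ^+ 2 * f (z + h)) by field; rewrite f0 f1.
rewrite cabs_div ler_pdivrMr ?cabs_gt0 ?mulf_neq0 ?expf_neq0 //.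
apply: (@le_trans _ _ (e * cabs h * (cabs (f z) ^+ 2 * (cabs (f z) / 2)))); last first.
  by rewrite cabsM cabsX; apply: ler_wpM2l; [rewrite mulr_ge0 // ltW|
    rewrite ler_wpM2l // exprn_ge0].
apply: (le_trans (cabsD _ _)).
have -> : e * cabs h * (cabs (f z) ^+ 2 * (cabs (f z) / 2)) =
  e * cabs (f z) ^+ 2 / 4 * cabs h * cabs (f z) + e * cabs (f z) ^+ 3 / 4 * cabs h.
  by field.
apply: lerD; first by rewrite cabsM cabsN ler_wpM2r // Hr.
rewrite !cabsM mulrCA [leRHS]mulrC ler_wpM2l //.
apply: (@le_trans _ _ (cabs d * (e * cabs (f z) ^+ 3 / 4 / (1 + cabs d)))).
  by rewrite ler_wpM2l.
rewrite mulrA ler_pdivrMr // mulrC ler_wpM2l ?lerDr //.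
by rewrite divr_ge0 // mulr_ge0 ?exprn_ge0 // ltW.
Qed.

Lemma analyticV f : analytic f -> (forall z, cabs z < 1 -> f z != 0) ->
  analytic (fun z => (f z)^-1).
Proof.
move=> af f0 z hz; have [d Hd] := af z hz.
by exists (- d / f z ^+ 2); apply: cderivV Hd; exact: f0.
Qed.

Lemma cderiv_comp_scale f (c z : R[i]) : (exists d, cderiv f (c * z) d) ->
  exists d, cderiv (fun u => f (c * u)) z d.
Proof.
move=> [d H]; exists (d * c) => e e0.
have c1 : 0 < 1 + cabs c by have := cabs_ge0 c; lra.
have [r r0 Hr] := H _ (divr_gt0 e0 c1).
exists (r / (1 + cabs c)); first by rewrite divr_gt0.
move=> h; rewrite ltr_pdivlMr // => hh.
rewrite mulrDr -mulrA; apply: (le_trans (Hr _ _)); last first.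
  rewrite cabsM mulrA ler_wpM2r // mulrAC ler_pdivrMr // ler_pM2l //.
  by rewrite lerDr.
by rewrite cabsM; have := cabs_ge0 h; nra.
Qed.

Lemma analytic_scale f (c : R[i]) : analytic f -> cabs c <= 1 -> analytic (fun z => f (c * z)).
Proof.
move=> af hc; move=> z hz.
apply: cderiv_comp_scale; apply: af.
by rewrite cabsM; have := cabs_ge0 z; nra.
Qed.

Lemma analytic_kernel (c : R[i]) : cabs c <= 1 -> analytic (fun z => (1 - c * z)^-1).
Proof.
move=> hc; apply: analyticV => [|z hz].
  by apply: analyticB; [exact: analytic_cst|exact: analyticZ analytic_id].
rewrite subr_eq0; apply/eqP => e; have := congr1 cabs e; rewrite cabs1 cabsM.
by have := cabs_ge0 z; nra.
Qed.

(** The density [phi] is arbitrary. This serves both uniform limits, which are not yet known to be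
    analytic, and quotients at a zero. *)
Lemma cauchy_integral_cderiv (phi : R -> R[i]) r z : 0 < r -> cabs z < r -> ccont phi ->
  exists d, cderiv (fun z => mean (fun t => phi t * (on_circle r t - z)^-1)) z d.
Proof.
move=> r0 hz cphi.
have [M HM] := ccont_bounded 0 (2 * pi) cphi.
have M0 : 0 <= M by apply: le_trans (cabs_ge0 _) (HM 0 _); rewrite lexx pi2_ge0.
pose k := r - cabs z; have k0 : 0 < k by rewrite subr_gt0.
have kz t : k <= cabs (on_circle r t - z).
  by rewrite /k -{1}(cabs_on_circle t (ltW r0)) lerB_cabs.
have nz t : on_circle r t - z != 0 by rewrite -cabs_gt0 (lt_le_trans k0).
have kh (h : R[i]) t : cabs h < k / 2 -> k / 2 <= cabs (on_circle r t - (z + h)).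
  move=> hh; rewrite opprD addrA; apply: le_trans (lerB_cabs _ _).
  by have := kz t; lra.
have nzh (h : R[i]) t : cabs h < k / 2 -> on_circle r t - (z + h) != 0.
  by move=> /(kh _ t) hh; rewrite -cabs_gt0; apply: lt_le_trans hh; rewrite divr_gt0.
have cz (w : R[i]) : (forall t, on_circle r t - w != 0) ->
    ccont (fun t => phi t * (on_circle r t - w)^-1).
  move=> hw; apply: ccontM cphi (ccontV hw _).
  by apply: ccontB (ccont_on_circle r) (ccont_cst _).
have cV : ccont (fun t => (on_circle r t - z)^-1).
  by apply: ccontV nz _; apply: ccontB (ccont_on_circle r) (ccont_cst _).
have c2 : ccont (fun t => phi t * ((on_circle r t - z)^-1 * (on_circle r t - z)^-1)).
  by apply: ccontM cphi _; exact: ccontM.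
exists (mean (fun t => phi t * ((on_circle r t - z)^-1 * (on_circle r t - z)^-1))).
move=> e e0; pose K := 1 + M * (2 / k ^+ 3).
have K0 : 0 < K by rewrite /K ltr_pwDl // mulr_ge0 // divr_ge0 // exprn_ge0 // ltW.
exists (Num.min (k / 2) (e / K)); first by rewrite lt_min !divr_gt0.
move=> h; rewrite lt_min => /andP[h1 h2].
have ch := cz _ (fun t => nzh h t h1).
rewrite (mulrC (mean _) h) -meanZ // -meanB //; last exact: cz.
rewrite -meanB //; last 2 first.
    by apply: ccontB => //; exact: cz.
  by apply: ccontM (ccont_cst _) _.
apply: (@le_trans _ _ (K * cabs h * cabs h)); last first.
  by rewrite ler_wpM2r // mulrC -ler_pdivlMr // ltW.
apply: mean_bound.
  by apply: ccontB; [apply: ccontB => //; exact: cz|exact: ccontM (ccont_cst _) _].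
move=> t ht; have n1 := nz t; have n2 := nzh h t h1.
have -> : phi t / (on_circle r t - (z + h)) - phi t / (on_circle r t - z) -
  h * (phi t * ((on_circle r t - z)^-1 / (on_circle r t - z))) =
  phi t * (h * h * ((on_circle r t - (z + h))^-1 *
    ((on_circle r t - z)^-1 * (on_circle r t - z)^-1))) by field; rewrite n1 n2.
rewrite !cabsM !cabsV.
have a1 : (cabs (on_circle r t - (z + h)))^-1 <= 2 / k.
  rewrite -[2 / k]invrK lef_pV2 ?posrE ?invr_gt0 ?divr_gt0 ?cabs_gt0 // invf_div.
  exact: kh.
have a2 : (cabs (on_circle r t - z))^-1 <= k^-1.
  by rewrite lef_pV2 ?posrE ?cabs_gt0.
apply: (@le_trans _ _ (M * (cabs h * cabs h * (2 / k * (k^-1 * k^-1))))).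
  have i0 (x : R[i]) : 0 <= (cabs x)^-1 by rewrite invr_ge0.
  apply: ler_pM (HM t ht) _; rewrite ?mulr_ge0 //.
  apply: ler_wpM2l; first by rewrite mulr_ge0.
  by apply: ler_pM a1 _; rewrite ?mulr_ge0 //; exact: ler_pM.
rewrite (_ : M * _ = (M * (2 / k ^+ 3)) * cabs h * cabs h); last first.
  by field; rewrite gt_eqF.
by apply: ler_wpM2r => //; apply: ler_wpM2r => //; rewrite /K; lra.
Qed.

Lemma cauchy_disc f r z : analytic f -> 0 < r < 1 -> cabs z < r ->
  f z = mean (fun t => f (on_circle r t) * (on_circle r t / (on_circle r t - z))).
Proof.
move=> af /andP[r0 r1] hz; apply: cauchy_formula => // u hu.
by apply: af; exact: le_lt_trans r1.
Qed.

(** Each approximant satisfies Cauchy's formula on a circle, uniform convergence transfers the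
    formula to f, and a Cauchy integral is analytic. *)
Lemma analytic_ulimit f :
  (forall r e : R, 0 < r < 1 -> 0 < e -> exists2 g, analytic g &
     forall z, cabs z <= r -> cabs (f z - g z) <= e) -> analytic f.
Proof.
move=> H; move=> z hz.
pose r := (1 + cabs z) / 2.
have r0 : 0 < r by have := cabs_ge0 z; rewrite /r; lra.
have r1 : r < 1 by rewrite /r; lra.
have zr : cabs z < r by rewrite /r; lra.
have r01 : 0 < r < 1 by rewrite r0.
pose s := (1 + r) / 2.
have s01 : 0 < s < 1 by rewrite /s; apply/andP; split; lra.
have cf : ccont (fun t => f (on_circle r t)).
  apply: ccont_comp (ccont_on_circle r) => t e e0.
  have [|g ag Hg] := H s (e / 4) s01; first by rewrite divr_gt0.
  have ct : cabs (on_circle r t) = r by rewrite cabs_on_circle // ltW.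
  have e2 : 0 < e / 2 by rewrite divr_gt0.
  have ct1 : cabs (on_circle r t) < 1 by rewrite ct.
  have [d d0 Hd] := analytic_cconv ag ct1 e2.
  exists (Num.min d (s - r)); first by rewrite lt_min d0 /s; lra.
  move=> u; rewrite lt_min => /andP[h1 h2].
  have us : cabs u <= s by have := lerB_cabs u (on_circle r t); rewrite ct; lra.
  have ts : cabs (on_circle r t) <= s by rewrite ct /s; lra.
  have := Hg _ us; have := Hg _ ts; have := Hd _ h1.
  have -> : f u - f (on_circle r t) = (f u - g u) + (g u - g (on_circle r t)) +
    - (f (on_circle r t) - g (on_circle r t)) by ring.
  move=> b1 b2 b3; apply: (le_trans (cabsD _ _)); rewrite cabsN.
  have := cabsD (f u - g u) (g u - g (on_circle r t)); lra.
pose F z := mean (fun t => (f (on_circle r t) * on_circle r t) * (on_circle r t - z)^-1).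
have fF w : cabs w < r -> f w = F w.
  move=> hw; have nw t : on_circle r t - w != 0.
    rewrite -cabs_gt0; apply: lt_le_trans (lerB_cabs _ _).
    by rewrite cabs_on_circle ?(ltW r0) // subr_gt0.
  have ck : ccont (fun t => on_circle r t / (on_circle r t - w)).
    apply: ccontM (ccont_on_circle r) (ccontV nw _).
    by apply: ccontB (ccont_on_circle r) (ccont_cst _).
  have k0 : 0 < r - cabs w by rewrite subr_gt0.
  pose K := 1 + r / (r - cabs w).
  have K0 : 0 < K by rewrite /K ltr_pwDl // divr_ge0 // ltW.
  apply: cabs_small_eq => e e0; have [|g ag Hg] := H r (e / K) r01.
    by rewrite divr_gt0.
  have cg : ccont (fun t => g (on_circle r t)).
    by apply: analytic_ccont => //; rewrite ltW.
  have -> : F w = mean (fun t => f (on_circle r t) * (on_circle r t / (on_circle r t - w))).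
    by apply: eq_mean => t; rewrite mulrA.
  have -> : f w - mean (fun t => f (on_circle r t) * (on_circle r t / (on_circle r t - w)))
     = (f w - g w) - mean (fun t => (f (on_circle r t) - g (on_circle r t)) *
       (on_circle r t / (on_circle r t - w))).
    rewrite {1}(cauchy_disc ag r01 hw).
    have -> : mean (fun t => (f (on_circle r t) - g (on_circle r t)) *
        (on_circle r t / (on_circle r t - w))) =
      mean (fun t => f (on_circle r t) * (on_circle r t / (on_circle r t - w))) -
      mean (fun t => g (on_circle r t) * (on_circle r t / (on_circle r t - w))).
      rewrite -meanB; [|exact: ccontM|exact: ccontM].
      by apply: eq_mean => t; rewrite mulrBl.
    by ring.
  apply: (le_trans (cabsB _ _)).
  rewrite -[leRHS](mulfVK (x := K)) ?gt_eqF // {2}/K mulrDr mulr1.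
  apply: lerD; first by apply: Hg; exact: ltW.
  apply: mean_bound; first by apply: ccontM ck; exact: ccontB.
  move=> t _; rewrite cabsM; apply: ler_pM => //.
    by apply: Hg; rewrite cabs_on_circle // ltW.
  rewrite cabs_div cabs_on_circle ?(ltW r0) // ler_pM2l // lef_pV2 ?posrE ?cabs_gt0 //.
  by apply: le_trans (lerB_cabs _ _); rewrite cabs_on_circle // ltW.
have [|d Hd] := cauchy_integral_cderiv r0 zr
   (phi := fun t => f (on_circle r t) * on_circle r t).
  by apply: ccontM cf (ccont_on_circle r).
have rz : 0 < r - cabs z by rewrite subr_gt0.
exists d; apply: cderiv_local rz _ Hd => u hu.
by apply: fF; have := lerB_cabs u z; lra.
Qed.

(** The difference of the Cauchy formulas at z and at l has the factor z - l, and what remains is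
    again a Cauchy integral, so the quotient is analytic at l too. *)
Lemma analytic_divide f l : analytic f -> cabs l < 1 -> f l = 0 ->
  exists2 h, analytic h & forall z, cabs z < 1 -> f z = (z - l) * h z.
Proof.
move=> af hl fl0; pose r := (1 + cabs l) / 2.
have r0 : 0 < r by have := cabs_ge0 l; rewrite /r; lra.
have r1 : r < 1 by rewrite /r; lra.
have lr : cabs l < r by rewrite /r; lra.
have r01 : 0 < r < 1 by rewrite r0.
have nw w t : cabs w < r -> on_circle r t - w != 0.
  move=> hw; rewrite -cabs_gt0; apply: lt_le_trans (lerB_cabs _ _).
  by rewrite cabs_on_circle ?(ltW r0) // subr_gt0.
have cf : ccont (fun t => f (on_circle r t)) by apply: analytic_ccont; rewrite ?ltW.
have cV w : cabs w < r -> ccont (fun t => (on_circle r t - w)^-1).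
  move=> hw; apply: ccontV => [t|]; first exact: nw.
  by apply: ccontB (ccont_on_circle r) (ccont_cst _).
pose phi t := f (on_circle r t) * (on_circle r t * (on_circle r t - l)^-1).
have cphi : ccont phi.
  by apply: ccontM cf _; apply: ccontM (ccont_on_circle r) (cV _ lr).
pose F z := mean (fun t => phi t * (on_circle r t - z)^-1).
have FE z : cabs z < r -> f z = (z - l) * F z.
  move=> hz; rewrite -[f z]subr0 -fl0 (cauchy_disc af r01 hz) (cauchy_disc af r01 lr).
  have ck w : cabs w < r ->
      ccont (fun t => f (on_circle r t) * (on_circle r t / (on_circle r t - w))).
    by move=> hw; apply: ccontM cf _; apply: ccontM (ccont_on_circle r) (cV _ hw).
  rewrite -meanB; try exact: ck.
  rewrite -meanZ; last by apply: ccontM cphi (cV _ hz).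
  by apply: eq_mean => t; rewrite /phi; field; rewrite !nw.
exists (fun z => if z == l then F l else f z / (z - l)); last first.
  move=> z hz; case: eqP => [->|/eqP zl]; first by rewrite subrr mul0r.
  by rewrite mulrC mulfVK // subr_eq0.
move=> z hz; have [zl|zl] := eqVneq z l.
  have [d Hd] := cauchy_integral_cderiv r0 lr cphi.
  exists d; rewrite zl.
  have rl : 0 < r - cabs l by rewrite subr_gt0.
  apply: cderiv_local rl _ Hd => u hu; case: eqP => [->//|/eqP ul].
  rewrite (FE u) ?[(u - l) * _]mulrC ?mulfK ?subr_eq0 //.
  by have := lerB_cabs u l; lra.
have zl0 : 0 < cabs (z - l) by rewrite cabs_gt0 subr_eq0.
have [d Hd] : exists d, cderiv (fun u => f u * (u - l)^-1) z d.
  have [d1 H1] := af z hz.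
  have [d2 H2] := analyticB analytic_id (analytic_cst l) hz.
  exists (d1 * (z - l)^-1 + f z * (- d2 / (z - l) ^+ 2)).
  apply: cderivM H1 _; apply: cderivV H2; by rewrite subr_eq0.
exists d; apply: cderiv_local Hd; first exact: zl0.
move=> u hu; case: eqP hu => // ->; by rewrite cabs_distC ltxx.
Qed.
End analytic.

(** * Power series with geometric remainders *)

Section power_series.
Context {R : realType}.
Implicit Types (f g h : R[i] -> R[i]) (a b : nat -> R[i]) (z u l : R[i]) (r s : R) (k n : nat).

(** Nested intervals of half-length [d n] = C q^n / (1 - q) around the partial values: their
    decrease from n to n + 1 is exactly the allowed step C q^n. *)
Lemma fast_cauchy (S : nat -> R[i]) (C q : R) : 0 <= q < 1 ->
  (forall n, cabs (S n.+1 - S n) <= C * q ^+ n) ->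
  exists l, forall n, cabs (l - S n) <= 2 * (C / (1 - q) * q ^+ n).
Proof.
move=> /andP[q0 q1] H; have q2 : 1 - q != 0 by rewrite subr_eq0 eq_sym lt_eqF.
have C0 : 0 <= C by have := H 0%N; rewrite expr0 mulr1; apply: le_trans.
pose d n := C / (1 - q) * q ^+ n.
have d0 n : 0 <= d n by rewrite mulr_ge0 ?exprn_ge0 // divr_ge0 // subr_ge0 ltW.
have dS n : d n - d n.+1 = C * q ^+ n by rewrite /d exprS; field.
have key (x : nat -> R) : (forall n, `|x n.+1 - x n| <= C * q ^+ n) ->
    exists p, forall n, `|p - x n| <= d n.
  move=> Hx; have [|k|p Hp] := @nested_point R (fun n => x n - d n) (fun n => 2 * d n).
      by move=> k; rewrite mulr_ge0.
    by have := Hx k; rewrite -dS ler_norml => /andP[h1 h2]; split; lra.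
  by exists p => n; have /andP[h1 h2] := Hp n; rewrite ler_norml; apply/andP; split; lra.
have [n|p Hp] := key (fun n => Re (S n)).
  by apply: le_trans (H n); have := Re_le (S n.+1 - S n); rewrite !ReImE.
have [n|p' Hp'] := key (fun n => Im (S n)).
  by apply: le_trans (H n); have := Im_le (S n.+1 - S n); rewrite !ReImE.
exists (p +i* p') => n; apply: (le_trans (cabs_le_ReIm _)); rewrite !ReImE /=.
by have := Hp n; have := Hp' n; rewrite -/(d n); lra.
Qed.

Lemma cauchy_schwarz_sum (I : Type) (s : seq I) (x y : I -> R) :
  (\sum_(i <- s) x i * y i) ^+ 2 <=
  (\sum_(i <- s) x i ^+ 2) * (\sum_(i <- s) y i ^+ 2).
Proof.
set P := \sum_(i <- s) x i * y i; set A := \sum_(i <- s) x i ^+ 2.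
set B := \sum_(i <- s) y i ^+ 2.
have H (t : R) : 0 <= A - 2 * t * P + t ^+ 2 * B.
  have -> : A - 2 * t * P + t ^+ 2 * B = \sum_(i <- s) (x i - t * y i) ^+ 2.
    rewrite /A /P /B !mulr_sumr -sumrB -big_split /=.
    by apply: eq_bigr => i _; ring.
  by apply: sumr_ge0 => i _; exact: sqr_ge0.
have B0 : 0 <= B by apply: sumr_ge0 => i _; exact: sqr_ge0.
have [Be|Bn] := eqVneq B 0.
  have : P = 0.
    apply/eqP/negPn/negP => P0.
    have := H ((A + 1) / (2 * P)); rewrite Be mulr0 addr0.
    by rewrite (_ : _ - _ = - 1) ?ler0N1 //; field.
  by move=> ->; rewrite Be mulr0 expr0n.
have Bp : 0 < B by rewrite lt_def Bn.
have := H (P / B); rewrite (_ : _ + _ = (A * B - P ^+ 2) / B); last by field.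
by rewrite pmulr_lge0 ?invr_gt0 // subr_ge0.
Qed.

(** A Taylor expansion given by a geometric error bound on each smaller disc, so that integrating it
    termwise involves finite sums only. *)
Definition pser f a := forall r, 0 <= r < 1 -> exists C q : R,
  [/\ 0 <= C, 0 <= q < 1 & forall z n, cabs z <= r ->
    cabs (f z - \sum_(k < n) a k * z ^+ k) <= C * q ^+ n].

Lemma pser_bound f a r : pser f a -> 0 <= r < 1 ->
  exists C : R, forall z, cabs z <= r -> cabs (f z) <= C.
Proof.
move=> Hf /Hf[C [q [C0 q01 H]]]; exists C => z hz.
by have := H z 0%N hz; rewrite big_ord0 subr0 expr0 mulr1.
Qed.

Lemma conjM z u : (z * u)^* = z^* * u^*.
Proof. by apply: eq_complex_ReIm; rewrite !ReImE; ring. Qed.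
Lemma conjX z n : (z ^+ n)^* = (z^*) ^+ n.
Proof.
elim: n => [|n IH]; last by rewrite !exprS conjM IH.
by apply: eq_complex_ReIm; rewrite !expr0 !ReImE ?oppr0.
Qed.
Lemma conj_real (x : R) : (x%:C)^* = x%:C :> R[i].
Proof. by apply: eq_complex_ReIm; rewrite !ReImE /= ?oppr0. Qed.
Lemma conjK z : (z^*)^* = z.
Proof. by apply: eq_complex_ReIm; rewrite !ReImE ?opprK. Qed.

Lemma mean_monomial g r k : ccont (fun t => g (on_circle r t)) ->
  mean (fun t => g (on_circle r t) * (on_circle r t ^+ k)^*) =
  (r%:C) ^+ k * mean (fun t => g (on_circle r t) * (cis t)^* ^+ k).
Proof.
move=> cg; rewrite -meanZ; last by apply: ccontM cg _; exact/ccontX/ccontJ/ccont_cis.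
by apply: eq_mean => t; rewrite on_circleE conjX conjM exprMn conj_real mulrCA.
Qed.

Lemma fourier_coef f a r (C q : R) k : 0 <= r -> 0 <= q < 1 ->
  ccont (fun t => f (on_circle r t)) ->
  (forall z n, cabs z <= r -> cabs (f z - \sum_(k < n) a k * z ^+ k) <= C * q ^+ n) ->
  mean (fun t => f (on_circle r t) * (cis t)^* ^+ k) = a k * r%:C ^+ k.
Proof.
move=> r0 q01 cf H.
have cc : ccont (fun t : R => (cis t)^* ^+ k) by exact/ccontX/ccontJ/ccont_cis.
apply: cabs_small_eq => e e0; have [N HN] := geom_small C q01 e0.
pose n := maxn N k.+1.
have cS : ccont (fun t => \sum_(j < n) a j * on_circle r t ^+ j).
  by apply: ccont_sum => j; apply: ccontM (ccont_cst _) _; apply/ccontX/ccont_on_circle.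
have eS : a k * r%:C ^+ k = mean (fun t => (\sum_(j < n) a j * on_circle r t ^+ j) *
    (cis t)^* ^+ k).
  have kn : (k < n)%N by rewrite leq_max leqnn orbT.
  have -> : (fun t : R => (\sum_(j < n) a j * on_circle r t ^+ j) * (cis t)^* ^+ k) =
     (fun t => \sum_(j < n) a j * r%:C ^+ j * (cis t ^+ j * (cis t)^* ^+ k)).
    apply/funext => t; rewrite mulr_suml; apply: eq_bigr => j _.
    by rewrite on_circleE exprMn; ring.
  rewrite mean_sum => [|j]; last first.
    by apply: ccontM (ccont_cst _) _; apply: ccontM cc; exact/ccontX/ccont_cis.
  rewrite (bigD1 (Ordinal kn)) //= meanZ ?mean_cis_orth ?eqxx ?mulr1; last first.
    by apply: ccontM cc; exact/ccontX/ccont_cis.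
  rewrite big1 ?addr0 // => j jk; rewrite meanZ ?mean_cis_orth; last first.
    by apply: ccontM cc; exact/ccontX/ccont_cis.
  by rewrite (_ : (j == k :> nat) = false) ?mulr0 //; apply: negbTE.
rewrite eS -meanB; [|exact: ccontM|exact: ccontM].
apply: mean_bound; first by apply: ccontB; exact: ccontM.
move=> t _; rewrite -mulrBl cabsM cabsX cabsJ cabs_cis expr1n mulr1.
apply: le_trans (HN n (leq_maxl _ _)); apply: H.
by rewrite cabs_on_circle.
Qed.

Lemma pser_mean f a r k : analytic f -> pser f a -> 0 <= r < 1 ->
  mean (fun t => f (on_circle r t) * (cis t)^* ^+ k) = a k * r%:C ^+ k.
Proof.
move=> af Hf r01; have [C [q [C0 q01 H]]] := Hf r r01; have /andP[r0 r1] := r01.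
exact: (fourier_coef k r0 q01 (analytic_ccont af r01) H).
Qed.

Lemma analytic_pser f : analytic f -> exists a, pser f a.
Proof.
move=> af.
have ex (rho : R) : 0 < rho < 1 -> forall r, 0 <= r < rho -> exists C q : R,
  [/\ 0 <= C, 0 <= q < 1 & forall z n, cabs z <= r ->
    cabs (f z - \sum_(k < n) tcoef f rho k * z ^+ k) <= C * q ^+ n].
  move=> /[dup] r01 /andP[r0 r1] r /andP[s0 s1].
  have af' u : cabs u <= rho -> exists d, cderiv f u d.
    by move=> hu; apply: af; exact: le_lt_trans r1.
  have cf : ccont (fun t => f (on_circle rho t)) by apply: analytic_ccont; rewrite ?ltW.
  have [M HM] := ccont_bounded 0 (2 * pi) cf.
  have M0 : 0 <= M by apply: le_trans (cabs_ge0 _) (HM 0 _); rewrite lexx pi2_ge0.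
  have k0 : 0 < rho - r by rewrite subr_gt0.
  exists (M * (rho / (rho - r))), (r / rho); split.
    by rewrite mulr_ge0 // divr_ge0 // ltW.
    by rewrite divr_ge0 ?(ltW r0) //= ltr_pdivrMr // mul1r.
  move=> z n hz; have hz' : cabs z < rho by apply: le_lt_trans s1.
  rewrite (cauchy_formula r0 af' hz').
  apply: (le_trans (kernel_expansion r0 af' HM n hz')).
  have k1 : 0 < rho - cabs z by rewrite subr_gt0.
  have zr : 0 <= cabs z / rho by rewrite mulr_ge0 // invr_ge0 ltW.
  apply: ler_pM; rewrite ?mulr_ge0 ?exprn_ge0 ?invr_ge0 ?(ltW r0) ?(ltW k1) //.
    by rewrite ler_wpM2l // ler_pM2l // lef_pV2 ?posrE //; lra.
  by rewrite lerXn2r ?nnegrE ?mulr_ge0 ?invr_ge0 ?(ltW r0) // ler_pM2r ?invr_gt0.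
exists (tcoef f (2^-1)) => r /andP[r0 r1].
pose rho := (1 + Num.max r 2^-1) / 2.
have m1 : r <= Num.max r 2^-1 by rewrite le_max lexx.
have m2 : 2^-1 <= Num.max r 2^-1 by rewrite le_max lexx orbT.
have m3 : Num.max r 2^-1 < 1 by rewrite gt_max r1 /=; lra.
have rho1 : 0 < rho < 1 by rewrite /rho; apply/andP; split; lra.
have half : 0 < (2^-1 : R) < 1 by apply/andP; split; lra.
suff -> : tcoef f (2^-1) = tcoef f rho.
  by apply: ex => //; rewrite r0 /= /rho; lra.
(* Both coefficient sequences are Fourier coefficients on one small circle. *)
apply/funext => k.
have [c c0 c1] : exists2 c : R, 0 < c & c < 2^-1 by exists (4^-1); lra.
have c01 : 0 <= c < 1 by rewrite ltW //=; lra.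
have sub (d : R) : 0 < d < 1 -> c < d ->
    mean (fun t => f (on_circle c t) * (cis t)^* ^+ k) = tcoef f d k * c%:C ^+ k.
  move=> d01 cd.
  have [C [q [C0 q01 H]]] : exists C q : R, [/\ 0 <= C, 0 <= q < 1 &
     forall z n, cabs z <= c ->
     cabs (f z - \sum_(k < n) tcoef f d k * z ^+ k) <= C * q ^+ n].
    by apply: ex => //; rewrite ltW.
  exact: (fourier_coef k (ltW c0) q01 (analytic_ccont af c01) H).
have c2 : c < rho by rewrite /rho; lra.
have c3 : c%:C ^+ k != 0 :> R[i].
  by rewrite expf_neq0 // -cabs_eq0 cabsC normr_eq0 gt_eqF.
have := etrans (esym (sub _ half c1)) (sub _ rho1 c2).
move: (tcoef f (2^-1) k) (tcoef f rho k) => x y.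
exact: (mulIf c3).
Qed.
End power_series.

(** * Parseval's formula and quadratic means *)

Section parseval.
Context {R : realType}.
Implicit Types (f g h : R[i] -> R[i]) (a b : nat -> R[i]) (z u l : R[i]) (r s : R) (k n : nat).

Lemma parseval f g a b r : analytic f -> analytic g -> pser f a -> pser g b ->
  0 <= r < 1 -> exists C q : R, 0 <= q < 1 /\ forall n,
  cabs (mean (fun t => f (on_circle r t) * (g (on_circle r t))^*) -
     \sum_(k < n) a k * (b k)^* * (r ^+ (2 * k))%:C) <= C * q ^+ n.
Proof.
move=> af ag Hf Hg r01; have /andP[r0 r1] := r01.
have cf := analytic_ccont af r01; have cg := analytic_ccont ag r01.
have [C [q [C0 q01 H]]] := Hg r r01.
have [M HM] := pser_bound Hf r01.
have M0 : 0 <= M by apply: le_trans (cabs_ge0 _) (HM 0 _); rewrite cabs0.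
exists (M * C), q; split=> // n.
have cm k : ccont (fun t : R => f (on_circle r t) * (on_circle r t ^+ k)^*).
  by apply: ccontM cf _; apply/ccontJ/ccontX/ccont_on_circle.
have cs : ccont (fun t => \sum_(k < n) (b k)^* * (f (on_circle r t) * (on_circle r t ^+ k)^*)).
  by apply: ccont_sum => k; apply: ccontM (ccont_cst _) _.
have -> : \sum_(k < n) a k * (b k)^* * (r ^+ (2 * k))%:C =
   mean (fun t => \sum_(k < n) (b k)^* * (f (on_circle r t) * (on_circle r t ^+ k)^*)).
  rewrite mean_sum => [|k]; last exact: ccontM (ccont_cst _) _.
  apply: eq_bigr => k _; rewrite meanZ // mean_monomial // (pser_mean k af Hf r01).
  by rewrite mulnC exprM rmorphXn rmorphXn /= expr2; ring.
have cfg : ccont (fun t => f (on_circle r t) * (g (on_circle r t))^*).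
  by apply: ccontM cf _; exact: ccontJ.
rewrite -meanB //; apply: mean_bound => [|t _]; first exact: ccontB.
have -> : f (on_circle r t) * (g (on_circle r t))^* -
  \sum_(k < n) (b k)^* * (f (on_circle r t) * (on_circle r t ^+ k)^*) =
  f (on_circle r t) * (g (on_circle r t) - \sum_(k < n) b k * on_circle r t ^+ k)^*.
  have conjB (x y : R[i]) : (x - y)^* = x^* - y^*.
    by apply: eq_complex_ReIm; rewrite !ReImE; ring.
  have conj_sum (F : 'I_n -> R[i]) : (\sum_(k < n) F k)^* = \sum_(k < n) (F k)^*.
    elim/big_rec2: _ => [|i x y _ <-]; apply: eq_complex_ReIm; rewrite !ReImE /= ?oppr0 //.
    by rewrite opprD.
  rewrite conjB mulrBr conj_sum mulr_sumr; congr (_ - _).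
  by apply: eq_bigr => k _; rewrite conjM mulrCA.
rewrite cabsM cabsJ -mulrA; apply: ler_pM => //.
  by apply: HM; rewrite cabs_on_circle.
by apply: H; rewrite cabs_on_circle.
Qed.

Lemma circ2_partial f a r : analytic f -> pser f a -> 0 <= r < 1 ->
  exists C q : R, 0 <= q < 1 /\ forall n,
  `|circ2 r f - \sum_(k < n) cabs (a k) ^+ 2 * r ^+ (2 * k)| <= C * q ^+ n.
Proof.
move=> af Hf r01; have [C [q [q01 H]]] := parseval af af Hf Hf r01.
exists C, q; split=> // n; apply: le_trans (H n).
rewrite -circ2_mean; last exact: analytic_ccont.
have -> : \sum_(k < n) a k * (a k)^* * (r ^+ (2 * k))%:C =
   (\sum_(k < n) cabs (a k) ^+ 2 * r ^+ (2 * k))%:C.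
  rewrite rmorph_sum; apply: eq_bigr => k _.
  by rewrite mulJ -rmorphM.
by rewrite -rmorphB cabsC.
Qed.

Lemma sum_circ2_le f a r n : analytic f -> pser f a -> 0 <= r < 1 ->
  \sum_(k < n) cabs (a k) ^+ 2 * r ^+ (2 * k) <= circ2 r f.
Proof.
move=> af Hf r01; have [C [q [q01 H]]] := circ2_partial af Hf r01.
have /andP[r0 r1] := r01.
apply/ler_addgt0Pl => e e0; have [N HN] := geom_small C q01 e0.
have := le_trans (H _) (HN (maxn N n) (leq_maxl _ _)).
rewrite ler_norml => /andP[h _].
apply: (@le_trans _ _ (\sum_(k < maxn N n) cabs (a k) ^+ 2 * r ^+ (2 * k))).
  rewrite (big_ord_widen _ (fun k => cabs (a k) ^+ 2 * r ^+ (2 * k)) (leq_maxr N n)).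
  rewrite big_mkcond; apply: ler_sum => k _; case: ifP => // _.
  by rewrite mulr_ge0 // ?exprn_ge0.
by move: h; lra.
Qed.

Lemma circ2_le_sum f a r (B : R) : analytic f -> pser f a -> 0 <= r < 1 ->
  (forall n, \sum_(k < n) cabs (a k) ^+ 2 * r ^+ (2 * k) <= B) -> circ2 r f <= B.
Proof.
move=> af Hf r01 HB; have [C [q [q01 H]]] := circ2_partial af Hf r01.
apply/ler_addgt0Pl => e e0; have [N HN] := geom_small C q01 e0.
have := le_trans (H _) (HN N (leqnn _)); have := HB N.
by rewrite ler_norml => h1 /andP[_ h]; lra.
Qed.

(** Parseval writes the mean as a series in r^2 with nonnegative coefficients. *)
Lemma circ2_mono f r s : analytic f -> 0 <= r -> r <= s -> s < 1 ->
  circ2 r f <= circ2 s f.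
Proof.
move=> af r0 rs s1; have [a Ha] := analytic_pser af.
have r01 : 0 <= r < 1 by rewrite r0 (le_lt_trans rs).
have s01 : 0 <= s < 1 by rewrite s1 (le_trans r0).
apply: (circ2_le_sum af Ha r01) => n; apply: le_trans (sum_circ2_le n af Ha s01).
apply: ler_sum => k _; rewrite ler_wpM2l ?exprn_ge0 //.
by rewrite lerXn2r ?nnegrE // (le_trans r0).
Qed.

Lemma circ2_ge0' f r : analytic f -> 0 <= r < 1 -> 0 <= circ2 r f.
Proof. by move=> af r01; apply: circ2_ge0; exact: analytic_ccont. Qed.

Lemma geom_sum_le (x : R) n : 0 <= x < 1 -> \sum_(k < n) x ^+ k <= (1 - x)^-1.
Proof.
move=> /andP[x0 x1]; have x2 : 0 < 1 - x by rewrite subr_gt0.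
elim: n => [|n IH]; first by rewrite big_ord0 invr_ge0 ltW.
rewrite big_ord_recl expr0 (eq_bigr (fun k : 'I_n => x * x ^+ k)); last first.
  by move=> k _; rewrite exprS.
rewrite -mulr_sumr (@le_trans _ _ (1 + x * (1 - x)^-1)) ?lerD2l ?ler_wpM2l //.
by rewrite le_eqVlt; apply/orP; left; apply/eqP; field; rewrite gt_eqF.
Qed.

(** Cauchy-Schwarz on the Taylor coefficients. The factor is the reciprocal of the Hardy space
    kernel of the disc of radius r on the diagonal. *)
Lemma circ2_point f r z : analytic f -> 0 < r < 1 -> cabs z < r ->
  cabs (f z) ^+ 2 * (1 - (cabs z / r) ^+ 2) <= circ2 r f.
Proof.
move=> af /andP[r0 r1] hz; have [a Ha] := analytic_pser af.
have r01 : 0 <= r < 1 by rewrite ltW.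
pose x := (cabs z / r) ^+ 2.
have zr1 : cabs z / r < 1 by rewrite ltr_pdivrMr // mul1r.
have zr0 : 0 <= cabs z / r by rewrite mulr_ge0 // invr_ge0 ltW.
have x01 : 0 <= x < 1 by rewrite exprn_ge0 //= expr_lt1.
have x1 : 0 < 1 - x by case/andP: x01 => _; rewrite subr_gt0.
rewrite -ler_pdivlMr // -/x.
set B := circ2 r f / (1 - x).
have B0 : 0 <= B by rewrite mulr_ge0 ?circ2_ge0' // invr_ge0 ltW.
rewrite -[B]sqr_sqrtr // lerXn2r ?nnegrE ?sqrtr_ge0 //.
have [C [q [C0 q01 H]]] := Ha r r01.
apply/ler_addgt0Pl => e e0; have [N HN] := geom_small C q01 e0.
have := le_trans (H z N (ltW hz)) (HN N (leqnn _)).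
set S := \sum_(k < N) _ => hS.
have : cabs S <= Num.sqrt B.
  rewrite -[leLHS]ger0_norm // -sqrtr_sqr ler_wsqrtr //.
  have zk k : cabs (a k * z ^+ k) = (cabs (a k) * r ^+ k) * (cabs z / r) ^+ k.
    by rewrite cabsM cabsX expr_div_n; field; rewrite expf_neq0 // gt_eqF.
  apply: (@le_trans _ _ ((\sum_(k < N) (cabs (a k) * r ^+ k) * (cabs z / r) ^+ k) ^+ 2)).
    rewrite lerXn2r ?nnegrE //.
      by apply: sumr_ge0 => k _; rewrite !mulr_ge0 ?exprn_ge0 // ltW.
    by apply: (le_trans (cabs_sum _ _ _)); apply: ler_sum => k _; rewrite zk.
  apply: (le_trans (cauchy_schwarz_sum _ _ _)).
  apply: ler_pM; try by apply: sumr_ge0 => k _; exact: sqr_ge0.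
    rewrite (eq_bigr (fun k : 'I_N => cabs (a k) ^+ 2 * r ^+ (2 * k))).
      exact: sum_circ2_le.
    by move=> k _; rewrite exprMn mulnC exprM.
  rewrite (eq_bigr (fun k : 'I_N => x ^+ k)); first exact: geom_sum_le.
  by move=> k _; rewrite /x -!exprM mulnC.
have := lerB_cabs (f z) S; lra.
Qed.

(** The reproducing kernel is known through its coefficients, and this lemma turns them into a
    function. *)
Lemma coef_bounded_pser b : (forall r, 0 <= r < 1 -> exists C : R, forall k,
  cabs (b k) * r ^+ k <= C) -> exists2 f, analytic f & pser f b.
Proof.
move=> Hb.
have ex r : 0 <= r < 1 -> exists C q : R, [/\ 0 <= C, 0 <= q < 1 &
    forall k, cabs (b k) * r ^+ k <= C * q ^+ k].
  move=> /andP[r0 r1]; pose s := (1 + r) / 2.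
  have s0 : 0 < s by rewrite /s; lra.
  have s1 : s < 1 by rewrite /s; lra.
  have rs : r < s by rewrite /s; lra.
  have [C HC] : exists C : R, forall k, cabs (b k) * s ^+ k <= C.
    by apply: Hb; rewrite (ltW s0).
  have C0 : 0 <= C by apply: le_trans (HC 0%N); rewrite mulr_ge0 // exprn_ge0 // ltW.
  exists C, (r / s); split=> //.
    by rewrite mulr_ge0 ?invr_ge0 ?(ltW s0) //= ltr_pdivrMr // mul1r.
  move=> k; rewrite expr_div_n mulrA ler_pdivlMr ?exprn_gt0 // mulrAC.
  by rewrite ler_wpM2r // exprn_ge0.
(* The limit is characterised through all admissible radii r at once, so the function chosen from it
   does not depend on a radius. *)
have lim z : exists l, cabs z < 1 -> forall r, cabs z <= r -> r < 1 ->
    forall C q, 0 <= q < 1 -> (forall k, cabs (b k) * r ^+ k <= C * q ^+ k) ->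
    forall n, cabs (l - \sum_(k < n) b k * z ^+ k) <= 2 * (C / (1 - q)) * q ^+ n.
  have [hz|] := boolP (cabs z < 1); last by exists 0.
  have step r C q : cabs z <= r -> (forall k, cabs (b k) * r ^+ k <= C * q ^+ k) ->
      forall n, cabs (\sum_(k < n.+1) b k * z ^+ k - \sum_(k < n) b k * z ^+ k) <= C * q ^+ n.
    move=> zr H n; rewrite big_ord_recr /= addrAC subrr add0r cabsM cabsX.
    apply: le_trans (H n); rewrite ler_wpM2l // lerXn2r ?nnegrE //.
    exact: le_trans zr.
  have z01 : 0 <= cabs z < 1 by rewrite hz andbT.
  have [C0 [q0 [_ q01 H0]]] := ex _ z01.
  have [l Hl] := fast_cauchy q01 (step _ _ _ (lexx _) H0).
  exists l => _ r zr r1 C q q01' H.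
  have [l' Hl'] := fast_cauchy q01' (step _ _ _ zr H).
  suff -> : l = l' by move=> n; rewrite -mulrA; exact: Hl'.
  apply: cabs_small_eq => e e0; have e2 : 0 < e / 2 by rewrite divr_gt0.
  have [N HN] := geom_small (2 * (C0 / (1 - q0))) q01 e2.
  have [N' HN'] := geom_small (2 * (C / (1 - q))) q01' e2.
  pose m := maxn N N'; apply: le_trans (cabs_distD (\sum_(k < m) b k * z ^+ k) _ _) _.
  rewrite [e]splitr [X in _ + X]cabs_distC; apply: lerD.
    by apply: (le_trans (Hl m)); rewrite mulrA; apply: HN; exact: leq_maxl.
  by apply: (le_trans (Hl' m)); rewrite mulrA; apply: HN'; exact: leq_maxr.
pose f z := projT1 (cid (lim z)).
have Hf z : cabs z < 1 -> forall r, cabs z <= r -> r < 1 ->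
    forall C q, 0 <= q < 1 -> (forall k, cabs (b k) * r ^+ k <= C * q ^+ k) ->
    forall n, cabs (f z - \sum_(k < n) b k * z ^+ k) <= 2 * (C / (1 - q)) * q ^+ n.
  exact: projT2 (cid (lim z)).
have pf : pser f b.
  move=> r /[dup] r01 /andP[r0 r1]; have [C [q [C0 q01 H]]] := ex _ r01.
  exists (2 * (C / (1 - q))), q; split=> //.
    case/andP: q01 => _ q1; rewrite mulr_ge0 // divr_ge0 // subr_ge0 ltW //.
  by move=> z n hz; apply: Hf H n => //; exact: le_lt_trans r1.
exists f => //; apply: analytic_ulimit => r e /andP[r0 r1] e0.
have [C [q [C0 q01 H]]] : exists C q : R,
  [/\ 0 <= C, 0 <= q < 1 & forall z n, cabs z <= r ->
    cabs (f z - \sum_(k < n) b k * z ^+ k) <= C * q ^+ n].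
  by apply: pf; rewrite ltW.
have [N HN] := geom_small C q01 e0.
exists (fun z => \sum_(k < N) b k * z ^+ k).
  by apply: analytic_sum => k _; apply: analyticZ; apply: analyticX; exact: analytic_id.
by move=> z hz; apply: le_trans (H z N hz) (HN N (leqnn _)).
Qed.
End parseval.

(** * The radii and the norm *)

Section radii.
Context {R : realType}.
Local Notation mu := (@lebesgue_measure R).

(** What the function theory keeps of an admissible weight. The last clause is the doubling
    condition read on the radii: p further rings at least halve the distance to the unit circle,
    uniformly in n. *)
Definition radii (r : nat -> R) := [/\ r 0%N = 0, forall n, r n < r n.+1,
  forall n, r n < 1 & exists p, forall n, 1 - r (n + p)%N <= (1 - r n) / 2].

Variable w : R -> R.
Hypothesis hw : admissible w.

Let w_gt0 x : 0 <= x < 1 -> 0 < w x. Proof. by case: hw => H _ _ _; exact: H. Qed.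

Let mw : measurable_fun (`[(0 : R), (1 : R)[ : set R) w.
Proof.
case: hw => _ cw _ _; apply: subspace_continuous_measurable_fun => //.
Qed.

Let iw0 : mu.-integrable (`[(0 : R), (1 : R)[ : set R) (EFin \o w).
Proof.
apply/integrableP; split; first exact/measurable_EFinP.
case: hw => _ _ h1 _; rewrite (_ : (\int[_]_(x in _) _)%E = 1%E) ?ltry // -h1.
apply: eq_integral => x; rewrite inE /= in_itv /= => hx.
by rewrite ger0_norm // ltW // w_gt0.
Qed.

Let iw : mu.-integrable (`[(0 : R), (1 : R)] : set R) (EFin \o w).
Proof.
have mw1 : measurable_fun (`[(0 : R), (1 : R)] : set R) w by apply/measurable_fun_itv_bndo_bndcP.
apply/integrableP; split; first exact/measurable_EFinP.
have /integrableP[_] := iw0; rewrite integral_itv_bndo_bndc //.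
apply/measurable_EFinP; exact: measurableT_comp.
Qed.

Let W x := \int[mu]_(t in `[0, x]) w t.

Let W1 : W 1 = 1.
Proof.
rewrite /W /Rintegral -integral_itv_bndo_bndc; last exact/measurable_EFinP.
by case: hw => _ _ -> _.
Qed.

Let W0 : W 0 = 0. Proof. by rewrite /W set_itv1 Rintegral_set1. Qed.

Let cW : {within (`[(0 : R), (1 : R)] : set R), continuous W}.
Proof. exact: parameterized_integral_continuous. Qed.

Let dW x : x \in `]0, (1 : R)[ -> derivable W x 1 /\ derive1 W x = w x.
Proof.
rewrite in_itv /= => /andP[x0 x1].
apply: (@continuous_FTC1_closed _ w 0 x 1) => //.
case: hw => _ cw _ _.
have : {within (`]0, 1[ : set R), continuous w}.
  apply: continuous_subspaceW cw; apply: subset_itvr; by rewrite bnd_simp.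
rewrite continuous_open_subspace; last exact: interval_open.
by move=> H; apply: H; rewrite inE /= in_itv /= x0.
Qed.

Let W_lt x y : 0 <= x -> x < y -> y <= 1 -> W x < W y.
Proof.
move=> x0 xy y1; have hx : x \in `[0, 1] by rewrite in_itv /=; lra.
have hy : y \in `[0, 1] by rewrite in_itv /=; lra.
have d1 : {in `]0, (1 : R)[, forall t, derivable W t 1} by move=> t /dW[].
have d2 : {in `]0, (1 : R)[, forall t, 0 < derive1 W t}.
  by move=> t ht; rewrite (dW ht).2 w_gt0 //; move: ht; rewrite in_itv /= => /andP[/ltW-> ->].
exact: (gtr0_derive1_lt_cc d1 d2 cW hx hy xy).
Qed.

Let tail x : 0 <= x < 1 -> (\int[mu]_(t in `[x, 1%R[) (w t)%:E = (1 - W x)%:E)%E.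
Proof.
move=> /andP[x0 x1].
have sub : (`[x, 1[ : set R) `<=` (`[(0 : R), (1 : R)] : set R).
  by move=> t; rewrite /= !in_itv /= => /andP[h1 h2]; rewrite (le_trans x0) // ltW.
have i1 : mu.-integrable `[x, 1%R] (EFin \o w).
  apply: integrableS iw => // t; rewrite /= !in_itv /= => /andP[h1 ->].
  by rewrite (le_trans x0).
have e : \int[mu]_(t in `[x, 1]) w t = 1 - W x.
  have -> : 1 - W x = W 1 - W x by rewrite W1.
  rewrite /W (@Rintegral_itvB _ w (BLeft 0) (BRight 1) x) ?bnd_simp ?(ltW x1) //.
  rewrite Rintegral_itv_obnd_cbnd //.
  by apply: integrableS i1 => //; apply: subset_itv_oc_cc.
rewrite -e /Rintegral fineK; last exact: integrable_fin_num.
rewrite integral_itv_bndo_bndc //.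
by apply: (measurable_int mu); apply: integrableS i1 => //; apply: subset_itv_co_cc.
Qed.

Lemma integral_ring x y : 0 <= x -> x <= y -> y < 1 ->
  (\int[mu]_(t in `[x, y[) (w t)%:E = (W y - W x)%:E)%E.
Proof.
move=> x0 xy y1.
have i1 : mu.-integrable `[x, y] (EFin \o w).
  apply: integrableS iw => // t; rewrite /= !in_itv /= => /andP[h1 h2].
  by rewrite (le_trans x0) //= (le_trans h2) // ltW.
have i2 : mu.-integrable `[0%R, y] (EFin \o w).
  apply: integrableS iw => // t; rewrite /= !in_itv /= => /andP[h1 h2].
  by rewrite h1 //= (le_trans h2) // ltW.
have e : \int[mu]_(t in `[x, y]) w t = W y - W x.
  rewrite /W (@Rintegral_itvB _ w (BLeft 0) (BRight y) x) ?bnd_simp //.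
  rewrite Rintegral_itv_obnd_cbnd // .
  by apply: integrableS i1 => //; apply: subset_itv_oc_cc.
rewrite -e /Rintegral fineK; last exact: integrable_fin_num.
rewrite integral_itv_bndo_bndc //.
by apply: (measurable_int mu); apply: integrableS i1 => //; apply: subset_itv_co_cc.
Qed.

Let rad_spec (n : nat) : 0 <= radius w n < 1 /\ W (radius w n) = 1 - 2^-1 ^+ n.
Proof.
suff [h1 h2] : [set r : R | 0 <= r < 1 /\
  (\int[mu]_(x in `[r, 1%R[) (w x)%:E = (2^-1 ^+ n)%:E)%E] (radius w n).
  by split=> //; move: h2; rewrite tail // => -[]; lra.
apply: getPex.
have p0 : 0 < 2^-1 ^+ n :> R by rewrite exprn_gt0.
have p1 : 2^-1 ^+ n <= 1 :> R by rewrite exprn_ile1 // invf_le1 ?ler1n.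
have [|c] := @IVT R W 0 1 (1 - 2^-1 ^+ n) ler01 cW.
  by rewrite W0 W1 ge_min le_max; apply/andP; split; apply/orP; [left|right]; lra.
rewrite in_itv /= => /andP[c0 c1] Wc.
have c2 : c < 1.
  rewrite lt_def c1 andbT eq_sym; apply/eqP => ce; move: Wc; rewrite ce W1; lra.
by exists c; rewrite /= c0 c2; split=> //; rewrite tail ?c0 // Wc; congr (_%:E); ring.
Qed.

(** The doubling condition integrated over [a, 1]; the substitution x -> 2 x - 1 is replaced by the
    monotonicity of [V], whose derivative is nonnegative by that condition. *)
Let W_double : exists2 c : R, 0 < c & forall a : R, 2^-1 <= a -> a <= 1 ->
    c * (1 - W (2 * a - 1)) <= 1 - W a.
Proof.
case: hw => _ _ _ [c c0 Hc]; exists (c / 2); first by rewrite divr_gt0.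
move=> a a0 a1; pose V x := W x - c / 2 * W (2 * x - 1).
have -> : 1 - W a = V 1 - V a + c / 2 * (1 - W (2 * a - 1)).
  by rewrite /V (_ : 2 * 1 - 1 = 1 :> R) ?W1; ring.
rewrite lerDr subr_ge0.
have dV x : x \in `](2^-1 : R), 1[ -> is_derive x (1 : R) V (w x - c * w (2 * x - 1)).
  rewrite in_itv /= => /andP[x0 x1].
  have i1 : x \in `]0, 1[ by rewrite in_itv /=; lra.
  have i2 : 2 * x - 1 \in `]0, 1[ by rewrite in_itv /=; lra.
  have d1 : is_derive x (1 : R) W (w x).
    by have [h1 h2] := dW i1; rewrite -h2 derive1E; exact: DeriveDef.
  have d2 : is_derive (2 * x - 1) (1 : R) W (w (2 * x - 1)).
    by have [h1 h2] := dW i2; rewrite -h2 derive1E; exact: DeriveDef.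
  have dl : is_derive x (1 : R) (fun x => 2 * x - 1) 2.
    by apply: is_derive_eq; rewrite /GRing.scale /= mulr1 ?subr0 ?mulr0 ?addr0.
  have d3 := @is_derive1_comp _ W (fun x => 2 * x - 1) x _ _ d2 dl.
  have d4 : is_derive x (1 : R) (fun x => c / 2 * W (2 * x - 1)) (c * w (2 * x - 1)).
    have := is_deriveZ (c / 2) d3; rewrite /GRing.scale /= => d5.
    by apply: is_derive_eq; field.
  exact: is_deriveB.
apply: (@ger0_derive1_le_cc _ V (2^-1) 1) => //.
- by move=> x /dV[].
- move=> x /[dup] hx /dV[_]; rewrite derive1E => ->; rewrite subr_ge0.
  move: hx; rewrite in_itv /= => /andP[x0 x1].
  have := Hc (1 - x); rewrite (_ : 1 - 2 * (1 - x) = 2 * x - 1); last by ring.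
  by rewrite subKr; apply; lra.
- move=> x; apply: continuousB.
    by apply: (continuous_subspaceW _ cW) => t; rewrite /= !in_itv /=; lra.
  apply: continuousM; first by move=> ?; exact: cvg_cst.
  move: x; apply/subspace_continuousP => x; rewrite /= in_itv /= => /andP[x0 x1].
  have A'x : [set` `[(0 : R), 1]] (2 * x - 1) by rewrite /= in_itv /=; lra.
  have H := (subspace_continuousP _ _).1 cW _ A'x.
  apply: cvg_comp H => P /= HP.
  have cg : (fun t : R => 2 * t - 1) @ x --> 2 * x - 1.
    by apply: cvgB; [apply: cvgM; [exact: cvg_cst|exact: cvg_id]|exact: cvg_cst].
  have HQ := cg _ HP.
  apply: (@filterS _ (nbhs x) _ _ _ _ HQ) => t Ht; rewrite /= in_itv /= => /andP[t0 t1].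
  by apply: Ht; rewrite /= in_itv /=; lra.
- by rewrite in_itv /= a0 a1.
- by rewrite in_itv /= lexx; lra.
Qed.

Lemma radiiP : radii (radius w).
Proof.
have h n := (rad_spec n).1; have e n := (rad_spec n).2.
have inj a b : 0 <= a < 1 -> 0 <= b < 1 -> W a <= W b -> a <= b.
  move=> /andP[a0 a1] /andP[b0 b1]; rewrite leNgt => Hw; rewrite leNgt.
  by apply: contra Hw => ba; apply: W_lt => //; exact: ltW.
split.
- apply/le_anti; case/andP: (h 0%N) => -> _; rewrite andbT; apply: inj => //.
    by rewrite lexx ltr01.
  by rewrite e W0 expr0 subrr.
- move=> n; rewrite ltNge; apply/negP => hn.
  have : W (radius w n.+1) <= W (radius w n).
    move: hn; rewrite le_eqVlt => /predU1P[-> //|hn]; apply/ltW/W_lt => //.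
      by case/andP: (h n.+1).
    by case/andP: (h n) => _ /ltW.
  rewrite !e exprS; have p0 : 0 < 2^-1 ^+ n :> R by rewrite exprn_gt0.
  by move: (2^-1 ^+ n) p0 => x x0; lra.
- by move=> n; case/andP: (h n).
- have [c c0 Hc] := W_double.
  (* By [W_double] the mass beyond the midpoint of r_n and 1 is at least c 2^-n, hence more than
     2^-(n + p), so r_(n + p) lies beyond that midpoint. *)
  have [p Hp] : exists p, 2^-1 ^+ p <= c / 2.
    have [N HN] := @geom_small R 1 (2^-1) (c / 2) ltac:(apply/andP; split; lra) ltac:(lra).
    by exists N; have := HN N (leqnn _); rewrite mul1r.
  exists p => n; have hn := h n; have hp := h (n + p)%N.
  case/andP: (hn) => hn0 hn1; case/andP: (hp) => hp0 hp1.
  suff : (1 + radius w n) / 2 <= radius w (n + p) by lra.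
  apply: inj => //; first by apply/andP; split; lra.
  have := Hc ((1 + radius w n) / 2) ltac:(lra) ltac:(lra).
  rewrite (_ : 2 * _ - 1 = radius w n); last by field.
  rewrite !e subKr exprD => H.
  have q0 : 0 < 2^-1 ^+ n :> R by rewrite exprn_gt0.
  have : 2^-1 ^+ n * 2^-1 ^+ p <= 2^-1 ^+ n * (c / 2) by rewrite ler_pM2l.
  move: H q0; move: (2^-1 ^+ n) (2^-1 ^+ p) => x y; nra.
Qed.

Lemma radius_ring n :
  (\int[mu]_(t in `[radius w n, radius w n.+1[) (w t)%:E = (2^-1 ^+ n.+1)%:E)%E.
Proof.
have [_ hr _ _] := radiiP.
have /andP[h1 h2] := (rad_spec n).1; have /andP[h3 h4] := (rad_spec n.+1).1.
rewrite integral_ring // ?ltW // !(rad_spec _).2 exprS; congr (_%:E); lra.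
Qed.
End radii.

(** * Substitution, and the circle in four quarters *)

Section antiderivative.
Context {R : realType}.
Implicit Types (h : R -> R) (a b t : R).

Lemma antiderivative h : continuous h ->
  exists H : R -> R, forall t, is_derive t (1 : R) H (h t).
Proof.
move=> ch; pose H x := if 0 <= x then rint 0 x h else - rint x 0 h.
have HE a x : a <= 0 -> a <= x -> H x = rint a x h - rint a 0 h.
  move=> a0 ax; rewrite /H; case: ifPn => [x0|].
    by rewrite (rint_split ch a0 x0); ring.
  rewrite -ltNge => /ltW x0; rewrite (rint_split ch ax x0); ring.
exists H => t; pose a := Num.min t 0 - 1.
have m0 : Num.min t 0 <= 0 by rewrite ge_min lexx orbT.
have m1 : Num.min t 0 <= t by rewrite ge_min lexx.
have a0 : a < 0 by rewrite /a; lra.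
have at' : a < t by rewrite /a; lra.
have t1 : t < t + 1 by rewrite ltrDl.
have [d1 d2] := @continuous_FTC1_closed _ h a t (t + 1) t1
  (continuous_integrable _ _ ch) at' (ch t).
have D : is_derive t (1 : R) (fun x => rint a x h) (h t).
  by rewrite -d2 derive1E; exact: DeriveDef.
have D2 : is_derive t (1 : R) (fun x => rint a x h - rint a 0 h) (h t).
  by apply: is_derive_eq; rewrite subr0.
apply: (@near_eq_is_derive _ _ _ _ _ _ _ _ _ D2).
near=> x; apply/esym/HE; first exact: ltW.
apply: ltW; near: x; exact: lt_nbhsr.
Unshelve. all: by end_near. Qed.

Lemma rint_subst h (H phi psi : R -> R) a b : a <= b -> continuous h -> continuous psi ->
  (forall t, is_derive t (1 : R) H (h t)) ->
  (forall t, is_derive t (1 : R) phi (psi t)) ->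
  rint a b (fun t => h (phi t) * psi t) = H (phi b) - H (phi a).
Proof.
move=> ab ch cpsi dH dphi; rewrite -(@rint_FTC _ a b (H \o phi) _ ab) //.
  have cphi : continuous phi.
    move=> t; apply: differentiable_continuous; apply/derivable1_diffP.
    by have [] := dphi t.
  move=> t; apply: cvgM; last exact: cpsi.
by apply: continuous_comp; [exact: cphi|exact: ch].
Qed.

(* The four quarter circles swept by the slope s in [-1, 1]. *)
Lemma rint_circle h : continuous h -> (forall t, h (t + 2 * pi) = h t) ->
  rint (-1) 1 (fun s => h (atan s) * (1 + s ^+ 2)^-1) +
  rint (-1) 1 (fun s => h (pi - atan s) * (1 + s ^+ 2)^-1) +
  rint (-1) 1 (fun s => h (pi / 2 - atan s) * (1 + s ^+ 2)^-1) +
  rint (-1) 1 (fun s => h (atan s - pi / 2) * (1 + s ^+ 2)^-1) =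
  rint 0 (2 * pi) h.
Proof.
move=> ch hper; have [H dH] := antiderivative ch.
have m11 : -1 <= 1 :> R by lra.
have cV : continuous (fun s : R => (1 + s ^+ 2)^-1).
  move=> s; apply: cvgV; first by rewrite gt_eqF // ltr_pwDl // sqr_ge0.
  by apply: cvgD; [exact: cvg_cst|exact: exprn_continuous].
have S (c e : R) : rint (-1) 1 (fun s => h (c + e * atan s) * (e * (1 + s ^+ 2)^-1)) =
    H (c + e * (pi / 4)) - H (c - e * (pi / 4)).
  have cpsi : continuous (fun s : R => e * (1 + s ^+ 2)^-1).
    by move=> s; apply: cvgM; [exact: cvg_cst|exact: cV].
  have dphi (t : R) : is_derive t (1 : R) (fun s => c + e * atan s) (e * (1 + t ^+ 2)^-1).
    have := is_deriveD (is_derive_cst c t 1) (is_deriveZ e (is_derive1_atan t)).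
    by rewrite add0r.
  by rewrite (rint_subst m11 ch cpsi dH dphi) atanN atan1 mulrN.
have e1 : rint (-1) 1 (fun s => h (atan s) * (1 + s ^+ 2)^-1) = H (pi / 4) - H (- (pi / 4)).
  have := S 0 1; rewrite !mul1r add0r sub0r => <-.
  by apply: eq_rint => s _; rewrite add0r !mul1r.
have Sm c : rint (-1) 1 (fun s => h (c - atan s) * (1 + s ^+ 2)^-1) =
    H (c + pi / 4) - H (c - pi / 4).
  have e2 := S c (-1); move: e2; rewrite !mulN1r opprK.
  set A := rint _ _ _; set B := rint _ _ _; suff -> : A = -1 * B by lra.
  rewrite /A /B -rintZ; last first.
    move=> t; apply: cvgM; last exact: cV.
    apply: continuous_comp; last exact: ch.
    by apply: cvgB; [exact: cvg_cst|exact: continuous_atan].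
  by apply: eq_rint => s _; rewrite mulN1r; ring.
have e3 : rint (-1) 1 (fun s => h (atan s - pi / 2) * (1 + s ^+ 2)^-1) =
    H (- (pi / 4)) - H (- (pi / 2) - pi / 4).
  have := S (- (pi / 2)) 1; rewrite !mul1r => e4.
  transitivity (H (- (pi / 2) + pi / 4) - H (- (pi / 2) - pi / 4)).
    by rewrite -e4; apply: eq_rint => s _; rewrite !mul1r addrC.
  by congr (H _ - _); field.
rewrite e1 !Sm e3.
have pi0 := @pi_gt0 R.
have e5 : H (2 * pi) - H (pi + pi / 4) = H 0 - H (- (pi / 2) - pi / 4).
  rewrite -(@rint_FTC _ (- (pi / 2) - pi / 4) 0 H h) //; last by lra.
  have dphi (t : R) : is_derive t (1 : R) (fun t => t + 2 * pi) 1.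
    by apply: is_derive_eq; rewrite addr0.
  have le0 : - (pi / 2) - pi / 4 <= 0 :> R by lra.
  have c1 : continuous (fun _ : R => 1 : R) by move=> t; exact: cvg_cst.
  have := rint_subst le0 ch c1 dH dphi.
  rewrite add0r (_ : _ + 2 * pi = pi + pi / 4) => [<-|]; last by field.
  by apply: eq_rint => t _; rewrite hper mulr1.
rewrite (@rint_FTC _ 0 (2 * pi) H h) //; last by lra.
have -> : pi - pi / 4 = pi / 2 + pi / 4 :> R by field.
have -> : pi / 2 - pi / 4 = pi / 4 :> R by field.
lra.
Qed.
End antiderivative.

(** * Integration in polar coordinates *)

Section scaling.
Context {R : realType}.
Local Notation mu := (@lebesgue_measure R).

(** The image of Lebesgue measure under x -> c x, multiplied by |c|, agrees with Lebesgue measure on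
    intervals and therefore everywhere. For c < 0 the preimage of a left-open interval is
    right-open, hence the second case. *)
Lemma ge0_integral_scale (c : R) (g : R -> \bar R) : c != 0 ->
  measurable_fun setT g -> (forall x, 0 <= g x)%E ->
  (\int[mu]_x g x = `|c|%:E * \int[mu]_x g (c * x)%R)%E.
Proof.
move=> c0 mg g0.
have mphi : measurable_fun [set: measurableTypeR R]
    ((fun x : R => c * x) : measurableTypeR R -> measurableTypeR R).
  by apply: measurable_funM => //; exact: measurable_cst.
pose m : {measure set (measurableTypeR R) -> \bar R} :=
  measure_function_pushforward__canonical__measure_function_Measure mu mphi.
have e A : measurable A -> mu A = mscale `|c|%:nng m A.
  move=> mA; apply: (@lebesgue_measure_unique R (mscale `|c|%:nng m)) => // X [[a b]] _ <- /=.
  rewrite /mscale /m /= /pushforward.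
  have [cp|cn] := ltP 0 c.
    have -> : (fun x : R => c * x) @^-1` [set` `]a, b]] = [set` `](a / c), (b / c)]].
      apply/seteqP; split=> x; rewrite /= !in_itv /= ltr_pdivrMr // ler_pdivlMr //;
      by rewrite [x * c]mulrC.
    rewrite !lebesgue_measure_itv /= !lte_fin ltr_pM2r ?invr_gt0 //.
    case: ifPn => _; last by rewrite mule0.
    by rewrite -!EFinB -EFinM ger0_norm ?(ltW cp) //; congr (_%:E); field.
  have {}cn : c < 0 by rewrite lt_neqAle c0.
  have -> : (fun x : R => c * x) @^-1` [set` `]a, b]] = [set` `[(b / c), (a / c)[].
    apply/seteqP; split=> x; rewrite /= !in_itv /= ltr_ndivlMr // ler_ndivrMr //;
    by rewrite [x * c]mulrC andbC.
  rewrite !lebesgue_measure_itv /= !lte_fin ltr_nM2r ?invr_lt0 //.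
  case: ifPn => _; last by rewrite mule0.
  by rewrite -!EFinB -EFinM ler0_norm ?(ltW cn) //; congr (_%:E); field.
rewrite (@eq_measure_integral _ _ _ setT (mscale `|c|%:nng m)) => [|A mA _]; last exact: e.
rewrite ge0_integral_mscale // /m ge0_integral_pushforward //.
Qed.
End scaling.

Section polar.
Context {R : realType}.
Local Notation mu := (@lebesgue_measure R).
Local Notation mu2 := (mu \x mu)%E.
Implicit Types G : R * R -> \bar R.

Let cs (s : R) := (Num.sqrt (1 + s ^+ 2))^-1.

Let sq_gt0 (s : R) : 0 < 1 + s ^+ 2. Proof. by rewrite ltr_pwDl // sqr_ge0. Qed.
Let cs_gt0 s : 0 < cs s. Proof. by rewrite invr_gt0 sqrtr_gt0. Qed.
Let cs2 s : cs s * cs s = (1 + s ^+ 2)^-1.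
Proof. by rewrite -invfM -expr2 sqr_sqrtr // ltW. Qed.

(** Polar coordinates on the quarter plane |y| <= x with the slope s = tan theta as parameter:
    [cs s] is cos theta, and d theta becomes ds / (1 + s^2). All substitutions are then linear in
    one variable. *)
Definition polar_integral G := (\int[mu]_r \int[mu]_s
  ((Num.max r 0 * (1 + s ^+ 2)^-1)%R%:E *
   (if (`|s| <= 1)%R then G (r * cs s, r * cs s * s)%R else 0)))%E.

Let sector G p : \bar R := if `|p.2| <= p.1 then G p else 0%E.

Let mfst : measurable_fun [set: R * R] (fun p : R * R => p.1). Proof. exact: measurable_fst. Qed.
Let msnd : measurable_fun [set: R * R] (fun p : R * R => p.2). Proof. exact: measurable_snd. Qed.
Let mV : measurable_fun [set: R] (fun s : R => (1 + s ^+ 2)^-1).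
Proof.
apply: continuous_measurable_fun => s; apply: cvgV; first by rewrite gt_eqF.
by apply: cvgD; [exact: cvg_cst|exact: exprn_continuous].
Qed.
Let mcs : measurable_fun [set: R] cs.
Proof.
apply: continuous_measurable_fun => s; apply: cvgV; first by rewrite gt_eqF ?sqrtr_gt0.
apply: continuous_comp; last exact: sqrt_continuous.
by apply: cvgD; [exact: cvg_cst|exact: exprn_continuous].
Qed.
Let mmax : measurable_fun [set: R] (fun r : R => Num.max r 0).
Proof. by apply: measurable_maxr; [exact: measurable_id|exact: measurable_cst]. Qed.

Let msector G : measurable_fun setT G -> measurable_fun setT (sector G).
Proof.
move=> mG; apply: measurable_fun_ifT => //.
by apply: measurable_fun_ler => //; exact: measurableT_comp.
Qed.

Let sector_ge0 G : (forall p, 0 <= G p)%E -> forall p, (0 <= sector G p)%E.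
Proof. by move=> G0 p; rewrite /sector; case: ifP. Qed.

(** Two linear substitutions joined by Tonelli: y = x s at fixed x produces the integrand [K], then
    x = r [cs s] at fixed s produces [L]. No change of variables in the plane is involved. *)
Lemma sector_polar G : measurable_fun setT G -> (forall p, 0 <= G p)%E ->
  (\int[mu2]_p sector G p = polar_integral G)%E.
Proof.
move=> mG G0.
pose K (p : R * R) : \bar R := ((Num.max p.1 0)%R%:E *
   (if (`|p.2| <= 1)%R then G (p.1, p.1 * p.2)%R else 0))%E.
pose L (p : R * R) : \bar R := ((Num.max p.1 0 * (1 + p.2 ^+ 2)^-1)%R%:E *
   (if (`|p.2| <= 1)%R then G (p.1 * cs p.2, p.1 * cs p.2 * p.2)%R else 0))%E.
have max0 (r : R) : 0 <= Num.max r 0 by rewrite le_max lexx orbT.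
have K0 p : (0 <= K p)%E by rewrite mule_ge0 ?lee_fin //; case: ifP.
have L0 p : (0 <= L p)%E.
  by rewrite mule_ge0 ?lee_fin ?mulr_ge0 ?invr_ge0 ?(ltW (sq_gt0 _)) //; case: ifP.
have mif (h : R * R -> R * R) : measurable_fun setT h ->
    measurable_fun setT (fun p : R * R => if `|p.2| <= 1 then G (h p) else 0%E).
  move=> mh; apply: measurable_fun_ifT => //; last exact: measurableT_comp.
  by apply: measurable_fun_ler => //; exact: measurableT_comp.
have mm : measurable_fun setT (fun p : R * R => Num.max p.1 0) := measurableT_comp mmax mfst.
have mv : measurable_fun setT (fun p : R * R => (1 + p.2 ^+ 2)^-1) := measurableT_comp mV msnd.
have mc : measurable_fun setT (fun p : R * R => cs p.2) := measurableT_comp mcs msnd.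
have mK : measurable_fun setT K.
  apply: emeasurable_funM; first exact/measurable_EFinP.
  by apply: (mif (fun p => (p.1, p.1 * p.2))); apply: measurable_fun_pair => //; exact: measurable_funM.
have mrc : measurable_fun setT (fun p : R * R => p.1 * cs p.2).
  by exact: measurable_funM.
have mL : measurable_fun setT L.
  apply: emeasurable_funM.
    by apply/measurable_EFinP/measurable_funM.
  apply: (mif (fun p => (p.1 * cs p.2, p.1 * cs p.2 * p.2))).
  by apply: measurable_fun_pair => //; exact: measurable_funM.
have mS := msector mG; have S0 := sector_ge0 G0.
rewrite (@fubini_tonelli1 _ _ _ _ R mu mu _ mS S0).
transitivity (\int[mu]_x \int[mu]_s K (x, s))%E.
{ apply: eq_integral => x _; rewrite /fubini_F.
  have [x0|x0|x0] := ltgtP x 0.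
  - rewrite !integral0_eq // => y _; rewrite ?/K ?/sector /=.
      by rewrite max_r ?mul0e // ltW.
    by rewrite ifF //; apply/negbTE; rewrite -ltNge (lt_le_trans x0).
  - rewrite [LHS](@ge0_integral_scale _ x) ?gt_eqF //; last exact: measurableT_comp.
    rewrite -ge0_integralZl_EFin //; last first.
      apply: measurableT_comp => //; apply: measurable_fun_pair; first exact: measurable_cst.
      by apply: measurable_funM; [exact: measurable_cst|exact: measurable_id].
    apply: eq_integral => s _; rewrite /K /sector /= gtr0_norm // max_l ?(ltW x0) //.
    by rewrite normrM gtr0_norm // ger_pMr.
  - rewrite [RHS]integral0_eq => [|s _]; last by rewrite /K /= x0 maxxx mul0e.
    rewrite -[RHS](@integral_set1 _ (fun y => G (x, y)) 0) [RHS]integral_mkcond.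
    apply: eq_integral => y _; rewrite /sector /= x0 normr_le0 patchE.
    by case: eqP => [->|y0]; [rewrite mem_set|rewrite memNset]. }
rewrite (@fubini_tonelli _ _ _ _ R mu mu K mK K0).
transitivity (\int[mu]_s \int[mu]_r L (r, s))%E; last by rewrite -(@fubini_tonelli _ _ _ _ R mu mu L mL L0).
apply: eq_integral => s _.
rewrite [LHS](@ge0_integral_scale _ (cs s)) ?gt_eqF //; last exact: measurableT_comp.
rewrite -ge0_integralZl_EFin //; last first.
  apply: measurableT_comp => //; apply: measurable_fun_pair; last exact: measurable_cst.
  by apply: measurable_funM; [exact: measurable_cst|exact: measurable_id].
apply: eq_integral => r _; rewrite /K /L /= muleA -EFinM gtr0_norm // [cs s * r]mulrC.
congr (_%:E * _)%E; rewrite -cs2.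
have -> : Num.max (r * cs s) 0 = Num.max r 0 * cs s.
  rewrite !maxEle; have c0 := cs_gt0 s.
  case: (lerP r 0) => r0; first by rewrite mul0r ifT // mulr_le0_ge0 // ltW.
  by rewrite ifF //; apply/negbTE; rewrite -ltNge mulr_gt0.
by ring.
Qed.

Let tau1 (p : R * R) : R * R := (- p.1, p.2).
Let tau2 (p : R * R) : R * R := (p.2, p.1).
Let tau3 (p : R * R) : R * R := (p.2, - p.1).
Let tau4 (p : R * R) : R * R := (- p.2, p.1).

Let mtau1 : measurable_fun setT tau1.
Proof. by apply: measurable_fun_pair => //; exact: measurableT_comp. Qed.
Let mtau2 : measurable_fun setT tau2. Proof. exact: measurable_fun_pair. Qed.
Let mtau3 : measurable_fun setT tau3.
Proof. by apply: measurable_fun_pair => //; exact: measurableT_comp. Qed.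
Let mtau4 : measurable_fun setT tau4.
Proof. by apply: measurable_fun_pair => //; exact: measurableT_comp. Qed.

Let integralN (g : R -> \bar R) : measurable_fun setT g -> (forall x, 0 <= g x)%E ->
  (\int[mu]_x g (- x)%R = \int[mu]_x g x)%E.
Proof.
move=> mg g0; rewrite [RHS](@ge0_integral_scale _ (-1)) ?oppr_eq0 ?oner_eq0 //.
by rewrite normrN normr1 mul1e; apply: eq_integral => x _; rewrite mulN1r.
Qed.

Let inv1 G : measurable_fun setT G -> (forall p, 0 <= G p)%E ->
  (\int[mu2]_p G (tau1 p) = \int[mu2]_p G p)%E.
Proof.
move=> mG G0; rewrite !fubini_tonelli1 //; last exact: measurableT_comp.
rewrite -[RHS]integralN //; first exact: measurable_fun_fubini_tonelli_F.
by move=> x; exact: integral_ge0.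
Qed.

Let inv2 G : measurable_fun setT G -> (forall p, 0 <= G p)%E ->
  (\int[mu2]_p G (tau2 p) = \int[mu2]_p G p)%E.
Proof.
by move=> mG G0; rewrite fubini_tonelli1 ?fubini_tonelli2 //; exact: measurableT_comp.
Qed.

Let inv3 G : measurable_fun setT G -> (forall p, 0 <= G p)%E ->
  (\int[mu2]_p G (tau3 p) = \int[mu2]_p G p)%E.
Proof.
move=> mG G0; rewrite -(inv2 mG G0).
exact: (@inv1 (fun p => G (tau2 p)) (measurableT_comp mG mtau2) (fun p => G0 _)).
Qed.

Let inv4 G : measurable_fun setT G -> (forall p, 0 <= G p)%E ->
  (\int[mu2]_p G (tau4 p) = \int[mu2]_p G p)%E.
Proof.
move=> mG G0; rewrite -(inv1 mG G0).
exact: (@inv2 (fun p => G (tau1 p)) (measurableT_comp mG mtau1) (fun p => G0 _)).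
Qed.

Lemma polar_lower G : measurable_fun setT G -> (forall p, 0 <= G p)%E ->
  [/\ polar_integral G <= \int[mu2]_p G p,
      polar_integral (fun p => G (- p.1, p.2)%R) <= \int[mu2]_p G p,
      polar_integral (fun p => G (p.2, p.1)) <= \int[mu2]_p G p &
      polar_integral (fun p => G (p.2, - p.1)%R) <= \int[mu2]_p G p]%E.
Proof.
move=> mG G0.
have low H : measurable_fun setT H -> (forall p, 0 <= H p)%E ->
    (polar_integral H <= \int[mu2]_p H p)%E.
  move=> mH H0; rewrite -sector_polar //; apply: ge0_le_integral => //; first by move=> p _; exact: sector_ge0.
    exact: msector.
  by move=> p _; rewrite /sector; case: ifP.
split; first exact: low.
- rewrite -(inv1 mG G0); apply: low => //; exact: (measurableT_comp mG mtau1).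
- rewrite -(inv2 mG G0); apply: low => //; exact: (measurableT_comp mG mtau2).
- rewrite -(inv3 mG G0); apply: low => //; exact: (measurableT_comp mG mtau3).
Qed.

Let quadrant (x y : R) : x < `|y| -> - x < `|y| -> y < `|x| -> `|x| <= - y.
Proof. by case: (ger0P x) => ?; case: (ger0P y) => ?; lra. Qed.

(** The four quarter planes cover the plane and overlap on the diagonals. An inequality is enough
    for finiteness, so no null sets need to be discussed. *)
Lemma polar_upper G : measurable_fun setT G -> (forall p, 0 <= G p)%E ->
  (\int[mu2]_p G p <= polar_integral G + polar_integral (fun p => G (- p.1, p.2)%R) +
      polar_integral (fun p => G (p.2, p.1)) +
      polar_integral (fun p => G (p.2, - p.1)%R))%E.
Proof.
move=> mG G0.
have m1 := measurableT_comp mG mtau1; have m2 := measurableT_comp mG mtau2.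
have m3 := measurableT_comp mG mtau3.
rewrite -!sector_polar //.
rewrite -(@inv1 (sector (G \o tau1))) //; try exact: msector; try exact: sector_ge0.
rewrite -(@inv2 (sector (G \o tau2))) //; try exact: msector; try exact: sector_ge0.
rewrite -(@inv4 (sector (G \o tau3))) //; try exact: msector; try exact: sector_ge0.
have ms1 := measurableT_comp (msector m1) mtau1.
have ms2 := measurableT_comp (msector m2) mtau2.
have ms3 := measurableT_comp (msector m3) mtau4.
have S0 := sector_ge0.
have a0 := fun p (_ : setT p) => sector_ge0 G0 p.
have a1 p (_ : setT p) : (0 <= sector (G \o tau1) (tau1 p))%E by apply: S0 => q; exact: G0.
have a2 p (_ : setT p) : (0 <= sector (G \o tau2) (tau2 p))%E by apply: S0 => q; exact: G0.
have a3 p (_ : setT p) : (0 <= sector (G \o tau3) (tau4 p))%E by apply: S0 => q; exact: G0.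
have ms0 := msector mG; have md1 := emeasurable_funD ms0 ms1.
have md2 := emeasurable_funD md1 ms2; have md3 := emeasurable_funD md2 ms3.
rewrite -ge0_integralD // -ge0_integralD //; last by move=> p h; rewrite adde_ge0 ?a0 ?a1.
rewrite -ge0_integralD //; last by move=> p h; rewrite !adde_ge0 ?a0 ?a1 ?a2.
apply: ge0_le_integral => //.
move=> [x y] _; rewrite /sector /tau1 /tau2 /tau3 /tau4 /= !opprK.
  have p0 b : (0 <= if b then G (x, y) else 0)%E by case: b.
  case: (leP `|y| x) => h1 /=; first by rewrite -!addeA leeDl ?adde_ge0.
  case: (leP `|y| (- x)) => h2 /=; first by rewrite add0e -!addeA leeDl ?adde_ge0.
  case: (leP `|x| y) => h3 /=; first by rewrite !add0e leeDl.
  by rewrite ifT ?add0e //; exact: quadrant h1 h2 h3.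
all: by apply: sector_ge0 => q; exact: G0.
Qed.

Definition four_sum G p : \bar R :=
  (G p + G (- p.1, p.2)%R + G (p.2, p.1) + G (p.2, - p.1)%R)%E.

(** Only finiteness is compared, so the symmetrised integrand may be used: its integral over the
    plane is four times that of G, and it dominates each of the four reflected copies. *)
Lemma polar_finite G : measurable_fun setT G -> (forall p, 0 <= G p)%E ->
  (\int[mu2]_p G p < +oo <-> polar_integral (four_sum G) < +oo)%E.
Proof.
move=> mG G0.
have m1 := measurableT_comp mG mtau1; have m2 := measurableT_comp mG mtau2.
have m3 := measurableT_comp mG mtau3.
have m01 := emeasurable_funD mG m1; have m012 := emeasurable_funD m01 m2.
have mS : measurable_fun setT (four_sum G) := emeasurable_funD m012 m3.
have S0 p : (0 <= four_sum G p)%E by rewrite /four_sum !adde_ge0.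
have eS : (\int[mu2]_p four_sum G p = \int[mu2]_p G p + \int[mu2]_p G p +
    \int[mu2]_p G p + \int[mu2]_p G p)%E.
  rewrite -{2}(inv1 mG G0) -{2}(inv2 mG G0) -{2}(inv3 mG G0).
  rewrite -!ge0_integralD //; try by move=> p _; rewrite ?adde_ge0.
split=> h.
  apply: (@le_lt_trans _ _ (\int[mu2]_p four_sum G p)%E); last first.
    by rewrite eS (lte_add_pinfty (lte_add_pinfty (lte_add_pinfty h h) h) h).
  by have [] := polar_lower mS S0.
have le H : measurable_fun setT H -> (forall p, 0 <= H p)%E ->
    (forall p, H p <= four_sum G p)%E -> (polar_integral H < +oo)%E.
  move=> mH H0 HS; apply: le_lt_trans h; rewrite -!sector_polar //.
  apply: ge0_le_integral => //; try exact: msector.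
    by move=> p _; exact: sector_ge0.
  by move=> p _; rewrite /sector; case: ifP.
apply: le_lt_trans (polar_upper mG G0) _.
apply: (lte_add_pinfty (lte_add_pinfty (lte_add_pinfty _ _) _) _);
  apply: le => // p; rewrite /four_sum.
- by rewrite -!addeA leeDl ?adde_ge0.
- by rewrite -!addeA addeCA leeDl ?adde_ge0.
- by rewrite addeC addeA leeDr ?adde_ge0.
- by rewrite leeDr ?adde_ge0.
Qed.

Lemma measurable_polar G : measurable_fun setT G -> (forall p, 0 <= G p)%E ->
  measurable_fun setT (fun r : R => \int[mu]_s
    ((Num.max r 0 * (1 + s ^+ 2)^-1)%R%:E *
   (if (`|s| <= 1)%R then G (r * cs s, r * cs s * s)%R else 0)))%E.
Proof.
move=> mG G0.
pose L (p : R * R) : \bar R := ((Num.max p.1 0 * (1 + p.2 ^+ 2)^-1)%R%:E *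
   (if (`|p.2| <= 1)%R then G (p.1 * cs p.2, p.1 * cs p.2 * p.2)%R else 0))%E.
apply: (@measurable_fun_fubini_tonelli_F _ _ _ _ _ mu L).
  apply: emeasurable_funM.
    apply/measurable_EFinP/measurable_funM; first exact: measurableT_comp mmax mfst.
    exact: measurableT_comp mV msnd.
  have mrc : measurable_fun setT (fun p : R * R => p.1 * cs p.2).
    by apply: measurable_funM => //; exact: measurableT_comp mcs msnd.
  apply: measurable_fun_ifT => //.
    by apply: measurable_fun_ler => //; exact: measurableT_comp.
  apply: measurableT_comp => //; apply: measurable_fun_pair => //; exact: measurable_funM.
move=> p; rewrite /L mule_ge0 ?lee_fin ?mulr_ge0 ?invr_ge0 ?(ltW (sq_gt0 _)) //.
  by rewrite le_max lexx orbT.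
by case: ifP.
Qed.
End polar.

(** * The area integral against the means over circles *)

Section bergman_norm.
Context {R : realType}.
Local Notation mu := (@lebesgue_measure R).
Local Notation mu2 := (mu \x mu)%E.
Implicit Types f : R[i] -> R[i].

Definition wsum (r : nat -> R) f m := \sum_(1 <= n < m) 2^-1 ^+ n * circ2 (r n) f.

(** A bound on the squared norm phrased through its partial sums, so that all later estimates
    concern finite sums of circle means. *)
Definition wbound (r : nat -> R) f B := analytic f /\ forall m, wsum r f m <= B.

Let mc (g : R * R -> R[i]) := measurable_fun setT (fun p => Re (g p)) /\
  measurable_fun setT (fun p => Im (g p)).

Let mc_cst c : mc (fun=> c).
Proof. by split; exact: measurable_cst. Qed.

Let mc_id : mc (fun p => p.1 +i* p.2).
Proof. by split; [exact: measurable_fst|exact: measurable_snd]. Qed.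

Let mcD g h : mc g -> mc h -> mc (fun p => g p + h p).
Proof.
move=> [a b] [c d]; split.
  by under eq_fun do rewrite ReD; exact: measurable_funD.
by under eq_fun do rewrite ImD; exact: measurable_funD.
Qed.

Let mcM g h : mc g -> mc h -> mc (fun p => g p * h p).
Proof.
move=> [a b] [c d]; split.
  by under eq_fun do rewrite ReM; apply: measurable_funB; exact: measurable_funM.
by under eq_fun do rewrite ImM; apply: measurable_funD; exact: measurable_funM.
Qed.

Let mc_pser (a : nat -> R[i]) n : mc (fun p => \sum_(k < n) a k * (p.1 +i* p.2) ^+ k).
Proof.
elim: n => [|n IH]; first by under eq_fun do rewrite big_ord0; exact: mc_cst.
under eq_fun do rewrite big_ord_recr /=.
apply: mcD => //; apply: mcM; first exact: mc_cst.
elim: n {IH} => [|n IH]; first by under eq_fun do rewrite expr0; exact: mc_cst.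
by under eq_fun do rewrite exprS; exact: mcM.
Qed.

Let mc_cabs g : mc g -> measurable_fun setT (fun p => cabs (g p)).
Proof.
move=> [a b]; under eq_fun do rewrite cabsE.
apply: measurableT_comp.
  by apply: continuous_measurable_fun => t; exact: sqrt_continuous.
by apply: measurable_funD; exact: measurable_funX.
Qed.

Let D : set (R * R) := [set p | cabs (p.1 +i* p.2) < 1].

Let mD : measurable D.
Proof.
rewrite (_ : D = setT `&` (fun p => cabs (p.1 +i* p.2)) @^-1` `]-oo, 1[).
  by apply: mc_cabs; [exact: mc_id|exact: measurableT|exact: measurable_itv].
by rewrite setTI; apply/seteqP; split=> p; rewrite /= in_itv.
Qed.

Let mf f : analytic f -> measurable_fun D (fun p => cabs (f (p.1 +i* p.2)) ^+ 2).
Proof.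
move=> af; have [a pa] := analytic_pser af; apply: measurable_funX.
pose h n (p : R * R) := cabs (\sum_(k < n) a k * (p.1 +i* p.2) ^+ k).
apply: (@measurable_fun_cvg _ _ _ D h) => [n|p Dp].
  by apply: measurable_funTS; exact: mc_cabs.
have [C [q [C0 q01 H]]] := pa (cabs (p.1 +i* p.2)) ltac:(by rewrite cabs_ge0 Dp).
apply/cvgrPdist_le => e e0.
have [N HN] := geom_small C q01 e0.
exists N => // n /= Nn; apply: le_trans (HN n Nn).
rewrite /h; have := H _ n (lexx _); rewrite ler_norml.
set u := f _; set v := \sum_(_ < _) _ => Huv.
have := lerB_cabs u v; have := lerB_cabs v u; rewrite (cabs_distC v u).
move: Huv; set X := C * _ => Huv h1 h2; lra.
Qed.

Variable w : R -> R.
Hypothesis hw : admissible w.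
Let r := radius w.

Let w_gt0 x : 0 <= x < 1 -> 0 < w x. Proof. by case: hw => H _ _ _; exact: H. Qed.

Let mw : measurable_fun (`[(0 : R), (1 : R)[ : set R) w.
Proof. by case: hw => _ cw _ _; exact: subspace_continuous_measurable_fun. Qed.

Let G f : R * R -> \bar R :=
  (fun p => (cabs (f (p.1 +i* p.2)) ^+ 2 * w (cabs (p.1 +i* p.2)))%:E) \_ D.

Let G0 f p : (0 <= G f p)%E.
Proof.
rewrite /G patchE; case: ifP => // /set_mem Dp.
by rewrite lee_fin mulr_ge0 ?sqr_ge0 // ltW // w_gt0 // cabs_ge0.
Qed.

Let mG f : analytic f -> measurable_fun setT (G f).
Proof.
move=> af; apply/(measurable_restrictT _ mD); apply/measurable_EFinP.
apply: measurable_funM; first exact: mf.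
apply: measurable_comp mw _ => //.
  by move=> _ /= [p Dp <-]; rewrite in_itv /= cabs_ge0.
by apply: measurable_funTS; exact: mc_cabs.
Qed.

Let sin_atan (s : R) : sin (atan s) = s * cos (atan s).
Proof. by rewrite -{2}(atanK s) /tan divfK // cos_atan invr_neq0 // gt_eqF // sqrtr_gt0 ltr_pwDl // sqr_ge0. Qed.

Let G_circle f x t : 0 <= x < 1 ->
  G f (x * cos t, x * sin t) = (cabs (f (on_circle x t)) ^+ 2 * w x)%:E.
Proof.
move=> /andP[x0 x1]; have e : cabs ((x * cos t) +i* (x * sin t)) = x := cabs_on_circle t x0.
by rewrite /G patchE ifT ?e // inE /D /= e.
Qed.

(** The radial density of the area integral. *)
Let Phi f x : \bar R := (if 0 <= x < 1 then x * w x * (2 * pi * circ2 x f) else 0)%:E.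

(** The four reflected copies of the quarter circle |z| = x make up the whole circle, by
    [rint_circle]; outside the unit disc everything vanishes. *)
Let polar_Phi f x : analytic f -> (\int[mu]_s
  ((Num.max x 0 * (1 + s ^+ 2)^-1)%R%:E * (if (`|s| <= 1)%R then
   four_sum (G f) (x * (Num.sqrt (1 + s ^+ 2))^-1, x * (Num.sqrt (1 + s ^+ 2))^-1 * s)%R
   else 0)) = Phi f x)%E.
Proof.
move=> af; rewrite /Phi; have [x0|x0] := ltP x 0.
  by apply: integral0_eq => s _; rewrite mul0r mul0e.
under eq_integral do rewrite -cos_atan -mulrA [cos _ * _]mulrC -sin_atan.
have [x1|x1] := ltP x 1; last first.
  apply: integral0_eq => s _; case: ifP; rewrite ?mule0 // => _.
  suff g0 p : p.1 ^+ 2 + p.2 ^+ 2 = x ^+ 2 -> G f p = 0%E.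
    have e : (x * cos (atan s)) ^+ 2 + (x * sin (atan s)) ^+ 2 = x ^+ 2.
      by rewrite !exprMn -mulrDr cos2Dsin2 mulr1.
    by rewrite /four_sum !g0 ?adde0 ?mule0 //= ?sqrrN // addrC.
  move=> e; rewrite /G patchE ifF //; apply/negbTE/negP => /set_mem; rewrite /D /= cabsE /= e.
  by rewrite sqrtr_sqr ger0_norm // ltNge x1.
have x01 : 0 <= x < 1 by rewrite x0.
pose h t := cabs (f (on_circle x t)) ^+ 2.
have ch : continuous h by apply: continuous_cabs2; exact: analytic_ccont.
have hper t : h (t + 2 * pi) = h t by rewrite /h /on_circle mulr_natl cosD2pi sinD2pi.
have gE s : four_sum (G f) (x * cos (atan s), x * sin (atan s)) =
   ((h (atan s) + h (pi - atan s) + h (pi / 2 - atan s) + h (atan s - pi / 2)) * w x)%:E.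
  rewrite /four_sum /=.
  have e1 : - (x * cos (atan s)) = x * cos (pi - atan s) by rewrite cosB cospi sinpi; ring.
  have e2 : x * sin (atan s) = x * sin (pi - atan s) by rewrite sinB cospi sinpi; ring.
  have e3 : x * sin (atan s) = x * cos (pi / 2 - atan s) by rewrite cosB cos_pihalf sin_pihalf; ring.
  have e4 : x * cos (atan s) = x * sin (pi / 2 - atan s) by rewrite sinB cos_pihalf sin_pihalf; ring.
  have e5 : x * sin (atan s) = x * cos (atan s - pi / 2) by rewrite cosB cos_pihalf sin_pihalf; ring.
  have e6 : - (x * cos (atan s)) = x * sin (atan s - pi / 2) by rewrite sinB cos_pihalf sin_pihalf; ring.
  have a1 : G f (- (x * cos (atan s)), x * sin (atan s)) = (h (pi - atan s) * w x)%:E.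
    by rewrite e1 e2 G_circle.
  have a2 : G f (x * sin (atan s), x * cos (atan s)) = (h (pi / 2 - atan s) * w x)%:E.
    by rewrite e3 e4 G_circle.
  have a3 : G f (x * sin (atan s), - (x * cos (atan s))) = (h (atan s - pi / 2) * w x)%:E.
    by rewrite e5 e6 G_circle.
  by rewrite a1 a2 a3 G_circle // -!EFinD !mulrDl.
transitivity (\int[mu]_(s in `[(-1)%R, 1%R]) (x * w x * (
   h (atan s) * (1 + s ^+ 2)^-1 + h (pi - atan s) * (1 + s ^+ 2)^-1 +
   h (pi / 2 - atan s) * (1 + s ^+ 2)^-1 + h (atan s - pi / 2) * (1 + s ^+ 2)^-1))%R%:E)%E.
  rewrite [RHS]integral_mkcond; apply: eq_integral => s _.
  rewrite patchE mem_setE in_itv /= ler_norml.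
  case: ifP => _; last by rewrite mule0.
  by rewrite gE -EFinM; congr (_%:E); ring.
have cV : continuous (fun s : R => (1 + s ^+ 2)^-1).
  move=> s; apply: cvgV; first by rewrite gt_eqF // ltr_pwDl // sqr_ge0.
  by apply: cvgD; [exact: cvg_cst|exact: exprn_continuous].
have c1 c : continuous (fun s => h (c - atan s) * (1 + s ^+ 2)^-1).
  move=> s; apply: cvgM; last exact: cV.
  apply: (@continuous_comp R R R (fun s => c - atan s) h s); last exact: ch.
  by apply: cvgB; [exact: cvg_cst|exact: continuous_atan].
have c0 : continuous (fun s => h (atan s) * (1 + s ^+ 2)^-1).
  move=> s; apply: cvgM; last exact: cV.
  by apply: (@continuous_comp R R R atan h s); [exact: continuous_atan|exact: ch].
have c2 : continuous (fun s => h (atan s - pi / 2) * (1 + s ^+ 2)^-1).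
  move=> s; apply: cvgM; last exact: cV.
  apply: (@continuous_comp R R R (fun s => atan s - pi / 2) h s); last exact: ch.
  by apply: cvgB; [exact: continuous_atan|exact: cvg_cst].
have c01 : continuous (fun s => h (atan s) * (1 + s ^+ 2)^-1 + h (pi - atan s) * (1 + s ^+ 2)^-1).
  by move=> s; apply: cvgD; [exact: c0|exact: c1].
have c012 : continuous (fun s => h (atan s) * (1 + s ^+ 2)^-1 + h (pi - atan s) * (1 + s ^+ 2)^-1
   + h (pi / 2 - atan s) * (1 + s ^+ 2)^-1).
  by move=> s; apply: cvgD; [exact: c01|exact: c1].
have call : continuous (fun s => h (atan s) * (1 + s ^+ 2)^-1 + h (pi - atan s) * (1 + s ^+ 2)^-1
   + h (pi / 2 - atan s) * (1 + s ^+ 2)^-1 + h (atan s - pi / 2) * (1 + s ^+ 2)^-1).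
  by move=> s; apply: cvgD; [exact: c012|exact: c2].
rewrite EFin_rint; last by move=> s; apply: cvgM; [exact: cvg_cst|exact: call].
rewrite (rintZ _ _ _ call) (rintD _ _ c012 c2) (rintD _ _ c01 (c1 _)) (rintD _ _ c0 (c1 _)).
rewrite (rint_circle ch hper) /circ2 [2 * pi * _]mulrA divff ?mul1r //.
by rewrite gt_eqF // pi2_gt0.
Qed.

Let mPhi f : analytic f -> measurable_fun setT (Phi f).
Proof.
move=> af; have m := mG af; rewrite (_ : Phi f = fun x => \int[mu]_s
  ((Num.max x 0 * (1 + s ^+ 2)^-1)%R%:E * (if (`|s| <= 1)%R then
   four_sum (G f) (x * (Num.sqrt (1 + s ^+ 2))^-1, x * (Num.sqrt (1 + s ^+ 2))^-1 * s)%R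
   else 0)))%E; last by apply/funext => x; rewrite polar_Phi.
apply: measurable_polar => [|p]; last by rewrite /four_sum !adde_ge0.
have mm : measurable_fun setT (fun p : R * R => p.1) := measurable_fst.
have mm2 : measurable_fun setT (fun p : R * R => p.2) := measurable_snd.
have n1 : measurable_fun setT (fun p : R * R => - p.1) by exact: measurableT_comp.
have h1 := measurableT_comp m (measurable_fun_pair n1 mm2).
have h2 := measurableT_comp m (measurable_fun_pair mm2 mm).
have h3 := measurableT_comp m (measurable_fun_pair mm2 n1).
have h01 := emeasurable_funD m h1; have h012 := emeasurable_funD h01 h2.
exact: emeasurable_funD h012 h3.
Qed.

Let Phi0 f x : analytic f -> (0 <= Phi f x)%E.
Proof.
move=> af; rewrite /Phi lee_fin; case: ifP => // x01; have /andP[x0 x1] := x01.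
have q0 := circ2_ge0' af x01; have w0 := ltW (w_gt0 x01).
by do 2 apply: mulr_ge0 => //; rewrite mulr_ge0 ?pi_ge0.
Qed.

Let bergman_Phi f : bergman w f <-> analytic f /\ (\int[mu]_(x in `[0%R, 1%R[) Phi f x < +oo)%E.
Proof.
have e : analytic f -> (\int[mu]_(x in `[0%R, 1%R[) Phi f x = polar_integral (four_sum (G f)))%E.
  move=> af; rewrite /polar_integral integral_mkcond; apply: eq_integral => x _.
  rewrite polar_Phi // patchE; case: ifP => //; rewrite mem_setE in_itv /= /Phi => ->.
  by [].
have e2 : (\int[mu2]_(p in D) (cabs (f (p.1 +i* p.2)) ^+ 2 * w (cabs (p.1 +i* p.2)))%:E =
   \int[mu2]_p G f p)%E by rewrite integral_mkcond.
split=> -[/analyticP af h]; split=> //; try by apply/analyticP.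
  rewrite e //; apply/polar_finite => //; first exact: mG.
  by rewrite -e2.
have {}af := (analyticP _).1 af; move: h; rewrite e // => h; rewrite [X in (X < _)%E]e2.
by apply/polar_finite => //; exact: mG.
Qed.

Let r_ge0 n : 0 <= r n.
Proof.
have [r0 ri _ _] := radiiP hw; elim: n => [|n IH]; first by rewrite /r r0.
exact: le_trans IH (ltW (ri n)).
Qed.

Let Phi_rings f : analytic f ->
  (\int[mu]_(x in `[0%R, 1%R[) Phi f x =
   \sum_(0 <= n <oo) \int[mu]_(x in `[r n, r n.+1[) Phi f x)%E.
Proof.
move=> af; have [r0 ri r1 [p rp]] := radiiP hw.
have rmono m n : (m <= n)%N -> r m <= r n.
  by elim: n => [|n IH]; rewrite leq_eqVlt => /predU1P[-> //|] // /IH h; exact: le_trans h (ltW (ri n)).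
have e : [set` `[(0 : R), (1 : R)[] = \bigcup_n [set` `[r n, r n.+1[].
  apply/seteqP; split=> x; rewrite /= in_itv /=; last first.
    move=> [n _]; rewrite /= in_itv /= => /andP[h1 h2].
    by rewrite (le_trans (r_ge0 n) h1) (lt_trans h2) // r1.
  move=> /andP[x0 x1].
  have [n hn] : exists n, x < r n.
    have H k : 1 - r (k * p)%N <= 2^-1 ^+ k.
      elim: k => [|k IH]; first by rewrite mul0n /r r0 expr0 subr0.
      by rewrite mulSn addnC exprS (le_trans (rp _)) // mulrC ler_pM2l ?invr_gt0.
    have [k Hk] := @geom_small R 1 (2^-1) ((1 - x) / 2) ltac:(lra) ltac:(lra).
    exists (k * p)%N; have := Hk k (leqnn _); have := H k; rewrite mul1r => h1 h2.
    by move: (le_trans h1 h2); set y := r _; lra.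
  elim: n hn => [|n IH] hn; first by move: hn; rewrite /r r0; lra.
  have [/IH //|h] := ltP x (r n).
  by exists n => //; rewrite /= in_itv /= h hn.
rewrite e ge0_integral_bigcup //.
- by apply: measurable_funTS; exact: mPhi.
- by move=> x _; exact: Phi0.
- apply/trivIsetP => m n _ _; wlog mn : m n / (m < n)%N.
    move=> W; rewrite neq_ltn => /orP[h|h]; first by apply: W => //; rewrite neq_ltn h.
    by rewrite setIC; apply: W => //; rewrite neq_ltn h.
  move=> _; apply/seteqP; split=> x //= []; rewrite !in_itv /= => /andP[h1 h2] /andP[h3 h4].
  by have := rmono _ _ mn; move: (lt_le_trans h2 (le_trans (rmono _ _ mn) h3)); rewrite ltxx.
Qed.

Let ring_int (c : R) n : 0 <= c ->
  (\int[mu]_(x in `[r n, r n.+1[) (c * w x)%:E = (c * 2^-1 ^+ n.+1)%:E)%E.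
Proof.
move=> c0; have [r0 ri r1 _] := radiiP hw.
have sub : (`[r n, r n.+1[ : set R) `<=` (`[(0 : R), (1 : R)[ : set R).
  move=> x; rewrite /= !in_itv /= => /andP[h1 h2].
  by rewrite (le_trans (r_ge0 n) h1) (lt_trans h2) // r1.
under eq_integral do rewrite EFinM.
rewrite ge0_integralZl ?lee_fin //.
- by rewrite [X in (_ * X)%E]radius_ring // -EFinM.
- by apply/measurable_EFinP; exact: measurable_funS mw.
- by move=> x /sub; rewrite /= in_itv /= => h; rewrite lee_fin ltW // w_gt0.
Qed.

Let ring_upper f n : analytic f ->
  (\int[mu]_(x in `[r n, r n.+1[) Phi f x <= (2 * pi * circ2 (r n.+1) f * 2^-1 ^+ n.+1)%:E)%E.
Proof.
move=> af; have [r0 ri r1 _] := radiiP hw.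
have c0 : 0 <= 2 * pi * circ2 (r n.+1) f.
  have q0 : 0 <= circ2 (r n.+1) f by rewrite circ2_ge0' // r_ge0 r1.
  by rewrite mulr_ge0 // mulr_ge0 // pi_ge0.
rewrite -ring_int //; apply: ge0_le_integral => //.
- by move=> x _; exact: Phi0.
- by apply: measurable_funTS; exact: mPhi.
- apply/measurable_EFinP; apply: measurable_funM => //; apply: measurable_funS mw => //.
  move=> x; rewrite /= !in_itv /= => /andP[h1 h2].
  by rewrite (le_trans (r_ge0 n) h1) (lt_trans h2) // r1.
- move=> x; rewrite /= in_itv /= => /andP[h1 h2]; rewrite /Phi lee_fin.
  have x0 := le_trans (r_ge0 n) h1; have x1 := lt_trans h2 (r1 n.+1).
  have w0 : 0 < w x by rewrite w_gt0 // x0.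
  have := circ2_mono af x0 (ltW h2) (r1 _); have p0 := @pi_gt0 R.
  have : 0 <= circ2 x f by rewrite circ2_ge0' // x0.
  rewrite x0 x1 /=; set A := circ2 x f; set B := circ2 _ f => A0 AB.
  have -> : x * w x * (2 * pi * A) = (2 * pi * w x) * (x * A) by ring.
  have -> : 2 * pi * B * w x = (2 * pi * w x) * B by ring.
  rewrite ler_pM2l ?mulr_gt0 //; apply: le_trans AB.
  by rewrite -[leRHS]mul1r ler_wpM2r // ltW.
Qed.

(** The Jacobian is bounded below only by r_n, so the ring n = 0 gives nothing; accordingly the norm
    starts at n = 1, where r_n >= r_1 > 0. *)
Let ring_lower f n : analytic f ->
  ((2 * pi * r n * circ2 (r n) f * 2^-1 ^+ n.+1)%:E <= \int[mu]_(x in `[r n, r n.+1[) Phi f x)%E.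
Proof.
move=> af; have [r0 ri r1 _] := radiiP hw.
have q0 : 0 <= circ2 (r n) f by rewrite circ2_ge0' // r_ge0 r1.
rewrite -ring_int; last by apply: mulr_ge0 => //; rewrite !mulr_ge0 ?pi_ge0 ?r_ge0.
apply: ge0_le_integral => //.
- move=> x; rewrite /= in_itv /= => /andP[h1 h2]; rewrite lee_fin.
  have w0 : 0 <= w x by rewrite ltW // w_gt0 // (le_trans (r_ge0 n) h1) (lt_trans h2) // r1.
  by apply: mulr_ge0 => //; apply: mulr_ge0 => //; rewrite !mulr_ge0 ?pi_ge0 ?r_ge0.
- apply/measurable_EFinP; apply: measurable_funM => //; apply: measurable_funS mw => //.
  move=> x; rewrite /= !in_itv /= => /andP[h1 h2].
  by rewrite (le_trans (r_ge0 n) h1) (lt_trans h2) // r1.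
- by apply: measurable_funTS; exact: mPhi.
- move=> x; rewrite /= in_itv /= => /andP[h1 h2]; rewrite /Phi lee_fin.
  have x0 := le_trans (r_ge0 n) h1; have x1 := lt_trans h2 (r1 n.+1).
  have wx : 0 < w x by rewrite w_gt0 // x0.
  have := circ2_mono af (r_ge0 n) h1 x1; have p0 := @pi_gt0 R.
  rewrite x0 x1 /= => h3.
  have -> : 2 * pi * r n * circ2 (r n) f * w x = (2 * pi * w x) * (r n * circ2 (r n) f) by ring.
  have -> : x * w x * (2 * pi * circ2 x f) = (2 * pi * w x) * (x * circ2 x f) by ring.
  by rewrite ler_pM2l ?mulr_gt0 // ler_pM.
Qed.

(** The ring between r_n and r_(n + 1) has weight 2^-(n + 1) and the means increase with the radius,
    so its share of the area integral lies between multiples of the terms n and n + 1 of the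
    norm. *)
Lemma bergmanP f : bergman w f <-> exists B, wbound r f B.
Proof.
have [r0 ri r1 _] := radiiP hw; have pi0 := @pi_gt0 R.
split=> [/bergman_Phi[af]|[B [af HB]]]; last first.
  apply/bergman_Phi; split=> //; rewrite Phi_rings //.
  apply: (@le_lt_trans _ _ (2 * pi * B)%:E); last exact: ltry.
  apply: lime_le; first by apply: is_cvg_nneseries => n _ _; apply: integral_ge0 => x _; exact: Phi0.
  apply: nearW => n.
  apply: (@le_trans _ _ (\sum_(0 <= i < n) (2 * pi * (2^-1 ^+ i.+1 * circ2 (r i.+1) f))%:E)%E).
    by apply: lee_sum => i _; rewrite (_ : 2 * pi * _ = 2 * pi * circ2 (r i.+1) f * 2^-1 ^+ i.+1) ?ring_upper //; ring.
  rewrite sumEFin lee_fin -mulr_sumr ler_pM2l ?mulr_gt0 //.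
  by have := HB n.+1; rewrite /wsum big_add1.
rewrite Phi_rings // => hfin.
have Jge0 n : (0 <= \int[mu]_(x in `[r n, r n.+1[) Phi f x)%E.
  by apply: integral_ge0 => x _; exact: Phi0.
set S := (\sum_(0 <= n <oo) _)%E in hfin.
have Sfin : S \is a fin_num by rewrite ge0_fin_numE //; apply: nneseries_ge0.
have r1p : 0 < r 1%N by have := ri 0%N; rewrite /r r0.
exists ((pi * r 1%N)^-1 * fine S); split=> // m.
rewrite -ler_pdivrMl ?invr_gt0 ?mulr_gt0 // invrK -lee_fin fineK //.
have := @nneseries_lim_ge R _ xpredT 0 m (fun n _ _ => Jge0 n).
apply: le_trans.
apply: (@le_trans _ _ (\sum_(1 <= i < m) \int[mu]_(x in `[r i, r i.+1[) Phi f x)%E); last first.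
  case: m => [|m]; first by rewrite !big_geq.
  by rewrite [leRHS]big_nat_recl // big_add1 leeDr.
rewrite /wsum mulr_sumr -sumEFin big_nat_cond [leRHS]big_nat_cond.
apply: lee_sum => i /andP[/andP[i1 _] _]; apply: le_trans (ring_lower i af); rewrite lee_fin.
have rm : r 1%N <= r i.
  elim: i i1 => // i IH _; case: i IH => [//|i] IH.
  exact: le_trans (IH isT) (ltW (ri _)).
rewrite exprS [leRHS](_ : _ = pi * r i * (2^-1 ^+ i * circ2 (r i) f)); last by field.
apply: ler_wpM2r; last by rewrite ler_pM2l.
by apply: mulr_ge0; [exact: exprn_ge0|apply: circ2_ge0'; rewrite // r_ge0 r1].
Qed.

Let norm2_term f n : analytic f ->
  (\int[mu]_(t in `[0%R, (2 * pi)%R]) (cabs (f (on_circle (radius w n) t)) ^+ 2 / (2 * pi))%:E =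
   (circ2 (r n) f)%:E)%E.
Proof.
move=> af; have [_ _ r1 _] := radiiP hw.
have c : continuous (fun t => cabs (f (on_circle (r n) t)) ^+ 2).
  by apply: continuous_cabs2; apply: analytic_ccont => //; rewrite r_ge0 r1.
rewrite /circ2 -rintZ // -EFin_rint; last by move=> t; apply: cvgM; [exact: cvg_cst|exact: c].
by apply: eq_integral => t _; rewrite mulrC.
Qed.


Let wsum_ge0_term f n : analytic f -> 0 <= 2^-1 ^+ n * circ2 (r n) f.
Proof.
by move=> af; have [_ _ r1 _] := radiiP hw; rewrite mulr_ge0 ?exprn_ge0 ?circ2_ge0' // r_ge0 r1.
Qed.

Lemma norm2_le f B : analytic f -> (norm2 w f <= B%:E)%E <-> wbound r f B.
Proof.
move=> af.
have p n : (1 <= n)%N -> true -> (0 <= (2^-1 ^+ n * circ2 (r n) f)%:E)%E.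
  by move=> _ _; rewrite lee_fin; exact: wsum_ge0_term.
have e : norm2 w f = (\sum_(1 <= n <oo) (2^-1 ^+ n * circ2 (r n) f)%:E)%E.
  by apply: eq_eseriesr => n _; rewrite norm2_term.
rewrite e; split=> [h|[_ h]].
  split=> // m; rewrite -lee_fin; apply: le_trans h.
  by rewrite /wsum -sumEFin; exact: nneseries_lim_ge.
apply: lime_le; first exact: is_cvg_nneseries.
by apply: nearW => m; rewrite sumEFin lee_fin; exact: h.
Qed.

Lemma norm2_fin f : bergman w f -> exists2 N, norm2 w f = N%:E & 0 <= N.
Proof.
move=> /bergmanP[B HB]; have [af _] := HB; have h := (norm2_le B af).2 HB.
have h0 : (0 <= norm2 w f)%E.
  apply: nneseries_ge0 => n _ _; rewrite mule_ge0 ?lee_fin ?exprn_ge0 // norm2_term // lee_fin.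
  by have [_ _ r1 _] := radiiP hw; rewrite circ2_ge0' // r_ge0 r1.
exists (fine (norm2 w f)); last exact: fine_ge0.
by rewrite fineK // ge0_fin_numE // (le_lt_trans h) // ltry.
Qed.
End bergman_norm.

(** * The reproducing kernel *)

Section peak.
Context {R : realType}.
Variable r : nat -> R.
Hypothesis hr : radii r.

Lemma radii_mono m n : (m <= n)%N -> r m <= r n.
Proof.
case: hr => _ ri _ _; elim: n => [|n IH]; rewrite leq_eqVlt => /predU1P[-> //|] // /IH h.
exact: le_trans h (ltW (ri n)).
Qed.

Lemma radii_ge0 n : 0 <= r n.
Proof. by case: (hr) => r0 _ _ _; rewrite -r0 radii_mono. Qed.

Lemma radii_lt1 n : r n < 1. Proof. by case: hr. Qed.

Lemma radii01 n : 0 <= r n < 1. Proof. by rewrite radii_ge0 radii_lt1. Qed.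

Lemma radii_halve : exists2 p, (0 < p)%N & forall j i, 1 - r (j + i * p)%N <= (1 - r j) * 2^-1 ^+ i.
Proof.
case: hr => r0 ri r1 [p Hp]; exists p.
  case: p Hp => // /(_ 0%N); rewrite r0; lra.
move=> j; elim=> [|i IH]; first by rewrite mul0n addn0 expr0 mulr1.
rewrite mulSn addnCA addnC; apply: le_trans (Hp _) _.
rewrite exprS; move: IH; set x := (_ ^+ i); lra.
Qed.

Lemma radii_small e : 0 < e -> exists n, 1 - r n <= e.
Proof.
move=> e0; have [p _ Hp] := radii_halve.
have [N HN] := @geom_small R 1 (2^-1) e ltac:(lra) e0.
exists (N * p)%N; have := Hp 0%N N; have := HN N (leqnn _); case: hr => r0 _ _ _.
by rewrite r0 subr0 add0n => h1 h2; exact: le_trans h2 h1.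
Qed.


Lemma bernoulli (x : R) n : 0 <= x <= 1 -> 1 - n%:R * x <= (1 - x) ^+ n.
Proof.
move=> /andP[x0 x1]; elim: n => [|n IH]; first by rewrite mul0r subr0 expr0.
rewrite exprS; apply: le_trans (ler_wpM2l _ IH); last by lra.
have : 0 <= n%:R :> R by []; rewrite -natr1; nra.
Qed.

Lemma bernoulli_inv (x : R) n : 0 <= x <= 1 -> (1 - x) ^+ n <= (1 + n%:R * x)^-1.
Proof.
move=> /andP[x0 x1]; elim: n => [|n IH]; first by rewrite mul0r addr0 expr0 invr1.
have n0 : 0 <= n%:R :> R by [].
have p0 : 0 < 1 + n%:R * x by rewrite ltr_pwDl // mulr_ge0.
have p1 : 0 < 1 + n.+1%:R * x by rewrite ltr_pwDl // mulr_ge0.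
rewrite exprS; apply: le_trans (ler_wpM2l _ IH) _; first by lra.
rewrite -(ler_pM2r p1) mulVf ?gt_eqF // -(ler_pM2r p0) mul1r mulrAC divfK ?gt_eqF // -natr1.
nra.
Qed.

(** High powers of z localise to a ring; with truncated subtraction the last two factors are 2^-|k -
    j|. For j > k the weight 2^-j alone decays fast enough. For j < k the power r_j^(2 M) has to
    decay like 4^-(k - j), which [bernoulli_inv] and the halving of distances provide. *)
Lemma peak : exists (M : nat -> nat) (c C : R), [/\ 0 < c, 0 < C,
  forall k x, r k <= x -> c <= x ^+ (2 * M k) &
  forall k j, 2^-1 ^+ j * r j ^+ (2 * M k) <= C * (2^-1 ^+ k * 2^-1 ^+ (k - j) * 2^-1 ^+ (j - k))].
Proof.
have [p p0 Hp] := radii_halve.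
pose t k := 1 - r k; have t0 k : 0 < t k by rewrite subr_gt0 radii_lt1.
have t1 k : t k <= 1 by rewrite /t; have := radii_ge0 k; lra.
pose m k := Num.truncn (2 * t k)^-1.
have m0 k : 0 <= (2 * t k)^-1 by rewrite invr_ge0 mulr_ge0 // ltW.
have mt k : (m k)%:R * t k <= 2^-1.
  have := truncn_le (2 * t k)^-1; rewrite m0 => h.
  rewrite -(ler_pM2r (t0 k)) in h; apply: le_trans h _.
  by rewrite invfM -mulrA mulVf ?mulr1 // gt_eqF.
have mt' k j : t j / (2 * t k) <= 1 + (m k)%:R * t j.
  have := truncnS_gt (2 * t k)^-1; rewrite -/(m k) -natr1 => /ltW h.
  by rewrite -(ler_pM2r (t0 j)) in h; have := t1 j; have := t0 j; rewrite mulrC; move: h; lra.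
(* [m k] is the integer part of 1 / (2 t_k), so r_k^(m k) >= 1/2, whence the lower constant. The
   exponent 2 p turns the decay 2^-i over i blocks of p rings into 4^-(i p). In 2^(4 p), one factor
   2^(2 p) pays for the 2 in [b1], the other for rounding k - j down to a multiple of p. *)
exists (fun k => p * m k)%N, ((2^-1) ^+ (2 * p)), (2 ^+ (4 * p)); split.
- by rewrite exprn_gt0.
- by rewrite exprn_gt0.
- move=> k x kx; have x0 : 0 <= x by apply: le_trans kx; exact: radii_ge0.
  rewrite (_ : 2 * (p * m k) = m k * (2 * p))%N 1?[leRHS]exprM 1?lerXn2r ?nnegrE ?exprn_ge0 ?invr_ge0 //; last lia.
  apply: (@le_trans _ _ (r k ^+ m k)); last first.
    by rewrite lerXn2r ?nnegrE ?radii_ge0 // (le_trans (radii_ge0 k)).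
  have := @bernoulli (t k) (m k) ltac:(by rewrite ltW //= t1).
  by rewrite {2}/t subKr; have := mt k; lra.
- move=> k j; have [jk|kj] := leqP j k; last first.
    have -> : (k - j = 0)%N by apply/eqP; rewrite subn_eq0 ltnW.
    rewrite expr0 mulr1 -exprD subnKC ?(ltnW kj) // [leRHS]mulrC ler_pM2l ?exprn_gt0 //.
    apply: (@le_trans _ _ 1); first by rewrite exprn_ile1 ?radii_ge0 // ltW // radii_lt1.
    by rewrite exprn_ege1 // ler1n.
  rewrite (eqP (_ : (j - k == 0)%N)) ?subn_eq0 // expr0 mulr1.
  pose i := ((k - j) %/ p)%N; pose s := ((k - j) %% p)%N.
  have kE : k = (j + (i * p + s))%N by rewrite /i /s -divn_eq subnKC.
  have sp : (s < p)%N by rewrite ltn_mod.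
  have tk : t k <= t j * 2^-1 ^+ i.
    apply: le_trans (Hp j i); rewrite /t lerD2l lerN2 radii_mono // kE; lia.
  have b1 : r j ^+ m k <= 2 * 2^-1 ^+ i.
    have := @bernoulli_inv (t j) (m k) ltac:(by rewrite ltW //= t1).
    rewrite {1}/t subKr => h; apply: le_trans h _.
    have pp : 0 < t j / (2 * t k) by rewrite divr_gt0 // mulr_gt0.
    apply: (@le_trans _ _ (t j / (2 * t k))^-1).
      by rewrite lef_pV2 ?posrE // (lt_le_trans pp).
    rewrite invf_div ler_pdivrMr // -mulrA ler_pM2l //; by rewrite mulrC.
  have i0 : 0 < 2^-1 ^+ i :> R by rewrite exprn_gt0.
  have b2 : r j ^+ (2 * (p * m k)) <= (2 * 2^-1 ^+ i) ^+ (2 * p).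
    rewrite (_ : 2 * (p * m k) = m k * (2 * p))%N 1?exprM 1?lerXn2r ?nnegrE ?exprn_ge0 ?radii_ge0 ?mulr_ge0 ?(ltW i0) //; lia.
  apply: (@le_trans _ _ (2^-1 ^+ j * (2 * 2^-1 ^+ i) ^+ (2 * p))); first by rewrite ler_pM2l ?exprn_gt0.
  rewrite exprMn -exprM.
  have -> : k = (j + (k - j))%N by rewrite subnKC.
  rewrite addKn [in leRHS]exprD -mulrA [leRHS]mulrCA ler_pM2l ?exprn_gt0 //.
  have h2 n : 2^-1 ^+ n * 2 ^+ n = 1 :> R by rewrite -exprMn mulVf // expr1n.
  have -> : 2 ^+ (4 * p) = 2 ^+ (2 * p) * 2 ^+ (2 * p) :> R by rewrite -exprD; congr (_ ^+ _); lia.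
  rewrite -mulrA ler_pM2l ?exprn_gt0 // -exprD.
  have -> : (k - j + (k - j) = i * (2 * p) + 2 * s)%N by rewrite kE; lia.
  rewrite exprD mulrCA -[leLHS]mulr1 ler_pM2l ?exprn_gt0 //.
  have -> : (2 * p = 2 * s + (2 * p - 2 * s))%N by lia.
  rewrite exprD -mulrA [leRHS]mulrC -mulrA h2 mulr1.
  by rewrite exprn_ege1 // ler1n.
Qed.
End peak.

Section kernel_function.
Context {R : realType}.
Implicit Types (f g : R[i] -> R[i]) (z u c : R[i]).

Lemma pser_kernel c : cabs c <= 1 -> pser (fun u => (1 - c * u)^-1) (fun k => c ^+ k).
Proof.
move=> c1 r /andP[r0 r1]; exists ((1 - r)^-1), r.
have r2 : 0 < 1 - r by rewrite subr_gt0.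
split; [by rewrite invr_ge0 ltW|by rewrite r0|move=> z n zr].
have cz : cabs (c * z) <= r.
  by rewrite cabsM -[leRHS]mul1r ler_pM.
have nz : 1 - c * z != 0.
  rewrite -cabs_gt0; have := lerB_cabs 1 (c * z); rewrite cabs1; lra.
have -> : (1 - c * z)^-1 - \sum_(k < n) c ^+ k * z ^+ k = (c * z) ^+ n / (1 - c * z).
  apply: (mulIf nz); rewrite divfK // mulrBl mulVf //.
  under eq_bigr do rewrite -exprMn.
  by rewrite -[_ * (1 - _)]opprK -mulrN opprB mulrC -subrX1; ring.
rewrite cabs_div cabsX mulrC ler_pM ?invr_ge0 ?exprn_ge0 //.
  rewrite lef_pV2 ?posrE ?cabs_gt0 //; have := lerB_cabs 1 (c * z); rewrite cabs1; lra.
by rewrite lerXn2r ?nnegrE.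
Qed.

Lemma circ2_kernel c r : cabs c < 1 -> 0 <= r < 1 ->
  circ2 r (fun u => (1 - c * u)^-1) <= (1 - cabs c ^+ 2)^-1.
Proof.
move=> c1 r01; have /andP[r0 r1] := r01; have c0 := cabs_ge0 c.
have x01 : 0 <= cabs c ^+ 2 < 1 by rewrite exprn_ge0 //= expr_lt1.
apply: (circ2_le_sum (analytic_kernel (ltW c1)) (pser_kernel (ltW c1)) r01) => n.
apply: le_trans (geom_sum_le n x01); apply: ler_sum => k _.
rewrite cabsX -exprM mulnC exprM -[leRHS]mulr1 ler_wpM2l ?exprn_ge0 //.
by rewrite exprn_ile1 // ltW.
Qed.

Lemma circ2_monomial f r n : analytic f -> 0 <= r < 1 ->
  circ2 r (fun u => u ^+ n * f u) = r ^+ (2 * n) * circ2 r f.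
Proof.
move=> af r01; have /andP[r0 r1] := r01.
have cf := continuous_cabs2 (analytic_ccont af r01).
rewrite /circ2 mulrCA -(rintZ _ _ _ cf).
congr (_ * _); apply: eq_rint => t _.
by rewrite cabsM exprMn cabsX cabs_on_circle // -exprM mulnC.
Qed.

Lemma cvg_complex (u : nat -> R[i]) (l : R[i]) :
  (forall e : R, 0 < e -> exists N, forall n, (N <= n)%N -> cabs (l - u n) <= e) ->
  limn (u : nat -> R[i]^o) = l.
Proof.
move=> H; apply/cvg_lim; first exact: (@norm_hausdorff _ (R[i]^o : normedModType R[i])).
apply/cvgrPdist_le => e e0.
have e1 : 0 < Re e by move: e0; case: e => a b; rewrite ltcE /= => /andP[].
have [N HN] := H _ e1; exists N => // n /= /HN.
rewrite /cabs; case: e e0 {e1 HN} => a b; rewrite ltcE /= => /andP[/eqP-> a0].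
by move=> h; rewrite [leLHS](_ : _ = (Normc.normc (l - u n))%:C) // lecR.
Qed.
End kernel_function.

(** * Convergence of the inner product *)

Section inner_product.
Context {R : realType}.
Variable r : nat -> R.
Hypothesis hr : radii r.
Implicit Types (f g : R[i] -> R[i]) (z : R[i]).

Definition inner_sum f g m := \sum_(1 <= n < m)
  (2^-1 ^+ n)%:C * mean (fun t => f (on_circle (r n) t) * (g (on_circle (r n) t))^*).

(** Positivity of the mean of |f - d g|^2, tested with d a real multiple of the mean itself, so that
    only a real quadratic in [tau] remains. *)
Lemma mean_cauchy_schwarz f g (s : R) : analytic f -> analytic g -> 0 <= s < 1 ->
  cabs (mean (fun t => f (on_circle s t) * (g (on_circle s t))^*)) ^+ 2 <= circ2 s f * circ2 s g.
Proof.
move=> af ag s01; set m := mean _.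
have cf := analytic_ccont af s01; have cg := analytic_ccont ag s01.
have H d : 0 <= circ2 s f + cabs d ^+ 2 * circ2 s g - 2 * Re (d^* * m).
  have cd := ccontM (ccont_cst d) cg.
  have -> : circ2 s f + cabs d ^+ 2 * circ2 s g - 2 * Re (d^* * m) = circ2 s (fun z => f z - d * g z).
    suff : (circ2 s f + cabs d ^+ 2 * circ2 s g - 2 * Re (d^* * m))%:C =
      (circ2 s (fun z => f z - d * g z))%:C :> R[i] by case.
    rewrite circ2_mean; last exact: ccontB.
    transitivity (mean (fun t => f (on_circle s t) * (f (on_circle s t))^*) +
      (d * d^*) * mean (fun t => g (on_circle s t) * (g (on_circle s t))^*) -
      (d^* * m + (d^* * m)^*)).
      rewrite -!circ2_mean // mulJ; apply: eq_complex_ReIm; rewrite !ReImE /=; ring.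
    have -> : (d^* * m)^* = d * mean (fun t => g (on_circle s t) * (f (on_circle s t))^*).
      rewrite conjM conjK /m -meanJ; last by apply: ccontM => //; exact: ccontJ.
      by congr (_ * _); apply: eq_mean => t; rewrite conjM conjK mulrC.
    have cff := ccontM cf (ccontJ cf); have cgg := ccontM cg (ccontJ cg).
    have cfg := ccontM cf (ccontJ cg); have cgf := ccontM cg (ccontJ cf).
    rewrite /m -!meanZ //.
    have c1 := ccontM (ccont_cst (d * d^*)) cgg; have c2 := ccontM (ccont_cst d^*) cfg.
    have c3 := ccontM (ccont_cst d) cgf.
    rewrite -(meanD c2 c3) -(meanD cff c1) -(meanB (ccontD cff c1) (ccontD c2 c3)).
    by apply: eq_mean => t; apply: eq_complex_ReIm; rewrite !ReImE /=; ring.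
  by apply: circ2_ge0; exact: ccontB.
have A0 := circ2_ge0 cf; have B0 := circ2_ge0 cg.
have Hm (tau : R) : 0 <= circ2 s f + tau ^+ 2 * cabs m ^+ 2 * circ2 s g - 2 * tau * cabs m ^+ 2.
  have := H (tau%:C * m); rewrite cabsM cabsC exprMn real_normK ?num_real //.
  have -> : (tau%:C * m)^* * m = (tau * cabs m ^+ 2)%:C.
    by rewrite conjM conj_real -mulrA [m^* * m]mulrC mulJ -rmorphM.
  by rewrite (_ : Re (tau * cabs m ^+ 2)%:C = tau * cabs m ^+ 2) // (mulrA 2).
move: A0 B0 Hm; move: (circ2 s f) (circ2 s g) (cabs m ^+ 2) (sqr_ge0 (cabs m)) => A B x x0 A0 B0 Hm.
have [xe|xn] := eqVneq x 0; first by rewrite xe mulr_ge0.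
have xp : 0 < x by rewrite lt_neqAle eq_sym xn.
have [Be|Bn] := eqVneq B 0.
  have := Hm ((A + 1) / x); rewrite Be mulr0 addr0 -mulrA divfK //; lra.
have Bp : 0 < B by rewrite lt_neqAle eq_sym Bn.
have := Hm B^-1; rewrite -(ler_pM2r Bp) mul0r => h.
have : (A + B^-1 ^+ 2 * x * B - 2 * B^-1 * x) * B = A * B - x by field.
move=> e; rewrite e in h; lra.
Qed.

Lemma wsum_term_ge0 f n : analytic f -> 0 <= 2^-1 ^+ n * circ2 (r n) f.
Proof. by move=> af; rewrite mulr_ge0 ?exprn_ge0 ?circ2_ge0' // radii01. Qed.

Lemma wsum_ge0 f m : analytic f -> 0 <= wsum r f m.
Proof. by move=> af; apply: sumr_ge0 => n _; exact: wsum_term_ge0. Qed.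

Lemma wsum_mono f m n : analytic f -> (m <= n)%N -> wsum r f m <= wsum r f n.
Proof.
move=> af mn; case: m mn => [|m] mn; first by rewrite {1}/wsum big_geq // wsum_ge0.
rewrite /wsum [leRHS](big_cat_nat (n := m.+1)) //= lerDl sumr_ge0 // => i _.
exact: wsum_term_ge0.
Qed.

Lemma inner_sum_cs f g m : analytic f -> analytic g ->
  cabs (inner_sum f g m) ^+ 2 <= wsum r f m * wsum r g m.
Proof.
move=> af ag; pose x n := Num.sqrt (2^-1 ^+ n * circ2 (r n) f).
pose y n := Num.sqrt (2^-1 ^+ n * circ2 (r n) g).
have -> : wsum r f m = \sum_(n <- index_iota 1 m) x n ^+ 2.
  by apply: eq_bigr => n _; rewrite sqr_sqrtr // wsum_term_ge0.
have -> : wsum r g m = \sum_(n <- index_iota 1 m) y n ^+ 2.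
  by apply: eq_bigr => n _; rewrite sqr_sqrtr // wsum_term_ge0.
apply: le_trans (cauchy_schwarz_sum _ _ _).
rewrite lerXn2r ?nnegrE ?cabs_ge0 //; first by apply: sumr_ge0 => n _; rewrite mulr_ge0 ?sqrtr_ge0.
apply: le_trans (cabs_sum _ _ _) _; apply: ler_sum => n _.
apply: ler_sqr2; first by rewrite mulr_ge0 ?sqrtr_ge0.
rewrite cabsM exprMn cabsC real_normK ?num_real // [leRHS]exprMn.
rewrite [x n ^+ 2]sqr_sqrtr ?wsum_term_ge0 // [y n ^+ 2]sqr_sqrtr ?wsum_term_ge0 //.
have p0 : 0 <= 2^-1 ^+ n :> R by rewrite exprn_ge0.
have := mean_cauchy_schwarz af ag (radii01 hr n).
move: (cabs _ ^+ 2) (circ2 _ f) (circ2 _ g) p0 => a b c; move: (2^-1 ^+ n) => p p0 h.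
by rewrite expr2 mulrACA ler_wpM2l // mulr_ge0.
Qed.

Lemma abs_series_cvg (a : nat -> R) (B : R) : (forall m, \sum_(0 <= n < m) `|a n| <= B) ->
  exists l, forall e, 0 < e -> exists N, forall m, (N <= m)%N -> `|l - \sum_(0 <= n < m) a n| <= e.
Proof.
move=> HB; have c : cvgn [normed series a].
  apply: nondecreasing_is_cvgn.
    apply/nondecreasing_seqP => n.
    have : \sum_(0 <= k < n) `|a k| <= \sum_(0 <= k < n.+1) `|a k| by rewrite big_nat_recr //= lerDl.
    by [].
  by exists B => _ [m _ <-]; exact: HB.
have /cvg_ex[/= l Hl] := normed_cvg c.
exists l => e e0; move/cvgrPdist_le: Hl => /(_ e e0)[N _ HN].
by exists N => m Nm; exact: (HN m Nm).
Qed.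

Lemma inner_sum_cvg f g A B : wbound r f A -> wbound r g B ->
  exists l, forall e, 0 < e -> exists N, forall m, (N <= m)%N -> cabs (l - inner_sum f g m) <= e.
Proof.
move=> [af HA] [ag HB].
pose a n : R[i] := if (n == 0)%N then 0 else
  (2^-1 ^+ n)%:C * mean (fun t => f (on_circle (r n) t) * (g (on_circle (r n) t))^*).
have aE m : inner_sum f g m = \sum_(0 <= n < m) a n.
  case: m => [|m]; first by rewrite /inner_sum !big_geq.
  rewrite [RHS]big_ltn // add0r /inner_sum.
  by apply: eq_big_nat => i /andP[i0 _]; rewrite /a gtn_eqF.
have ab m : \sum_(0 <= n < m) cabs (a n) <= A + B.
  apply: (@le_trans _ _ (wsum r f m + wsum r g m)); last by rewrite lerD.
  case: m => [|m]; first by rewrite /wsum !big_geq // addr0.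
  rewrite big_ltn // {1}/a eqxx cabs0 add0r -big_split /= !big_nat; apply: ler_sum => n /andP[n0 _].
  rewrite /a gtn_eqF // cabsM cabsC ger0_norm ?exprn_ge0 // -mulrDr ler_pM2l ?exprn_gt0 //.
  have := mean_cauchy_schwarz af ag (radii01 hr n).
  have := circ2_ge0' af (radii01 hr n); have := circ2_ge0' ag (radii01 hr n).
  have := cabs_ge0 (mean (fun t => f (on_circle (r n) t) * (g (on_circle (r n) t))^*)).
  move: (cabs _) (circ2 _ f) (circ2 _ g) => x p q x0 q0 p0 h.
  by apply: ler_sqr2; [exact: addr_ge0|nra].
have ab2 (F : R[i] -> R) : (forall z, `|F z| <= cabs z) -> forall m, \sum_(0 <= n < m) `|F (a n)| <= A + B.
  by move=> HF m; apply: le_trans (ab m); apply: ler_sum => n _; exact: HF.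
have [l1 H1] := abs_series_cvg (ab2 _ (@Re_le R)).
have [l2 H2] := abs_series_cvg (ab2 _ (@Im_le R)).
exists (l1 +i* l2) => e e0; have e2 : 0 < e / 2 by rewrite divr_gt0.
have [N1 {}H1] := H1 _ e2; have [N2 {}H2] := H2 _ e2.
exists (maxn N1 N2) => m; rewrite geq_max => /andP[/H1 h1 /H2 h2].
apply: le_trans (cabs_le_ReIm _) _; rewrite aE !ReImE Re_sum /=.
rewrite (_ : Im (\sum_(0 <= n < m) a n) = \sum_(0 <= n < m) Im (a n)); first by lra.
by elim/big_rec2: _ => // i x y _ <-; rewrite ImD.
Qed.
End inner_product.

Section kernel.
Context {R : realType}.
Implicit Types (f g : R[i] -> R[i]) (z : R[i]).

Section moments.
Variable r : nat -> R.
Hypothesis hr : radii r.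

(** Partial sums of the squared norm of z^k. The monomials are orthogonal, so the kernel is
    determined by the limits of these moments. *)
Definition moment m k := \sum_(1 <= n < m) 2^-1 ^+ n * r n ^+ (2 * k) : R.

Let term0 n k : 0 <= 2^-1 ^+ n * r n ^+ (2 * k).
Proof. by rewrite mulr_ge0 ?exprn_ge0 // radii_ge0. Qed.

Let termle n k : 2^-1 ^+ n * r n ^+ (2 * k) <= 2^-1 ^+ n.
Proof.
rewrite -[leRHS]mulr1 ler_pM2l ?exprn_gt0 // exprn_ile1 ?radii_ge0 //.
exact/ltW/radii_lt1.
Qed.

Let momentS m k : moment m.+2 k = moment m.+1 k + 2^-1 ^+ m.+1 * r m.+1 ^+ (2 * k).
Proof. by rewrite /moment big_nat_recr. Qed.

Lemma moment_mono m n k : (m <= n)%N -> moment m k <= moment n k.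
Proof.
have S i : moment i k <= moment i.+1 k.
  case: i => [|i]; first by rewrite /moment !big_geq.
  by rewrite momentS lerDl.
by elim: n => [|n IH]; rewrite leq_eqVlt => /predU1P[-> //|] // /IH h; exact: le_trans h (S n).
Qed.

Lemma moment_tail m n k : moment n k <= moment m.+1 k + 2^-1 ^+ m.
Proof.
have p n' : 0 < 2^-1 ^+ n' :> R by rewrite exprn_gt0.
have [nm|mn] := leqP n m.+1.
  by rewrite (le_trans (moment_mono k nm)) // lerDl ltW.
suff H d : moment (m + d).+1 k <= moment m.+1 k + 2^-1 ^+ m - 2^-1 ^+ (m + d).
  have -> : n = (m + (n - m.+1)).+1 by lia.
  by have := H (n - m.+1)%N; have := p (m + (n - m.+1))%N; lra.
elim: d => [|d IH]; first by rewrite addn0 addrK.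
rewrite addnS momentS; have := termle (m + d).+1 k; move: IH.
rewrite (exprS _ (m + d)); have := p (m + d)%N; lra.
Qed.

Lemma limit_moments : exists om : nat -> R,
  forall k m, moment m.+1 k <= om k <= moment m.+1 k + 2^-1 ^+ m.
Proof.
exists (fun k => sup (range (moment^~ k))) => k m.
have ub : has_ubound (range (moment^~ k)).
  by exists (moment 1 k + 2^-1 ^+ 0) => _ [n _ <-]; exact: moment_tail.
apply/andP; split; first by apply: ub_le_sup => //; exists m.+1.
apply: ge_sup; first by exists (moment 0 k); exists 0%N.
by move=> _ [n _ <-]; exact: moment_tail.
Qed.

Lemma wsum_le_coef f (a : nat -> R[i]) m (B : R) : analytic f -> pser f a ->
  (forall K, \sum_(k < K) cabs (a k) ^+ 2 * moment m k <= B) -> wsum r f m <= B.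
Proof.
move=> af pa HB.
have c0 k : 0 <= cabs (a k) ^+ 2 by rewrite sqr_ge0.
have H j : forall e, 0 < e -> exists K, wsum r f j <= \sum_(k < K) cabs (a k) ^+ 2 * moment j k + e.
  elim: j => [|j IH] e e0.
    exists 0%N; rewrite /wsum big_geq // big_ord0 add0r ltW //.
  case: j IH => [|j] IH; first by exists 0%N; rewrite /wsum big_geq // big_ord0 add0r ltW.
  have e2 : 0 < e / 2 by rewrite divr_gt0.
  have [K1 H1] := IH _ e2.
  have [C [q [q01 H2]]] := circ2_partial af pa (radii01 hr j.+1).
  have [K2 H3] := geom_small C q01 e2.
  exists (maxn K1 K2); rewrite /wsum big_nat_recr //= -/(wsum r f j.+1).
  have mono (F : nat -> R) i K : (forall k, 0 <= F k) -> (i <= K)%N ->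
      \sum_(k < i) F k <= \sum_(k < K) F k.
    move=> F0 iK; rewrite -(subnKC iK) big_split_ord /= lerDl.
    by apply: sumr_ge0 => k _; exact: F0.
  have h1 : wsum r f j.+1 <= \sum_(k < maxn K1 K2) cabs (a k) ^+ 2 * moment j.+1 k + e / 2.
    apply: le_trans H1 _; rewrite lerD2r.
    apply: (mono (fun k => cabs (a k) ^+ 2 * moment j.+1 k)); last exact: leq_maxl.
    by move=> k; rewrite mulr_ge0 //; apply: sumr_ge0 => n _.
  have h2 := le_trans (H2 _) (H3 _ (leq_maxr K1 K2)).
  have h3 : circ2 (r j.+1) f <= \sum_(k < maxn K1 K2) cabs (a k) ^+ 2 * r j.+1 ^+ (2 * k) + e / 2.
    by move: h2; rewrite ler_norml => /andP[_]; lra.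
  have -> : \sum_(k < maxn K1 K2) cabs (a k) ^+ 2 * moment j.+2 k =
    \sum_(k < maxn K1 K2) cabs (a k) ^+ 2 * moment j.+1 k +
    2^-1 ^+ j.+1 * \sum_(k < maxn K1 K2) cabs (a k) ^+ 2 * r j.+1 ^+ (2 * k).
    rewrite mulr_sumr -big_split /=; apply: eq_bigr => k _; rewrite momentS; ring.
  have p0 : 0 < 2^-1 ^+ j.+1 :> R by rewrite exprn_gt0.
  have p1 : 2^-1 ^+ j.+1 <= 1 :> R by rewrite exprn_ile1 //; lra.
  move: h1 h3 p0 p1; move: (2^-1 ^+ _) (circ2 _ _) (wsum _ _ _) (\sum_(_ < _) _) (\sum_(_ < _) _).
  move=> x A B' S1 S2 h1 h3 x0 x1.
  have : x * A <= x * (S1 + e / 2) by rewrite ler_pM2l.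
  have : x * (e / 2) <= e / 2 by rewrite ler_piMl // ltW.
  by rewrite mulrDr; lra.
apply/ler_addgt0Pr => e e0; have [K HK] := H m e e0.
by apply: le_trans HK _; rewrite lerD2r.
Qed.

(* Tannery's argument: the k-th terms of the two series agree up to the factor moment m k / om k, which tends to 1. *)
Lemma kernel_exists z : cabs z < 1 -> exists k B, wbound r k B /\
  forall f, analytic f -> forall e, 0 < e -> exists N, forall m, (N <= m)%N ->
    cabs (f z - inner_sum r f k m) <= e.
Proof.
move=> z1; have [om Hom] := limit_moments; have z0 := cabs_ge0 z.
have om_ge n k : 2^-1 ^+ n.+1 * r n.+1 ^+ (2 * k) <= om k.
  have /andP[h _] := Hom k n.+1; apply: le_trans h; rewrite momentS lerDr.
  by apply: sumr_ge0 => i _.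
have rp n : 0 < r n.+1.
  have [r0 ri _ _] := hr; by apply: le_lt_trans (radii_ge0 hr n) (ri n).
have om0 k : 0 < om k.
  apply: lt_le_trans (om_ge 0%N k); by rewrite mulr_gt0 ?exprn_gt0 // rp.
(* Reproducing the monomials, whose squared norms are [om k], forces these coefficients. *)
pose b k := (z^* ^+ k) * (om k)^-1%:C.
have bE k : cabs (b k) = cabs z ^+ k / om k.
  by rewrite cabsM cabsX cabsJ cabsC ger0_norm // invr_ge0 ltW.
have pick x : 0 <= x < 1 -> exists n, x < r n.+1 ^+ 2.
  move=> /andP[x0 x1]; have [n Hn] := @radii_small _ _ hr ((1 - x) / 2) ltac:(lra).
  exists n; have [_ ri _ _] := hr; have := ri n; have := radii_lt1 hr n.+1; move: Hn.
  set y := r n.+1; set y' := r n; nra.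
have bb : forall s, 0 <= s < 1 -> exists C : R, forall k, cabs (b k) * s ^+ k <= C.
  move=> s /andP[s0 s1].
  have [|n Hn] := pick (cabs z * s); first by rewrite mulr_ge0 //=; nra.
  exists (2 ^+ n.+1) => k; rewrite bE mulrAC -exprMn ler_pdivrMr //.
  apply: (@le_trans _ _ (r n.+1 ^+ (2 * k))).
    by rewrite exprM lerXn2r ?nnegrE ?mulr_ge0 ?sqr_ge0 // ltW.
  have := om_ge n k; rewrite -[X in X <= _ -> _]mulrC => h.
  have p0 : 0 < 2 ^+ n.+1 :> R by rewrite exprn_gt0.
  rewrite -(ler_pM2l p0) in h; apply: le_trans h.
  by rewrite mulrCA -exprMn divff // expr1n mulr1.
have [k ak pk] := coef_bounded_pser bb.
have [|n Hn] := pick (cabs z ^+ 2); first by rewrite exprn_ge0 //= expr_lt1.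
pose x := cabs z ^+ 2 / r n.+1 ^+ 2.
have r2 : 0 < r n.+1 ^+ 2 by rewrite exprn_gt0 // rp.
have x01 : 0 <= x < 1 by rewrite /x ltr_pdivrMr // mul1r Hn divr_ge0 ?sqr_ge0 ?(ltW r2).
exists k, (2 ^+ n.+1 * (1 - x)^-1); split.
  split=> // m; apply: wsum_le_coef ak pk _ => K.
  apply: (@le_trans _ _ (\sum_(j < K) 2 ^+ n.+1 * x ^+ j)); last first.
    by rewrite -mulr_sumr ler_pM2l ?exprn_gt0 // geom_sum_le.
  apply: ler_sum => j _; rewrite bE.
  have mo : moment m j <= om j.
    case: m => [|m]; first by rewrite /moment big_geq // ltW.
    by have /andP[] := Hom j m.
  apply: (@le_trans _ _ ((cabs z ^+ j / om j) ^+ 2 * om j)).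
    by rewrite ler_wpM2l ?sqr_ge0.
  have -> : (cabs z ^+ j / om j) ^+ 2 * om j = cabs z ^+ (2 * j) / om j.
    by rewrite mulnC exprM; field; rewrite gt_eqF.
  rewrite ler_pdivrMr // /x expr_div_n -!exprM.
  rewrite -mulrA [X in _ <= _ * X]mulrAC -mulrA.
  have rj : 0 < r n.+1 ^+ (2 * j) by rewrite exprn_gt0 // rp.
  have h : 1 <= 2 ^+ n.+1 * (om j / r n.+1 ^+ (2 * j)).
    rewrite mulrA ler_pdivlMr // mul1r -ler_pdivrMl ?exprn_gt0 // -exprVn; exact: om_ge.
  have -> : 2 ^+ n.+1 * (cabs z ^+ (2 * j) * (om j / r n.+1 ^+ (2 * j))) =
    cabs z ^+ (2 * j) * (2 ^+ n.+1 * (om j / r n.+1 ^+ (2 * j))) by rewrite mulrCA.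
  by rewrite ler_peMr // exprn_ge0.
move=> f af e e0; have [a pa] := analytic_pser af.
have [C [q [C0 q01 Hf]]] := pa (cabs z) ltac:(by rewrite z0).
have /andP[q0 q1] := q01; have q2 : 0 < 1 - q by rewrite subr_gt0.
have az j : cabs (a j * z ^+ j) <= 2 * C * q ^+ j.
  have h1 := Hf z j (lexx _); have h2 := Hf z j.+1 (lexx _).
  rewrite big_ord_recr /= in h2; move: h1 h2; set S := \sum_(_ < _) _ => h1 h2.
  have -> : a j * z ^+ j = (f z - S) - (f z - (S + a j * z ^+ j)) by ring.
  apply: le_trans (cabsB _ _) _.
  have : C * q ^+ j.+1 <= C * q ^+ j by rewrite ler_wpM2l // exprS ler_piMl ?exprn_ge0 // ltW.
  by rewrite -[2 * C * _]mulrA; move: h1 h2; move: (C * q ^+ j.+1) (C * q ^+ j) => y y'; lra.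
have e4 : 0 < e / 4 by rewrite divr_gt0.
have [K HK] := geom_small (2 * C / (1 - q)) q01 e4.
pose th m j := moment m j / om j.
have th0 m j : 0 <= th m j by rewrite divr_ge0 ?(ltW (om0 _)) //; apply: sumr_ge0 => i _.
have th1 m j : th m j <= 1.
  rewrite ler_pdivrMr // mul1r; case: m => [|m]; first by rewrite /moment big_geq // ltW.
  by have /andP[] := Hom j m.
(* The Taylor polynomial of f at z with its j-th term damped by [th m j]. As M grows it tends to the
   m-th partial inner product; as m grows the damping disappears. The tail beyond K is controlled
   uniformly in m, the head by the rate 2^-m of the moments. *)
pose T M m := \sum_(j < M) a j * z ^+ j * (th m j)%:C.
have Ttail M m : (K <= M)%N -> cabs (T M m - T K m) <= e / 4.
  move=> KM; apply: le_trans (HK K (leqnn _)).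
  have -> : T M m = T K m + \sum_(i < M - K) a (K + i)%N * z ^+ (K + i) * (th m (K + i)%N)%:C.
    have -> : T M m = T (K + (M - K))%N m by rewrite subnKC.
    by rewrite /T big_split_ord.
  rewrite [T K m + _]addrC addrK.
  apply: le_trans (cabs_sum _ _ _) _.
  apply: (@le_trans _ _ (\sum_(i < M - K) 2 * C * q ^+ K * q ^+ i)).
    apply: ler_sum => i _; rewrite cabsM cabsC ger0_norm //.
    apply: le_trans (ler_piMr (cabs_ge0 _) (th1 _ _)) _.
    by apply: le_trans (az _) _; rewrite exprD mulrA.
  rewrite -mulr_sumr [leRHS]mulrAC ler_wpM2l ?geom_sum_le //.
  by rewrite !mulr_ge0 ?exprn_ge0.
have Tinner m : forall d, 0 < d -> exists2 M, (K <= M)%N & cabs (inner_sum r f k m - T M m) <= d.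
  move=> d d0.
  suff [M0 H] : exists M0, forall M, (M0 <= M)%N -> cabs (inner_sum r f k m - T M m) <= d.
    by exists (maxn K M0); [exact: leq_maxl|apply: H; exact: leq_maxr].
  elim: m d d0 => [|m IH] d d0.
    exists 0%N => M _; rewrite /inner_sum big_geq // /T big1 ?subrr ?cabs0 ?ltW // => i _.
    by rewrite /th /moment big_geq // mul0r mulr0.
  case: m IH => [|m] IH.
    exists 0%N => M _; rewrite /inner_sum big_geq // /T big1 ?subrr ?cabs0 ?ltW // => i _.
    by rewrite /th /moment big_geq // mul0r mulr0.
  have d2 : 0 < d / 2 by rewrite divr_gt0.
  have [M1 H1] := IH _ d2.
  have [D [q' [q01' H2]]] := parseval af ak pa pk (radii01 hr m.+1).
  have [M2 H3] := geom_small D q01' d2.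
  exists (maxn M1 M2) => M; rewrite geq_max => /andP[h1 h2].
  have {H1}h1 := H1 _ h1; have {H3}h2 := le_trans (H2 M) (H3 M h2).
  rewrite /inner_sum big_nat_recr //= -/(inner_sum r f k m.+1).
  move: h2; set me := mean _; set S := \sum_(_ < _) _ => h2.
  have -> : T M m.+2 = T M m.+1 + (2^-1 ^+ m.+1)%:C * S.
    rewrite /T /S mulr_sumr -big_split /=; apply: eq_bigr => j _.
    rewrite /th momentS mulrDl rmorphD mulrDr; congr (_ + _).
    rewrite /b conjM conjX conjK conj_real !rmorphM /=; ring.
  have -> : inner_sum r f k m.+1 + (2^-1 ^+ m.+1)%:C * me - (T M m.+1 + (2^-1 ^+ m.+1)%:C * S) =
    (inner_sum r f k m.+1 - T M m.+1) + (2^-1 ^+ m.+1)%:C * (me - S) by ring.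
  apply: le_trans (cabsD _ _) _; rewrite cabsM cabsC ger0_norm ?exprn_ge0 //.
  have p1 : 2^-1 ^+ m.+1 <= 1 :> R by rewrite exprn_ile1 //; lra.
  have := ler_piMl (cabs_ge0 (me - S)) p1; lra.
have [N HN] := @geom_small R (\sum_(j < K) 2 * C / om j) (2^-1) (e / 4) ltac:(lra) e4.
exists N.+1 => m; case: m => // m; rewrite ltnS => /HN hN.
have h1 : cabs (f z - \sum_(j < K) a j * z ^+ j) <= e / 4.
  apply: le_trans (Hf z K (lexx _)) _; apply: le_trans (HK K (leqnn _)).
  rewrite ler_wpM2r ?exprn_ge0 // ler_pdivlMr //; nra.
have h2 : cabs (\sum_(j < K) a j * z ^+ j - T K m.+1) <= e / 4.
  apply: le_trans hN; rewrite /T -sumrB mulr_suml; apply: le_trans (cabs_sum _ _ _) _.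
  apply: ler_sum => j _.
  have -> : a j * z ^+ j - a j * z ^+ j * (th m.+1 j)%:C = a j * z ^+ j * (1 - th m.+1 j)%:C.
    by rewrite rmorphB rmorph1; ring.
  rewrite cabsM cabsC ger0_norm ?subr_ge0 // -mulrA ler_pM ?subr_ge0 //.
    apply: le_trans (az j) _; rewrite ler_piMr ?mulr_ge0 //.
    by rewrite exprn_ile1 // ltW.
  have /andP[_ h] := Hom j m; rewrite mulrC ler_pdivlMr // mulrBl mul1r /th divfK ?gt_eqF //.
  by lra.
have [M KM h3] := Tinner m.+1 _ e4; have h4 := Ttail M m.+1 KM.
have -> : f z - inner_sum r f k m.+1 = (f z - \sum_(j < K) a j * z ^+ j) +
  (\sum_(j < K) a j * z ^+ j - T K m.+1) - (T M m.+1 - T K m.+1) -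
  (inner_sum r f k m.+1 - T M m.+1).
  by move: (inner_sum _ _ _ _) (T _ _) (T K _) (\sum_(_ < _) _) => u v v' x'; ring.
apply: le_trans (cabsB _ _) _; have := cabsB (f z - \sum_(j < K) a j * z ^+ j +
  (\sum_(j < K) a j * z ^+ j - T K m.+1)) (T M m.+1 - T K m.+1).
have := cabsD (f z - \sum_(j < K) a j * z ^+ j) (\sum_(j < K) a j * z ^+ j - T K m.+1).
lra.
Qed.
End moments.
End kernel.

(** * The size of the kernel on the diagonal *)

Section kernel_diag.
Context {R : realType}.

Lemma one_subJ (z : R[i]) : 1 - z^* * z = (1 - cabs z ^+ 2)%:C.
Proof. by rewrite mulrC mulJ rmorphB rmorph1. Qed.

Lemma sum_half_le (m : nat) : \sum_(0 <= j < m) 2^-1 ^+ j <= (2 : R).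
Proof.
have := @geom_sum_le R (2^-1) m ltac:(lra); rewrite big_mkord => h; apply: le_trans h _.
by rewrite (_ : 1 - 2^-1 = 2^-1) ?invrK //; field.
Qed.

(** Truncated subtraction makes each term 2^-|n - j|. The induction carries the closed forms of the
    partial sums below and above n. *)
Lemma sum_half_dist (n m : nat) : \sum_(1 <= j < m) 2^-1 ^+ (n - j) * 2^-1 ^+ (j - n) <= (3 : R).
Proof.
have p k : 0 < 2^-1 ^+ k :> R by rewrite exprn_gt0.
suff H : forall m', \sum_(1 <= j < m'.+1) 2^-1 ^+ (n - j) * 2^-1 ^+ (j - n) <=
   (if (m' <= n)%N then 2 * 2^-1 ^+ (n - m') else 3 - 2^-1 ^+ (m' - n)) :> R.
  case: m => [|m]; first by rewrite big_geq.
  apply: le_trans (H m) _; case: ifP => _; last by rewrite gerBl ltW.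
  have : 2^-1 ^+ (n - m) <= 1 :> R by rewrite exprn_ile1 //; lra.
  lra.
elim=> [|m' IH]; first by rewrite big_geq //= subn0 mulr_ge0 // ltW.
rewrite big_nat_recr //=; apply: le_trans (lerD IH (lexx _)) _.
have [h|h] := leqP m'.+1 n.
  have h' := ltnW h; rewrite h' (_ : n - m' = (n - m'.+1).+1)%N; last by lia.
  by rewrite (_ : m'.+1 - n = 0)%N ?expr0 ?exprS; [have := p (n - m'.+1)%N; lra|lia].
rewrite (_ : n - m'.+1 = 0)%N; last by lia.
rewrite expr0 mul1r (_ : m'.+1 - n = (m' - n).+1)%N; last by lia.
rewrite exprS; case: ifP => h2; last by lra.
by rewrite (eqP (h2 : m' - n == 0)%N) (eqP (h : n - m' == 0)%N) expr0; lra.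
Qed.

Variable w : R -> R.
Hypothesis hw : admissible w.
Implicit Types (f g : R[i] -> R[i]) (z : R[i]).
Local Notation r := (radius w).
Let hr := radiiP hw.

Lemma circle_meanE s f : ccont (fun t => f (on_circle s t)) ->
  circle_mean s f = mean (fun t => f (on_circle s t)).
Proof.
move=> [c1 c2]; apply: eq_complex_ReIm; rewrite /mean !ReImE Re_itg Im_itg /= mul0r ?subr0 ?addr0;
  rewrite -rintZ //; apply: eq_rint => t _; rewrite mulrC //.
Qed.

Lemma inner_wE f g l : analytic f -> analytic g ->
  (forall e, 0 < e -> exists N, forall m, (N <= m)%N -> cabs (l - inner_sum r f g m) <= e) ->
  inner_w w f g = l.
Proof.
move=> af ag H; rewrite /inner_w.
rewrite (_ : (fun N => _) = inner_sum r f g); first exact: cvg_complex.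
apply/funext => m; apply: eq_bigr => n _; rewrite circle_meanE; last first.
  by apply: ccontM; [|apply: ccontJ]; apply: analytic_ccont => //; exact: radii01.
by congr (_ * _); rewrite rmorphXn /= fmorphV rmorphMn.
Qed.

(** [kernel_exists] rules out the default value 0 of [xget]. *)
Lemma rkernelP z : cabs z < 1 -> reproducing_at w z (rkernel w z).
Proof.
move=> z1; rewrite /rkernel; case: xgetP => [k _ //|H]; exfalso.
have [k [B [[ak HB] Hk]]] := kernel_exists hr z1.
apply: (H k); split; first by apply/bergmanP => //; exists B.
move=> f /(bergmanP hw)[B' [af _]]; apply/esym/inner_wE => // e e0; exact: Hk.
Qed.

(** These properties suffice for the two-sided estimate that follows, which is all that the later
    arguments use of the kernel. *)
Lemma kernel_diag_spec z : cabs z < 1 -> exists k, [/\ wbound r k (kernel_diag w z),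
  cabs (k z) = kernel_diag w z & forall f B, wbound r f B ->
    cabs (f z) ^+ 2 <= B * kernel_diag w z].
Proof.
move=> z1; have [bk Hk] := rkernelP z1; set k := rkernel w z in bk Hk *.
have [B HB] := (bergmanP hw _).1 bk; have [ak _] := HB.
have self m : inner_sum r k k m = (wsum r k m)%:C.
  rewrite /wsum rmorph_sum /=; apply: eq_bigr => n _.
  by rewrite rmorphM /= circ2_mean //; apply: analytic_ccont => //; exact: radii01.
have lim f A : wbound r f A ->
    forall e, 0 < e -> exists N, forall m, (N <= m)%N -> cabs (f z - inner_sum r f k m) <= e.
  move=> HA; have [af _] := HA; have [l Hl] := inner_sum_cvg hr HA HB.
  rewrite Hk ?(inner_wE af ak Hl) //; by apply/bergmanP => //; exists A.
have kE : kernel_diag w z = Re (k z) by [].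
have Hw : wbound r k (kernel_diag w z).
  split=> // m; apply/ler_addgt0Pr => e e0.
  have [N HN] := lim _ _ HB e e0.
  have := HN _ (leq_maxl N m); rewrite self => h.
  have := le_trans (Re_le _) h; rewrite !ReImE /= -kE ler_norml => /andP[h1 h2].
  have := wsum_mono hr ak (leq_maxr N m); lra.
have kd0 : 0 <= kernel_diag w z.
  by have := Hw.2 0%N; rewrite /wsum big_geq.
have Im0 : Im (k z) = 0.
  apply/eqP; rewrite -normr_le0; apply/ler_addgt0Pl => e e0.
  have [N HN] := lim _ _ HB e e0.
  have := HN N (leqnn _); rewrite self => h.
  by have := le_trans (Im_le _) h; rewrite !ReImE /= oppr0 !addr0.
exists k; split=> //.
  by rewrite cabsE Im0 -kE expr0n addr0 sqrtr_sqr ger0_norm.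
move=> f A HA; have [af HA2] := HA.
have A0 : 0 <= A by have := HA2 0%N; rewrite /wsum big_geq.
have AB0 : 0 <= A * kernel_diag w z by rewrite mulr_ge0.
rewrite -(sqr_sqrtr AB0) lerXn2r ?nnegrE ?sqrtr_ge0 ?cabs_ge0 //.
apply/ler_addgt0Pr => e e0; have [N HN] := lim _ _ HA e e0.
have h := HN N (leqnn _).
have := lerB_cabs (f z) (inner_sum r f k N).
have h2 : cabs (inner_sum r f k N) <= Num.sqrt (A * kernel_diag w z).
  apply: ler_sqr2; first exact: sqrtr_ge0.
  rewrite sqr_sqrtr //; apply: le_trans (inner_sum_cs hr _ af ak) _.
  by rewrite ler_pM ?wsum_ge0 //; exact: Hw.2.
lra.
Qed.

(** The upper bound is the point estimate applied to the kernel itself on a larger circle: its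
    squared value at z is at most a multiple of its squared norm, which is at most the value at z.
    The lower bound tests point evaluation on u^(M n) / (1 - conj z u), with the exponents of
    [peak]. *)
Lemma kernel_diag_bounds : exists c C : R, [/\ 0 < c, 0 < C & forall n z, r n <= cabs z < r n.+1 ->
  c * 2 ^+ n <= kernel_diag w z * (1 - cabs z) <= C * 2 ^+ n].
Proof.
have [M [c [C [c0 C0 Hc HC]]]] := peak hr; have [p p0 Hp] := radii_halve hr.
exists (c / (6 * C)), (2 ^+ p.+2); split; [by rewrite divr_gt0 // mulr_gt0|by rewrite exprn_gt0|].
move=> n z /andP[h1 h2]; have z1 := lt_trans h2 (radii_lt1 hr n.+1).
have z0 := cabs_ge0 z.
have [k [Hk kz Hf]] := kernel_diag_spec z1.
set kd := kernel_diag w z in Hk kz Hf *.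
have kd0 : 0 <= kd by rewrite -kz.
apply/andP; split; last first.
  (* One block of p rings beyond z halves the distance to the unit circle, so z is well inside |u| =
     r_N while 2^N exceeds 2^n by a constant factor only. *)
  pose N := (n.+1 + 1 * p)%N.
  have tN : 1 - r N <= (1 - cabs z) / 2 by have := Hp n.+1 1%N; rewrite expr1 -/N; lra.
  have rN := radii_lt1 hr N; have zN : cabs z < r N by lra.
  have rN0 : 0 < r N by apply: le_lt_trans zN.
  have := circ2_point Hk.1 (_ : 0 < r N < 1) zN; rewrite rN0 => /(_ rN); rewrite kz => h.
  have h3 : circ2 (r N) k <= 2 ^+ N * kd.
    have := Hk.2 N.+1; rewrite /wsum (_ : N = N.-1.+1) // big_nat_recr //= -/(wsum r k _).
    have := wsum_ge0 hr N.-1.+1 Hk.1; rewrite /N -/kd => a1 a2.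
    have p1 : 0 < 2 ^+ (n + 1 * p).+1 :> R by rewrite exprn_gt0.
    rewrite -ler_pdivrMl // -exprVn; lra.
  have h4 : (1 - cabs z) / 2 <= 1 - (cabs z / r N) ^+ 2.
    have e1 : cabs z / r N <= 1 by rewrite ler_pdivrMr // mul1r ltW.
    have e2 : cabs z / r N <= 1 - (1 - cabs z) / 2.
      rewrite ler_pdivrMr //; nra.
    have e3 : 0 <= cabs z / r N by rewrite divr_ge0 // ltW.
    by nra.
  have h5 : kd ^+ 2 * ((1 - cabs z) / 2) <= 2 ^+ N * kd.
    by apply: le_trans h3; apply: le_trans h; rewrite ler_wpM2l ?sqr_ge0.
  have [->|kn] := eqVneq kd 0; first by rewrite mul0r mulr_ge0 // exprn_ge0.
  have kp : 0 < kd by rewrite lt_neqAle eq_sym kn.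
  have h6 : kd * ((1 - cabs z) / 2) <= 2 ^+ N.
    by rewrite -(ler_pM2r kp) mulrAC -expr2.
  have -> : 2 ^+ p.+2 * 2 ^+ n = 2 * 2 ^+ N :> R by rewrite /N mul1n addSn !exprS exprD; ring.
  lra.
pose F := fun u : R[i] => u ^+ M n * (1 - z^* * u)^-1.
have cz : cabs z^* <= 1 by rewrite cabsJ ltW.
have aF : analytic F.
  by apply: analyticM (analytic_kernel cz); apply: analyticX; exact: analytic_id.
have d0 : 0 < 1 - cabs z ^+ 2 by rewrite subr_gt0 expr_lt1.
have WF : wbound r F (3 * C * 2^-1 ^+ n * (1 - cabs z ^+ 2)^-1).
  split=> // m.
  have tm j : 2^-1 ^+ j * circ2 (r j) F <= C * 2^-1 ^+ n * (1 - cabs z ^+ 2)^-1 * (2^-1 ^+ (n - j) * 2^-1 ^+ (j - n)).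
    rewrite circ2_monomial ?radii01 //; last exact: analytic_kernel.
    have q1 : circ2 (r j) (fun u => (1 - z^* * u)^-1) <= (1 - cabs z ^+ 2)^-1.
      rewrite -(cabsJ z); apply: circ2_kernel; rewrite ?cabsJ // radii01 //.
    apply: (@le_trans _ _ (2^-1 ^+ j * r j ^+ (2 * M n) * (1 - cabs z ^+ 2)^-1)).
      by rewrite mulrA ler_wpM2l // mulr_ge0 ?exprn_ge0 // radii_ge0.
    have v0 : 0 <= (1 - cabs z ^+ 2)^-1 by rewrite invr_ge0 ltW.
    apply: le_trans (ler_wpM2r v0 (HC n j)) _.
    by rewrite le_eqVlt; apply/orP; left; apply/eqP; ring.
  apply: le_trans (ler_sum _ (fun j _ => tm j)) _.
  rewrite -mulr_sumr (_ : 3 * C * _ * _ = C * 2^-1 ^+ n * (1 - cabs z ^+ 2)^-1 * 3); last by ring.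
  rewrite ler_wpM2l ?mulr_ge0 ?invr_ge0 ?(ltW C0) ?(ltW d0) ?exprn_ge0 //.
  exact: sum_half_dist.
have := Hf _ _ WF; rewrite /F cabsM cabsX cabsV.
have -> : cabs (1 - z^* * z) = 1 - cabs z ^+ 2.
  by rewrite one_subJ cabsC ger0_norm // ltW.
rewrite exprMn -exprM mulnC => h.
have h3 := Hc n _ h1.
have h4 : c * (1 - cabs z ^+ 2)^-1 ^+ 2 <= 3 * C * 2^-1 ^+ n * (1 - cabs z ^+ 2)^-1 * kd.
  by apply: le_trans h; rewrite ler_wpM2r // sqr_ge0.
have p2 : 0 < 2^-1 ^+ n :> R by rewrite exprn_gt0.
have h5 : c <= 3 * C * 2^-1 ^+ n * (1 - cabs z ^+ 2) * kd.
  have d2 : 0 < (1 - cabs z ^+ 2) ^+ 2 by rewrite exprn_gt0.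
  rewrite -(ler_pM2r d2) in h4; move: h4; have dn : 1 - cabs z ^+ 2 != 0 by rewrite gt_eqF.
  move: (1 - cabs z ^+ 2) dn (2^-1 ^+ n) => d dn y.
  rewrite (_ : c * d^-1 ^+ 2 * d ^+ 2 = c); last by field.
  by rewrite (_ : 3 * C * y / d * kd * d ^+ 2 = 3 * C * y * d * kd) //; field.
have h6 : 1 - cabs z ^+ 2 <= 2 * (1 - cabs z) by nra.
have h7 : c <= 3 * C * 2^-1 ^+ n * (2 * (1 - cabs z)) * kd.
  apply: le_trans h5 _; rewrite ler_wpM2r // ler_wpM2l // !mulr_ge0 // ltW //.
rewrite mulrAC ler_pdivrMr ?mulr_gt0 // [c * _]mulrC.
have e1 : 2 ^+ n * 2^-1 ^+ n = 1 :> R by rewrite -exprMn divff // expr1n.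
have p3 : 0 < 2 ^+ n :> R by rewrite exprn_gt0.
rewrite -(ler_pM2l p3) in h7; apply: le_trans h7 _.
rewrite (_ : 2 ^+ n * _ = (2 ^+ n * 2^-1 ^+ n) * (kd * (1 - cabs z) * (6 * C))); last by ring.
by rewrite e1 mul1r.
Qed.
End kernel_diag.

(** * Carleson sequences and Blaschke products *)

Section carleson_gram.
Context {R : realType} {I : finType}.
Variables (x m : I -> R) (D : I -> I -> R) (A : R).
Hypothesis x0 : forall i, 0 <= x i.
Hypothesis m0 : forall i, 0 < m i.
Hypothesis D0 : forall i j, 0 < D i j.
Hypothesis Dsym : forall i j, D i j = D j i.
Hypothesis Dtri : forall i j k, D i k <= 2 * (D i j + D j k).
Hypothesis A0 : 0 <= A.
Hypothesis HA : forall i, \sum_j m i * m j / D i j <= A.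

Let G := \sum_i \sum_j x i * x j * m i * m j * (m i + m j) / D i j.
Let X := \sum_i m i * x i ^+ 2.
Let T j := \sum_i if m j <= m i then x i * m i ^+ 2 / D i j else 0.
Let Z := \sum_j m j * x j * T j.
Let Y := \sum_j m j * T j ^+ 2.

Let termT i j : 0 <= x i * m i ^+ 2 / D i j.
Proof. by rewrite divr_ge0 ?mulr_ge0 ?exprn_ge0 // ltW. Qed.

Let T0 j : 0 <= T j.
Proof. by apply: sumr_ge0 => i _; case: ifP. Qed.

(** By symmetry only pairs with m_j <= m_i need to be counted, and for them m_i + m_j <= 2 m_i. *)
Let GZ : G <= 4 * Z.
Proof.
pose h i j := if m j <= m i then x i * x j * m j * m i ^+ 2 / D i j else 0.
have hZ : \sum_i \sum_j h i j = Z.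
  rewrite exchange_big /=; apply: eq_bigr => j _; rewrite mulr_sumr; apply: eq_bigr => i _.
  by rewrite /h; case: ifP => _; [ring|rewrite mulr0].
have h0 i j : 0 <= h i j.
  by rewrite /h; case: ifP => // _; rewrite divr_ge0 ?mulr_ge0 ?exprn_ge0 // ltW.
have c0 i j : 0 <= x i * x j * m i * m j.
  by do 3?apply: mulr_ge0 => //; exact: ltW.
have gh i j : x i * x j * m i * m j * (m i + m j) / D i j <= 2 * (h i j + h j i).
  have [ij|ji] := leP (m j) (m i).
    apply: (@le_trans _ _ (2 * h i j)); last by rewrite ler_pM2l // lerDl.
    rewrite /h ij mulrA ler_pM2r ?invr_gt0 //.
    have -> : 2 * (x i * x j * m j * m i ^+ 2) = x i * x j * m i * m j * (2 * m i) by ring.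
    by rewrite ler_wpM2l ?c0 //; lra.
  apply: (@le_trans _ _ (2 * h j i)); last by rewrite ler_pM2l // lerDr.
  rewrite /h (ltW ji) mulrA Dsym ler_pM2r ?invr_gt0 //.
  have -> : 2 * (x j * x i * m i * m j ^+ 2) = x i * x j * m i * m j * (2 * m j) by ring.
  by rewrite ler_wpM2l ?c0 //; lra.
apply: (@le_trans _ _ (\sum_i \sum_j 2 * (h i j + h j i))).
  by apply: ler_sum => i _; apply: ler_sum => j _; exact: gh.
under eq_bigr do rewrite -mulr_sumr big_split /=.
rewrite -mulr_sumr big_split /= [X in _ * (_ + X)]exchange_big /= hZ; lra.
Qed.

(** Squaring [T j] produces 1 / (D_ij D_kj), which the quasi-triangle inequality bounds by 2 (1 /
    D_ij + 1 / D_kj) / D_ik. Summing over j with [HA] gives back the very kernel of [G]. *)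
Let YG : Y <= 2 * A * G.
Proof.
pose b i j := x i * m i ^+ 2 / D i j.
have HA' i : \sum_j m j / D i j <= A / m i.
  rewrite ler_pdivlMr // mulrC mulr_sumr; apply: le_trans (HA i).
  by apply: ler_sum => j _; rewrite mulrA.
have Tb j : T j <= \sum_i b i j.
  by apply: ler_sum => i _; case: ifP => // _; exact: termT.
have bb i j k : m j * (b i j * b k j) <=
   2 * (x i * x k * m i ^+ 2 * m k ^+ 2 / D i k) * (m j / D i j + m j / D k j).
  rewrite /b; set c := x i * x k * m i ^+ 2 * m k ^+ 2 * m j.
  have c0 : 0 <= c by rewrite !mulr_ge0 ?exprn_ge0 // ltW.
  have d1 := D0 i j; have d2 := D0 k j; have d3 := D0 i k.
  have -> : m j * (x i * m i ^+ 2 / D i j * (x k * m k ^+ 2 / D k j)) =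
     c * (D i k / (D i j * D k j * D i k)).
    by rewrite /c; field; rewrite !gt_eqF.
  have -> : 2 * (x i * x k * m i ^+ 2 * m k ^+ 2 / D i k) * (m j / D i j + m j / D k j) =
     c * (2 * (D i j + D k j) / (D i j * D k j * D i k)).
    by rewrite /c; field; rewrite !gt_eqF.
  rewrite ler_wpM2l // ler_pM2r ?invr_gt0 ?mulr_gt0 //.
  by rewrite (Dsym k j); exact: Dtri.
have -> : 2 * A * G = \sum_i \sum_k 2 * (x i * x k * m i ^+ 2 * m k ^+ 2 / D i k) * (A / m i + A / m k).
  rewrite /G mulr_sumr; apply: eq_bigr => i _; rewrite mulr_sumr; apply: eq_bigr => k _.
  by field; rewrite !gt_eqF.
apply: (@le_trans _ _ (\sum_j \sum_i \sum_k m j * (b i j * b k j))).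
  apply: ler_sum => j _.
  under eq_bigr do rewrite -mulr_sumr -mulr_sumr.
  rewrite -mulr_sumr -mulr_suml -expr2 ler_pM2l //.
  by rewrite lerXn2r ?nnegrE //; apply: sumr_ge0 => i _; exact: termT.
rewrite exchange_big /=; apply: ler_sum => i _; rewrite exchange_big /=; apply: ler_sum => k _.
apply: le_trans (ler_sum _ (fun j _ => bb i j k)) _.
rewrite -mulr_sumr ler_wpM2l ?big_split /= ?lerD //.
by rewrite mulr_ge0 // divr_ge0 ?mulr_ge0 ?exprn_ge0 // ltW.
Qed.

(** The estimate improves itself: G <= 4 Z, Cauchy-Schwarz gives Z^2 <= X Y, and Y <= 2 A G, so G^2
    <= 32 A X G, and the finite number G can be cancelled. *)
Lemma carleson_gram : G <= 32 * A * X.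
Proof.
have X0 : 0 <= X by apply: sumr_ge0 => i _; rewrite mulr_ge0 ?sqr_ge0 // ltW.
have G0 : 0 <= G.
  apply: sumr_ge0 => i _; apply: sumr_ge0 => j _; have := m0 i; have := m0 j => h1 h2.
  by rewrite divr_ge0 ?mulr_ge0 ?addr_ge0 // ltW.
have Z0 : 0 <= Z by apply: sumr_ge0 => j _; rewrite !mulr_ge0 // ltW.
have ZXY : Z ^+ 2 <= X * Y.
  have sm i : Num.sqrt (m i) ^+ 2 = m i by rewrite sqr_sqrtr // ltW.
  have := cauchy_schwarz_sum (index_enum I) (fun i => Num.sqrt (m i) * x i) (fun i => Num.sqrt (m i) * T i).
  rewrite (eq_bigr (fun j => m j * x j * T j)); last first.
    by move=> i _; rewrite mulrACA -expr2 sm mulrA.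
  rewrite [X in _ <= X * _ -> _](eq_bigr (fun i => m i * x i ^+ 2)); last first.
    by move=> i _; rewrite exprMn sm.
  by rewrite [X in _ <= _ * X -> _](eq_bigr (fun i => m i * T i ^+ 2)) // => i _; rewrite exprMn sm.
have [G1|Gp] := eqVneq G 0; first by rewrite G1 !mulr_ge0.
have {}Gp : 0 < G by rewrite lt_neqAle eq_sym Gp.
rewrite -(ler_pM2r Gp) -expr2; move: GZ YG; nra.
Qed.
End carleson_gram.

(** * The Carleson embedding for finite sequences *)

Section carleson.
Context {R : realType}.
Implicit Types (a b z l : R[i]) (s : seq R[i]).

Definition mm z : R := 1 - cabs z ^+ 2.

Definition dd a b : R := cabs (1 - b^* * a) ^+ 2.

(* 1 - rho^2 for the pseudohyperbolic distance rho. *)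
Definition pp a b : R := mm a * mm b / dd a b.

Lemma mm_gt0 z : cabs z < 1 -> 0 < mm z.
Proof. by move=> h; have := cabs_ge0 z; rewrite /mm; nra. Qed.

Lemma mm_le z : cabs z < 1 -> 1 - cabs z <= mm z <= 2 * (1 - cabs z).
Proof. by move=> h; have := cabs_ge0 z; rewrite /mm; nra. Qed.

Lemma dd_sym a b : dd a b = dd b a.
Proof. by rewrite /dd -cabsJ; congr (cabs _ ^+ 2); apply: eq_complex_ReIm; rewrite !ReImE; ring. Qed.

Lemma dd_ge a b : cabs a < 1 -> cabs b < 1 -> 1 - cabs a * cabs b <= cabs (1 - b^* * a).
Proof. by move=> _ _; have := lerB_cabs 1 (b^* * a); rewrite cabs1 cabsM cabsJ mulrC. Qed.

Lemma kernel_gt0 a b : cabs a < 1 -> cabs b <= 1 -> 0 < cabs (1 - b^* * a).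
Proof.
move=> ha hb; have := lerB_cabs 1 (b^* * a); rewrite cabs1 cabsM cabsJ.
by have := cabs_ge0 a; have := cabs_ge0 b; nra.
Qed.

Lemma dd_gt0 a b : cabs a < 1 -> cabs b < 1 -> 0 < dd a b.
Proof. by move=> ha hb; rewrite exprn_gt0 // kernel_gt0 // ltW. Qed.

(** The modulus of 1 - conj b a obeys the triangle inequality because it dominates |a - b|; squaring
    costs the factor 2. *)
Lemma dd_tri a b c : cabs a < 1 -> cabs b < 1 -> cabs c < 1 ->
  dd a c <= 2 * (dd a b + dd b c).
Proof.
move=> ha hb hc; rewrite /dd.
suff h : cabs (1 - c^* * a) <= cabs (1 - b^* * a) + cabs (1 - c^* * b).
  have h0 := cabs_ge0 (1 - c^* * a).
  apply: (@le_trans _ _ ((cabs (1 - b^* * a) + cabs (1 - c^* * b)) ^+ 2)).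
    by rewrite lerXn2r ?nnegrE ?addr_ge0.
  have := sqr_ge0 (cabs (1 - b^* * a) - cabs (1 - c^* * b)); nra.

have e : 1 - c^* * a = (1 - c^* * b) - c^* * (a - b) by ring.
have h1 : cabs (a - b) <= cabs (1 - b^* * a).
  apply: ler_sqr2 => //; have : cabs (1 - b^* * a) ^+ 2 - cabs (a - b) ^+ 2 = mm a * mm b.
    by rewrite /mm !cabs2E !ReImE /=; ring.
  have := mulr_gt0 (mm_gt0 ha) (mm_gt0 hb); lra.
rewrite e; apply: le_trans (cabsB _ _) _; rewrite cabsM cabsJ addrC lerD2r.
by apply: le_trans h1; rewrite ler_piMl // ltW.
Qed.

Lemma rho2E a b : cabs a < 1 -> cabs b < 1 ->
  1 - pp a b = cabs ((a - b) / (1 - b^* * a)) ^+ 2.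
Proof.
move=> ha hb; have d := dd_gt0 ha hb; rewrite cabs_div expr_div_n -/(dd a b) /pp.
have : dd a b - cabs (a - b) ^+ 2 = mm a * mm b.
  by rewrite /dd /mm !cabs2E !ReImE /=; ring.
by move=> <-; field; rewrite gt_eqF.
Qed.

Lemma pp_sym a b : pp a b = pp b a.
Proof. by rewrite /pp dd_sym mulrC [mm a * _]mulrC mulrC. Qed.

Lemma pp_gt0 a b : cabs a < 1 -> cabs b < 1 -> 0 < pp a b.
Proof. move=> ha hb; apply: divr_gt0; last exact: dd_gt0.
by apply: mulr_gt0; exact: mm_gt0. Qed.

Lemma pp_le1 a b : cabs a < 1 -> cabs b < 1 -> pp a b <= 1.
Proof. by move=> ha hb; have := rho2E ha hb; have := sqr_ge0 (cabs ((a - b) / (1 - b^* * a))); lra. Qed.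

(** The Carleson condition tested only at the points of s; [carleson_embedding] makes this
    enough. *)
Definition carl s (A : R) := forall l, l \in s -> \sum_(j <- s) pp l j <= A.

Lemma conj1B (x : R[i]) : (1 - x)^* = 1 - x^*.
Proof. by apply: eq_complex_ReIm; rewrite !ReImE /= ?oppr0 ?add0r ?sub0r ?opprB ?opprK; ring. Qed.

Lemma conjV (x : R[i]) : (x^-1)^* = (x^*)^-1.
Proof. exact: fmorphV. Qed.

Lemma poisson_sum (x : R[i]) n : x != 1 ->
  \sum_(k < n.+1) x ^+ k + \sum_(k < n) x^* ^+ k.+1 =
  ((1 - cabs x ^+ 2) / cabs (1 - x) ^+ 2)%:C - x ^+ n.+1 / (1 - x) - (x ^+ n.+1 / (1 - x))^*.
Proof.
move=> x1; have d0 : 1 - x != 0 by rewrite subr_eq0 eq_sym.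
have d1 : 1 - x^* != 0.
  by rewrite -conj1B -cabs_eq0 cabsJ cabs_eq0.
have geo (y : R[i]) k : 1 - y != 0 -> \sum_(i < k) y ^+ i = (1 - y ^+ k) / (1 - y).
  move=> y0; apply: (mulIf y0); rewrite divfK // mulrC.
  by rewrite -[LHS]opprK -mulNr opprB -subrX1 opprB.
have e2 : \sum_(k < n) x^* ^+ k.+1 = (1 - x^* ^+ n.+1) / (1 - x^*) - 1.
  by rewrite -geo // big_ord_recl expr0 addrC addKr.
rewrite e2 geo //.
have -> : (x ^+ n.+1 / (1 - x))^* = x^* ^+ n.+1 / (1 - x^*).
  by rewrite conjM conjX conjV conj1B.
have -> : ((1 - cabs x ^+ 2) / cabs (1 - x) ^+ 2)%:C = (1 - x * x^*) / ((1 - x) * (1 - x^*)).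
  rewrite mulJ rmorphM /= fmorphV rmorphB rmorph1; congr (_ / _).
  by transitivity ((1 - x) * (1 - x)^*); [rewrite mulJ|rewrite conj1B].
by field; rewrite d0 d1.
Qed.

Lemma seq_bound (s : seq R[i]) : (forall l, l \in s -> cabs l < 1) ->
  exists2 q : R, 0 < q < 1 & forall l, l \in s -> cabs l <= q.
Proof.
elim: s => [|a s IH] Hs; first by exists 2^-1 => //; lra.
have [|q /andP[q0 q1] Hq] := IH; first by move=> l ls; apply: Hs; rewrite inE ls orbT.
exists (Num.max q (cabs a)); first by rewrite lt_max q0 gt_max q1 Hs // inE eqxx.
by move=> l; rewrite inE le_max => /predU1P[->|/Hq ->]; rewrite ?lexx ?orbT.
Qed.

Section indexed.
Variables (I : finType) (l : I -> R[i]) (A : R).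
Hypothesis l1 : forall i, cabs (l i) < 1.
Hypothesis A0 : 0 <= A.
Hypothesis HA : forall i, \sum_j pp (l i) (l j) <= A.

(** Adding the nonnegative sums of [g'] completes the geometric series in xx i j to partial sums of
    a Poisson kernel. The latter is at most [w i j], a kernel that [carleson_gram] controls after
    absolute values have been taken. *)
Lemma carleson_coef_indexed (d : I -> R[i]) n :
  \sum_(k < n) cabs (\sum_i d i * (l i)^* ^+ k) ^+ 2 <=
  32 * A * \sum_i cabs (d i) ^+ 2 / mm (l i).
Proof.
have m0 i := mm_gt0 (l1 i).
pose x i := cabs (d i) / mm (l i).
have x0 i : 0 <= x i by rewrite divr_ge0 // ltW.
have /= gram := @carleson_gram _ _ x (fun i => mm (l i)) (fun i j => dd (l i) (l j)) A x0 m0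
  (fun i j => dd_gt0 (l1 i) (l1 j)) (fun i j => dd_sym _ _)
  (fun i j k => dd_tri (l1 i) (l1 j) (l1 k)) A0 HA.
have -> : \sum_i cabs (d i) ^+ 2 / mm (l i) = \sum_i mm (l i) * x i ^+ 2.
  by apply: eq_bigr => i _; rewrite /x; field; rewrite gt_eqF.
apply: le_trans gram.
pose w i j := (mm (l i) + mm (l j)) / dd (l i) (l j).
have -> : \sum_i \sum_j x i * x j * mm (l i) * mm (l j) * (mm (l i) + mm (l j)) / dd (l i) (l j) =
    \sum_i \sum_j cabs (d i) * cabs (d j) * w i j.
  apply: eq_bigr => i _; apply: eq_bigr => j _; rewrite /x /w.
  by have := dd_gt0 (l1 i) (l1 j) => h; field; rewrite !gt_eqF.
have [|q /andP[q0 q1] Hq] := @seq_bound [seq l i | i <- enum I].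
  by move=> _ /mapP[i _ ->].
have {}Hq i : cabs (l i) <= q by apply/Hq/map_f; rewrite mem_enum.
have q2 : 0 < 1 - q by rewrite subr_gt0.
pose xx i j := (l i)^* * l j.
have xq i j : cabs (xx i j) <= q.
  by rewrite /xx cabsM cabsJ; have := Hq i; have := Hq j; have := cabs_ge0 (l i); have := cabs_ge0 (l j); nra.
apply/ler_addgt0Pr => e e0.
have q01 : 0 <= q < 1 by rewrite ltW.
have [N HN] := geom_small (\sum_i \sum_j cabs (d i) * cabs (d j) * (2 / (1 - q))) q01 e0.
pose M := maxn n N.
pose g k := \sum_i d i * (l i)^* ^+ k; pose g' k := \sum_i d i * (l i) ^+ k.
have gE k : (cabs (g k) ^+ 2)%:C = \sum_i \sum_j d i * (d j)^* * xx i j ^+ k.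
  rewrite -mulJ /g rmorph_sum /= mulr_suml; apply: eq_bigr => i _; rewrite mulr_sumr.
  by apply: eq_bigr => j _; rewrite conjM conjX conjK /xx exprMn; ring.
have gE' k : (cabs (g' k) ^+ 2)%:C = \sum_i \sum_j d i * (d j)^* * (xx i j)^* ^+ k.
  rewrite -mulJ /g' rmorph_sum /= mulr_suml; apply: eq_bigr => i _; rewrite mulr_sumr.
  by apply: eq_bigr => j _; rewrite conjM conjX /xx conjM conjK exprMn; ring.
pose S := \sum_(k < M.+1) cabs (g k) ^+ 2 + \sum_(k < M) cabs (g' k.+1) ^+ 2.
have nS : \sum_(k < n) cabs (g k) ^+ 2 <= S.
  have nM : (n <= M.+1)%N by rewrite leqW // leq_maxl.
  rewrite /S -(subnKC nM) big_split_ord /= -addrA lerDl addr_ge0 //; apply: sumr_ge0 => k _; exact: sqr_ge0.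
apply: le_trans nS _.
have SE : S%:C = \sum_i \sum_j d i * (d j)^* *
    (\sum_(k < M.+1) xx i j ^+ k + \sum_(k < M) (xx i j)^* ^+ k.+1).
  rewrite /S rmorphD !rmorph_sum /=.
  under eq_bigr do rewrite gE.
  under [X in _ + X]eq_bigr do rewrite gE'.
  rewrite exchange_big [X in _ + X]exchange_big -big_split /=; apply: eq_bigr => i _.
  rewrite exchange_big [X in _ + X]exchange_big -big_split /=; apply: eq_bigr => j _.
  by rewrite mulrDr !mulr_sumr.
have -> : S = Re S%:C by [].
apply: le_trans (ler_norm _) _; apply: le_trans (Re_le _) _; rewrite SE.
apply: (@le_trans _ _ (\sum_i \sum_j (cabs (d i) * cabs (d j) * w i j +
    cabs (d i) * cabs (d j) * (2 / (1 - q)) * q ^+ M))); last first.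
  under eq_bigr do rewrite big_split /=.
  rewrite big_split /= lerD2l; apply: le_trans (HN M (leq_maxr _ _)).
  rewrite mulr_suml; apply: ler_sum => i _; rewrite mulr_suml; exact: lexx.
apply: le_trans (cabs_sum _ _ _) _; apply: ler_sum => i _.
apply: le_trans (cabs_sum _ _ _) _; apply: ler_sum => j _.
rewrite !cabsM cabsJ -[X in _ <= _ + X]mulrA -mulrDr ler_wpM2l ?mulr_ge0 //.
set X := xx i j; have Xq := xq i j; rewrite -/X in Xq.
have X0 := cabs_ge0 X.
have X1 : X != 1 by apply: contraTneq Xq => ->; rewrite cabs1 -ltNge.
have k0 : 1 - q <= cabs (1 - X) by have := lerB_cabs 1 X; rewrite cabs1; lra.
rewrite poisson_sum //.
have hw : (1 - cabs X ^+ 2) / cabs (1 - X) ^+ 2 <= w i j.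
  rewrite /w (dd_sym (l i)) /dd -/(xx i j) -/X ler_pM2r; last first.
    by rewrite invr_gt0 exprn_gt0 // (lt_le_trans q2).
  rewrite /X /xx /mm cabsM cabsJ exprMn; have := l1 i; have := l1 j.
  have := cabs_ge0 (l i); have := cabs_ge0 (l j).
  move: (cabs (l i)) (cabs (l j)) => u v v0 u0 v1 u1.
  have : 0 <= (1 - u ^+ 2) * (1 - v ^+ 2) by rewrite mulr_ge0 // subr_ge0 expr_le1 // ltW.
  lra.
have hp : 0 <= (1 - cabs X ^+ 2) / cabs (1 - X) ^+ 2.
  by rewrite divr_ge0 ?sqr_ge0 // subr_ge0 expr_le1 // (le_trans Xq) // ltW.
have ht : cabs (X ^+ M.+1 / (1 - X)) <= q ^+ M / (1 - q).
  rewrite cabs_div cabsX ler_pM ?invr_ge0 ?exprn_ge0 //.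
    apply: (@le_trans _ _ (q ^+ M.+1)); first by rewrite lerXn2r ?nnegrE // ltW.
    by rewrite exprS ler_piMl ?exprn_ge0 // ltW.
  by rewrite lef_pV2 ?posrE // (lt_le_trans q2).
apply: le_trans (cabsB _ _) _; rewrite cabsJ.
have := cabsB ((1 - cabs X ^+ 2) / cabs (1 - X) ^+ 2)%:C (X ^+ M.+1 / (1 - X)).
rewrite cabsC ger0_norm // => h.
have -> : 2 / (1 - q) * q ^+ M = q ^+ M / (1 - q) + q ^+ M / (1 - q) by ring.
lra.
Qed.
End indexed.

Lemma carleson_coef s (A : R) (d : R[i] -> R[i]) n : (forall l, l \in s -> cabs l < 1) ->
  0 <= A -> carl s A ->
  \sum_(k < n) cabs (\sum_(l <- s) d l * l^* ^+ k) ^+ 2 <=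
  32 * A * \sum_(l <- s) cabs (d l) ^+ 2 / mm l.
Proof.
move=> Hs A0 HA.
have := @carleson_coef_indexed 'I_(size s) (fun i => s`_i) A
  (fun i => Hs _ (mem_nth _ (ltn_ord i))) A0 _ (fun i => d s`_i) n.
have e (F : R[i] -> R) : \sum_(l <- s) F l = \sum_(i < size s) F s`_i.
  by rewrite (big_nth 0) big_mkord.
rewrite -(e (fun l => cabs (d l) ^+ 2 / mm l)) => /(_ _)H.
apply: le_trans (H _); last by move=> i; rewrite -(e (pp s`_i)); apply: HA; exact: mem_nth.
by apply: ler_sum => k _; rewrite (big_nth 0) big_mkord.
Qed.

(** G bounds the squared norm of f in the Hardy space H^2 of the disc. *)
Definition hardy (f : R[i] -> R[i]) (G : R) :=
  analytic f /\ forall r, 0 <= r < 1 -> circ2 r f <= G.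

Lemma hardy_coef f (G : R) (a : nat -> R[i]) n : hardy f G -> pser f a -> \sum_(k < n) cabs (a k) ^+ 2 <= G.
Proof.
move=> [af HG] pa; apply/ler_addgt0Pr => e e0.
have H (r : R) : 0 <= r < 1 -> \sum_(k < n) cabs (a k) ^+ 2 * r ^+ (2 * k) <= G.
  by move=> r01; apply: le_trans (HG r r01); exact: sum_circ2_le.
set S := \sum_(k < n) _.
have S0 : 0 <= S by apply: sumr_ge0 => k _; exact: sqr_ge0.
(* Chosen so that Bernoulli's inequality loses at most 2 n x S <= e in passing from the radius 1 - x
   to 1. *)
pose x := e / (1 + e + (2 * n)%:R * S).
have n0 : 0 <= (2 * n)%:R * S by rewrite mulr_ge0.
have x0 : 0 < x by rewrite divr_gt0 //; lra.
have x1 : x <= 1 by rewrite ler_pdivrMr ?mul1r; lra.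
have xS : (2 * n)%:R * x * S <= e.
  rewrite (_ : _ * x * S = e * ((2 * n)%:R * S) / (1 + e + (2 * n)%:R * S)); last by rewrite /x; ring.
  by move: n0; set y := _ * S => n0; rewrite ler_pdivrMr; nra.
have r01 : 0 <= 1 - x < 1 by lra.
apply: (@le_trans _ _ (\sum_(k < n) cabs (a k) ^+ 2 * (1 - x) ^+ (2 * k) + (2 * n)%:R * x * S)); last first.
  by have := H _ r01; lra.
rewrite /S mulr_sumr -big_split /=; apply: ler_sum => k _.
have := @bernoulli R x (2 * k) ltac:(lra).
have : (2 * k)%:R <= (2 * n)%:R :> R by rewrite ler_nat leq_mul2l /= ltnW.
have := sqr_ge0 (cabs (a k)).
move: (cabs (a k) ^+ 2) ((1 - x) ^+ _) (2 * k)%:R (2 * n)%:R => y z u v y0 uv uz.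
have : u * x <= v * x by rewrite ler_pM2r.
move=> h; have : y * (1 - v * x) <= y * z by rewrite ler_wpM2l //; lra.
lra.
Qed.

(** Duality with [carleson_coef]: for d l = (1 - |l|^2) f l the sum X is the pairing of f with a
    combination of kernels whose squared norm is at most 32 A X, so X^2 <= 32 A G X. *)
Lemma carleson_embedding s (A G : R) f : (forall l, l \in s -> cabs l < 1) ->
  0 <= A -> carl s A -> hardy f G -> \sum_(l <- s) mm l * cabs (f l) ^+ 2 <= 32 * A * G.
Proof.
move=> Hs A0 HA Hf; have [af _] := Hf; have [a pa] := analytic_pser af.
pose d l := (mm l)%:C * f l; pose X := \sum_(l <- s) mm l * cabs (f l) ^+ 2.
have X0 : 0 <= X.
  rewrite /X big_seq; apply: sumr_ge0 => l ls; rewrite mulr_ge0 ?sqr_ge0 //.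
  exact/ltW/mm_gt0/Hs.
have HX n : \sum_(k < n) cabs (\sum_(l <- s) d l * l^* ^+ k) ^+ 2 <= 32 * A * X.
  apply: le_trans (carleson_coef d n Hs A0 HA) _.
  rewrite le_eqVlt; apply/orP; left; apply/eqP; congr (_ * _).
  apply: eq_big_seq => l ls; have := mm_gt0 (Hs l ls) => m0.
  by rewrite /d cabsM cabsC gtr0_norm // exprMn; field; rewrite gt_eqF.
have G0 : 0 <= G by have := hardy_coef 0 Hf pa; rewrite big_ord0.
have part n : Re (\sum_(l <- s) (d l)^* * \sum_(k < n) a k * l ^+ k) ^+ 2 <= G * (32 * A * X).
  have -> : \sum_(l <- s) (d l)^* * (\sum_(k < n) a k * l ^+ k) =
     \sum_(k < n) a k * (\sum_(l <- s) d l * l^* ^+ k)^*.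
    under eq_bigr do rewrite mulr_sumr.
    rewrite exchange_big /=; apply: eq_bigr => k _; rewrite rmorph_sum mulr_sumr /=.
    by apply: eq_bigr => l _; rewrite (conjM (d l)) conjX conjK; ring.
  set u := fun k => \sum_(l <- s) d l * l^* ^+ k.
  apply: (@le_trans _ _ ((\sum_(k < n) cabs (a k) * cabs (u k)) ^+ 2)).
    rewrite -ler_sqrt ?sqr_ge0 // !sqrtr_sqr; apply: le_trans (Re_le _) _.
    rewrite [leRHS]ger0_norm; last by apply: sumr_ge0 => k _; rewrite mulr_ge0.
    apply: le_trans (cabs_sum _ _ _) _; apply: ler_sum => k _; by rewrite cabsM cabsJ.
  apply: le_trans (cauchy_schwarz_sum _ _ _) _.
  by apply: ler_pM; [apply: sumr_ge0 => k _; exact: sqr_ge0|apply: sumr_ge0 => k _; exact: sqr_ge0|exact: hardy_coef pa|exact: HX].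
have XX : X ^+ 2 <= G * (32 * A * X).
  rewrite -[leRHS]sqr_sqrtr ?mulr_ge0 // lerXn2r ?nnegrE ?sqrtr_ge0 //.
  apply/ler_addgt0Pr => e e0.
  have [q /andP[q0 q1] Hq] := seq_bound Hs.
  have [C [q' [C0 q01 H]]] := pa q ltac:(by rewrite (ltW q0)).
  have [N HN] := geom_small (C * \sum_(l <- s) mm l * cabs (f l)) q01 e0.
  have XE : X = Re (\sum_(l <- s) (d l)^* * f l).
    rewrite Re_sum; apply: eq_bigr => l _; rewrite /d conjM conj_real -mulrA [_^* * _]mulrC mulJ.
    by rewrite -rmorphM.
  rewrite [leLHS]XE; set T := \sum_(l <- s) _ * f l.
  have h1 := part N; set U := \sum_(l <- s) _ in h1.
  have h2 : `|Re U| <= Num.sqrt (G * (32 * A * X)).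
    by rewrite -sqrtr_sqr ler_sqrt // !mulr_ge0.
  have h3 : `|Re (T - U)| <= e.
    apply: le_trans (Re_le _) _; apply: le_trans (HN N (leqnn _)).
    rewrite /T /U -sumrB mulrAC mulr_sumr.
    apply: le_trans (cabs_sum _ _ _) _; rewrite big_seq [leRHS]big_seq; apply: ler_sum => l ls.
    have m0 := mm_gt0 (Hs l ls).
    rewrite -mulrBr cabsM cabsJ /d cabsM cabsC gtr0_norm // [leRHS]mulrC.
    by rewrite ler_wpM2l ?mulr_ge0 ?(ltW m0) //; apply: H; exact: Hq.
  move: h2 h3; rewrite !ReImE; move: (Re T) (Re U) => t u; rewrite !ler_norml; lra.
rewrite -/X; have [->|Xn] := eqVneq X 0; first by rewrite !mulr_ge0.
have Xp : 0 < X by rewrite lt_neqAle eq_sym Xn.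
rewrite -(ler_pM2r Xp) -expr2; apply: le_trans XX _; rewrite le_eqVlt; apply/orP; left.
by apply/eqP; ring.
Qed.
End carleson.

(** * Blaschke products and interpolation in Hardy space *)

Section blaschke.
Context {R : realType}.
Implicit Types (f g : R[i] -> R[i]) (l z : R[i]) (s u : seq R[i]) (G A : R).

Definition bl l z := (z - l) / (1 - l^* * z).

Lemma bl_sqr l z : cabs l < 1 -> cabs z < 1 -> cabs (bl l z) ^+ 2 = 1 - pp z l.
Proof. by move=> hl hz; rewrite rho2E. Qed.

Lemma bl_ll l : bl l l = 0. Proof. by rewrite /bl subrr mul0r. Qed.

Lemma bl_eq0 l z : cabs l < 1 -> cabs z < 1 -> (bl l z == 0) = (z == l).
Proof.
move=> hl hz; rewrite /bl mulf_eq0 subr_eq0 invr_eq0 -cabs_eq0.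
by rewrite (gt_eqF (kernel_gt0 hz (ltW hl))) orbF.
Qed.

Lemma cabs_bl_circle l z : cabs l < 1 -> cabs z = 1 -> cabs (bl l z) = 1.
Proof.
move=> hl hz; rewrite /bl cabs_div.
have -> : cabs (z - l) = cabs (1 - l^* * z).
  have -> : 1 - l^* * z = z * (z - l)^*.
    have : z * z^* = 1 by rewrite mulJ hz expr1n.
    move=> e; rewrite -[X in X - _ = _]e; have -> : (z - l)^* = z^* - l^*.
      by apply: eq_complex_ReIm; rewrite !ReImE; ring.
    ring.
  by rewrite cabsM cabsJ hz mul1r.
rewrite divff // gt_eqF // -[l]conjK -cabsJ conj1B conjM conjK conjK mulrC.
have := lerB_cabs 1 (z^* * l); rewrite cabs1 cabsM cabsJ hz mul1r => h.
by apply: lt_le_trans h; rewrite subr_gt0.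
Qed.

Lemma analytic_bl l : cabs l < 1 -> analytic (bl l).
Proof.
move=> hl; apply: analyticM; first by apply: analyticB; [exact: analytic_id|exact: analytic_cst].
by apply: analytic_kernel; rewrite cabsJ ltW.
Qed.

Lemma circ2_scale f (c r : R) : circ2 r (fun z => f (c%:C * z)) = circ2 (c * r) f.
Proof.
rewrite /circ2; congr (_ * _); apply: eq_rint => t _; congr (cabs (f _) ^+ 2).
by rewrite !on_circleE rmorphM mulrA.
Qed.

Lemma hardy_scale f (s : R) : analytic f -> 0 <= s < 1 -> hardy (fun z => f (s%:C * z)) (circ2 s f).
Proof.
move=> af /andP[s0 s1]; split=> [|r /andP[r0 r1]].
  by apply: analytic_scale => //; rewrite cabsC ger0_norm // ltW.
rewrite circ2_scale; apply: circ2_mono => //; first exact: mulr_ge0.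
by rewrite ler_piMr // ltW.
Qed.

Lemma hardy_ge0 f G : hardy f G -> 0 <= G.
Proof. by move=> [af H]; apply: le_trans (circ2_ge0' af _) (H 0 _); rewrite lexx ltr01. Qed.

Lemma hardy_point f G z : hardy f G -> cabs z < 1 -> cabs (f z) ^+ 2 * mm z <= G.
Proof.
move=> Hf z1; have [af H] := Hf; have G0 := hardy_ge0 Hf.
apply/ler_addgt0Pr => e e0; set y := cabs (f z) ^+ 2.
have y0 : 0 <= y by rewrite sqr_ge0.
have z0 := cabs_ge0 z.
pose x := Num.min ((1 - cabs z) / 2) (e / (2 * y + 1)).
have x0 : 0 < x by rewrite lt_min; apply/andP; split; [lra|rewrite divr_gt0 //; lra].
have x1 : x <= (1 - cabs z) / 2 by rewrite ge_min lexx.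
have x2 : x * (2 * y + 1) <= e by rewrite -ler_pdivlMr ?ge_min ?lexx ?orbT //; lra.
have r0 : 0 < 1 - x by lra.
have h1 := circ2_point af (_ : 0 < 1 - x < 1) (_ : cabs z < 1 - x).
have {h1} := le_trans (h1 ltac:(lra) ltac:(lra)) (H (1 - x) ltac:(lra)).
have r2 : 0 < (1 - x) ^+ 2 by rewrite exprn_gt0.
rewrite -/y -(ler_pM2r r2) => h1; rewrite /mm.
have e1 : y * (1 - (cabs z / (1 - x)) ^+ 2) * (1 - x) ^+ 2 = y * ((1 - x) ^+ 2 - cabs z ^+ 2).
  by field; rewrite gt_eqF.
rewrite e1 in h1; have : G * (1 - x) ^+ 2 <= G by rewrite ler_piMr // expr_le1 //; lra.
nra.
Qed.

(** On |z| = 1 - x the squared modulus of [bl l] is at least 1 - k x, so division costs a factor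
    that tends to 1 with x; the monotonicity of the means then covers all smaller circles. *)
Lemma hardy_divide1 f G l : hardy f G -> cabs l < 1 -> f l = 0 ->
  exists2 g, hardy g G & forall z, cabs z < 1 -> f z = bl l z * g z.
Proof.
move=> Hf l1 fl; have [af H] := Hf; have G0 := hardy_ge0 Hf.
have [h ah Hh] := analytic_divide af l1 fl.
pose g z := (1 - l^* * z) * h z.
have ag : analytic g.
  apply: analyticM => //; apply: analyticB; first exact: analytic_cst.
  by apply: analyticZ; exact: analytic_id.
have fg z : cabs z < 1 -> f z = bl l z * g z.
  move=> z1; rewrite Hh // /bl /g; have := kernel_gt0 z1 (ltW l1); rewrite cabs_gt0 => k0.
  by field.
exists g => //; split=> // r /andP[r0 r1]; apply/ler_addgt0Pr => e e0.
have l0 := cabs_ge0 l.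
pose k := 2 / (1 - cabs l) ^+ 2.
have k0 : 0 < k by rewrite divr_gt0 // exprn_gt0 // subr_gt0.
have p0 : 0 < k * (G + e + 1) by rewrite mulr_gt0 //; lra.
pose x := Num.min (Num.min (1 - r) (2^-1)) (e / (k * (G + e + 1))).
have x0 : 0 < x by rewrite !lt_min divr_gt0 // subr_gt0 r1 invr_gt0 ltr0n.
have x1 : x <= 1 - r by rewrite !ge_min lexx.
have x2 : x <= 2^-1 by rewrite !ge_min lexx orbT.
have x3 : k * x * (G + e + 1) <= e.
  have : x <= e / (k * (G + e + 1)) by rewrite ge_min lexx orbT.
  by rewrite ler_pdivlMr // mulrCA mulrA.
have rho01 : 0 <= 1 - x < 1 by lra.
apply: (@le_trans _ _ (circ2 (1 - x) g)); first by apply: circ2_mono => //; lra.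
have kx0 : 0 < k * x by rewrite mulr_gt0.
have kx : k * x < 1 by nra.
have kx1 : 0 < 1 - k * x by rewrite subr_gt0.
apply: (@le_trans _ _ ((1 - k * x)^-1 * circ2 (1 - x) f)).
  apply: circ2_le; try exact: analytic_ccont.
  move=> t; set z := on_circle _ _.
  have zx : cabs z = 1 - x by apply: cabs_on_circle; lra.
  have z1 : cabs z < 1 by rewrite zx; lra.
  rewrite -ler_pdivrMl ?invr_gt0 // invrK fg // cabsM exprMn bl_sqr //.
  rewrite ler_wpM2r ?sqr_ge0 // lerD2l lerN2 /pp ler_pdivrMr ?dd_gt0 //.
  have hd : (1 - cabs l) ^+ 2 <= dd z l.
    rewrite /dd lerXn2r ?nnegrE ?subr_ge0 ?(ltW l1) //.
    have := lerB_cabs 1 (l^* * z); rewrite cabs1 cabsM cabsJ; have := cabs_ge0 z; nra.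
  have hm : mm z * mm l <= 2 * x.
    rewrite /mm zx; have : 0 <= cabs l ^+ 2 <= 1 by rewrite sqr_ge0 expr_le1 // ltW.
    nra.
  apply: le_trans hm _; apply: (@le_trans _ _ (k * x * (1 - cabs l) ^+ 2)).
    rewrite /k mulrAC mulfVK ?gt_eqF // exprn_gt0 // subr_gt0 //.
  by rewrite ler_pM2l.
rewrite ler_pdivrMl //; have := H _ rho01; have : 0 <= circ2 (1 - x) f by exact: circ2_ge0'.
move=> a1 a2; nra.
Qed.

Definition bprod s z := \prod_(l <- s) bl l z.

Lemma analytic_bprod s : (forall l, l \in s -> cabs l < 1) -> analytic (bprod s).
Proof.
move=> Hs; apply: (@eq_analytic _ (fun z => \prod_(l <- s | l \in s) bl l z)).
  by move=> z _; rewrite -big_seq.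
by apply: analytic_prod => l ls; apply: analytic_bl; exact: Hs.
Qed.

Lemma bprod_sqr s z : (forall l, l \in s -> cabs l < 1) -> cabs z < 1 ->
  cabs (bprod s z) ^+ 2 = \prod_(l <- s) (1 - pp z l).
Proof.
move=> Hs z1; rewrite cabs_prod -prodrXl !big_seq; apply: eq_bigr => l ls.
by rewrite bl_sqr // Hs.
Qed.

Lemma rho2_prod_le1 (I : Type) (s : seq I) (P : pred I) (F : I -> R[i]) z :
  (forall i, P i -> cabs (F i) < 1) -> cabs z < 1 ->
  0 <= \prod_(i <- s | P i) (1 - pp z (F i)) <= 1.
Proof.
move=> HF z1; have h i : P i -> 0 <= 1 - pp z (F i) <= 1.
  move=> Pi; rewrite subr_ge0 pp_le1 ?HF //= gerBl ltW // pp_gt0 ?HF //.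
apply/andP; split; first by apply: prodr_ge0 => i /h/andP[].
by apply: prodr_ile1.
Qed.

Lemma hardy_divide s f G : uniq s -> (forall l, l \in s -> cabs l < 1) -> hardy f G ->
  (forall l, l \in s -> f l = 0) ->
  exists2 g, hardy g G & forall z, cabs z < 1 -> f z = bprod s z * g z.
Proof.
elim: s f => [|a s IH] f.
  by move=> _ _ Hf _; exists f => // z _; rewrite /bprod big_nil mul1r.
rewrite /= => /andP[aN us] Hs Hf f0.
have a1 : cabs a < 1 by apply: Hs; rewrite inE eqxx.
have Hs' l : l \in s -> cabs l < 1 by move=> ls; apply: Hs; rewrite inE ls orbT.
have [h Hh fh] := hardy_divide1 Hf a1 (f0 a (mem_head _ _)).
have [|g Hg hg] := IH h us Hs' Hh.
  move=> l ls; have := fh l (Hs' l ls); rewrite f0 ?inE ?ls ?orbT // => /esym/eqP.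
  rewrite mulf_eq0 (bl_eq0 a1 (Hs' l ls)) => /orP[/eqP e|/eqP //].
  by rewrite e in ls; rewrite ls in aN.
by exists g => // z z1; rewrite fh // hg // mulrA /bprod big_cons.
Qed.

Lemma blaschke_point s f G z : uniq s -> (forall l, l \in s -> cabs l < 1) -> hardy f G ->
  (forall l, l \in s -> f l = 0) -> cabs z < 1 ->
  cabs (f z) ^+ 2 * mm z <= G * \prod_(l <- s) (1 - pp z l).
Proof.
move=> us Hs Hf f0 z1; have [g Hg fg] := hardy_divide us Hs Hf f0.
rewrite fg // cabsM exprMn bprod_sqr // -mulrA mulrC ler_wpM2r ?hardy_point //.
by rewrite big_seq; case/andP: (@rho2_prod_le1 _ s (mem s) id z Hs z1).
Qed.

Lemma pserZ f (a : nat -> R[i]) c : pser f a -> pser (fun z => c * f z) (fun k => c * a k).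
Proof.
move=> pa r r01; have [C [q [C0 q01 H]]] := pa r r01.
exists (cabs c * C), q; split=> //; first by rewrite mulr_ge0.
move=> z n zr; under eq_bigr do rewrite -mulrA.
by rewrite -mulr_sumr -mulrBr cabsM -mulrA ler_wpM2l // H.
Qed.

Lemma pserD f g (a b : nat -> R[i]) : pser f a -> pser g b ->
  pser (fun z => f z + g z) (fun k => a k + b k).
Proof.
move=> pa pb r r01; have [C [q [C0 /andP[q0 q1] H]]] := pa r r01.
have [C' [q' [C0' /andP[q0' q1'] H']]] := pb r r01.
exists (C + C'), (Num.max q q'); split; [exact: addr_ge0|by rewrite le_max q0 gt_max q1|].
move=> z n zr; under eq_bigr do rewrite mulrDl.
rewrite big_split /= opprD addrACA; apply: le_trans (cabsD _ _) _.
rewrite mulrDl lerD //.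
  apply: le_trans (H z n zr) _; rewrite ler_wpM2l // lerXn2r ?nnegrE ?le_max ?lexx ?q0 //.
apply: le_trans (H' z n zr) _; rewrite ler_wpM2l // lerXn2r ?nnegrE ?le_max ?lexx ?q0' ?orbT //.
Qed.

Lemma pser_kernel_sum s (e c : R[i] -> R[i]) : (forall l, l \in s -> cabs (c l) <= 1) ->
  pser (fun z => \sum_(l <- s) e l * (1 - c l * z)^-1) (fun k => \sum_(l <- s) e l * c l ^+ k).
Proof.
elim: s => [|a s IH] Hs.
  move=> r r01; exists 0, 0; split; rewrite ?lexx ?ltr01 // => z n _.
  by rewrite !big_nil big1 ?subrr ?cabs0 ?mul0r // => k _; rewrite big_nil mul0r.
have h1 := pserZ (e a) (pser_kernel (Hs a (mem_head _ _))).
have h2 := IH (fun l ls => Hs l (mem_behead (s := a :: s) ls)).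
have := pserD h1 h2; congr pser; apply/funext => z; by rewrite big_cons.
Qed.

Lemma analytic_kernel_sum s (e c : R[i] -> R[i]) : (forall l, l \in s -> cabs (c l) <= 1) ->
  analytic (fun z => \sum_(l <- s) e l * (1 - c l * z)^-1).
Proof.
move=> Hs; apply: (@eq_analytic _ (fun z => \sum_(l <- s | l \in s) e l * (1 - c l * z)^-1)).
  by move=> z _; rewrite -big_seq.
by apply: analytic_sum => l ls; apply: analyticZ; apply: analytic_kernel; exact: Hs.
Qed.

(** Lagrange interpolation with Blaschke products in place of polynomials: [B l] vanishes on u
    except at l, and the kernel factor 1 / (1 - conj l z) makes the norm computable by
    [carleson_coef]. The points of u outside s only contribute zeros. *)
Lemma interp s u A (c : R[i] -> R[i]) : uniq s -> uniq u -> {subset s <= u} ->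
  (forall l, l \in u -> cabs l < 1) -> 0 <= A -> carl s A ->
  exists f, [/\ hardy f (32 * A * \sum_(l <- s) mm l * cabs (c l) ^+ 2 /
      \prod_(i <- u | i != l) (1 - pp l i)),
    forall l, l \in s -> f l = c l & forall l, l \in u -> l \notin s -> f l = 0].
Proof.
move=> us uu su Hu A0 HA; have Hs l : l \in s -> cabs l < 1 by move=> /su/Hu.
have [q /andP[q0 q1] Hq] := seq_bound Hu.
pose B l z := \prod_(i <- u | i != l) bl i z.
pose d l := c l / B l l.
pose f z := \sum_(l <- s) d l * (mm l)%:C * (B l z * (1 - l^* * z)^-1).
have B0 l : l \in u -> B l l != 0.
  move=> lu; rewrite /B prodf_seq_neq0; apply/allP => i iu; apply/implyP => il.
  by rewrite bl_eq0 ?Hu // eq_sym.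
have Bz l l' : l' \in u -> l' != l -> B l l' = 0.
  by move=> l'u l'l; apply/eqP; rewrite /B prodf_seq_eq0; apply/hasP; exists l' => //=; rewrite l'l bl_ll eqxx.
have fval l : l \in s -> f l = c l.
  move=> ls; rewrite /f (bigD1_seq l) //= big1_seq ?addr0 => [|l' /andP[l'l l's]]; last first.
    by rewrite Bz ?mul0r ?mulr0 ?su // eq_sym.
  have m0 : (mm l)%:C != 0 :> R[i] by rewrite -cabs_eq0 cabsC normr_eq0 gt_eqF // mm_gt0 // Hs.
  rewrite one_subJ -/(mm l) /d; have := B0 l (su l ls); set b := B l l => b0.
  by field; rewrite b0 m0.
have fzero l : l \in u -> l \notin s -> f l = 0.
  move=> lu ls; rewrite /f big1_seq // => l' /andP[_ l's]; rewrite Bz ?mul0r ?mulr0 //.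
  by apply: contraNneq ls => ->.
exists f; split=> //.
(* f is analytic up to the radius 1 / q > 1, so its mean over the unit circle makes sense: it is the
   mean of [F] over |z| = q, and it dominates the means of f over smaller circles. *)
pose F z := f ((q^-1)%:C * z).
have cq l : l \in u -> cabs (l^* * (q^-1)%:C) <= 1.
  move=> lu; rewrite cabsM cabsJ cabsC ger0_norm ?invr_ge0 ?(ltW q0) //.
  by rewrite ler_pdivrMr // mul1r Hq.
have aker l : l \in u -> analytic (fun z => (1 - l^* * ((q^-1)%:C * z))^-1).
  move=> lu; apply: eq_analytic (analytic_kernel (cq l lu)) => z _; by rewrite mulrA.
have aF : analytic F.
  apply: (@eq_analytic _ (fun z => \sum_(l <- s | l \in s) d l * (mm l)%:C *
     (\prod_(i <- u | (i != l) && (i \in u)) bl i ((q^-1)%:C * z) * (1 - l^* * ((q^-1)%:C * z))^-1))).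
    move=> z _; rewrite -big_seq /F /f; apply: eq_bigr => l _; congr (_ * (_ * _)).
    by rewrite /B [RHS]big_seq_cond; apply: eq_bigl => i; rewrite andbC.
  apply: analytic_sum => l ls; apply: analyticZ; apply: analyticM; last by apply: aker; exact: su.
  apply: analytic_prod => i /andP[_ iu]; apply: analyticM; last exact: aker.
  apply: analyticB; last exact: analytic_cst.
  by apply: analyticZ; exact: analytic_id.
have af : analytic f.
  have e z : f z = F (q%:C * z).
    by rewrite /F mulrA -rmorphM /= mulVf ?gt_eqF // mul1r.
  apply: (@eq_analytic _ (fun z => F (q%:C * z))) => [z _|]; first by rewrite e.
  by apply: analytic_scale => //; rewrite cabsC ger0_norm ltW.
split=> // r /andP[r0 r1].
have q01 : 0 <= q < 1 by rewrite ltW.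
have -> : circ2 r f = circ2 (q * r) F.
  by rewrite /F circ2_scale mulrA mulVf ?gt_eqF // mul1r.
apply: (@le_trans _ _ (circ2 q F)).
  by apply: circ2_mono => //; [rewrite mulr_ge0 // ltW|rewrite ler_piMr // ltW].
pose e l := (d l * (mm l)%:C)^*.
pose g z := \sum_(l <- s) e l * (1 - l^* * (q^-1)%:C * z)^-1.
have cs l : l \in s -> cabs (l^* * (q^-1)%:C) <= 1 by move=> ls; apply: cq; exact: su.
(* On the unit circle B / (z - l) and 1 / (1 - l^* z) have the same modulus. *)
have -> : circ2 q F = circ2 q g.
  rewrite /circ2; congr (_ * _); apply: eq_rint => t _; congr (_ ^+ 2).
  rewrite /F /g; under [in RHS]eq_bigr do rewrite -mulrA.
  set z := (q^-1)%:C * _.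
  have z1 : cabs z = 1.
    by rewrite /z cabsM cabsC cabs_on_circle ?(ltW q0) // ger0_norm ?invr_ge0 ?(ltW q0) // mulVf // gt_eqF.
  have zz : z * z^* = 1 by rewrite mulJ z1 expr1n.
  have z0 : z != 0 by rewrite -cabs_eq0 z1 oner_eq0.
  have zl l : l \in u -> z - l != 0.
    by move=> lu; rewrite subr_eq0; apply: contraTneq (Hu l lu) => <-; rewrite z1 ltxx.
  have zk l : l \in u -> 1 - l^* * z != 0.
    by move=> lu; have := cabs_bl_circle (Hu l lu) z1 => h; apply: contra_eq_neq h => h; rewrite /bl h invr0 mulr0 cabs0 eq_sym oner_eq0.
  have -> : f z = bprod u z * \sum_(l <- s) d l * (mm l)%:C / (z - l).
    rewrite /f mulr_sumr; apply: eq_big_seq => l ls; have lu := su l ls.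
    rewrite /bprod (bigD1_seq l) //= -/(B l z) /bl.
    by field; rewrite zl ?zk.
  have -> : \sum_(l <- s) d l * (mm l)%:C / (z - l) = (z * \sum_(l <- s) e l * (1 - l^* * z)^-1)^*.
    rewrite mulr_sumr rmorph_sum /=; apply: eq_big_seq => l ls; have lu := su l ls.
    rewrite (conjM z) (conjM (e l)) /e conjK conjV conj1B (conjM l^*) conjK.
    have -> : 1 - l * z^* = z^* * (z - l) by rewrite mulrBr [z^* * z]mulrC zz mulrC.
    have z2 : z^* != 0 by rewrite -cabs_eq0 cabsJ z1 oner_eq0.
    by have := zl l lu => h; field; rewrite h z2.
  rewrite cabsM cabsJ cabsM z1 mul1r cabs_prod big1_seq ?mul1r // => l /andP[_ lu].
  by apply: cabs_bl_circle => //; exact: Hu.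
have ag : analytic g := analytic_kernel_sum e cs.
apply: (circ2_le_sum ag (pser_kernel_sum e cs) q01) => n.
have -> : \sum_(k < n) cabs (\sum_(l <- s) e l * (l^* * (q^-1)%:C) ^+ k) ^+ 2 * q ^+ (2 * k) =
   \sum_(k < n) cabs (\sum_(l <- s) e l * l^* ^+ k) ^+ 2.
  apply: eq_bigr => k _; under eq_bigr do rewrite exprMn mulrA.
  rewrite -mulr_suml cabsM cabsX cabsC ger0_norm ?invr_ge0 ?(ltW q0) // exprMn -mulrA.
  by rewrite -exprM [(k * 2)%N]mulnC -exprMn mulVf ?gt_eqF // expr1n mulr1.
apply: le_trans (carleson_coef e n Hs A0 HA) _.
rewrite le_eqVlt; apply/orP; left; apply/eqP; congr (_ * _); apply: eq_big_seq => l ls.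
have lu := su l ls; have m0 := mm_gt0 (Hs l ls).
rewrite /e cabsJ cabsM cabsC gtr0_norm // /d cabs_div.
have BE : cabs (B l l) ^+ 2 = \prod_(i <- u | i != l) (1 - pp l i).
  rewrite /B cabs_prod -prodrXl big_seq_cond [RHS]big_seq_cond; apply: eq_bigr => i /andP[iu _].
  by rewrite bl_sqr ?Hu.
rewrite -BE; have b0 : cabs (B l l) != 0 by rewrite cabs_eq0 B0.
by field; rewrite b0 gt_eqF.
Qed.
End blaschke.

(** * Configurations in rings *)

Section scaled_circle.
Context {R : realType}.
Implicit Types (a b z l : R[i]) (s : R).

(** The quantity [pp] of the disc |z| < s rescaled to the unit disc. It governs the Blaschke factors
    when zeros are divided out on |z| = s. *)
Definition pps s a b := pp ((s^-1)%:C * a) ((s^-1)%:C * b).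

Let ss s a b := cabs ((s ^+ 2)%:C - b^* * a).

Lemma mm_scale s a : 0 < s -> mm ((s^-1)%:C * a) = (s ^+ 2 - cabs a ^+ 2) / s ^+ 2.
Proof.
move=> s0; rewrite /mm cabsM cabsC ger0_norm ?invr_ge0 ?(ltW s0) //.
by field; rewrite gt_eqF.
Qed.

Let ppsE s a b : 0 < s -> 0 < ss s a b ->
  pps s a b = (s ^+ 2 - cabs a ^+ 2) * (s ^+ 2 - cabs b ^+ 2) / ss s a b ^+ 2.
Proof.
move=> s0 k0; rewrite /pps /pp !mm_scale //.
have -> : dd ((s^-1)%:C * a) ((s^-1)%:C * b) = ss s a b ^+ 2 / s ^+ 4.
  rewrite /dd /ss.
  have -> : 1 - ((s^-1)%:C * b)^* * ((s^-1)%:C * a) = (s^-1 ^+ 2)%:C * ((s ^+ 2)%:C - b^* * a).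
    rewrite conjM conj_real mulrBr -rmorphM -exprMn mulVf ?gt_eqF // expr1n rmorph1 rmorphXn /=.
    by congr (_ - _); ring.
  rewrite cabsM cabsC ger0_norm ?exprn_ge0 ?invr_ge0 ?(ltW s0) // exprMn mulrC -exprM.
  by rewrite exprVn.
by field; rewrite !gt_eqF.
Qed.

Section pair.
Variables (s : R) (a b : R[i]).
Hypotheses (s0 : 0 < s) (s1 : s < 1) (as_ : cabs a < s) (bs : cabs b < s).

Let a1 : cabs a < 1. Proof. exact: lt_trans s1. Qed.
Let b1 : cabs b < 1. Proof. exact: lt_trans s1. Qed.

Let w0 : cabs (b^* * a) < s ^+ 2.
Proof. by rewrite cabsM cabsJ expr2; apply: ltr_pM. Qed.

Let k0 : 0 < ss s a b.
Proof.
rewrite /ss; have := lerB_cabs (s ^+ 2)%:C (b^* * a); rewrite cabsC ger0_norm ?sqr_ge0 //.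
by move: w0; lra.
Qed.

Lemma rho2_scale : 1 - pps s a b = (1 - pp a b) *
  (1 + (1 - s ^+ 2) * (s ^+ 2 - cabs (b^* * a) ^+ 2) / ss s a b ^+ 2).
Proof.
have d0 := dd_gt0 a1 b1; rewrite ppsE // /pp.
have e1 : ss s a b ^+ 2 - (s ^+ 2 - cabs a ^+ 2) * (s ^+ 2 - cabs b ^+ 2) = s ^+ 2 * cabs (a - b) ^+ 2.
  by rewrite /ss !cabs2E !ReImE /=; ring.
have e2 : dd a b - mm a * mm b = cabs (a - b) ^+ 2.
  by rewrite /dd /mm !cabs2E !ReImE /=; ring.
have e3 : s ^+ 2 * dd a b = ss s a b ^+ 2 + (1 - s ^+ 2) * (s ^+ 2 - cabs (b^* * a) ^+ 2).
  by rewrite /dd /ss !cabs2E !ReImE /=; ring.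
have k2 : 0 < ss s a b ^+ 2 by rewrite exprn_gt0.
transitivity (s ^+ 2 * cabs (a - b) ^+ 2 / ss s a b ^+ 2); first by rewrite -e1; field; rewrite gt_eqF.
transitivity (cabs (a - b) ^+ 2 / dd a b * (s ^+ 2 * dd a b / ss s a b ^+ 2)).
  by field; rewrite !gt_eqF.
by rewrite e3 -e2; field; rewrite !gt_eqF.
Qed.

Lemma pps_le : pps s a b <= pp a b.
Proof.
have := rho2_scale; have h : 0 <= (1 - s ^+ 2) * (s ^+ 2 - cabs (b^* * a) ^+ 2) / ss s a b ^+ 2.
  rewrite divr_ge0 ?sqr_ge0 // mulr_ge0 // subr_ge0; first by rewrite expr_le1 // ltW.
  rewrite lerXn2r ?nnegrE ?(ltW s0) //; apply: (le_trans (ltW w0)).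
  by rewrite expr2 ler_piMl // ltW.
have := pp_le1 a1 b1; move: h; move: (_ / _) => x; nra.
Qed.

(** This places a so far inside |z| = s that replacing 1 by s^2 changes 1 - conj b a by at most a
    quarter of its modulus. *)
Hypothesis deep : 8 * (1 - s) <= 1 - cabs a.

Let kk := dd_ge a1 b1.

Let s2 : 1 - s ^+ 2 <= cabs (1 - b^* * a) / 4.
Proof. by move: kk deep; have := cabs_ge0 a; have := cabs_ge0 b; move: s0 s1 b1; nra. Qed.

Let kb : 3 / 4 * cabs (1 - b^* * a) <= ss s a b <= 5 / 4 * cabs (1 - b^* * a).
Proof.
have e : (s ^+ 2)%:C - b^* * a = (1 - b^* * a) - (1 - s ^+ 2)%:C.
  by rewrite rmorphB rmorph1; ring.
rewrite /ss e; have := lerB_cabs (1 - b^* * a) (1 - s ^+ 2)%:C.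
have := cabsB (1 - b^* * a) (1 - s ^+ 2)%:C; rewrite cabsC ger0_norm; last first.
  by rewrite subr_ge0 expr_le1 // ltW.
by move: s2; lra.
Qed.

Let scale_le : (1 - s ^+ 2) * (s ^+ 2 - cabs (b^* * a) ^+ 2) / ss s a b ^+ 2 <=
  4 * (1 - s) * ((mm a)^-1 + (mm b)^-1) * pp a b.
Proof.
have := mm_gt0 a1; have := mm_gt0 b1; have d0 := dd_gt0 a1 b1 => mb ma.
have -> : 4 * (1 - s) * ((mm a)^-1 + (mm b)^-1) * pp a b = 4 * (1 - s) * (mm a + mm b) / dd a b.
  by rewrite /pp; field; rewrite !gt_eqF.
have k2 : 0 < ss s a b ^+ 2 by rewrite exprn_gt0.
have h1 : dd a b <= 16 / 9 * ss s a b ^+ 2.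
  rewrite /dd; have := cabs_ge0 (1 - b^* * a); case/andP: kb => h _; nra.
have h2 : 0 <= s ^+ 2 - cabs (b^* * a) ^+ 2 <= mm a + mm b.
  apply/andP; split.
    rewrite subr_ge0 lerXn2r ?nnegrE ?(ltW s0) //; apply: (le_trans (ltW w0)).
    by rewrite expr2 ler_piMl // ltW.
  rewrite /mm cabsM cabsJ exprMn; have : s ^+ 2 <= 1 by rewrite expr_le1 // ltW.
  have : 0 <= mm a * mm b by rewrite mulr_ge0 // ltW.
  rewrite /mm; lra.
case/andP: h2 => h2 h3.
have h4 : 1 - s ^+ 2 <= 2 * (1 - s) by move: s0 s1; nra.
have h5 : 0 <= 1 - s ^+ 2 by rewrite subr_ge0 expr_le1 // ltW.
rewrite ler_pdivrMr // mulrAC ler_pdivlMr //.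
apply: (@le_trans _ _ ((2 * (1 - s) * (mm a + mm b)) * (16 / 9 * ss s a b ^+ 2))).
  by rewrite ler_pM ?mulr_ge0 // ?(ltW d0) // ler_pM.
have : 0 <= (1 - s) * (mm a + mm b) * ss s a b ^+ 2.
  apply: mulr_ge0; last exact: ltW.
  by apply: mulr_ge0; [rewrite subr_ge0 ltW|rewrite addr_ge0 // ltW].
by move: (ss s a b ^+ 2) => y; nra.
Qed.

(** The distortion is proportional to [pp a b] times (1 - s) (1 / mm a + 1 / mm b), a quantity that
    can be summed over the rings of b. *)
Lemma rho2_scale_le : 1 - pps s a b <=
  (1 - pp a b) * (1 + 4 * (1 - s) * ((mm a)^-1 + (mm b)^-1) * pp a b).
Proof. by rewrite rho2_scale ler_wpM2l ?subr_ge0 ?pp_le1 // lerD2l. Qed.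

(** Dividing [bl b] by the Blaschke factor of the disc of radius s leaves, up to a unimodular
    constant, (s^2 - conj b a) / (s (1 - conj b a)); this bounds the modulus of that quotient from
    below. *)
Lemma dd_scale_le : s ^+ 2 * dd a b <=
  (1 + 4 * (1 - s) * ((mm a)^-1 + (mm b)^-1) * pp a b) * cabs ((s ^+ 2)%:C - b^* * a) ^+ 2.
Proof.
have e3 : s ^+ 2 * dd a b = ss s a b ^+ 2 + (1 - s ^+ 2) * (s ^+ 2 - cabs (b^* * a) ^+ 2).
  by rewrite /dd /ss !cabs2E !ReImE /=; ring.
by rewrite e3 [leRHS]mulrDl mul1r -/(ss s a b) lerD2l -ler_pdivrMr ?exprn_gt0.
Qed.

Hypothesis deepb : 8 * (1 - s) <= 1 - cabs b.

Lemma mm_scale_ge : 3 / 4 * mm a <= mm ((s^-1)%:C * a).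
Proof.
rewrite mm_scale // ler_pdivlMr ?exprn_gt0 //; have := mm_le a1 => /andP[h1 _].
have h2 : mm a * s ^+ 2 <= mm a by rewrite ler_piMr ?ltW ?mm_gt0 // expr_lt1 // ltW.
have : 1 - s ^+ 2 <= 2 * (1 - s) by move: s0 s1; nra.
by move: h1 h2 deep; rewrite /mm; nra.
Qed.

Lemma pp_le_pps : pp a b <= 3 * pps s a b.
Proof.
have := mm_gt0 a1; have := mm_gt0 b1; have d0 := dd_gt0 a1 b1 => mb ma.
have /andP[ha _] := mm_le a1; have /andP[hb _] := mm_le b1.
have h4 : 1 - s ^+ 2 <= 2 * (1 - s) by move: s0 s1; nra.
have h5 : 3 / 4 * mm a <= s ^+ 2 - cabs a ^+ 2 by move: h4 ha deep; rewrite /mm; lra.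
have h6 : 3 / 4 * mm b <= s ^+ 2 - cabs b ^+ 2 by move: h4 hb deepb; rewrite /mm; lra.
rewrite ppsE // /pp ler_pdivrMr // mulrA mulrAC ler_pdivlMr ?exprn_gt0 //.
have h7 : ss s a b ^+ 2 <= 25 / 16 * dd a b.
  by rewrite /dd; have := cabs_ge0 (1 - b^* * a); case/andP: kb => _; have := ltW k0; nra.
have h8 : 9 / 16 * (mm a * mm b) <= (s ^+ 2 - cabs a ^+ 2) * (s ^+ 2 - cabs b ^+ 2).
  have -> : 9 / 16 * (mm a * mm b) = (3 / 4 * mm a) * (3 / 4 * mm b) by field.
  by rewrite ler_pM // mulr_ge0 // ltW.
apply: (@le_trans _ _ (mm a * mm b * (25 / 16 * dd a b))).
  by rewrite ler_pM2l // mulr_gt0.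
have : 0 < mm a * mm b by rewrite mulr_gt0.
by move: h8; move: (mm a * mm b) (_ * (_ - _)) => x y h8 x0; nra.
Qed.
End pair.

Lemma cabs_scale_lt1 s a : 0 < s -> cabs a < s -> cabs ((s^-1)%:C * a) < 1.
Proof.
by move=> s0 h; rewrite cabsM cabsC ger0_norm ?invr_ge0 ?(ltW s0) // ltr_pdivrMl // mulr1.
Qed.
End scaled_circle.

(** * Ring indices and sums over rings *)

Section rings.
Context {R : realType}.
Variable r : nat -> R.
Hypothesis hr : radii r.
Variable p : nat.
Hypothesis p0 : (0 < p)%N.
Hypothesis Hp : forall j i, 1 - r (j + i * p)%N <= (1 - r j) * 2^-1 ^+ i.
Implicit Types (z l a b : R[i]) (s : seq R[i]) (A : R).
Local Notation t k := (1 - r k).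

Definition rk z : nat := get [set n | r n <= cabs z < r n.+1].

Let rmono := radii_mono hr.
Let rge0 := radii_ge0 hr.
Let rlt1 := radii_lt1 hr.

Let t_gt0 k : 0 < t k. Proof. by rewrite subr_gt0. Qed.

Lemma rkP z : cabs z < 1 -> r (rk z) <= cabs z < r (rk z).+1.
Proof.
move=> z1; apply: (@getPex _ [set n | r n <= cabs z < r n.+1]).
have [n hn] : exists n, cabs z < r n.
  have [n hn] := @radii_small _ _ hr ((1 - cabs z) / 2) ltac:(lra).
  by exists n; lra.
elim: n hn => [|n IH] hn.
  by case: hr hn => -> _ _ _; have := cabs_ge0 z; lra.
by have [/IH //|h] := ltP (cabs z) (r n); exists n; rewrite /= h hn.
Qed.

Lemma rk_lt z n : cabs z < 1 -> (rk z < n)%N = (cabs z < r n).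
Proof.
move=> /rkP/andP[h1 h2]; apply/idP/idP => [h|h]; first by apply: lt_le_trans h2 _; exact: rmono.
by rewrite ltnNge; apply/negP => h'; have := le_lt_trans h1 h; rewrite ltNge rmono.
Qed.

Lemma rk_eq z n : r n <= cabs z < r n.+1 -> rk z = n.
Proof.
move=> /andP[h1 h2]; have z1 := lt_trans h2 (rlt1 n.+1).
apply/eqP; rewrite eqn_leq -ltnS rk_lt // h2 /= leqNgt rk_lt // -leNgt h1 //.
Qed.

(** Going down by p rings halves the terms, and any p consecutive terms add up to at most p. *)
Lemma radii_sum K : \sum_(k < K.+1) t K / t k <= (2 * p)%:R.
Proof.
have tK k K' : (k <= K')%N -> t K' / t k <= 1.
  by move=> h; rewrite ler_pdivrMr // mul1r lerD2l lerN2 rmono.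
have [m] := ubnP K; elim: m K => // m IH K Km.
have [Kp|pK] := ltnP K p.
  apply: (@le_trans _ _ (\sum_(k < K.+1) 1)).
    by apply: ler_sum => k _; apply: tK; rewrite -ltnS.
  by rewrite sumr_const card_ord ler_nat; lia.
have -> : K.+1 = ((K - p).+1 + p)%N by lia.
rewrite big_split_ord /=.
have h1 : \sum_(i < (K - p).+1) t K / t i <= p%:R.
  apply: (@le_trans _ _ (2^-1 * \sum_(i < (K - p).+1) t (K - p)%N / t i)).
    rewrite mulr_sumr; apply: ler_sum => i _; rewrite mulrA ler_pM2r ?invr_gt0 //.
    have := Hp (K - p)%N 1; rewrite mul1n subnK // expr1; lra.
  have := IH (K - p)%N ltac:(lia); rewrite natrM; lra.
have h2 : \sum_(i < p) t K / t ((K - p).+1 + i)%N <= p%:R.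
  apply: (@le_trans _ _ (\sum_(i < p) 1)); last by rewrite sumr_const card_ord.
  by apply: ler_sum => i _; apply: tK; have := ltn_ord i; lia.
by rewrite natrM; lra.
Qed.

(** For i = 4 the bound is 1/2, so points that lie 4 p rings beyond z are at distance at least 1/2
    from it; the recurring 4 p comes from here. *)
Lemma pp_far z l n i : cabs z < r n.+1 -> r (n.+1 + i * p)%N <= cabs l -> cabs l < 1 ->
  pp z l <= 8 * 2^-1 ^+ i.
Proof.
move=> hz hl l1; have z1 := lt_trans hz (rlt1 _).
have := mm_gt0 l1; have := mm_gt0 z1; have d0 := dd_gt0 z1 l1 => mz ml.
have /andP[z2 z3] := mm_le z1; have /andP[l2 l3] := mm_le l1.
have hd : (1 - cabs z) ^+ 2 <= dd z l.
  rewrite /dd lerXn2r ?nnegrE ?subr_ge0 ?(ltW z1) //; apply: le_trans (dd_ge z1 l1).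
  by rewrite lerD2l lerN2 ler_piMr // ltW.
have h := Hp n.+1 i; have x0 : 0 < 2^-1 ^+ i :> R by rewrite exprn_gt0.
rewrite /pp ler_pdivrMr //; apply: (@le_trans _ _ (8 * 2^-1 ^+ i * (1 - cabs z) ^+ 2)).
  have h1 : mm l <= 2 * (2^-1 ^+ i * (1 - cabs z)).
    apply: le_trans l3 _; rewrite ler_pM2l //; apply: (@le_trans _ _ (t n.+1 * 2^-1 ^+ i)); first by lra.
    by rewrite mulrC ler_pM2l //; lra.
  apply: (@le_trans _ _ (2 * (1 - cabs z) * (2 * (2^-1 ^+ i * (1 - cabs z))))).
    by rewrite ler_pM // ltW.
  have : 0 <= 2^-1 ^+ i * (1 - cabs z) ^+ 2 by rewrite mulr_ge0 ?sqr_ge0 // ltW.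
  by move: (2^-1 ^+ i) => x; lra.
by rewrite ler_pM2l // mulr_gt0.
Qed.

Section configuration.
Variable L : set R[i].
Hypothesis L1 : forall l, L l -> cabs l < 1.

(** Finite subsets of L as duplicate-free lists. All sums over L are controlled through them, with
    constants that do not depend on the list. *)
Definition fin s := uniq s /\ forall l, l \in s -> L l.

Lemma fin_filter s (P : pred R[i]) : fin s -> fin (seq.filter P s).
Proof. by move=> [u H]; split=> [|l]; rewrite ?filter_uniq // mem_filter => /andP[_ /H]. Qed.

Lemma fin_lt1 s : fin s -> forall l, l \in s -> cabs l < 1.
Proof. by move=> [_ H] l /H/L1. Qed.

Lemma fin_prod01 s (P : pred R[i]) z : fin s -> cabs z < 1 ->
  0 <= \prod_(l <- s | P l) (1 - pp z l) <= 1.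
Proof.
move=> fs z1; rewrite big_seq_cond.
apply: (@rho2_prod_le1 _ _ s (fun l => (l \in s) && P l) id z _ z1).
by move=> l /andP[ls _]; exact: fin_lt1 ls.
Qed.

(* The points of L in one ring form a Carleson sequence, uniformly over the rings. *)
Definition CR A := 0 <= A /\ forall s k z, fin s -> cabs z < 1 ->
  \sum_(l <- s | rk l == k) pp z l <= A.

Lemma sum_rings s (F : R[i] -> R) (a b : nat) : \sum_(l <- s | (a <= rk l < b)%N) F l =
  \sum_(a <= k < b) \sum_(l <- s | rk l == k) F l.
Proof.
rewrite (eq_bigr (fun k => \sum_(l <- s) if rk l == k then F l else 0)); last first.
  by move=> k _; rewrite -big_mkcond.
rewrite exchange_big /= [LHS]big_mkcond /=; apply: eq_bigr => l _.
have [h|h] := boolP (a <= rk l < b)%N.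
  rewrite (bigD1_seq (rk l)) ?mem_index_iota ?iota_uniq //= eqxx big1 ?addr0 // => k.
  by rewrite eq_sym => /negbTE ->.
rewrite big_nat_cond big1 // => k /andP[/andP[h1 h2] _].
by rewrite ifF //; apply/negbTE; apply: contraNneq h => ->; rewrite h1.
Qed.

Let pp_ge0 s z l : fin s -> cabs z < 1 -> l \in s -> 0 <= pp z l.
Proof. by move=> fs z1 /(fin_lt1 fs) l1; rewrite ltW // pp_gt0. Qed.

Lemma pp_retract z z' l k : cabs z' = r k.+1 -> z' = (r k.+1 / cabs z)%:C * z ->
  r k.+1 <= cabs z -> cabs z < 1 -> cabs l < r k.+1 ->
  pp z l <= 8 * ((1 - cabs z) / t k.+1) * pp z' l.
Proof.
move=> z'E z'z kz z1 lk; have z'1 : cabs z' < 1 by rewrite z'E.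
have l1 : cabs l < 1 by apply: lt_trans lk _.
have z0 : 0 < cabs z by apply: lt_le_trans kz; apply: le_lt_trans (cabs_ge0 l) lk.
have d0 := dd_gt0 z1 l1; have d1 := dd_gt0 z'1 l1; have ml := mm_gt0 l1.
have /andP[_ mz] := mm_le z1; have /andP[mz' _] := mm_le z'1.
have hzz : cabs (z - z') = cabs z - r k.+1.
  have -> : z - z' = (1 - r k.+1 / cabs z)%:C * z by rewrite z'z rmorphB rmorph1; ring.
  rewrite cabsM cabsC ger0_norm ?subr_ge0 ?ler_pdivrMr ?mul1r //.
  by rewrite mulrBl mul1r divfK // gt_eqF.
have hd : dd z' l <= 4 * dd z l.
  suff h : cabs (1 - l^* * z') <= 2 * cabs (1 - l^* * z).
    by rewrite /dd; have := cabs_ge0 (1 - l^* * z'); nra.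
  have -> : 1 - l^* * z' = (1 - l^* * z) + l^* * (z - z') by ring.
  apply: le_trans (cabsD _ _) _; rewrite cabsM cabsJ hzz.
  have := dd_ge z1 l1; have := cabs_ge0 l; nra.
rewrite /pp z'E in mz' *; have tk := t_gt0 k.+1.
have -> : 8 * ((1 - cabs z) / t k.+1) * (mm z' * mm l / dd z' l) =
  2 * (1 - cabs z) * (4 * (mm z' / t k.+1)) * mm l / dd z' l by field; rewrite !gt_eqF.
rewrite ler_pdivrMr // mulrAC ler_pdivlMr //.
have h1 : 1 <= mm z' / t k.+1 by rewrite ler_pdivlMr // mul1r.
have h2 : dd z' l <= 4 * (mm z' / t k.+1) * dd z l.
  apply: le_trans hd _; rewrite ler_pM2r //; lra.
apply: (@le_trans _ _ (2 * (1 - cabs z) * mm l * (4 * (mm z' / t k.+1) * dd z l))).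
  by rewrite ler_pM ?mulr_ge0 ?(ltW ml) ?(ltW d1) ?ler_pM2r // ltW // mm_gt0.
by rewrite le_eqVlt; apply/orP; left; apply/eqP; ring.
Qed.

Section CR_bounds.
Variable A : R.
Hypothesis HA : CR A.
Let A0 := HA.1.

(** The point z is retracted radially to the circle r_(k + 1), where [CR] applies; the comparison in
    [pp_retract] supplies the decay in 1 - |z|. *)
Lemma CR_outside s k z : fin s -> r k.+1 <= cabs z -> cabs z < 1 ->
  \sum_(l <- s | rk l == k) pp z l <= 8 * A * ((1 - cabs z) / t k.+1).
Proof.
move=> fs kz z1; pose z' := (r k.+1 / cabs z)%:C * z.
have rk0 : 0 < r k.+1 by case: hr => _ ri _ _; exact: le_lt_trans (rge0 k) (ri k).
have z0 : 0 < cabs z by apply: lt_le_trans kz.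
have z'E : cabs z' = r k.+1.
  by rewrite /z' cabsM cabsC ger0_norm ?divr_ge0 // divfK // gt_eqF.
apply: (@le_trans _ _ (8 * ((1 - cabs z) / t k.+1) * \sum_(l <- s | rk l == k) pp z' l)).
  rewrite mulr_sumr big_seq_cond [leRHS]big_seq_cond; apply: ler_sum => l /andP[ls /eqP lk].
  apply: pp_retract => //; have /andP[_] := rkP (fin_lt1 fs ls); by rewrite lk.
have q0 : 0 <= (1 - cabs z) / t k.+1 by rewrite divr_ge0 // ?subr_ge0 ltW.
rewrite [leRHS](_ : _ = 8 * ((1 - cabs z) / t k.+1) * A); last by ring.
apply: ler_wpM2l; first by rewrite mulr_ge0.
by apply: HA.2 => //; rewrite z'E.
Qed.

Lemma CR_inner s z : fin s -> cabs z < 1 ->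
  \sum_(l <- s | (rk l < rk z)%N) pp z l <= (16 * p)%:R * A.
Proof.
move=> fs z1; have /andP[h1 h2] := rkP z1; set n := rk z in h1 h2 *.
have -> : \sum_(l <- s | (rk l < n)%N) pp z l = \sum_(0 <= k < n) \sum_(l <- s | rk l == k) pp z l.
  by rewrite -sum_rings.
apply: (@le_trans _ _ (\sum_(0 <= k < n) 8 * A * (t n / t k.+1))).
  rewrite !big_nat; apply: ler_sum => k /andP[_ kn].
  apply: le_trans (CR_outside fs (le_trans (rmono kn) h1) z1) _.
  by rewrite ler_wpM2l ?mulr_ge0 // ler_pM2r ?invr_gt0 //; lra.
rewrite -mulr_sumr.
have := radii_sum n; rewrite big_ord_recl /= => h.
have h3 : \sum_(0 <= k < n) t n / t k.+1 <= (2 * p)%:R.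
  apply: le_trans h; rewrite big_mkord lerDr divr_ge0 // ltW //; exact: t_gt0.
rewrite [leRHS](_ : _ = 8 * A * (2 * p)%:R); last by rewrite !natrM; ring.
by rewrite ler_wpM2l // mulr_ge0.
Qed.

Lemma CR_total s z m : fin s -> cabs z < 1 ->
  \sum_(l <- s | (rk l < rk z + m)%N) pp z l <= (16 * p + m)%:R * A.
Proof.
move=> fs z1; have h := CR_inner fs z1.
have e : \sum_(l <- s | (rk l < rk z + m)%N) pp z l =
    \sum_(l <- s | (rk l < rk z)%N) pp z l + \sum_(rk z <= k < rk z + m) \sum_(l <- s | rk l == k) pp z l.
  rewrite -sum_rings (bigID (fun l => (rk l < rk z)%N)) /=; congr (_ + _); apply: eq_bigl => l; lia.
rewrite e natrD mulrDl lerD //; apply: (@le_trans _ _ (\sum_(rk z <= k < rk z + m) A)).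
  by apply: ler_sum => k _; exact: HA.2.
by rewrite sumr_const_nat addKn mulr_natl.
Qed.

(** By [pp_far] a point with [pp z l] at least eta lies at most a fixed number of rings beyond z, so
    [CR_total] applies. *)
Lemma CR_near eta : 0 < eta -> exists2 C : R, 0 <= C & forall s z, fin s -> cabs z < 1 ->
  \sum_(l <- s | eta <= pp z l) pp z l <= C.
Proof.
move=> e0; have [i Hi] := @geom_small R 8 (2^-1) (eta / 2) ltac:(lra) ltac:(lra).
exists ((16 * p + (1 + i * p))%:R * A); first by rewrite mulr_ge0.
move=> s z fs z1; apply: le_trans (CR_total (1 + i * p) fs z1).
rewrite big_mkcond [leRHS]big_mkcond /= !big_seq; apply: ler_sum => l ls.
have l1 := fin_lt1 fs ls; case: ifPn => [h|_]; last by case: ifP => // _; exact: pp_ge0 ls.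
rewrite ifT // rk_lt // ltNge; apply/negP => h2.
have /andP[_ hz] := rkP z1.
have := @pp_far z l (rk z) i hz; rewrite addSn -addnS => /(_ h2 l1).
by have := Hi i (leqnn _); lra.
Qed.

(** At the centre each point below r_N contributes at least 1 - r_N to a total of at most N A. The
    lengths of such lists are therefore bounded, and a longest one contains all the points. *)
Lemma CR_finite N : exists2 s, fin s & forall l, L l -> cabs l < r N -> l \in s.
Proof.
have bnd s : fin s -> (forall l, l \in s -> cabs l < r N) -> (size s)%:R * t N <= N%:R * A.
  move=> fs sN; have z1 : cabs (0 : R[i]) < 1 by rewrite cabs0.
  have -> : (size s)%:R * t N = \sum_(l <- s) t N by rewrite big_const_seq count_predT iter_addr_0 mulr_natl.
  apply: (@le_trans _ _ (\sum_(l <- s | (0 <= rk l < N)%N) pp 0 l)).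
    rewrite [leRHS]big_mkcond !big_seq; apply: ler_sum => l ls; have l1 := fin_lt1 fs ls.
    rewrite rk_lt // sN //= /pp /dd mulr0 subr0 cabs1 expr1n divr1 /mm cabs0 expr0n subr0 mul1r.
    by have /andP[h _] := mm_le l1; apply: le_trans h; rewrite lerD2l lerN2 ltW // sN.
  rewrite sum_rings; apply: (@le_trans _ _ (\sum_(0 <= k < N) A)).
    by apply: ler_sum => k _; exact: HA.2.
  by rewrite sumr_const_nat subn0 mulr_natl.
pose good n := `[< exists s, [/\ fin s, (forall l, l \in s -> cabs l < r N) & size s = n] >].
have ex : exists n, good n by exists 0%N; apply/asboolP; exists [::].
pose B := Num.truncn (N%:R * A / t N).
have ub n : good n -> (n <= B)%N.
  move=> /asboolP[s [fs sN <-]]; rewrite truncn_ge_nat; last by rewrite divr_ge0 ?mulr_ge0 // ltW.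
  by rewrite ler_pdivlMr //; exact: bnd.
case: (ex_maxnP ex ub) => n /asboolP[s [fs sN sz]] mx.
exists s => // l Ll lN; apply/negPn/negP => ls.
suff /mx : good n.+1 by rewrite ltnn.
apply/asboolP; exists (l :: s); split.
- split; first by rewrite /= ls; case: fs.
  by move=> x; rewrite inE => /predU1P[-> //|]; case: fs => _; apply.
- by move=> x; rewrite inE => /predU1P[-> //|]; exact: sN.
- by rewrite /= sz.
Qed.

Section scaling.
Variables (s : seq R[i]) (z : R[i]) (K : nat).
Hypotheses (fs : fin s) (z1 : cabs z < 1) (zK : 8 * t K <= 1 - cabs z).

Let tK := t_gt0 K.

Let rz : cabs z < r K. Proof. by move: tK zK; lra. Qed.

Let rK0 : 0 < r K. Proof. by apply: le_lt_trans rz. Qed.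

Let x l := 4 * t K * ((mm z)^-1 + (mm l)^-1) * pp z l.

(** Of 24 p, the terms with 1 / mm l give 8 p, and those with 1 / mm z give 8 p on the rings inside
    z and 8 p on the rings from z on. Each of these sums over rings is geometric in blocks of p. *)
Let hx : \sum_(l <- s | (rk l < K)%N) x l <= (24 * p)%:R * A.
Proof.
have /andP[mz _] := mm_le z1; have mz0 := mm_gt0 z1.
  have nK : (rk z < K)%N by rewrite rk_lt.
  have S2 : \sum_(0 <= k < K) t K / t k.+1 <= (2 * p)%:R.
    have := radii_sum K; rewrite big_ord_recl /= => h; apply: le_trans h.
    by rewrite big_mkord lerDr divr_ge0 // ltW // t_gt0.
  have e : \sum_(l <- s | (rk l < K)%N) x l = \sum_(l <- s | (rk l < K)%N) 4 * (t K / mm z) * pp z l +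
      \sum_(l <- s | (rk l < K)%N) 4 * (t K / mm l) * pp z l.
    by rewrite -big_split /=; apply: eq_bigr => l _; rewrite /x; ring.
  have h1 : \sum_(l <- s | (rk l < K)%N) 4 * (t K / mm l) * pp z l <= (8 * p)%:R * A.
    have -> : \sum_(l <- s | (rk l < K)%N) 4 * (t K / mm l) * pp z l =
       \sum_(0 <= k < K) \sum_(l <- s | rk l == k) 4 * (t K / mm l) * pp z l by rewrite -sum_rings.
    apply: (@le_trans _ _ (\sum_(0 <= k < K) 4 * (t K / t k.+1) * A)).
      apply: ler_sum => k _.
      apply: (@le_trans _ _ (4 * (t K / t k.+1) * \sum_(l <- s | rk l == k) pp z l)).
        rewrite mulr_sumr big_seq_cond [leRHS]big_seq_cond; apply: ler_sum => l /andP[ls /eqP lk].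
        have l1 := fin_lt1 fs ls; have ml := mm_gt0 l1.
        rewrite ler_wpM2r ?(pp_ge0 fs) // ler_pM2l // ler_pM2l // lef_pV2 ?posrE //.
        have /andP[_] := rkP l1; rewrite lk; have /andP[] := mm_le l1; lra.
      apply: ler_wpM2l; last exact: HA.2.
      by rewrite mulr_ge0 // divr_ge0 // ltW // t_gt0.
    rewrite -mulr_suml -mulr_sumr ler_wpM2r // (_ : (8 * p)%:R = 4 * (2 * p)%:R) ?ler_pM2l //.
    by rewrite !natrM; ring.
  have h2 : \sum_(l <- s | (rk l < K)%N) 4 * (t K / mm z) * pp z l <= (16 * p)%:R * A.
    rewrite (bigID (fun l => (rk l < rk z)%N)) /=.
    have tz : 4 * (t K / mm z) <= 2^-1 by move: zK mz; rewrite mulrA ler_pdivrMr //; lra.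
    have a1 : \sum_(l <- s | (rk l < K)%N && (rk l < rk z)%N) 4 * (t K / mm z) * pp z l <= (8 * p)%:R * A.
      rewrite -mulr_sumr.
      have -> : \sum_(l <- s | (rk l < K)%N && (rk l < rk z)%N) pp z l = \sum_(l <- s | (rk l < rk z)%N) pp z l.
        by apply: eq_bigl => l; case: (ltnP (rk l) (rk z)) => h; rewrite ?andbF // andbT (ltn_trans h nK).
      have := CR_inner fs z1; set S := \sum_(l <- s | _) _ => hS.
      have S0 : 0 <= S by rewrite /S big_seq_cond; apply: sumr_ge0 => l /andP[ls _]; exact: pp_ge0 ls.
      apply: (@le_trans _ _ (2^-1 * S)); first by rewrite ler_wpM2r.
      by rewrite natrM; rewrite natrM in hS; lra.
    have a2 : \sum_(l <- s | (rk l < K)%N && ~~ (rk l < rk z)%N) 4 * (t K / mm z) * pp z l <= (8 * p)%:R * A.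
      have -> : \sum_(l <- s | (rk l < K)%N && ~~ (rk l < rk z)%N) 4 * (t K / mm z) * pp z l =
         \sum_(rk z <= k < K) \sum_(l <- s | rk l == k) 4 * (t K / mm z) * pp z l.
        by rewrite -sum_rings; apply: eq_bigl => l; rewrite -leqNgt andbC.
      apply: (@le_trans _ _ (\sum_(rk z <= k < K) 4 * (t K / t k.+1) * A)).
        rewrite !big_nat; apply: ler_sum => k /andP[k1 k2].
        have S0 : 0 <= \sum_(l <- s | rk l == k) pp z l.
          rewrite big_seq_cond; apply: sumr_ge0 => l /andP[ls _]; exact: pp_ge0 ls.
        have tk1 := t_gt0 k.+1.
        rewrite -mulr_sumr; apply: ler_pM => //; [| |exact: HA.2].
          by rewrite mulr_ge0 // divr_ge0 // ltW.
        rewrite ler_pM2l // ler_pM2l // lef_pV2 ?posrE //.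
        have /andP[_ h] := rkP z1; have := rmono (_ : (rk z).+1 <= k.+1)%N; rewrite ltnS k1 => /(_ isT).
        lra.
      rewrite -mulr_suml -mulr_sumr ler_wpM2r // (_ : (8 * p)%:R = 4 * (2 * p)%:R); last by rewrite !natrM; ring.
      rewrite ler_pM2l //; apply: le_trans S2; rewrite [leRHS](big_cat_nat (n := rk z)) ?leq0n ?(ltnW nK) //=.
      by rewrite lerDr; apply: sumr_ge0 => k _; rewrite divr_ge0 // ltW // t_gt0.
    by apply: le_trans (lerD a1 a2) _; rewrite !natrM; lra.
  by rewrite e; apply: le_trans (lerD h2 h1) _; rewrite !natrM; lra.
Qed.

(** Each factor is distorted by at most 1 + x <= exp x, and [hx] adds the exponents. *)
Lemma rho2_prod_scale : \prod_(l <- s | (rk l < K)%N) (1 - pps (r K) z l) <=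
  expR ((24 * p)%:R * A) * \prod_(l <- s | (rk l < K)%N) (1 - pp z l).
Proof.
apply: (@le_trans _ _ (\prod_(l <- s | (rk l < K)%N) (expR (x l) * (1 - pp z l)))).
  rewrite big_seq_cond [leRHS]big_seq_cond; apply: ler_prod => l /andP[ls lK].
  have l1 := fin_lt1 fs ls; rewrite rk_lt // in lK.
  rewrite subr_ge0 (pp_le1 (cabs_scale_lt1 rK0 rz) (cabs_scale_lt1 rK0 lK)) /=.
  apply: le_trans (rho2_scale_le rK0 (rlt1 K) rz lK zK) _.
  by rewrite mulrC ler_wpM2r ?subr_ge0 ?pp_le1 // expR_ge1Dx.
rewrite big_split /= -expR_sum ler_wpM2r ?ler_expR //.
by case/andP: (fin_prod01 (fun l => (rk l < K)%N) fs z1).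
Qed.

Lemma dd_prod_scale : \prod_(l <- s | (rk l < K)%N) (r K ^+ 2 * dd z l) <=
  expR ((24 * p)%:R * A) * \prod_(l <- s | (rk l < K)%N) cabs ((r K ^+ 2)%:C - l^* * z) ^+ 2.
Proof.
apply: (@le_trans _ _ (\prod_(l <- s | (rk l < K)%N) (expR (x l) * cabs ((r K ^+ 2)%:C - l^* * z) ^+ 2))).
  rewrite big_seq_cond [leRHS]big_seq_cond; apply: ler_prod => l /andP[ls lK].
  have l1 := fin_lt1 fs ls; rewrite rk_lt // in lK.
  rewrite mulr_ge0 ?sqr_ge0 //=; apply: le_trans (dd_scale_le rK0 (rlt1 K) rz lK zK) _.
  by rewrite ler_wpM2r ?sqr_ge0 // expR_ge1Dx.
rewrite big_split /= -expR_sum ler_wpM2r ?ler_expR //.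
by apply: prodr_ge0 => l _; exact: sqr_ge0.
Qed.
End scaling.
End CR_bounds.
End configuration.
End rings.

(** * Functions of bounded weighted norm *)

Section function_space.
Context {R : realType}.
Variable r : nat -> R.
Hypothesis hr : radii r.
Variable p : nat.
Hypothesis p0 : (0 < p)%N.
Hypothesis Hp : forall j i, 1 - r (j + i * p)%N <= (1 - r j) * 2^-1 ^+ i.
Implicit Types (z l u : R[i]) (s : seq R[i]) (f g h : R[i] -> R[i]) (A B G : R).
Local Notation t k := (1 - r k).

Let half_gt0 n : 0 < 2^-1 ^+ n :> R. Proof. by rewrite exprn_gt0. Qed.
Let pow_gt0 n : 0 < 2 ^+ n :> R. Proof. by rewrite exprn_gt0. Qed.

Lemma half_pow n : 2 ^+ n * 2^-1 ^+ n = 1 :> R.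
Proof. by rewrite -exprMn divff // expr1n. Qed.

(* Comparable with 1 / K_z(z), see kernel_weight. *)
Definition weight z := 2^-1 ^+ rk r z * mm z.

Lemma weight_gt0 z : cabs z < 1 -> 0 < weight z.
Proof. by move=> z1; rewrite mulr_gt0 // mm_gt0. Qed.

Lemma wbound_ge0 f B : wbound r f B -> 0 <= B.
Proof. by case=> _ /(_ 0%N); rewrite /wsum big_geq. Qed.

Lemma wbound_mono f A B : A <= B -> wbound r f A -> wbound r f B.
Proof. by move=> AB [af H]; split=> // m; exact: le_trans (H m) AB. Qed.

Lemma wbound_circ2 f B n : wbound r f B -> (0 < n)%N -> circ2 (r n) f <= 2 ^+ n * B.
Proof.
case: n => // n [af H] _; rewrite -ler_pdivrMl // -exprVn; apply: le_trans (H n.+2).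
by rewrite /wsum big_nat_recr //= lerDr; exact: wsum_ge0.
Qed.

Lemma wbound_le f g B c : analytic g -> 0 <= c -> wbound r f B ->
  (forall n, circ2 (r n) g <= c * circ2 (r n) f) -> wbound r g (c * B).
Proof.
move=> ag c0 [af H] Hg; split=> // m; apply: le_trans (ler_wpM2l c0 (H m)).
by rewrite /wsum mulr_sumr; apply: ler_sum => n _; rewrite [leRHS]mulrCA ler_pM2l.
Qed.

Lemma wboundD f g A B : wbound r f A -> wbound r g B ->
  wbound r (fun z => f z + g z) (2 * (A + B)).
Proof.
move=> [af H] [ag H']; split=> [|m]; first exact: analyticD.
apply: (@le_trans _ _ (2 * (wsum r f m + wsum r g m))); last by rewrite ler_pM2l // lerD.
rewrite /wsum -big_split mulr_sumr; apply: ler_sum => n _ /=.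
rewrite (_ : 2 * (_ + _) = 2^-1 ^+ n * (2 * (circ2 (r n) f + circ2 (r n) g))); last by ring.
rewrite ler_pM2l //.
by apply: circ2D; apply: analytic_ccont => //; exact: radii01.
Qed.

Lemma wboundM f h B : wbound r f B -> analytic h -> (forall z, cabs z < 1 -> cabs (h z) <= 1) ->
  wbound r (fun z => h z * f z) B.
Proof.
move=> Hf ah h1; have [af _] := Hf; rewrite -[B]mul1r; apply: wbound_le Hf _ => //.
  exact: analyticM.
move=> n; apply: circ2_le (analytic_ccont (analyticM ah af) (radii01 hr n)) (analytic_ccont af (radii01 hr n)) _.
move=> x; rewrite cabsM exprMn; apply: ler_wpM2r; first exact: sqr_ge0.
rewrite expr_le1 //.
by apply: h1; rewrite cabs_on_circle ?radii_ge0 ?radii_lt1.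
Qed.

Lemma wboundZ f c B : wbound r f B -> wbound r (fun z => c * f z) (cabs c ^+ 2 * B).
Proof.
move=> Hf; have [af _] := Hf; apply: wbound_le Hf _; rewrite ?sqr_ge0 //; first exact: analyticZ.
move=> n; apply: circ2_le (analytic_ccont (analyticZ c af) (radii01 hr n)) (analytic_ccont af (radii01 hr n)) _.
by move=> x; rewrite cabsM exprMn.
Qed.

Lemma wboundB f g A B : wbound r f A -> wbound r g B ->
  wbound r (fun z => f z - g z) (2 * (A + B)).
Proof.
move=> Hf /(wboundZ (-1)) Hg; have := wboundD Hf Hg.
rewrite cabsN cabs1 expr1n mul1r (_ : (fun z => _) = (fun z => f z - g z)) //.
by apply/funext => z; rewrite mulN1r.
Qed.

Lemma eq_wbound f g B : (forall z, cabs z < 1 -> f z = g z) -> wbound r f B -> wbound r g B.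
Proof.
move=> e Hf; have [af _] := Hf; rewrite -[B]mul1r; have ag := eq_analytic e af.
apply: wbound_le Hf _ => // n; rewrite mul1r /circ2 ler_pM2l ?invr_gt0 ?pi2_gt0 //.
rewrite le_eqVlt; apply/orP; left; apply/eqP; apply: eq_rint => x _.
by rewrite e // cabs_on_circle ?radii_ge0 ?radii_lt1.
Qed.

(** Cauchy-Schwarz with free weights [lam]: sums of almost orthogonal functions are estimated
    without a factor equal to the number of terms. *)
Lemma circ2_sum_le (I : Type) (s : seq I) (F : I -> R[i] -> R[i]) (lam : I -> R) rho :
  (forall i, analytic (F i)) -> (forall i, 0 < lam i) -> 0 <= rho < 1 ->
  circ2 rho (fun z => \sum_(i <- s) F i z) <=
  (\sum_(i <- s) lam i) * \sum_(i <- s) (lam i)^-1 * circ2 rho (F i).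
Proof.
move=> aF l0 r01; set La := \sum_(i <- s) lam i.
have cF i := analytic_ccont (aF i) r01.
have c2 i := continuous_cabs2 (cF i).
pose phi t' := \sum_(i <- s) (lam i)^-1 * cabs (F i (on_circle rho t')) ^+ 2.
have [cphi ephi] : continuous phi /\ rint 0 (2 * pi) phi =
    \sum_(i <- s) (lam i)^-1 * rint 0 (2 * pi) (fun t' => cabs (F i (on_circle rho t')) ^+ 2).
  rewrite /phi; elim: (s) => [|i s' [IH1 IH2]].
    rewrite big_nil; under eq_fun do rewrite big_nil.
    by split; [move=> ?; exact: cvg_cst|rewrite rint_2pi_cst mul0r].
  rewrite big_cons; under eq_fun do rewrite big_cons.
  have ci : continuous (fun t' => (lam i)^-1 * cabs (F i (on_circle rho t')) ^+ 2).
    by move=> ?; apply: cvgM; [exact: cvg_cst|exact: c2].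
  split; first by move=> ?; apply: cvgD; [exact: ci|exact: IH1].
  by rewrite (rintD _ _ ci IH1) IH2 (rintZ _ _ _ (c2 i)).
have -> : \sum_(i <- s) (lam i)^-1 * circ2 rho (F i) = (2 * pi)^-1 * rint 0 (2 * pi) phi.
  by rewrite ephi mulr_sumr; apply: eq_bigr => i _; rewrite /circ2 mulrCA.
rewrite mulrCA /circ2 ler_pM2l ?invr_gt0 ?pi2_gt0 // -(rintZ _ _ _ cphi).
apply: ler_rint; rewrite ?pi2_ge0 //.
- apply: (continuous_cabs2 (g := fun t' => \sum_(i <- s) F i (on_circle rho t'))).
  exact: (analytic_ccont (analytic_sum s (P := xpredT) (fun i _ => aF i)) r01).
- by move=> ?; apply: cvgM; [exact: cvg_cst|exact: cphi].
- move=> t' _; rewrite /phi.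
  apply: (@le_trans _ _ ((\sum_(i <- s) Num.sqrt (lam i) * (Num.sqrt (lam i)^-1 * cabs (F i (on_circle rho t')))) ^+ 2)).
    rewrite lerXn2r ?nnegrE //; first by apply: sumr_ge0 => i _; rewrite !mulr_ge0 ?sqrtr_ge0.
    apply: le_trans (cabs_sum _ _ _) _; apply: ler_sum => i _.
    by rewrite mulrA -sqrtrM ?(ltW (l0 _)) // divff ?gt_eqF // sqrtr1 mul1r.
  apply: le_trans (cauchy_schwarz_sum _ _ _) _.
  rewrite le_eqVlt; apply/orP; left; apply/eqP; congr (_ * _); apply: eq_bigr => i _.
    by rewrite sqr_sqrtr // ltW.
  by rewrite exprMn sqr_sqrtr // invr_ge0 ltW.
Qed.

Lemma wbound_series (f : nat -> R[i] -> R[i]) B :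
  (forall k, wbound r (f k) (B * 4^-1 ^+ k)) ->
  exists F, wbound r F (12 * B) /\ forall z, cabs z < 1 -> forall e, 0 < e -> exists N,
    forall n, (N <= n)%N -> cabs (F z - \sum_(k < n) f k z) <= e.
Proof.
move=> Hf; have af k : analytic (f k) := (Hf k).1.
have B0 : 0 <= B by have := wbound_ge0 (Hf 0%N); rewrite expr0 mulr1.
have sq4 k : 4^-1 ^+ k = (2^-1 ^+ k) ^+ 2 :> R by rewrite -exprM mulnC exprM; congr (_ ^+ _); field.
have unif rho : 0 <= rho < 1 -> exists2 C : R, 0 <= C & forall k z, cabs z <= rho ->
    cabs (f k z) <= C * 2^-1 ^+ k.
  move=> /andP[rho0 rho1]; have [N HN] := @radii_small _ _ hr ((1 - rho) / 2) ltac:(lra).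
  have rN : rho < r N by lra.
  have rN0 : 0 < r N by apply: le_lt_trans rN.
  have N0 : (0 < N)%N by case: N rN0 {HN rN} => //; case: hr => -> _ _ _; rewrite ltxx.
  pose d := 1 - (rho / r N) ^+ 2.
  have q0 : 0 <= rho / r N by rewrite divr_ge0 // ltW.
  have d0 : 0 < d by rewrite subr_gt0 expr_lt1 // ltr_pdivrMr // mul1r.
  exists (Num.sqrt (2 ^+ N * B / d)); first exact: sqrtr_ge0.
  move=> k z zr; have zN := le_lt_trans zr rN.
  have := hardy_point (hardy_scale (af k) (radii01 hr N)) (cabs_scale_lt1 rN0 zN).
  rewrite mulrA -rmorphM divff ?gt_eqF // rmorph1 mul1r => h.
  have {}h := le_trans h (wbound_circ2 (Hf k) N0).
  apply: ler_sqr2; first by rewrite mulr_ge0 ?sqrtr_ge0 // ltW.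
  rewrite exprMn sqr_sqrtr; last by rewrite divr_ge0 ?mulr_ge0 // ltW.
  rewrite -sq4 mulrAC ler_pdivlMr // -[leRHS]mulrA; apply: le_trans h.
  rewrite ler_wpM2l ?sqr_ge0 // /mm lerD2l lerN2 cabsM cabsC ger0_norm ?invr_ge0 ?(ltW rN0) //.
  by rewrite lerXn2r ?nnegrE ?mulr_ge0 ?invr_ge0 ?(ltW rN0) // mulrC ler_pM2r ?invr_gt0.
pose S n z := \sum_(k < n) f k z.
have SS n z : S n.+1 z - S n z = f n z by rewrite /S big_ord_recr /= [_ + f n z]addrC addrK.
have half01 : 0 <= (2^-1 : R) < 1 by lra.
have lim z : cabs z < 1 -> exists F, forall rho C, 0 <= rho < 1 -> 0 <= C -> cabs z <= rho ->
    (forall k z, cabs z <= rho -> cabs (f k z) <= C * 2^-1 ^+ k) ->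
    forall n, cabs (F - S n z) <= 4 * C * 2^-1 ^+ n.
  move=> z1; have [C C0 HC] := unif (cabs z) ltac:(by rewrite cabs_ge0).
  have [F HF] := @fast_cauchy R (S^~ z) C _ half01 ltac:(by
    move=> n; rewrite SS; exact: HC).
  exists F => rho C' rho01 C'0 zr HC' n.
  have [F' HF'] := @fast_cauchy R (S^~ z) C' _ half01 ltac:(by
    move=> k; rewrite SS; exact: HC').
  have e : F = F'.
    apply: cabs_small_eq => e e0.
    have [N1 H1] := geom_small (2 * (C / (1 - 2^-1))) half01 (divr_gt0 e0 (ltr0n R 2)).
    have [N2 H2] := geom_small (2 * (C' / (1 - 2^-1))) half01 (divr_gt0 e0 (ltr0n R 2)).
    pose m := maxn N1 N2.
    have h1 := HF m; have h2 := HF' m.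
    have h3 := H1 m (leq_maxl _ _); have h4 := H2 m (leq_maxr _ _).
    have := cabsB (F - S m z) (F' - S m z); rewrite opprB addrA subrK => h5.
    by rewrite -mulrA in h3; rewrite -mulrA in h4; lra.
  rewrite e; apply: le_trans (HF' n) _; rewrite le_eqVlt; apply/orP; left; apply/eqP; by field.
have [F HF] : exists F : R[i] -> R[i], forall z, cabs z < 1 -> forall rho C, 0 <= rho < 1 -> 0 <= C -> cabs z <= rho ->
    (forall k z, cabs z <= rho -> cabs (f k z) <= C * 2^-1 ^+ k) ->
    forall n, cabs (F z - S n z) <= 4 * C * 2^-1 ^+ n.
  pose P z (y : R[i]) := cabs z < 1 -> forall rho C, 0 <= rho < 1 -> 0 <= C -> cabs z <= rho ->
    (forall k z, cabs z <= rho -> cabs (f k z) <= C * 2^-1 ^+ k) ->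
    forall n, cabs (y - S n z) <= 4 * C * 2^-1 ^+ n.
  have /choice[F HF] : forall z, exists y, P z y.
    move=> z; have [z1|z1] := boolP (cabs z < 1); first by have [y Hy] := lim z z1; exists y => _.
    by exists 0 => h; rewrite h in z1.
  by exists F.
have aS n : analytic (S n) by apply: analytic_sum => k _; exact: af.
have aF : analytic F.
  apply: analytic_ulimit => rho e /andP[rho0 rho1] e0.
  have rho01 : 0 <= rho < 1 by rewrite ltW.
  have [C C0 HC] := unif rho rho01; have [N HN] := geom_small (4 * C) half01 e0.
  exists (S N) => // z zr; apply: le_trans (HN N (leqnn _)).
  exact: (HF z (le_lt_trans zr rho1) rho C rho01 C0 zr HC).
exists F; split; last first.
  move=> z z1 e e0; have z01 : 0 <= cabs z < 1 by rewrite cabs_ge0.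
  have [C C0 HC] := unif _ z01; have [N HN] := geom_small (4 * C) half01 e0.
  by exists N => n /HN; apply: le_trans; exact: (HF z z1 (cabs z)).
split=> // m.
have WS n : wsum r (S n) m <= 6 * B.
  (* The ratio 3/4 leaves both the sum of [lam], at most 4, and the sum of 4^-k / lam = 3^-k, at
     most 3/2, finite. Partial sums are thus bounded by 6 B, and passing to the limit doubles
     this. *)
  pose lam k : R := (3 / 4) ^+ k.
  have l0 k : 0 < lam k by rewrite exprn_gt0 // divr_gt0.
  have Sl : \sum_(k < n) lam k <= 4.
    have := @geom_sum_le R (3 / 4) n ltac:(lra) => h; apply: le_trans h _.
    by rewrite (_ : 1 - 3 / 4 = 4^-1) ?invrK //; field.
  apply: (@le_trans _ _ (4 * \sum_(k < n) (lam k)^-1 * wsum r (f k) m)).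
    rewrite /wsum mulr_sumr; under [leRHS]eq_bigr do rewrite !mulr_sumr.
    rewrite exchange_big /=; apply: ler_sum => j _.
    have := @circ2_sum_le 'I_n (index_enum 'I_n) f lam (r j) af l0 (radii01 hr j) => h.
    apply: (@le_trans _ _ (2^-1 ^+ j * (4 * \sum_(k < n) (lam k)^-1 * circ2 (r j) (f k)))).
      rewrite ler_pM2l //; apply: le_trans h _; rewrite ler_wpM2r //.
      by apply: sumr_ge0 => k _; rewrite mulr_ge0 ?invr_ge0 ?(ltW (l0 _)) // circ2_ge0' // radii01.
    rewrite le_eqVlt; apply/orP; left; apply/eqP; rewrite !mulr_sumr; apply: eq_bigr => k _; ring.
  apply: (@le_trans _ _ (4 * \sum_(k < n) B * 3^-1 ^+ k)).
    rewrite ler_pM2l //; apply: ler_sum => k _; rewrite mulrC ler_pdivrMr //.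
    apply: le_trans ((Hf k).2 m) _; rewrite /lam -mulrA -exprMn.
    by rewrite (_ : 3^-1 * (3 / 4) = 4^-1) //; field.
  rewrite -mulr_sumr.
  have h : \sum_(k < n) 3^-1 ^+ k <= (1 - 3^-1 : R)^-1 := @geom_sum_le R (3^-1) n ltac:(lra).
  have e3 : (1 - 3^-1 : R)^-1 = 3 / 2 by field.
  rewrite e3 in h; have := ler_wpM2l B0 h; lra.
apply/ler_addgt0Pr => e e0.
have [C C0 HC] := unif (r m) (radii01 hr m).
have [N HN] := @geom_small R (32 * C ^+ 2) (4^-1) e ltac:(lra) e0.
have hN := HN N (leqnn _).
have W2 : wsum r (fun z => F z - S N z) m <= 16 * C ^+ 2 * 4^-1 ^+ N.
  apply: (@le_trans _ _ (\sum_(1 <= j < m) 2^-1 ^+ j * (16 * C ^+ 2 * 4^-1 ^+ N))).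
    rewrite /wsum !big_nat; apply: ler_sum => j /andP[_ jm]; rewrite ler_pM2l //.
    apply: circ2_bound => [|x].
      exact: (analytic_ccont (analyticB aF (aS N)) (radii01 hr j)).
    have hj : cabs (on_circle (r j) x) <= r m.
      by rewrite cabs_on_circle ?radii_ge0 // radii_mono // ltnW.
    have := HF _ (le_lt_trans hj (radii_lt1 hr m)) _ _ (radii01 hr m) C0 hj HC N => h.
    rewrite (_ : 16 * C ^+ 2 * 4^-1 ^+ N = (4 * C * 2^-1 ^+ N) ^+ 2); last by rewrite sq4; ring.
    by rewrite lerXn2r ?nnegrE // !mulr_ge0 // ltW.
  rewrite -mulr_suml ler_piMl ?mulr_ge0 ?sqr_ge0 ?exprn_ge0 //.
  case: m {WS HC} => [|m]; first by rewrite big_geq.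
  rewrite big_add1 /=; under eq_bigr do rewrite exprS.
  by rewrite -mulr_sumr; have := sum_half_le (R := R) m; lra.
have W1 := WS N.
apply: (@le_trans _ _ (2 * (wsum r (fun z => F z - S N z) m + wsum r (S N) m))).
  rewrite /wsum -big_split mulr_sumr; apply: ler_sum => n _ /=.
  rewrite (_ : 2 * (_ + _) = 2^-1 ^+ n * (2 * (circ2 (r n) (fun z => F z - S N z) + circ2 (r n) (S N)))); last by ring.
  rewrite ler_pM2l //.
  have := @circ2D R (r n) (fun z => F z - S N z) (S N); rewrite (_ : (fun z => F z - S N z + S N z) = F).
    by apply; [exact: (analytic_ccont (analyticB aF (aS N)) (radii01 hr n))|exact: (analytic_ccont (aS N) (radii01 hr n))].
  by apply/funext => z; rewrite subrK.
by move: hN; rewrite -mulrA; move: W2; rewrite -mulrA; move: (C ^+ 2 * _) => x; lra.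
Qed.
End function_space.

(** * Weighted data, test functions and the Bessel inequality *)

Section sequence_space.
Context {R : realType}.
Variable r : nat -> R.
Hypothesis hr : radii r.
Variable p : nat.
Hypothesis p0 : (0 < p)%N.
Hypothesis Hp : forall j i, 1 - r (j + i * p)%N <= (1 - r j) * 2^-1 ^+ i.
Variable L : set R[i].
Hypothesis L1 : forall l, L l -> cabs l < 1.
Implicit Types (z l u : R[i]) (s : seq R[i]) (f g h a : R[i] -> R[i]) (A B G C X : R).
Local Notation t k := (1 - r k).
Local Notation v := (weight r).

Let half_gt0 n : 0 < 2^-1 ^+ n :> R. Proof. by rewrite exprn_gt0. Qed.
Let pow_gt0 n : 0 < 2 ^+ n :> R. Proof. by rewrite exprn_gt0. Qed.

(** X bounds the squared norm of the data, with [weight] in place of the reciprocal of the kernel on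
    the diagonal. *)
Definition tot a X := forall s, fin L s -> \sum_(l <- s) v l * cabs (a l) ^+ 2 <= X.

Lemma tot_point a X l : tot a X -> L l -> v l * cabs (a l) ^+ 2 <= X.
Proof.
move=> Ha Ll; have := Ha [:: l]; rewrite big_seq1; apply; split=> // x.
by rewrite inE => /eqP ->.
Qed.

(** Each round quarters the squared norm of the residual, so the corrections satisfy the hypothesis
    of [wbound_series], and the residual tends to 0 at every point. *)
Lemma iterate C : 0 <= C -> (forall a X, 0 <= X -> tot a X ->
    exists2 f, wbound r f (C * X) & tot (fun l => a l - f l) (X / 4)) ->
  forall a X, 0 <= X -> tot a X ->
    exists2 f, wbound r f (12 * (C * X)) & forall l, L l -> f l = a l.
Proof.
move=> C0 step a X X0 Ha.
have /choice[st Hst] : forall y : (R[i] -> R[i]) * R, exists f, 0 <= y.2 -> tot y.1 y.2 ->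
    wbound r f (C * y.2) /\ tot (fun l => y.1 l - f l) (y.2 / 4).
  move=> [b Y]; have [[Y0 Hb]|n] := pselect (0 <= Y /\ tot b Y).
    by have [f h1 h2] := step b Y Y0 Hb; exists f.
  by exists (fun=> 0) => h1 h2; case: n.
pose next (y : (R[i] -> R[i]) * R) := (fun l => y.1 l - st y l, y.2 / 4).
pose y k := iter k next (a, X).
have yE k : (y k).2 = X * 4^-1 ^+ k.
  by elim: k => [|k IH]; rewrite ?expr0 ?mulr1 //= IH exprSr mulrA.
have yk k : 0 <= (y k).2 /\ tot (y k).1 (y k).2.
  elim: k => [//|k [h1 h2]]; split; first by rewrite /= divr_ge0.
  by have [] := Hst _ h1 h2.
have fk k : wbound r (st (y k)) (C * X * 4^-1 ^+ k).
  by have [h1 h2] := yk k; have [] := Hst _ h1 h2; rewrite yE mulrA.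
have [F [HF HS]] := wbound_series hr fk.
exists F => // l Ll; have l1 := L1 Ll.
have aE n : a l - \sum_(k < n) st (y k) l = (y n).1 l.
  by elim: n => [|n IH]; rewrite ?big_ord0 ?subr0 // big_ord_recr /= opprD addrA IH.
apply: cabs_small_eq => e e0; have e2 : 0 < e / 2 by rewrite divr_gt0.
have [N1 H1] := HS l l1 _ e2.
have v0 := weight_gt0 r l1.
have [N2 H2] := @geom_small R (X / v l) (4^-1) ((e / 2) ^+ 2) ltac:(lra) ltac:(by rewrite exprn_gt0).
have h1 := H1 _ (leq_maxl N1 N2); have h2 := H2 _ (leq_maxr N1 N2).
have h3 : cabs (a l - \sum_(k < maxn N1 N2) st (y k) l) <= e / 2.
  apply: ler_sqr2; first exact: ltW.
  apply: le_trans h2; have := tot_point (yk (maxn N1 N2)).2 Ll; rewrite yE aE => h.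
  by rewrite mulrAC ler_pdivlMr // mulrC.
move: h1 h3; set S := \sum_(_ < _) _ => h1 h3.
have := cabsB (F l - S) (a l - S); rewrite opprB addrA subrK; lra.
Qed.

Lemma sum_geo_dist (x : R) (j n' : nat) : 0 <= x < 1 ->
  \sum_(k < n') x ^+ (k - j) * x ^+ (j - k) <= 2 / (1 - x).
Proof.
move=> x01; have x0 i : 0 <= x ^+ i by rewrite exprn_ge0 //; case/andP: x01.
have [nj|jn] := leqP n' j.
  rewrite (eq_bigr (fun k : 'I_n' => x ^+ (j - k))); last first.
    by move=> k _; rewrite (eqP (_ : k - j == 0)%N) ?expr0 ?mul1r // subn_eq0 ltnW // (leq_trans (ltn_ord k)).
  apply: (@le_trans _ _ (\sum_(k < j.+1) x ^+ (j - k))).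
    rewrite -(subnKC (leqW nj)) big_split_ord /= lerDl; apply: sumr_ge0 => k _; exact: x0.
  rewrite (reindex_inj rev_ord_inj) /= (eq_bigr (fun k : 'I_j.+1 => x ^+ k)); last first.
    by move=> k _; congr (_ ^+ _); rewrite subSS subKn // -ltnS.
  have := geom_sum_le j.+1 x01; have : 0 <= (1 - x)^-1 by rewrite invr_ge0 subr_ge0 ltW //; case/andP: x01.
  lra.
rewrite -(subnKC jn) big_split_ord /=.
have h1 : \sum_(k < j.+1) x ^+ (k - j) * x ^+ (j - k) <= (1 - x)^-1.
  rewrite (reindex_inj rev_ord_inj) /= (eq_bigr (fun k : 'I_j.+1 => x ^+ k)); last first.
    move=> k _; have kj : (k <= j)%N by rewrite -ltnS.
    by rewrite subSS (subKn kj) (eqP (_ : j - k - j == 0)%N) ?mul1r // subn_eq0 leq_subr.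
  by have := geom_sum_le j.+1 x01.
have h2 : \sum_(k < n' - j.+1) x ^+ (j.+1 + k - j) * x ^+ (j - (j.+1 + k)) <= (1 - x)^-1.
  apply: (@le_trans _ _ (\sum_(k < n' - j.+1) x ^+ k)).
    apply: ler_sum => k _; rewrite (eqP (_ : j - (j.+1 + k) == 0)%N) ?mulr1 ?subn_eq0; last first.
      by rewrite addSn leqW // leq_addr.
    by rewrite addSnnS addKn exprS ler_piMl ?x0 // ltW //; case/andP: x01.
  by have := geom_sum_le (n' - j.+1) x01.
lra.
Qed.

(** The powers of [peak] times Hardy functions. The last clause says that such products for
    different rings are almost orthogonal, since only 2^-|k - j| of ring k is seen on the circle
    j. *)
Lemma test_function : exists (M : nat -> nat) (c C : R), [/\ 0 < c /\ 0 < C,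
  forall k l, r k <= cabs l -> c <= cabs (l ^+ M k) ^+ 2,
  forall k f G, hardy f G -> wbound r (fun u => u ^+ M k * f u) (C * 2^-1 ^+ k * G),
  forall k z, cabs z < 1 -> wbound r (fun u => u ^+ M k * (1 - z^* * u)^-1) (C * 2^-1 ^+ k / mm z) &
  forall (F : nat -> R[i] -> R[i]) (G : nat -> R) n, (forall k, hardy (F k) (G k)) ->
    wbound r (fun u => \sum_(k < n) u ^+ M k * F k u) (C * \sum_(k < n) 2^-1 ^+ k * G k)].
Proof.
have [M [c [C [c0 C0 Hc HC]]]] := peak hr.
have single k f G : hardy f G -> wbound r (fun u => u ^+ M k * f u) (3 * C * 2^-1 ^+ k * G).
  move=> Hf; have [af HG] := Hf; have G0 := hardy_ge0 Hf.
  split=> [|m]; first by apply: (analyticM _ af); apply: analyticX; exact: analytic_id.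
  have tm j : 2^-1 ^+ j * circ2 (r j) (fun u => u ^+ M k * f u) <=
      C * 2^-1 ^+ k * G * (2^-1 ^+ (k - j) * 2^-1 ^+ (j - k)).
    rewrite (circ2_monomial _ af (radii01 hr j)).
    apply: (@le_trans _ _ (2^-1 ^+ j * r j ^+ (2 * M k) * G)).
      by rewrite mulrA ler_wpM2l ?HG ?radii01 // mulr_ge0 ?exprn_ge0 // radii_ge0.
    apply: le_trans (ler_wpM2r G0 (HC k j)) _.
    by rewrite le_eqVlt; apply/orP; left; apply/eqP; ring.
  apply: le_trans (ler_sum _ (fun j _ => tm j)) _.
  rewrite -mulr_sumr (_ : 3 * C * _ * _ = C * 2^-1 ^+ k * G * 3); last by ring.
  by rewrite ler_wpM2l ?sum_half_dist // !mulr_ge0 // ltW.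
have hk z : cabs z < 1 -> hardy (fun u => (1 - z^* * u)^-1) (mm z)^-1.
  move=> z1; split; first by apply: analytic_kernel; rewrite cabsJ ltW.
  by move=> rho rho01; rewrite /mm -(cabsJ z); apply: circ2_kernel; rewrite ?cabsJ.
exists M, c, (48 * C); split=> //.
- by rewrite mulr_gt0.
- by move=> k l hl; rewrite cabsX -exprM mulnC; exact: Hc.
- move=> k f G Hf; apply: wbound_mono (single k f G Hf).
  have := hardy_ge0 Hf => G0; rewrite ler_wpM2r // ler_pM2r //; lra.
- move=> k z z1; apply: wbound_mono (single k _ _ (hk z z1)).
  have := mm_gt0 z1 => m0; rewrite ler_pM2r ?invr_gt0 // ler_pM2r //; lra.
- move=> F G n HF; have aF k : analytic (F k) := (HF k).1.
  have aE k : analytic (fun u => u ^+ M k * F k u).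
    by apply: (analyticM _ (aF k)); apply: analyticX; exact: analytic_id.
  split=> [|m]; first exact: (analytic_sum _ (P := xpredT) (fun (k : 'I_n) _ => aE k)).
  (* The decay 1/2 splits as (3/4)(2/3): powers of 3/4 serve as weights in Cauchy-Schwarz and add up
     to at most 8, the remaining powers of 2/3 add up over the circles to at most 6, whence 48. *)
  pose x : R := 3 / 4.
  have x01 : 0 <= x < 1 by rewrite /x; lra.
  have x0 n' : 0 < x ^+ n' by rewrite exprn_gt0 // /x divr_gt0.
  have sx j n' : \sum_(k < n') x ^+ (k - j) * x ^+ (j - k) <= 8.
    have := sum_geo_dist j n' x01; rewrite (_ : 2 / (1 - x) = 8) //; by rewrite /x; field.
  have G0 k : 0 <= G k := hardy_ge0 (HF k).
  apply: (@le_trans _ _ (\sum_(1 <= j < m) 8 * \sum_(k < n) (C * 2^-1 ^+ k * G k) * ((2 / 3) ^+ (k - j) * (2 / 3) ^+ (j - k)))).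
    apply: ler_sum => j _.
    pose lam (k : 'I_n) := x ^+ (k - j) * x ^+ (j - k).
    have l0 k : 0 < lam k by rewrite mulr_gt0.
    have := @circ2_sum_le R 'I_n (index_enum 'I_n) (fun k u => u ^+ M k * F k u) lam (r j)
      (fun k => aE k) l0 (radii01 hr j) => h.
    apply: (@le_trans _ _ (2^-1 ^+ j * (8 * \sum_(k < n) (lam k)^-1 * circ2 (r j) (fun u => u ^+ M k * F k u)))).
      rewrite ler_pM2l //; apply: le_trans h _; rewrite ler_wpM2r //.
      apply: sumr_ge0 => k _; rewrite mulr_ge0 ?invr_ge0 ?(ltW (l0 _)) // circ2_ge0' ?radii01 //.
      exact: sx.
    rewrite mulrCA ler_pM2l // mulr_sumr; apply: ler_sum => k _.
    rewrite mulrCA (circ2_monomial _ (aF k) (radii01 hr j)) mulrC ler_pdivrMr //.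
    apply: (@le_trans _ _ (2^-1 ^+ j * r j ^+ (2 * M k) * G k)).
      by rewrite mulrA ler_wpM2l ?(HF k).2 ?radii01 // mulr_ge0 ?exprn_ge0 // radii_ge0.
    apply: le_trans (ler_wpM2r (G0 k) (HC k j)) _; rewrite /lam.
    have e (i : nat) : 2^-1 ^+ i = (2 / 3) ^+ i * x ^+ i :> R.
      by rewrite -exprMn /x; congr (_ ^+ _); field.
    by rewrite (e (k - j)%N) (e (j - k)%N) le_eqVlt; apply/orP; left; apply/eqP; ring.
  rewrite -mulr_sumr exchange_big /= (_ : 48 * C * _ = 8 * \sum_(k < n) (C * 2^-1 ^+ k * G k) * 6); last first.
    by rewrite !mulr_sumr; apply: eq_bigr => k _; ring.
  rewrite ler_pM2l //; apply: ler_sum => k _; rewrite -mulr_sumr ler_wpM2l //.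
    by rewrite !mulr_ge0 // ltW.
  have y01 : 0 <= (2 / 3 : R) < 1 by lra.
  have := sum_geo_dist k m y01; rewrite (_ : 2 / (1 - 2 / 3) = 6); last by field.
  apply: le_trans; case: m => [|m]; first by rewrite big_geq // sumr_ge0.
  rewrite -(big_mkord xpredT (fun j => (2 / 3) ^+ (j - k) * (2 / 3) ^+ (k - j))) big_ltn //.
  rewrite [leLHS](eq_bigr (fun j => (2 / 3) ^+ (j - k) * (2 / 3) ^+ (k - j))) => [|j _]; last by rewrite mulrC.
  have y0 : 0 <= (2 / 3 : R) by lra.
  by rewrite lerDr; apply: mulr_ge0; exact: exprn_ge0.
Qed.

(** Ring n lies deep inside the circle r_(n + 1 + 3 p), on which f is a Hardy function, and [pps_le]
    preserves the Carleson condition. The 43 exceeds 32 * 4/3, where 4/3 comes from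
    [mm_scale_ge]. *)
Lemma ring_embedding A f s n : CR r L A -> analytic f -> fin L s ->
  \sum_(l <- s | rk r l == n) mm l * cabs (f l) ^+ 2 <= 43 * A * circ2 (r (n.+1 + 3 * p)%N) f.
Proof.
move=> [A0 HA] af fs; set N := (n.+1 + 3 * p)%N; set S := r N.
have S01 := radii01 hr N; have /andP[_ S1] := S01.
have Sn : r n.+1 < S by apply: lt_le_trans (radii_mono hr (_ : n.+2 <= N)%N); [case: hr|rewrite /N; lia].
have S0 : 0 < S by apply: le_lt_trans Sn; exact: radii_ge0.
pose s' := seq.filter (fun l => rk r l == n) s.
have fs' : fin L s' := fin_filter _ fs.
have s'P l : l \in s' -> [/\ cabs l < 1, cabs l < S & 8 * (1 - S) <= 1 - cabs l].
  move=> ls; have l1 := fin_lt1 L1 fs' ls; move: ls; rewrite mem_filter => /andP[/eqP ln _].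
  have /andP[_] := rkP hr l1; rewrite ln => h; split=> //; first exact: lt_trans Sn.
  by have := Hp n.+1 3; rewrite -/N -/S; lra.
pose sc l := (S^-1)%:C * l.
have C' : carl [seq sc l | l <- s'] A.
  move=> _ /mapP[l ls ->]; rewrite big_map; have [l1 lS _] := s'P l ls.
  apply: le_trans (HA s n l fs l1); rewrite big_filter big_seq_cond [leRHS]big_seq_cond.
  apply: ler_sum => j /andP[js jn]; have [j1 jS _] := s'P j ltac:(by rewrite mem_filter jn).
  exact: pps_le.
have H := carleson_embedding _ A0 C' (hardy_scale af S01).
have {H} := H ltac:(by move=> _ /mapP[l ls ->]; have [_ lS _] := s'P l ls; exact: cabs_scale_lt1).
rewrite big_map => h.
have h2 : 3 / 4 * \sum_(l <- s') mm l * cabs (f l) ^+ 2 <= 32 * A * circ2 S f.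
  apply: le_trans h; rewrite mulr_sumr big_seq [leRHS]big_seq; apply: ler_sum => l ls.
  have [l1 lS ld] := s'P l ls; rewrite /sc mulrA -rmorphM divff ?gt_eqF // rmorph1 mul1r.
  rewrite mulrA; apply: ler_wpM2r; first exact: sqr_ge0.
  exact: mm_scale_ge.
rewrite -big_filter -/s'; have q0 : 0 <= A * circ2 S f by rewrite mulr_ge0 // circ2_ge0'.
move: h2 q0; rewrite -![_ * A * _]mulrA; move: (\sum_(_ <- s') _) (A * _) => x y; lra.
Qed.

Lemma bessel A : CR r L A -> exists2 C, 0 <= C & forall f B, wbound r f B -> tot f (C * B).
Proof.
move=> HA; have A0 := HA.1; exists (43 * A * 2 ^+ (1 + 3 * p)); first by rewrite !mulr_ge0 // ltW.
move=> f B Hf s fs; have [af HB] := Hf.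
pose N := (\max_(l <- s) rk r l).+1.
have e : \sum_(l <- s) v l * cabs (f l) ^+ 2 =
    \sum_(0 <= k < N) 2^-1 ^+ k * \sum_(l <- s | rk r l == k) mm l * cabs (f l) ^+ 2.
  transitivity (\sum_(l <- s | (0 <= rk r l < N)%N) v l * cabs (f l) ^+ 2).
    rewrite big_seq [RHS]big_seq_cond; apply: eq_bigl => l; case ls : (l \in s) => //=.
    by rewrite ltnS leq_bigmax_seq.
  rewrite sum_rings; apply: eq_bigr => k _; rewrite mulr_sumr; apply: eq_bigr => l /eqP lk.
  by rewrite /weight lk -mulrA.
rewrite e; apply: (@le_trans _ _ (\sum_(0 <= k < N) 2^-1 ^+ k * (43 * A * circ2 (r (k.+1 + 3 * p)%N) f))).
  by apply: ler_sum => k _; rewrite ler_pM2l //; exact: ring_embedding.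
pose D := (1 + 3 * p)%N.
apply: (@le_trans _ _ (43 * A * 2 ^+ D * \sum_(0 <= k < N) 2^-1 ^+ (k + D) * circ2 (r (k + D)%N) f)).
  rewrite mulr_sumr; apply: ler_sum => k _; rewrite (_ : (k.+1 + 3 * p = k + D)%N); last by rewrite /D add1n addSnnS.
  rewrite exprD.
  have := half_pow (R := R) D; move: (2 ^+ D) (2^-1 ^+ D) (2^-1 ^+ k) (circ2 _ _) => y y' x q h.
  have -> : 43 * A * y * (x * y' * q) = (y * y') * (x * (43 * A * q)) by ring.
  by rewrite h mul1r.
rewrite ler_wpM2l ?mulr_ge0 ?(ltW (pow_gt0 _)) //; apply: le_trans (HB (N + D)%N).
rewrite /wsum [leRHS](big_cat_nat (n := D)) /= ?leq_addl //.
have -> : \sum_(D <= i < N + D) 2^-1 ^+ i * circ2 (r i) f =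
    \sum_(0 <= k < N) 2^-1 ^+ (k + D) * circ2 (r (k + D)%N) f.
  by rewrite -{1}[D]add0n big_addn addnK.
by rewrite lerDr; apply: sumr_ge0 => j _; exact: wsum_term_ge0.
Qed.
End sequence_space.

(** * Logarithmic sums and densities *)

Section density.
Context {R : realType}.
Variable r : nat -> R.
Hypothesis hr : radii r.
Variable p : nat.
Hypothesis p0 : (0 < p)%N.
Hypothesis Hp : forall j i, 1 - r (j + i * p)%N <= (1 - r j) * 2^-1 ^+ i.
Variable L : set R[i].
Hypothesis L1 : forall l, L l -> cabs l < 1.
Implicit Types (z l u : R[i]) (s : seq R[i]) (A C beta eta d : R).
Local Notation t k := (1 - r k).

Definition lg z l : R := - ln (cabs (bl l z)).

Lemma rho_le1 z l : cabs z < 1 -> cabs l < 1 -> cabs (bl l z) <= 1.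
Proof.
move=> z1 l1; have := bl_sqr l1 z1; have := pp_gt0 z1 l1; have := cabs_ge0 (bl l z); nra.
Qed.

Lemma one_sub_rho z l : cabs z < 1 -> cabs l < 1 ->
  [/\ 0 <= 1 - cabs (bl l z), 1 - cabs (bl l z) <= pp z l & pp z l <= 2 * (1 - cabs (bl l z))].
Proof.
move=> z1 l1; have := bl_sqr l1 z1; have := rho_le1 z1 l1; have := cabs_ge0 (bl l z).
by move: (cabs _) (pp z l) => x y x0 x1 e; split; nra.
Qed.

Lemma one_sub_rho_lg z l : cabs z < 1 -> cabs l < 1 -> 0 < cabs (bl l z) ->
  1 - cabs (bl l z) <= lg z l.
Proof.
move=> z1 l1 h; have := @le_ln1Dx R (cabs (bl l z) - 1) ltac:(lra).
by rewrite /lg addrC subrK; lra.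
Qed.

Lemma lg_ge0 z l : cabs z < 1 -> cabs l < 1 -> 0 <= lg z l.
Proof. by move=> z1 l1; rewrite /lg oppr_ge0 ln_le0 // rho_le1. Qed.

Lemma rho2_prod_lg s (P : pred R[i]) z : (forall l, l \in s -> P l -> 0 < cabs (bl l z)) ->
  cabs z < 1 -> (forall l, l \in s -> cabs l < 1) ->
  \prod_(l <- s | P l) (1 - pp z l) = expR (- (2 * \sum_(l <- s | P l) lg z l)).
Proof.
move=> H z1 Hs; rewrite mulr_sumr -sumrN expR_sum big_seq_cond [RHS]big_seq_cond.
apply: eq_bigr => l /andP[ls Pl]; rewrite -(bl_sqr (Hs l ls) z1) /lg.
have h := H l ls Pl; rewrite mulrN opprK (_ : 2 * ln _ = ln (cabs (bl l z)) + ln (cabs (bl l z))).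
  by rewrite expRD lnK ?posrE // expr2.
by rewrite mulr_natl mulr2n.
Qed.

(** Near points, with pp at least eta / 2, have bounded Carleson sum by [CR_near] and logarithms
    bounded through d. At the other points rho is so close to 1 that -ln rho <= (1 + eta) (1 -
    rho). *)
Lemma lg_sum_le A eta d : CR r L A -> 0 < eta <= 1 -> 0 < d < 1 ->
  exists2 C, 0 <= C & forall s (P : pred R[i]) z, fin L s -> cabs z < 1 ->
    (forall l, l \in s -> P l -> d <= cabs (bl l z)) ->
    \sum_(l <- s | P l) lg z l <= (1 + eta) * \sum_(l <- s | P l) (1 - cabs (bl l z)) + C.
Proof.
move=> HA /andP[e0 e1] /andP[d0 d1]; have e2 : 0 < eta / 2 by rewrite divr_gt0.
have [C C0 HC] := CR_near hr p0 Hp L1 HA e2.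
have ld : 0 < - ln d by rewrite oppr_gt0 ln_lt0 // d0.
pose c := - ln d / (eta / 2); have c0 : 0 < c by rewrite divr_gt0.
exists (c * C); first by rewrite mulr_ge0 // ltW.
move=> s P z fs z1 Hd.
apply: (@le_trans _ _ ((1 + eta) * \sum_(l <- s | P l) (1 - cabs (bl l z)) +
    c * \sum_(l <- s | eta / 2 <= pp z l) pp z l)); last by rewrite lerD2l ler_pM2l // HC.
rewrite mulr_sumr [X in _ <= _ + c * X]big_mkcond mulr_sumr [X in _ <= X + _]big_mkcond [leLHS]big_mkcond -big_split /=.
rewrite [leLHS]big_seq [leRHS]big_seq; apply: ler_sum => l ls.
have l1 := fin_lt1 L1 fs ls; have [h1 h2 h3] := one_sub_rho z1 l1.
have pp0 := pp_gt0 z1 l1; have := bl_sqr l1 z1; have x0 := cabs_ge0 (bl l z).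
case: ifP => Pl; last first.
  by move=> _; rewrite add0r mulr_ge0 // ?(ltW c0) //; case: ifP => // _; exact: ltW.
have hd := Hd l ls Pl; rewrite /lg; set x := cabs (bl l z) in x0 h1 h2 h3 hd *.
have xp : 0 < x by apply: lt_le_trans hd.
move=> e; case: ifPn => [near|far].
  have : - ln x <= - ln d by rewrite lerN2 ler_ln ?posrE.
  have : - ln d <= c * pp z l by rewrite /c mulrAC ler_pdivlMr // ler_pM2l.
  have : 0 <= (1 + eta) * (1 - x) by rewrite mulr_ge0 //; lra.
  lra.
rewrite mulr0 addr0 -ltNge in far *.
(* This rests on (1 + eta)^2 (1 - eta / 2) >= 1 for 0 < eta <= 1. *)
have hx : 1 <= (1 + eta) * x.
  rewrite leNgt; apply/negP => h.
  have : ((1 + eta) * x) ^+ 2 < 1 by rewrite expr_lt1 // mulr_ge0 //; lra.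
  have : 1 - eta / 2 <= x ^+ 2 by rewrite e; lra.
  rewrite exprMn; move: (x ^+ 2) => y hy; have : (1 + eta) ^+ 2 * (1 - eta / 2) <= (1 + eta) ^+ 2 * y.
    by rewrite ler_wpM2l // sqr_ge0.
  nra.
have xi : 0 < x^-1 by rewrite invr_gt0.
have := @le_ln1Dx R (x^-1 - 1) ltac:(lra).
rewrite (_ : 1 + (x^-1 - 1) = x^-1); last by ring.
rewrite lnV ?posrE // => h.
apply: le_trans h _; have -> : x^-1 - 1 = (1 - x) / x by field; rewrite gt_eqF.
rewrite ler_pdivrMr // mulrAC; nra.
Qed.

(* The upper density is less than b iff this holds for some beta < b, see upper_densityP. *)
Definition upD beta := exists m0, forall m, (m0 <= m)%N -> forall z s, cabs z < 1 -> fin L s ->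
  (forall l, l \in s -> cabs l <= r (rk r z + m)%N) ->
  \sum_(l <- s) (1 - cabs (bl l z)) <= m%:R * beta.

Definition sep d := 0 < d < 1 /\ forall a b, L a -> L b -> a <> b -> d <= cabs (bl b a).

(** The embedding is applied to the Hardy kernel at z, whose squared norm is at most 1 / (1 -
    |z|^2): a Carleson bound at the points of one ring extends to every test point. *)
Lemma carl_CR A : 0 <= A -> (forall s k, fin L s -> (forall l, l \in s -> rk r l = k) -> carl s A) ->
  CR r L (32 * A).
Proof.
move=> A0 H; split=> [|s k z fs z1]; first by rewrite mulr_ge0.
pose s' := seq.filter (fun l => rk r l == k) s.
have fs' : fin L s' := fin_filter _ fs.
have C' : carl s' A by apply: (H s' k fs') => l; rewrite mem_filter => /andP[/eqP].
have z1' : cabs z^* <= 1 by rewrite cabsJ ltW.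
have hk : hardy (fun u => (1 - z^* * u)^-1) (mm z)^-1.
  split; first exact: analytic_kernel.
  by move=> rho rho01; rewrite /mm -(cabsJ z); apply: circ2_kernel; rewrite ?cabsJ.
have := carleson_embedding (fun l ls => fin_lt1 L1 fs' ls) A0 C' hk.
have mz := mm_gt0 z1; rewrite ler_pdivlMr // => h.
rewrite -big_filter; apply: le_trans h; rewrite mulr_suml big_seq [leRHS]big_seq.
apply: ler_sum => l ls; rewrite le_eqVlt; apply/orP; left; apply/eqP.
by rewrite /pp dd_sym /dd cabsV exprVn; ring.
Qed.

(** All points of ring k have modulus below r_(k + 1), hence they occur in the density sum at any of
    them for a fixed m >= 1; the factor 2 is pp <= 2 (1 - rho). *)
Lemma upD_CR beta : upD beta -> exists A, CR r L A.
Proof.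
move=> [m0 H]; pose m := maxn m0 1.
have m0m : (m0 <= m)%N := leq_maxl _ _; have m1 : (1 <= m)%N := leq_maxr _ _.
have z0 : cabs (0 : R[i]) < 1 by rewrite cabs0.
have b0 : 0 <= m%:R * beta by have := H m m0m 0 [::] z0; rewrite big_nil; apply.
exists (32 * (2 * (m%:R * beta))); apply: carl_CR => [|s k fs Hk l ls]; first by rewrite mulr_ge0.
have l1 := fin_lt1 L1 fs ls; have := H m m0m l s l1 fs => h.
apply: (@le_trans _ _ (2 * \sum_(j <- s) (1 - cabs (bl j l)))).
  rewrite mulr_sumr big_seq [leRHS]big_seq; apply: ler_sum => j js.
  by case: (one_sub_rho l1 (fin_lt1 L1 fs js)).
rewrite ler_pM2l //; apply: h => j js; have j1 := fin_lt1 L1 fs js.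
have /andP[_ hj] := rkP hr j1; apply: le_trans (ltW hj) _.
by rewrite radii_mono // Hk // (Hk l) // -addn1 leq_add2l.
Qed.

(** The closed bound on the modulus admits m + 1 rings from that of z on, and 16 p + m + 1 <= m (16
    p + 2) for m >= 1. *)
Lemma CR_upD A : CR r L A -> upD ((16 * p + 2)%:R * A).
Proof.
move=> HA; have A0 := HA.1; exists 1%N => m m1 z s z1 fs Hs.
apply: (@le_trans _ _ (\sum_(l <- s | (rk r l < rk r z + m.+1)%N) pp z l)).
  rewrite [leRHS]big_mkcond [leLHS]big_seq [leRHS]big_seq; apply: ler_sum => l ls.
  have l1 := fin_lt1 L1 fs ls; rewrite rk_lt // ifT; first by case: (one_sub_rho z1 l1).
  by apply: le_lt_trans (Hs l ls) _; rewrite addnS; case: hr.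
apply: le_trans (CR_total hr p0 Hp L1 HA m.+1 fs z1) _; rewrite mulrA ler_wpM2r // -natrM ler_nat.
nia.
Qed.

(** s is chosen so that its sum nearly attains the supremum over all finite lists. *)
Lemma tot_tail (a : R[i] -> R[i]) (X : R) eta : tot r L a X -> 0 < eta ->
  exists2 s, fin L s & forall s', fin L s' ->
    \sum_(l <- s' | l \notin s) weight r l * cabs (a l) ^+ 2 <= eta.
Proof.
move=> Ha e0; pose S := [set y | exists2 s, fin L s & y = \sum_(l <- s) weight r l * cabs (a l) ^+ 2].
have hS : has_sup S.
  split; first by exists 0; exists [::] => //; rewrite big_nil.
  by exists X => _ [s fs ->]; exact: Ha.
have [_ [s fs ->] hs] := sup_adherent e0 hS.
exists s => // s' fs'.
pose q := s ++ seq.filter (fun l => l \notin s) s'.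
have fq : fin L q.
  split.
    rewrite cat_uniq fs.1 filter_uniq ?fs'.1 // andbT /=.
    by apply/hasPn => l; rewrite mem_filter => /andP[].
  by move=> l; rewrite mem_cat mem_filter => /orP[|/andP[_]]; [apply: fs.2|apply: fs'.2].
have : \sum_(l <- q) weight r l * cabs (a l) ^+ 2 <= sup S.
  by apply: ub_le_sup; [case: hS|exists q].
rewrite big_cat big_filter /=; move: hs; set x := \sum_(_ <- s) _; set y := \sum_(_ <- s' | _) _.
lra.
Qed.
End density.

(** * Interpolation *)

Section interpolation_sufficiency.
Context {R : realType}.
Variable r : nat -> R.
Hypothesis hr : radii r.
Variable p : nat.
Hypothesis p0 : (0 < p)%N.
Hypothesis Hp : forall j i, 1 - r (j + i * p)%N <= (1 - r j) * 2^-1 ^+ i.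
Variable L : set R[i].
Hypothesis L1 : forall l, L l -> cabs l < 1.
Implicit Types (z l u : R[i]) (s : seq R[i]) (A C beta eta d : R).
Local Notation t k := (1 - r k).
Local Notation v := (weight r).

Let half_gt0 n : 0 < 2^-1 ^+ n :> R. Proof. by rewrite exprn_gt0. Qed.

Let beyond_cut N k m n : (n < N - minn N (k.+1 - m))%N -> (k < minn N (k.+1 - m) + n + m)%N.
Proof. by clear; lia. Qed.

Let cut_le N k m : (0 < m)%N -> (minn N (k.+1 - m) <= k)%N.
Proof. by clear; lia. Qed.

Let below_cut N k m n : (n < minn N (k.+1 - m))%N -> (n + m <= k)%N /\ (n <= k - m)%N.
Proof. by clear; lia. Qed.

Section step.
Variables (A D : R) (m : nat) (M : nat -> nat) (c C : R).
Hypothesis HA : CR r L A.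
Hypothesis m1 : (0 < m)%N.
Hypothesis D0 : 0 < D.
Hypothesis HD : forall l (u : seq R[i]), L l -> fin L u -> (forall i, i \in u -> cabs i <= r (rk r l + m)%N) ->
  D <= \prod_(i <- u | i != l) (1 - pp l i).
Hypothesis c0 : 0 < c.
Hypothesis C0 : 0 < C.
Hypothesis Hc : forall k l, r k <= cabs l -> c <= cabs (l ^+ M k) ^+ 2.
Hypothesis HM : forall (F : nat -> R[i] -> R[i]) (G : nat -> R) n, (forall k, hardy (F k) (G k)) ->
    wbound r (fun u => \sum_(k < n) u ^+ M k * F k u) (C * \sum_(k < n) 2^-1 ^+ k * G k).

Let A0 : 0 <= A := HA.1.
Let K := 32 * A / (c * D).
Let K0 : 0 <= K. Proof. by rewrite divr_ge0 ?mulr_ge0 // ltW. Qed.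

Variable a : R[i] -> R[i].

Let S s n := \sum_(l <- s | rk r l == n) mm l * cabs (a l) ^+ 2.

Let u n := sval (cid2 (CR_finite hr L1 HA (n + m).+1)).

Let uP n : fin L (u n) /\ forall l, L l -> cabs l < r (n + m).+1 -> l \in u n.
Proof. by rewrite /u; case: (cid2 _). Qed.

(** The data are divided by l^(M n), which [Hc] bounds below on ring n. The zeros up to r_(n + m)
    keep this piece from disturbing other data before ring n + m. *)
Lemma ring_interpolant s n : fin L s -> exists F, [/\ hardy F (K * S s n),
  forall l, l \in s -> rk r l = n -> l ^+ M n * F l = a l &
  forall l, L l -> cabs l <= r (n + m)%N -> (rk r l != n) || (l \notin s) -> F l = 0].
Proof.
move=> fs; pose s' := seq.filter (fun l => rk r l == n) s.
pose u' := seq.filter (fun l => cabs l <= r (n + m)%N) (u n).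
have fs' : fin L s' := fin_filter _ fs.
have fu' : fin L u' := fin_filter _ (uP n).1.
have ri k : r k < r k.+1 by case: hr.
have u'P l : L l -> cabs l <= r (n + m)%N -> l \in u'.
  by move=> Ll h; rewrite mem_filter h (uP n).2 // (le_lt_trans h).
have su : {subset s' <= u'}.
  move=> l; rewrite mem_filter => /andP[/eqP ln ls]; apply: u'P; first exact: fs.2.
  have /andP[_ h] := rkP hr (fin_lt1 L1 fs ls); apply: le_trans (ltW h) _.
  by rewrite ln radii_mono // -addn1 leq_add2l.
have cs : carl s' A.
  move=> l ls; rewrite big_filter; apply: HA.2 => //; exact: (fin_lt1 L1 fs' ls).
have [F [HF Fs Fu]] := interp (fun l => a l / l ^+ M n) fs'.1 fu'.1 su
  (fun l lu => fin_lt1 L1 fu' lu) A0 cs.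
have E0 l : l \in s' -> c <= cabs (l ^+ M n) ^+ 2.
  move=> ls; apply: Hc; have l1 := fin_lt1 L1 fs' ls; have /andP[h _] := rkP hr l1.
  by move: ls; rewrite mem_filter => /andP[/eqP <- _].
exists F; split.
- have [aF HG] := HF; split=> // rho rho01; apply: le_trans (HG rho rho01) _.
  have -> : S s n = \sum_(l <- s') mm l * cabs (a l) ^+ 2 by rewrite /S big_filter.
  rewrite /K !mulr_sumr big_seq [leRHS]big_seq; apply: ler_sum => l ls.
  have l1 := fin_lt1 L1 fs' ls; have ml := mm_gt0 l1; have E := E0 l ls.
  have hD : D <= \prod_(i <- u' | i != l) (1 - pp l i).
    apply: HD => //; first exact: fs'.2.
    move=> i; rewrite mem_filter; move: ls; rewrite mem_filter => /andP[/eqP -> _].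
    by case/andP.
  have -> : 32 * A / (c * D) * (mm l * cabs (a l) ^+ 2) =
      32 * A * (mm l * (cabs (a l) ^+ 2 / c) / D) by field; rewrite !gt_eqF.
  apply: ler_wpM2l; first by rewrite mulr_ge0.
  rewrite ler_pM ?invr_ge0 //.
  + by rewrite mulr_ge0 ?sqr_ge0 // ltW.
  + exact: le_trans (ltW D0) hD.
  + rewrite ler_pM2l // cabs_div expr_div_n ler_wpM2l ?sqr_ge0 // lef_pV2 ?posrE //.
    exact: lt_le_trans E.
  + by rewrite lef_pV2 ?posrE // (lt_le_trans D0).
- move=> l ls ln; have ls' : l \in s' by rewrite mem_filter ln eqxx.
  rewrite Fs // mulrC divfK // -cabs_eq0; apply/eqP => e; have := E0 l ls'; rewrite e expr0n /=.
  by rewrite leNgt c0.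
- move=> l Ll hl ne; apply: Fu; first exact: u'P.
  by rewrite mem_filter negb_and.
Qed.

(** An error on ring k comes only from pieces n with n + m <= k and decays away from ring n + m. The
    shift by m rings gains 2^-m against the constant [K]. The number 2064 = 43 * 6 * 8 collects
    [ring_embedding] and two geometric sums, and 32 leaves X / 32 for these errors. *)
Lemma interpolation_step s (X : R) : fin L s -> 0 <= X -> tot r L a X ->
  (forall s', fin L s' -> \sum_(l <- s' | l \notin s) v l * cabs (a l) ^+ 2 <= X / 16) ->
  32 * 2064 * A * K * 2^-1 ^+ m <= 1 ->
  exists2 F, wbound r F (C * K * X) & tot r L (fun l => a l - F l) (X / 4).
Proof.
move=> fs X0 Ha Htail small.
have /choice[F HF] := fun n => ring_interpolant n fs.
pose N := (\max_(l <- s) rk r l).+1.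
pose G n := K * S s n.
have S0 n : 0 <= S s n.
  rewrite /S big_seq_cond; apply: sumr_ge0 => l /andP[ls _].
  by rewrite mulr_ge0 ?sqr_ge0 // ltW // mm_gt0 // (fin_lt1 L1 fs ls).
have G0 n : 0 <= G n by rewrite mulr_ge0.
have SX : \sum_(n < N) 2^-1 ^+ n * S s n <= X.
  apply: le_trans (Ha s fs); rewrite -(big_mkord xpredT (fun n => 2^-1 ^+ n * S s n)).
  have -> : \sum_(l <- s) v l * cabs (a l) ^+ 2 = \sum_(l <- s | (0 <= rk r l < N)%N) v l * cabs (a l) ^+ 2.
    rewrite big_seq [RHS]big_seq_cond; apply: eq_bigl => l; case ls : (l \in s) => //=.
    by rewrite ltnS leq_bigmax_seq.
  rewrite sum_rings; apply: ler_sum => n _; rewrite mulr_sumr; apply: ler_sum => l /eqP ln.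
  by rewrite /weight ln -mulrA.
have GX : \sum_(n < N) 2^-1 ^+ n * G n <= K * X.
  apply: le_trans (ler_wpM2l K0 SX); rewrite mulr_sumr; apply: ler_sum => n _.
  by rewrite mulrCA.
pose F0 n z := z ^+ M n * F n z.
have Fh n : hardy (F n) (G n) by case: (HF n).
have aF0 n : analytic (F0 n).
  by apply: (analyticM _ (Fh n).1); apply: analyticX; exact: analytic_id.
pose Ft z := \sum_(n < N) F0 n z.
exists Ft.
  apply: wbound_mono (HM N Fh); rewrite -mulrA ler_pM2l //.
(* n < k + 1 - m means n + m <= k: these are the pieces that need not vanish on ring k. *)
pose q k := minn N (k.+1 - m).
pose Rk k z := \sum_(n < q k) F0 n z.
have qN k : (q k <= N)%N := geq_minl _ _.
have resid l : L l -> a l - Ft l = (if l \in s then 0 else a l) - Rk (rk r l) l.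
  move=> Ll; have l1 := L1 Ll; have /andP[_ hl] := rkP hr l1; set k := rk r l in hl *.
  have zero n : (k < n + m)%N -> (n != k) || (l \notin s) -> F0 n l = 0.
    move=> kn ne; rewrite /F0; have [_ _ H0] := HF n; rewrite H0 ?mulr0 //.
      by apply: le_trans (ltW hl) _; apply: radii_mono.
    by rewrite eq_sym.
  suff -> : Ft l = (if l \in s then a l else 0) + Rk k l.
    by case: ifP => _; rewrite opprD addrA ?subrr ?sub0r ?subr0.
  rewrite /Ft /Rk -(subnKC (qN k)) big_split_ord /= addrC; congr (_ + _).
  case ls : (l \in s); last first.
    apply: big1 => n _; apply: zero; last by rewrite ls orbT.
    exact: beyond_cut (ltn_ord n).
  have kN : (k < N)%N by rewrite ltnS leq_bigmax_seq.
  have qk : (q k <= k)%N by exact: cut_le.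
  have kq : (k - q k < N - q k)%N by apply: ltn_sub2r => //; exact: leq_ltn_trans kN.
  rewrite (bigD1 (Ordinal kq)) //= big1 ?addr0 => [|n nk].
    rewrite subnKC // /F0; have [_ H _] := HF k; by rewrite H.
  have nk' : (q k + n != k)%N.
    by apply: contra_neq nk => e; apply: val_inj; apply/eqP; rewrite /= -(eqn_add2l (q k)) subnKC // e.
  by apply: zero; [exact: beyond_cut (ltn_ord n)|rewrite nk'].
have RB k s' : fin L s' -> \sum_(l <- s' | rk r l == k) mm l * cabs (Rk k l) ^+ 2 * 2^-1 ^+ k <=
    258 * A * \sum_(n < N) (2^-1 ^+ n * 2^-1 ^+ m * G n) * ((3 / 4) ^+ (k - (n + m)) * (3 / 4) ^+ (n + m - k)).
  move=> fs'; have aR : analytic (Rk k) := analytic_sum _ (P := xpredT) (fun (n : 'I_(q k)) _ => aF0 n).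
  rewrite -mulr_suml.
  (* The decay 1/2 splits as (2/3)(3/4): the powers of 2/3 are the weights for the sum over n, those
     of 3/4 remain for the later sum over k. *)
  pose x : R := 2 / 3; have x01 : 0 <= x < 1 by rewrite /x; lra.
  have x0 i : 0 < x ^+ i by rewrite exprn_gt0 // /x divr_gt0.
  pose j := (k - m)%N; pose lam (n : 'I_(q k)) := x ^+ (n - j) * x ^+ (j - n).
  have l0 n : 0 < lam n by rewrite mulr_gt0.
  have Sl : \sum_n lam n <= 6.
    by have := sum_geo_dist j (q k) x01; rewrite (_ : 2 / (1 - x) = 6) //; by rewrite /x; field.
  set rho := r (k.+1 + 3 * p)%N; have rho01 : 0 <= rho < 1 := radii01 hr _.
  have h1 : circ2 rho (Rk k) <= 6 * \sum_n (lam n)^-1 * G n.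
    have := circ2_sum_le (index_enum 'I_(q k)) (fun n => aF0 n) l0 rho01 => h; apply: le_trans h _.
    apply: ler_pM => //; [by apply: sumr_ge0 => n _; exact: ltW| |].
      apply: sumr_ge0 => n _; rewrite mulr_ge0 ?invr_ge0 ?(ltW (l0 _)) //.
      by apply: circ2_ge0'.
    apply: ler_sum => n _; rewrite ler_pM2l ?invr_gt0 //.
    rewrite (circ2_monomial _ (Fh n).1 rho01) -[leRHS]mul1r; apply: ler_pM.
    { by rewrite exprn_ge0 //; case/andP: rho01. }
    { by apply: circ2_ge0' => //; exact: (Fh n).1. }
    { by rewrite exprn_ile1 //; case/andP: rho01 => ? /ltW. }
    by apply: (Fh n).2.
  apply: (@le_trans _ _ (43 * A * (6 * \sum_n (lam n)^-1 * G n) * 2^-1 ^+ k)).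
    rewrite ler_pM2r //; apply: le_trans (ring_embedding hr p0 Hp L1 k HA aR fs') _.
    by rewrite ler_wpM2l // mulr_ge0.
  have -> : 43 * A * (6 * \sum_n (lam n)^-1 * G n) * 2^-1 ^+ k =
     258 * A * \sum_n (lam n)^-1 * G n * 2^-1 ^+ k.
    by rewrite -[in RHS]mulr_suml; ring.
  apply: ler_wpM2l; first by rewrite mulr_ge0.
  rewrite -(subnKC (qN k)) big_split_ord /= -[leLHS]addr0 lerD //; last first.
    have y0 i : 0 <= (3 / 4 : R) ^+ i by rewrite exprn_ge0 // divr_ge0.
    apply: sumr_ge0 => n _; apply: mulr_ge0; last exact: mulr_ge0.
    by apply: mulr_ge0 => //; apply: mulr_ge0; exact: ltW.
  apply: ler_sum => n _; have [nq nj] := below_cut (ltn_ord n).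
  rewrite (eqP (_ : (n + m - k == 0)%N)) ?subn_eq0 // expr0 mulr1 /lam.
  rewrite (eqP (_ : (n - j == 0)%N)); last by rewrite subn_eq0.
  rewrite expr0 mul1r (_ : (j - n = k - (n + m))%N); last by rewrite /j -subnDA addnC.
  set i := (k - (n + m))%N.
  have -> : 2^-1 ^+ k = 2^-1 ^+ n * 2^-1 ^+ m * 2^-1 ^+ i :> R.
    by rewrite -!exprD subnKC.
  have -> : (3 / 4) ^+ i = (x ^+ i)^-1 * 2^-1 ^+ i.
    rewrite -exprVn -exprMn; congr (_ ^+ _); by rewrite /x; field.
  by rewrite le_eqVlt; apply/orP; left; apply/eqP; ring.
move=> s' fs'.
have bound : \sum_(l <- s') v l * cabs (Rk (rk r l) l) ^+ 2 <= 2064 * A * 2^-1 ^+ m * (K * X).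
  pose N' := (\max_(l <- s') rk r l).+1.
  have -> : \sum_(l <- s') v l * cabs (Rk (rk r l) l) ^+ 2 =
     \sum_(0 <= k < N') \sum_(l <- s' | rk r l == k) mm l * cabs (Rk k l) ^+ 2 * 2^-1 ^+ k.
    transitivity (\sum_(l <- s' | (0 <= rk r l < N')%N) v l * cabs (Rk (rk r l) l) ^+ 2).
      rewrite big_seq [RHS]big_seq_cond; apply: eq_bigl => l; case ls : (l \in s') => //=.
      by rewrite ltnS leq_bigmax_seq.
    rewrite sum_rings; apply: eq_bigr => k _; apply: eq_bigr => l /eqP lk.
    by rewrite /weight lk -mulrA mulrC.
  apply: le_trans (ler_sum _ (fun k _ => RB k s' fs')) _.
  rewrite -mulr_sumr exchange_big /=.
  apply: (@le_trans _ _ (258 * A * \sum_(n < N) (2^-1 ^+ n * 2^-1 ^+ m * G n) * 8)).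
    apply: ler_wpM2l; first by rewrite mulr_ge0.
    apply: ler_sum => n _; rewrite -mulr_sumr; apply: ler_wpM2l.
      by apply: mulr_ge0 => //; apply: mulr_ge0; exact: ltW.
    have y01 : 0 <= (3 / 4 : R) < 1 by lra.
    rewrite big_mkord; have := sum_geo_dist (n + m) N' y01.
    by rewrite (_ : 2 / (1 - 3 / 4) = 8 :> R) //; field.
  have -> : 258 * A * \sum_(n < N) 2^-1 ^+ n * 2^-1 ^+ m * G n * 8 =
     2064 * A * 2^-1 ^+ m * \sum_(n < N) 2^-1 ^+ n * G n.
    by rewrite !mulr_sumr; apply: eq_bigr => n _; ring.
  have q0 : 0 <= 2064 * A * 2^-1 ^+ m := mulr_ge0 (mulr_ge0 (ler0n R 2064) A0) (ltW (half_gt0 m)).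
  by move: q0; move: (2064 * A * _) => y y0; rewrite ler_wpM2l.
apply: (@le_trans _ _ (2 * (\sum_(l <- s' | l \notin s) v l * cabs (a l) ^+ 2 +
    \sum_(l <- s') v l * cabs (Rk (rk r l) l) ^+ 2))).
  rewrite [X in _ <= 2 * (X + _)]big_mkcond -big_split mulr_sumr /= big_seq [leRHS]big_seq.
  apply: ler_sum => l ls; rewrite resid; last exact: fs'.2.
  have v0 := weight_gt0 r (fin_lt1 L1 fs' ls).
  have -> : (if l \notin s then v l * cabs (a l) ^+ 2 else 0) = v l * cabs (if l \in s then 0 else a l) ^+ 2.
    by case: (l \in s); rewrite /= ?cabs0 ?expr0n ?mulr0.
  rewrite -mulrDr [leRHS]mulrCA ler_pM2l //.
  rewrite -[X in cabs (_ + X)]mulN1r; apply: le_trans (cabsD_sqr _ _) _.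
  by rewrite mulN1r cabsN.
have h1 := Htail s' fs'.
have h2 : 2064 * A * 2^-1 ^+ m * (K * X) <= X / 16.
  rewrite (_ : 2064 * A * _ * _ = (32 * 2064 * A * K * 2^-1 ^+ m) * (X / 32)); last by field.
  apply: (@le_trans _ _ (1 * (X / 32))); first by rewrite ler_wpM2r // divr_ge0.
  by rewrite mul1r; lra.
move: h1 (le_trans bound h2); move: (\sum_(_ <- _ | _) _) (\sum_(_ <- _) _) => x y; lra.
Qed.
End step.

Lemma pow2_expR (m : nat) : 2^-1 ^+ m = expR (- (m%:R * ln 2)) :> R.
Proof.
by rewrite -mulrN expRM_natl expRN lnK // posrE.
Qed.

Lemma interpolation_sufficient d beta : sep L d -> upD r L beta -> beta < ln 2 / 2 ->
  exists2 C, 0 <= C & forall a (X : R), 0 <= X -> tot r L a X ->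
    exists2 f, wbound r f (C * X) & forall l, L l -> f l = a l.
Proof.
move=> [d01 Hd] Hup hb; have [A HA] := upD_CR hr L1 Hup; have A0 := HA.1.
have [m0 Hm0] := Hup.
have b0 : 0 <= beta.
  have z0 : cabs (0 : R[i]) < 1 by rewrite cabs0.
  have := Hm0 (maxn m0 1) (leq_maxl _ _) 0 [::] z0; rewrite big_nil => /(_ _ _) h.
  have := h ltac:(by []) ltac:(by []); rewrite pmulr_rge0 // ltr0n leq_max //= orbT //.
pose kap := ln 2 / 2 - beta; have kap0 : 0 < kap by rewrite subr_gt0.
(* Half of the gap [kap] pays for the factor 1 + eta by which a sum of -log rho may exceed the sum
   of 1 - rho. *)
pose eta := Num.min 1 (kap / (2 * (beta + 1))).
have eta0 : 0 < eta by rewrite lt_min ltr01 divr_gt0 //; lra.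
have eta1 : eta <= 1 by rewrite ge_min lexx.
have etab : eta * beta <= kap / 2.
  have h : eta <= kap / (2 * (beta + 1)) by rewrite ge_min lexx orbT.
  apply: le_trans (ler_wpM2r b0 h) _; rewrite mulrAC ler_pdivrMr; nra.
have e01 : 0 < eta <= 1 by rewrite eta0.
have [C1 C10 HC1] := lg_sum_le hr p0 Hp L1 HA e01 d01.
have [M [c [C [[c0 C0] Hc _ _ HM]]]] := test_function hr.
pose beta' := ln 2 / 2 - kap / 2.
have q01 : 0 <= expR (- kap) < 1 by rewrite expR_ge0 expR_lt1 oppr_lt0.
pose Q := 32 * 2064 * A * (32 * A / c) * expR (2 * C1).
have [N HN] := geom_small Q q01 (ltr01 : 0 < 1 :> R).
pose m := maxn (maxn m0 1) N.
have mm0 : (m0 <= m)%N by rewrite !leq_max leqnn.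
have m1 : (0 < m)%N by rewrite !leq_max leqnn orbT.
(* Since 2 beta' = ln 2 - kap, the quotient 2^-m / D is a constant times exp (- kap m), so a large m
   makes the errors small. *)
pose D := expR (- (2 * (m%:R * beta' + C1))).
have D0 : 0 < D := expR_gt0 _.
have HD l (u : seq R[i]) : L l -> fin L u -> (forall i, i \in u -> cabs i <= r (rk r l + m)%N) ->
    D <= \prod_(i <- u | i != l) (1 - pp l i).
  move=> Ll fu Hu; have l1 := L1 Ll.
  have sepu i : i \in u -> i != l -> d <= cabs (bl i l).
    by move=> iu /eqP il; apply: Hd => //; [exact: fu.2|move=> e; apply: il].
  have dpos i : i \in u -> i != l -> 0 < cabs (bl i l).
    by move=> iu il; case/andP: d01 => h _; apply: lt_le_trans h _; exact: sepu.
  rewrite (rho2_prod_lg dpos l1 (fin_lt1 L1 fu)).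
  rewrite ler_expR lerN2 ler_pM2l //.
  apply: le_trans (HC1 u (fun i => i != l) l fu l1 sepu) _; rewrite lerD2r.
  have h := Hm0 m mm0 l u l1 fu Hu.
  have h2 : \sum_(i <- u | i != l) (1 - cabs (bl i l)) <= m%:R * beta.
    apply: le_trans h; rewrite big_mkcond big_seq [leRHS]big_seq; apply: ler_sum => i iu.
    by case: ifP => // _; case: (one_sub_rho l1 (fin_lt1 L1 fu iu)).
  apply: (@le_trans _ _ ((1 + eta) * (m%:R * beta))).
    by apply: ler_wpM2l h2; lra.
  rewrite mulrCA; apply: ler_wpM2l => //; rewrite /beta' /kap; rewrite /kap in etab; lra.
pose K := 32 * A / (c * D).
have small : 32 * 2064 * A * K * 2^-1 ^+ m <= 1.
  apply: le_trans (HN m (leq_maxr _ _)); rewrite le_eqVlt; apply/orP; left; apply/eqP.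
  have -> : expR (- kap) ^+ m = expR (2 * (m%:R * beta')) * 2^-1 ^+ m.
    rewrite pow2_expR -expRD -expRM_natl; congr expR; by rewrite /beta'; field.
  have -> : K = 32 * A / c * (expR (2 * C1) * expR (2 * (m%:R * beta'))).
    rewrite /K /D expRN -expRD -mulrDr [C1 + _]addrC invfM invrK; ring.
  rewrite /Q; move: (expR _) (expR _) (2^-1 ^+ m) (2064 : R) => x y z q; ring.
have K0 : 0 <= K by rewrite divr_ge0 ?mulr_ge0 // ltW.
exists (12 * (C * K)); first by apply: mulr_ge0 => //; apply: mulr_ge0 => //; exact: ltW.
move=> a X X0 Ha.
have step b Y : 0 <= Y -> tot r L b Y -> exists2 f, wbound r f (C * K * Y) &
    tot r L (fun l => b l - f l) (Y / 4).
  move=> Y0 Hb; have [s fs Hs] : exists2 s, fin L s & forall s', fin L s' ->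
      \sum_(l <- s' | l \notin s) weight r l * cabs (b l) ^+ 2 <= Y / 16.
    have [Ye|Yn] := eqVneq Y 0.
      exists [::] => // s' fs'; rewrite Ye mul0r; have := Hb s' fs'; rewrite Ye.
      by under [X in _ -> X <= _]eq_bigl do rewrite in_nil.
    apply: (tot_tail Hb); rewrite divr_gt0 // lt_neqAle eq_sym Yn //.
  exact: (interpolation_step HA m1 D0 HD c0 C0 Hc HM fs Y0 Hb Hs small).
have [f Hf1 Hf2] := iterate hr L1 (mulr_ge0 (ltW C0) K0) step X0 Ha.
by exists f => //; rewrite -!mulrA; rewrite -!mulrA in Hf1.
Qed.
End interpolation_sufficiency.

(** * Uniform bounds for interpolation *)

Section uniform_interpolation.
Context {R : realType}.
Variable r : nat -> R.
Hypothesis hr : radii r.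
Variable L : set R[i].
Hypothesis L1 : forall l, L l -> cabs l < 1.
Implicit Types (z l u : R[i]) (s : seq R[i]) (a b : R[i] -> R[i]).
Local Notation v := (weight r).

(** No bound on f in terms of X is asked here; uniformity is the conclusion of
    [uniform_interpolation]. *)
Definition interpolates := forall a X, tot r L a X ->
  exists f B, wbound r f B /\ forall l, L l -> f l = a l.

Lemma totD a b (X Y : R) : tot r L a X -> tot r L b Y -> tot r L (fun l => a l + b l) (2 * (X + Y)).
Proof.
move=> Ha Hb s fs; apply: (@le_trans _ _ (2 * (\sum_(l <- s) v l * cabs (a l) ^+ 2 +
  \sum_(l <- s) v l * cabs (b l) ^+ 2))); last by rewrite ler_pM2l // lerD ?Ha ?Hb.
rewrite -big_split mulr_sumr big_seq [leRHS]big_seq /=; apply: ler_sum => l ls.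
have v0 := weight_gt0 r (fin_lt1 L1 fs ls); have := cabsD_sqr (a l) (b l).
by rewrite -mulrDr (mulrCA 2 (v l)) ler_pM2l.
Qed.

Lemma totZ a (X : R) c : tot r L a X -> tot r L (fun l => c * a l) (cabs c ^+ 2 * X).
Proof.
move=> Ha s fs; apply: le_trans (ler_wpM2l (sqr_ge0 _) (Ha s fs)).
rewrite mulr_sumr; apply: ler_sum => l _; rewrite cabsM exprMn.
by rewrite le_eqVlt; apply/orP; left; apply/eqP; ring.
Qed.

Lemma eq_tot a b (X : R) : (forall l, L l -> a l = b l) -> tot r L a X -> tot r L b X.
Proof.
move=> e Ha s fs; apply: le_trans (Ha s fs); rewrite big_seq [leRHS]big_seq.
by apply: ler_sum => l ls; rewrite e //; exact: fs.2.
Qed.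

Lemma tot_mono a (X Y : R) : X <= Y -> tot r L a X -> tot r L a Y.
Proof. by move=> h Ha s fs; apply: le_trans (Ha s fs) h. Qed.

Lemma tot0 (X : R) : 0 <= X -> tot r L (fun=> 0) X.
Proof. by move=> X0 s _; rewrite big1 // => l _; rewrite cabs0 expr0n mulr0. Qed.

Let e8 n : (0 : R) < 8^-1 ^+ n. Proof. by rewrite exprn_gt0. Qed.

(* Gliding hump: data that are hard to interpolate with bounds growing fast enough
   add up to data that cannot be interpolated at all. *)
Lemma approximate_interpolation : interpolates -> exists2 M : R, 0 <= M & forall a, tot r L a 1 ->
  exists2 f, wbound r f M & tot r L (fun l => a l - f l) 4^-1.
Proof.
move=> Int; apply: contrapT => no.
have /choice[al Hal] : forall M : R, exists a, tot r L a 1 /\ (0 <= M ->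
    ~ exists2 f, wbound r f M & tot r L (fun l => a l - f l) 4^-1).
  move=> M; have [M0|nM] := pselect (0 <= M); last first.
    by exists (fun=> 0); split=> [|/nM //]; exact: tot0.
  apply: contrapT => H; apply: no; exists M => // a Ha; apply: contrapT => na.
  by apply: H; exists a.
have /choice[I HI] : forall a, exists g : (R[i] -> R[i]) * R, (exists X, tot r L a X) ->
    wbound r g.1 g.2 /\ forall l, L l -> g.1 l = a l.
  move=> a; have [[X Ha]|n] := pselect (exists X, tot r L a X); last by exists (a, 0) => /n.
  by have [f [B H]] := Int a X Ha; exists (f, B).
(* This dominates the squared norm of 8^p (f - g) whenever f has squared norm at most p and g is the
   chosen interpolant of a. The data [alp p] are taken so that no function within this bound
   approximates them. *)
pose M p a := 64 ^+ p * (2 * (p%:R + (I a).2)).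
pose A := fix A p : R[i] -> R[i] := if p is q.+1
  then fun l => A q l + (8^-1 ^+ q)%:C * al (M q (A q)) l else fun=> 0.
pose alp p := al (M p (A p)).
have Ta p : tot r L (alp p) 1 := (Hal _).1.
have AS p l : A p.+1 l = A p l + (8^-1 ^+ p)%:C * alp p l by [].
have c8 p : cabs ((8^-1 ^+ p)%:C : R[i]) = 8^-1 ^+ p by rewrite cabsC ger0_norm // ltW.
have diff k p : tot r L (fun l => A (p + k)%N l - A p l) (3 * 64^-1 ^+ p).
  elim: k p => [|k IH] p.
    apply: (@eq_tot (fun=> 0)); first by move=> l _; rewrite addn0 subrr.
    by apply: tot0; rewrite mulr_ge0 // exprn_ge0.
  apply: (@eq_tot (fun l => (8^-1 ^+ p)%:C * alp p l + (A (p.+1 + k)%N l - A p.+1 l))).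
    by move=> l _; rewrite addnS addSn (AS p); ring.
  apply: tot_mono (totD (totZ (8^-1 ^+ p)%:C (Ta p)) (IH p.+1)).
  rewrite c8 -exprM mulnC exprM (_ : 8^-1 ^+ 2 = 64^-1 :> R); last by field.
  have : (0 : R) <= 64^-1 ^+ p by rewrite exprn_ge0.
  by rewrite exprS; move: (_ ^+ p) => x; lra.
have /choice[Lm HLm] : forall l, exists y, L l -> forall e, 0 < e -> exists N, forall n, (N <= n)%N ->
    cabs (y - A n l) <= e.
  move=> l; have [Ll|n] := pselect (L l); last by exists 0.
  have v0 := weight_gt0 r (L1 Ll).
  have q01 : 0 <= (8^-1 : R) < 1 by lra.
  have [y Hy] : exists y, forall n, cabs (y - A n l) <= 2 * ((1 + (v l)^-1) / (1 - 8^-1) * 8^-1 ^+ n).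
    apply: fast_cauchy => // n; rewrite AS addrC addKr cabsM c8 mulrC ler_pM2r //.
    have := tot_point (Ta n) Ll; rewrite -ler_pdivlMl // mulr1 => h.
    have := sqr_ge0 (cabs (alp n l)); have := cabs_ge0 (alp n l); nra.
  exists y => _ e e0; have [N HN] := geom_small (2 * ((1 + (v l)^-1) / (1 - 8^-1))) q01 e0.
  by exists N => n Nn; apply: le_trans (Hy n) _; rewrite mulrA; exact: HN.
have tail p : tot r L (fun l => Lm l - A p l) (7 * 64^-1 ^+ p).
  move=> s fs.
  have V0 : 0 <= \sum_(l <- s) v l.
    by rewrite big_seq; apply: sumr_ge0 => l ls; rewrite ltW // weight_gt0 // (fin_lt1 L1 fs).
  have x0 : (0 : R) < 64^-1 ^+ p by rewrite exprn_gt0.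
  have [e e0 He] : exists2 e : R, 0 < e & 2 * (e ^+ 2 * \sum_(l <- s) v l) <= 64^-1 ^+ p.
    set V := \sum_(l <- s) v l in V0 *.
    pose e := Num.min 1 (64^-1 ^+ p / (2 * (V + 1))).
    have eg : 0 < e by rewrite lt_min ltr01 divr_gt0 //; lra.
    exists e => //; have e1 : e <= 1 by rewrite ge_min lexx.
    have : e <= 64^-1 ^+ p / (2 * (V + 1)) by rewrite ge_min lexx orbT.
    rewrite ler_pdivlMr; last by lra.
    move: (64^-1 ^+ p) => x h; apply: le_trans h.
    rewrite expr2; have : 0 <= e * (1 - e) by apply: mulr_ge0; lra.
    nra.
  have [N HN] : exists N, forall n, (N <= n)%N -> forall l, l \in s -> cabs (Lm l - A n l) <= e.
    elim: s {V0 He} fs => [|x s IH] fs; first by exists 0%N.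
    have [us ss] := fs; have /andP[_ us'] := us.
    have [|N HN] := IH; first by split=> // l ls; apply: ss; rewrite inE ls orbT.
    have [N' HN'] := HLm x (ss x (mem_head _ _)) e e0.
    exists (maxn N N') => n; rewrite geq_max => /andP[h1 h2] l; rewrite inE => /orP[/eqP ->|ls].
      exact: HN'.
    exact: HN.
  have Np : (N <= p + N)%N := leq_addl _ _.
  apply: (@le_trans _ _ (2 * (e ^+ 2 * (\sum_(l <- s) v l) + 3 * 64^-1 ^+ p))); last first.
    by rewrite mulrDr; move: He; move: (2 * (_ * _)) (64^-1 ^+ p) => x y; lra.
  apply: le_trans (ler_wpM2l _ (lerD (lexx _) (diff N p s fs))) => //.
  rewrite [_ * \sum_(l <- s) v l]mulr_sumr -big_split mulr_sumr big_seq [leRHS]big_seq /=.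
  apply: ler_sum => l ls; have v0 := weight_gt0 r (fin_lt1 L1 fs ls).
  have -> : Lm l - A p l = (Lm l - A (p + N)%N l) + (A (p + N)%N l - A p l) by ring.
  have h := cabsD_sqr (Lm l - A (p + N)%N l) (A (p + N)%N l - A p l).
  have h' : cabs (Lm l - A (p + N)%N l) ^+ 2 <= e ^+ 2.
    by rewrite ler_sqr ?nnegrE ?cabs_ge0 ?(ltW e0) // HN.
  rewrite [e ^+ 2 * _]mulrC -mulrDr [leRHS]mulrCA ler_pM2l //; apply: le_trans h _.
  by rewrite ler_pM2l // lerD2r.
have TA p : exists X, tot r L (A p) X by exists (3 * 64^-1 ^+ 0); have := diff p 0%N;
  apply: eq_tot => l _; rewrite add0n subr0.
have [f [B [Hf fL]]] := Int Lm _ (eq_tot (fun l _ => subr0 _) (tail 0%N)).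
have [p pB] : exists p : nat, B <= p%:R.
  by exists (Num.truncn B).+1; apply: ltW; exact: truncnS_gt.
have [Hg gL] := HI _ (TA p); set g := (I (A p)).1 in Hg gL; set Bg := (I (A p)).2 in Hg.
have Bg0 := wbound_ge0 Hg.
apply: ((Hal (M p (A p))).2); first by rewrite /M mulr_ge0 ?exprn_ge0 // mulr_ge0 // addr_ge0.
(* If f interpolates the limit [Lm], this function approximates [alp p] with an error of modulus 8^p
   |Lm - A (p + 1)|, of squared norm at most 7/64 < 1/4, against the choice of [alp p]. *)
exists (fun z => (8 ^+ p)%:C * (f z - g z)).
  apply: (wbound_mono _ (wboundZ hr (8 ^+ p)%:C (wboundB hr Hf Hg))).
  rewrite cabsC ger0_norm ?exprn_ge0 // -exprM mulnC exprM (_ : 8 ^+ 2 = 64 :> R); last by ring.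
  rewrite /M -/Bg; apply: ler_wpM2l; first by rewrite exprn_ge0.
  by rewrite ler_pM2l // lerD2r.
have E : 8 ^+ p * 8^-1 ^+ p = 1 :> R by rewrite -exprMn mulfV // expr1n.
apply: (@eq_tot (fun l => - (8 ^+ p)%:C * (Lm l - A p.+1 l))).
  move=> l Ll; rewrite fL // gL // AS -/(alp p).
  have E' : (8 ^+ p)%:C * (8^-1 ^+ p)%:C = 1 :> R[i] by rewrite -rmorphM E rmorph1.
  transitivity ((8 ^+ p)%:C * (8^-1 ^+ p)%:C * alp p l - (8 ^+ p)%:C * (Lm l - A p l)); first by ring.
  by rewrite E' mul1r.
apply: tot_mono (totZ _ (tail p.+1)).
rewrite cabsN cabsC ger0_norm ?exprn_ge0 // -exprM mulnC exprM (_ : 8 ^+ 2 = 64 :> R); last by ring.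
have : 64 ^+ p * 64^-1 ^+ p = 1 :> R by rewrite -exprMn mulfV // expr1n.
move=> e; rewrite [leLHS](_ : _ = 7 * 64^-1 * (64 ^+ p * 64^-1 ^+ p)); last first.
  by rewrite (exprS (64^-1) p); move: (64 ^+ p) (64^-1 ^+ p) => x y; ring.
rewrite e mulr1 ler_pdivrMr // mulrC ler_pdivlMr //; lra.
Qed.

(** A residual of one quarter is what [iterate] consumes; data are normalised by the square root of
    Y first. This plays the part of the open mapping theorem. *)
Lemma uniform_interpolation : interpolates -> exists2 M : R, 0 <= M & forall a X, 0 <= X -> tot r L a X ->
  exists2 f, wbound r f (M * X) & forall l, L l -> f l = a l.
Proof.
move=> /approximate_interpolation[M M0 HM]; exists (12 * M); first by rewrite mulr_ge0.
move=> a X X0 Ha; rewrite -mulrA; apply: (iterate hr L1 M0 _ X0 Ha) => b Y Y0 Hb.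
have [Ye|Yn] := eqVneq Y 0.
  exists (fun=> 0).
    rewrite Ye mulr0; have w0 : wbound r (fun=> 0 : R[i]) (cabs (0 : R[i]) ^+ 2 * M).
      have [f Hf _] := HM _ (tot0 ler01).
      by apply: (eq_wbound hr _ (wboundZ hr 0 Hf)) => z _; rewrite mul0r.
    by move: w0; rewrite cabs0 expr0n mul0r.
  rewrite Ye mul0r; apply: (@eq_tot b) => [l _|]; first by rewrite subr0.
  by rewrite -Ye.
have Yp : 0 < Y by rewrite lt_neqAle eq_sym Yn.
have sY : Num.sqrt Y ^+ 2 = Y by rewrite sqr_sqrtr.
have s0 : 0 < Num.sqrt Y by rewrite sqrtr_gt0.
have cs : cabs (Num.sqrt Y)%:C = Num.sqrt Y by rewrite cabsC ger0_norm // ltW.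
have n0 : (Num.sqrt Y)%:C != 0 :> R[i] by rewrite -cabs_eq0 cs gt_eqF.
have Tb : tot r L (fun l => (Num.sqrt Y)%:C^-1 * b l) 1.
  by have := totZ (Num.sqrt Y)%:C^-1 Hb; rewrite cabsV cs exprVn sY mulVf.
have [f Hf Tf] := HM _ Tb.
exists (fun z => (Num.sqrt Y)%:C * f z).
  by have := wboundZ hr (Num.sqrt Y)%:C Hf; rewrite cs sY mulrC.
apply: (@eq_tot (fun l => (Num.sqrt Y)%:C * ((Num.sqrt Y)%:C^-1 * b l - f l))).
  by move=> l _; field.
by have := totZ (Num.sqrt Y)%:C Tf; rewrite cs sY.
Qed.
End uniform_interpolation.

(** * Necessity of separation and of the upper density condition *)

Section interpolation_necessity.
Context {R : realType}.
Variable r : nat -> R.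
Hypothesis hr : radii r.
Variable p : nat.
Hypothesis p0 : (0 < p)%N.
Hypothesis Hp : forall j i, 1 - r (j + i * p)%N <= (1 - r j) * 2^-1 ^+ i.
Implicit Types (z l u : R[i]) (s : seq R[i]) (a b : R[i] -> R[i]).
Local Notation v := (weight r).
Local Notation t k := (1 - r k).

Let split_if (x : R) (i N N1 q : nat) : 0 <= x -> (if (i < N)%N then x else 0) <=
  (if (i < N1)%N then x else 0) + ((if (N1 <= i < N1 + q)%N then x else 0) +
  (if (N1 + q <= i < N)%N then x else 0)).
Proof.
by case: (ltnP i N) => _; case: (ltnP i N1) => _; case: (ltnP i (N1 + q)) => _; rewrite ?andbF ?andbT /=; lra.
Qed.

(** Three blocks of p rings give the factor 2^3 that the rescaling estimates require. *)
Lemma deep n k z : cabs z < r n -> (n + 3 * p <= k)%N -> 8 * t k <= 1 - cabs z.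
Proof.
move=> zn nk; have h := Hp n 3; have := radii_mono hr nk; have := radii_lt1 hr n.
have e : 2^-1 ^+ 3 = 8^-1 :> R by field.
by rewrite e in h; lra.
Qed.

(** [circ2_point] is applied to large powers of f, for which its factor 1 - |z / rho|^2 becomes
    negligible. *)
Lemma max_modulus f (rho G : R) z : analytic f -> 0 < rho < 1 ->
  (forall u, cabs u = rho -> cabs (f u) <= G) -> cabs z < rho -> cabs (f z) <= G.
Proof.
move=> af /[dup] rho01 /andP[rho0 rho1] HG zr; have G0 : 0 <= G.
  by apply: le_trans (HG (on_circle rho 0) _); rewrite ?cabs_ge0 // cabs_on_circle // ltW.
rewrite leNgt; apply/negP => h; have f0 : 0 < cabs (f z) by apply: le_lt_trans h.
pose e := 1 - (cabs z / rho) ^+ 2.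
have e0 : 0 < e.
  have : cabs z / rho < 1 by rewrite ltr_pdivrMr ?mul1r.
  have : 0 <= cabs z / rho by rewrite divr_ge0 ?cabs_ge0 // ltW.
  rewrite /e; move: (_ / _) => x; nra.
have q01 : 0 <= G / cabs (f z) < 1.
  by apply/andP; split; [apply: divr_ge0 => //; exact: ltW|rewrite ltr_pdivrMr ?mul1r].
have [N HN] := geom_small 1 q01 (divr_gt0 e0 (ltr0Sn R 1)).
have := HN (2 * N.+1)%N (leq_trans (leqnSn N) (leq_pmull _ _)) => /(_ isT).
have := circ2_point (analyticX N.+1 af) rho01 zr; rewrite -/e.
have : circ2 rho (fun u => f u ^+ N.+1) <= (G ^+ N.+1) ^+ 2.
  have rho01' : 0 <= rho < 1 by rewrite ltW.
  apply: (circ2_bound (analytic_ccont (analyticX N.+1 af) rho01')) => x.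
  rewrite cabsX ler_sqr ?nnegrE ?exprn_ge0 ?cabs_ge0 // lerXn2r ?nnegrE ?cabs_ge0 //.
  by apply: HG; rewrite cabs_on_circle // ltW.
move=> h1 h2; have := le_trans h2 h1; rewrite cabsX -!exprM [(N.+1 * 2)%N]mulnC.
rewrite mul1r expr_div_n => {h1 h2}; have : 0 < cabs (f z) ^+ (2 * N.+1) by rewrite exprn_gt0.
move: (cabs (f z) ^+ _) (G ^+ _) => x y x0 h1; rewrite ler_pdivrMr // => h2.
have : e * x <= e / 2 * x by apply: le_trans h2; rewrite mulrC.
by rewrite ler_pM2r //; lra.
Qed.

Lemma circle_point f s z K : analytic f -> (0 < K)%N -> uniq s -> (forall l, l \in s -> cabs l < r K) ->
  (forall l, l \in s -> f l = 0) -> 8 * t K <= 1 - cabs z -> cabs z < 1 ->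
  cabs (f z) ^+ 2 * (3 / 4 * mm z) <= circ2 (r K) f * \prod_(l <- s) (1 - pps (r K) z l).
Proof.
move=> af K0 us sK fs dp z1; have [rz ri _ _] := hr; have rK1 := radii_lt1 hr K.
have rK0 : 0 < r K by case: K K0 {sK dp rK1} => // K _; apply: le_lt_trans (radii_ge0 hr K) (ri K).
have zK : cabs z < r K by lra.
have sc x : (r K)%:C * ((r K)^-1%:C * x) = x.
  by rewrite mulrA -rmorphM mulfV ?gt_eqF // rmorph1 mul1r.
have inj : injective (fun x : R[i] => (r K)^-1%:C * x) by apply: (can_inj (g := fun x => (r K)%:C * x)).
have := @blaschke_point R [seq (r K)^-1%:C * l | l <- s] (fun u => f ((r K)%:C * u)) (circ2 (r K) f)
  ((r K)^-1%:C * z); rewrite sc big_map => H.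
apply: (le_trans _ (H _ _ _ _ _)).
- by apply: ler_wpM2l; [exact: sqr_ge0|apply: mm_scale_ge => //; rewrite rK0].
- by rewrite map_inj_uniq.
- by move=> l /mapP[x xs ->]; apply: cabs_scale_lt1 => //; exact: sK.
- by apply: hardy_scale => //; rewrite ltW.
- by move=> l /mapP[x xs ->]; rewrite sc fs.
- exact: cabs_scale_lt1.
Qed.

Lemma prod_1sub_le (I : eqType) (s : seq I) (P : pred I) (F : I -> R) :
  (forall i, i \in s -> P i -> F i <= 1) ->
  \prod_(i <- s | P i) (1 - F i) <= expR (- \sum_(i <- s | P i) F i).
Proof.
move=> H; rewrite -sumrN expR_sum big_seq_cond [leRHS]big_seq_cond; apply: ler_prod => i /andP[i1 i2].
by rewrite subr_ge0 H //= expR_ge1Dx.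
Qed.

(** One of m consecutive terms of the norm is at most their average. Both necessity proofs draw
    their strict inequality from this factor 1 / m. *)
Lemma pigeonhole f B (a m : nat) : wbound r f B -> (0 < a)%N -> (0 < m)%N ->
  exists2 N, (a <= N < a + m)%N & circ2 (r N) f <= 2 ^+ N * (B / m%:R).
Proof.
move=> [af HB] a0 m0; apply: contrapT => no.
have H N : (a <= N < a + m)%N -> B / m%:R < 2^-1 ^+ N * circ2 (r N) f.
  move=> aN; rewrite ltNge; apply/negP => h; apply: no; exists N => //.
  have -> : circ2 (r N) f = 2 ^+ N * (2^-1 ^+ N * circ2 (r N) f) by rewrite mulrA half_pow mul1r.
  by apply: ler_wpM2l => //; rewrite exprn_ge0.
have := HB (a + m)%N; rewrite /wsum (big_cat_nat _ (n := a)) ?leq_addr //= => h.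
have h1 : 0 <= \sum_(1 <= n < a) 2^-1 ^+ n * circ2 (r n) f.
  by apply: sumr_ge0 => n _; exact: wsum_term_ge0.
have h2 : B < \sum_(a <= n < a + m) 2^-1 ^+ n * circ2 (r n) f.
  have -> : B = \sum_(a <= n < a + m) B / m%:R.
    by rewrite sumr_const_nat addKn -[RHS]mulr_natr divfK // pnatr_eq0 -lt0n.
  by apply: ltr_sum_nat; [rewrite -[ltnLHS]addn0 ltn_add2l|move=> n; exact: H].
lra.
Qed.

Lemma lg_le_pp z l : cabs z < 1 -> cabs l < 1 -> 2^-1 <= cabs (bl l z) -> lg z l <= 2 * pp z l.
Proof.
move=> z1 l1 h; have [_ h1 _] := one_sub_rho z1 l1.
have := @le_ln1Dx R ((cabs (bl l z))^-1 - 1).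
rewrite (_ : 1 + (_ - 1) = (cabs (bl l z))^-1) ?lnV ?posrE; [|lra|ring].
have : (cabs (bl l z))^-1 - 1 <= 2 * (1 - cabs (bl l z)).
  by rewrite lerBlDr -div1r ler_pdivrMr; [have := rho_le1 z1 l1; nra|lra].
have : 0 < (cabs (bl l z))^-1 by rewrite invr_gt0; lra.
rewrite /lg; move: (cabs _)^-1 => y y0 h2 h3; have := h3 ltac:(lra); lra.
Qed.

Lemma cabs_blC z l : cabs z < 1 -> cabs l < 1 -> cabs (bl l z) = cabs (bl z l).
Proof.
by move=> z1 l1; apply: (@pexpIrn _ 2) => //; rewrite ?nnegrE ?cabs_ge0 // !bl_sqr // pp_sym.
Qed.

(** The sum is the logarithm of the modulus of an inverse Blaschke product, which is analytic in |u|
    < r_(N + 1) because all points of s lie beyond; rescaling by r_(N + 1) turns that into the unit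
    disc. *)
Lemma max_lg s z N (G : R) : (forall l, l \in s -> r N.+1 <= cabs l < 1) -> (0 < N)%N -> cabs z < r N ->
  (forall u, cabs u = r N -> \sum_(l <- s) lg u l <= G) -> \sum_(l <- s) lg z l <= G.
Proof.
move=> Hs N0 zN HG; have [rz ri _ _] := hr; have r1 := radii_lt1 hr.
have rN0 : 0 < r N by case: N N0 {Hs zN HG} => // n _; apply: le_lt_trans (radii_ge0 hr n) (ri n).
set sg := r N.+1 in Hs *; have sg0 : 0 < sg := lt_trans rN0 (ri N).
have l1 l : l \in s -> cabs l < 1 by move=> /Hs/andP[].
have cs : cabs sg%:C = sg by rewrite cabsC ger0_norm // ltW.
have bne u : cabs u < sg -> forall l, l \in s -> 0 < cabs (bl l u).
  move=> us l ls; have /andP[h _] := Hs l ls.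
  rewrite cabs_gt0 (bl_eq0 (l1 l ls) (lt_trans us (r1 N.+1))).
  by apply: contraTneq us => ->; rewrite -leNgt.
have E u : cabs u < sg -> cabs (bprod s u)^-1 = expR (\sum_(l <- s) lg u l).
  move=> us; rewrite cabsV /bprod cabs_prod expR_sum -prodfV big_seq [RHS]big_seq.
  by apply: eq_bigr => l ls; rewrite /lg expRN lnK // posrE bne.
pose f u := (bprod s (sg%:C * u))^-1.
have af : analytic f.
  apply: analyticV; first by apply: analytic_scale; [exact: analytic_bprod|rewrite cs ltW // r1].
  move=> u u1; rewrite /bprod prodf_seq_neq0; apply/allP => l ls /=.
  by rewrite -cabs_gt0 bne // cabsM cs -[ltRHS]mulr1 ltr_pM2l.
have rr : 0 < r N / sg < 1 by rewrite divr_gt0 //= ltr_pdivrMr // mul1r; exact: ri.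
have := @max_modulus f (r N / sg) (expR G) (z / sg%:C) af rr.
have -> : f (z / sg%:C) = (bprod s z)^-1.
  by rewrite /f mulrC divfK // -cabs_eq0 cs gt_eqF.
rewrite E ?(lt_trans zN) ?ri // ler_expR; apply.
- move=> u ur; have us : cabs (sg%:C * u) = r N by rewrite cabsM cs ur mulrC divfK ?gt_eqF.
  by rewrite /f E ?us ?ri // ler_expR; exact: HG.
- by rewrite cabs_div cs ltr_pM2r ?invr_gt0.
Qed.

Section duality.
Variable L : set R[i].
Hypothesis L1 : forall l, L l -> cabs l < 1.
Variable M : R.
Hypothesis M0 : 0 <= M.
Hypothesis HM : forall a X, 0 <= X -> tot r L a X ->
  exists2 f, wbound r f (M * X) & forall l, L l -> f l = a l.

Lemma dual l : L l -> exists f, [/\ wbound r f M, v l * cabs (f l) ^+ 2 = 1 &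
  forall l', L l' -> l' != l -> f l' = 0].
Proof.
move=> Ll; have v0 := weight_gt0 r (L1 Ll); have s0 : 0 < Num.sqrt (v l) by rewrite sqrtr_gt0.
pose a x := if x == l then ((Num.sqrt (v l))^-1)%:C else 0 : R[i].
have al : v l * cabs (a l) ^+ 2 = 1.
  rewrite /a eqxx cabsC ger0_norm ?invr_ge0 ?(ltW s0) // exprVn sqr_sqrtr ?(ltW v0) // mulfV // gt_eqF //.
have Ta : tot r L a 1.
  move=> s [us _]; have z x : x != l -> v x * cabs (a x) ^+ 2 = 0.
    by move=> /negPf xl; rewrite /a xl cabs0 expr0n mulr0.
  have [ls|ls] := boolP (l \in s).
    by rewrite (bigD1_seq l) //= al big1 ?addr0.
  rewrite big1_seq // => x /andP[_ xs]; apply: z; by apply: contraNneq ls => <-.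
have [f Hf Hl] := HM ler01 Ta; exists f; split; first by rewrite mulr1 in Hf.
  by rewrite Hl.
by move=> l' Ll' /negPf h; rewrite Hl // /a h.
Qed.

(** [circle_point] for the dual function of l on |u| = r_K: its known size at l cancels 2^n, so only
    the number of rings between l and that circle remains in the constant. *)
Lemma dual_product l s i : L l -> fin L s -> l \notin s ->
  (forall x, x \in s -> cabs x < r ((rk r l).+1 + i)%N) ->
  3 / 4 <= 2 ^+ (i + 3 * p).+1 * M * \prod_(x <- s) (1 - pps (r ((rk r l).+1 + i + 3 * p)%N) l x).
Proof.
move=> Ll fs ls Hs; have l1 := L1 Ll; have [f [Hf fl f0]] := dual Ll.
have /andP[_ lr] := rkP hr l1; set n := rk r l in Hs lr *; set K := (n.+1 + i + 3 * p)%N.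
have iK : r (n.+1 + i)%N <= r K by apply: radii_mono => //; exact: leq_addr.
have sK x : x \in s -> cabs x < r K by move=> xs; apply: lt_le_trans (Hs x xs) iK.
have lK : 8 * t K <= 1 - cabs l.
  by apply: (deep (n := (n.+1 + i)%N)) => //; apply: lt_le_trans lr _; apply: radii_mono => //; exact: leq_addr.
have lr' : cabs l < r K by have := radii_lt1 hr K; lra.
have rK0 : 0 < r K by apply: le_lt_trans (cabs_ge0 l) lr'.
have fz x : x \in s -> f x = 0.
  by move=> xs; apply: f0; [exact: fs.2|apply: contraNneq ls => <-].
have := circle_point (K := K) Hf.1 isT fs.1 sK fz lK l1 => h.
have := wbound_circ2 hr Hf (isT : (0 < K)%N) => h2.
have /andP[P0 _] : 0 <= \prod_(x <- s) (1 - pps (r K) l x) <= 1.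
  rewrite big_seq; apply: (@rho2_prod_le1 R _ s (mem s) (fun x => (r K)^-1%:C * x)).
    by move=> x xs; apply: cabs_scale_lt1 => //; exact: sK.
  exact: cabs_scale_lt1.
have h3 := le_trans h (ler_wpM2r P0 h2).
have e : cabs (f l) ^+ 2 * (3 / 4 * mm l) = 3 / 4 * 2 ^+ n.
  have := @half_pow R n; move: fl; rewrite /weight -/n; move: (2^-1 ^+ n) (2 ^+ n) => x y fl xy.
  move: (cabs _ ^+ 2) fl => q fl.
  transitivity (3 / 4 * (mm l * q) * (y * x)); first by rewrite xy; ring.
  by transitivity (3 / 4 * y * (x * mm l * q)); [ring|rewrite fl mulr1].
rewrite e in h3; have p2 : 0 < 2 ^+ n :> R by rewrite exprn_gt0.
rewrite -(ler_pM2r p2); apply: le_trans h3 _.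
rewrite (_ : K = ((i + 3 * p).+1 + n)%N) ?exprD; last by rewrite /K; clear; lia.
by move: (2 ^+ n) (2 ^+ _) (\prod_(_ <- _) _) => x y q; rewrite le_eqVlt; apply/orP; left; apply/eqP; ring.
Qed.

Lemma dual_separated : exists d, sep L d.
Proof.
(* If b lies 4 p rings or more beyond ring n of a, then pp <= 1/2 and nothing is to be proved, so
   [dual_product] is needed for i = 4 p only; 3 p is its own offset. *)
pose Q : R := 2 ^+ (4 * p + 3 * p).+1; have Q1 : 1 <= Q by rewrite exprn_ege1 // ler1n.
pose c := 3 / 8 / (Q * (M + 1)).
have QM : 0 < Q * (M + 1).
  by apply: mulr_gt0; [exact: lt_le_trans Q1|move: M0; lra].
have c0 : 0 < c by rewrite divr_gt0 // divr_gt0.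
have c1 : c <= 3 / 8.
  rewrite /c -[leRHS]mulr1; apply: ler_wpM2l; first lra.
  by rewrite invf_le1 //; move: M0 Q1; nra.
exists c; split; first by rewrite c0 /=; lra.
move=> a b La Lb ab; have a1 := L1 La; have b1 := L1 Lb.
suff h : c <= 1 - pp a b.
  rewrite -bl_sqr // in h; rewrite -ler_sqr ?nnegrE ?cabs_ge0 ?(ltW c0) //.
  by apply: le_trans h; rewrite expr2; move: c1 c0; nra.
have [h|h] := lerP (pp a b) (1 / 2); first lra.
have /andP[_ ar] := rkP hr a1; set n := rk r a in ar *.
have br : cabs b < r (n.+1 + 4 * p)%N.
  rewrite ltNge; apply/negP => h'; have := pp_far hr Hp ar h' b1.
  by rewrite (_ : 8 * 2^-1 ^+ 4 = 1 / 2 :> R); [lra|field].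
have nb : a \notin [:: b] by rewrite inE; apply/eqP.
have fb : fin L [:: b] by split=> // x; rewrite inE => /eqP ->.
have := dual_product (i := (4 * p)%N) La fb nb; rewrite -/n big_seq1 -/Q => H.
have {}H := H (fun x => ltac:(rewrite inE => /eqP ->; exact: br)).
set K := (n.+1 + 4 * p + 3 * p)%N in H.
have dpa : 8 * t K <= 1 - cabs a.
  by apply: (deep (n := (n.+1 + 4 * p)%N)) => //; apply: lt_le_trans ar _; apply: radii_mono => //; exact: leq_addr.
have dpb : 8 * t K <= 1 - cabs b by apply: (deep (n := (n.+1 + 4 * p)%N)).
have rK1 := radii_lt1 hr K.
have rK0 : 0 < r K by have := cabs_ge0 a; lra.
have aK : cabs a < r K by lra.
have bK : cabs b < r K by lra.
have h1 : 1 - pps (r K) a b <= 2 * (1 - pp a b).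
  have /andP[ma _] := mm_le a1; have /andP[mb _] := mm_le b1.
  have ma0 := mm_gt0 a1; have mb0 := mm_gt0 b1.
  have ea : t K * (mm a)^-1 <= 8^-1 by rewrite ler_pdivrMr //; lra.
  have eb : t K * (mm b)^-1 <= 8^-1 by rewrite ler_pdivrMr //; lra.
  have p1 := pp_le1 a1 b1; have pg := pp_gt0 a1 b1.
  have t0 : 0 <= t K * (mm a)^-1 by rewrite mulr_ge0 ?invr_ge0 ?ltW //; lra.
  have t0' : 0 <= t K * (mm b)^-1 by rewrite mulr_ge0 ?invr_ge0 ?ltW //; lra.
  apply: (@le_trans _ _ ((1 - pp a b) * (1 + 4 * t K * ((mm a)^-1 + (mm b)^-1) * pp a b))).
    exact: rho2_scale_le.
  rewrite [leRHS]mulrC; apply: ler_wpM2l; first lra.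
  rewrite (_ : 4 * t K * _ * _ = 4 * (t K * (mm a)^-1 + t K * (mm b)^-1) * pp a b); last by ring.
  by move: (t K * _) (t K * _) ea eb t0 t0' => x y ea eb x0 y0; nra.
rewrite ler_pdivrMr //; have : 0 <= 1 - pp a b by have := pp_le1 a1 b1; lra.
move: (1 - pp a b) (1 - pps _ a b) h1 H => x y h1 H x0.
have h2 : 3 / 4 <= Q * M * (2 * x) by apply: le_trans H _; apply: ler_wpM2l => //; apply: mulr_ge0 => //; lra.
have h3 : 0 <= Q * x by apply: mulr_ge0 => //; lra.
rewrite (_ : x * _ = (Q * M * (2 * x)) / 2 + Q * x); [lra|by field].
Qed.

(** 1 - x <= exp (-x) turns the lower bound for the product over the other points of a ring into an
    upper bound for their Carleson sum. *)
Lemma dual_CR : exists A, CR r L A.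
Proof.
pose Q : R := 2 ^+ (0 + 3 * p).+1; have Q0 : 0 < Q by rewrite exprn_gt0.
exists (32 * (1 + 4 * (Q * M))); apply: carl_CR => //.
  by rewrite addr_ge0 // mulr_ge0 // mulr_ge0 // ltW.
move=> s k fs Hk l ls; have Ll := fs.2 l ls; have l1 := L1 Ll; have [us _] := fs.
pose s' := seq.filter (fun x => x != l) s; have fs' : fin L s' := fin_filter _ fs.
have ns : l \notin s' by rewrite mem_filter eqxx.
have sr x : x \in s' -> cabs x < r ((rk r l).+1 + 0)%N.
  move=> xs; have /andP[_ h] := rkP hr (fin_lt1 L1 fs' xs).
  by rewrite addn0 (Hk l ls); move: xs; rewrite mem_filter => /andP[_ /Hk <-].
have := dual_product Ll fs' ns sr; rewrite -/Q addn0; set K := (_ + 3 * p)%N => H.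
have /andP[_ lr] := rkP hr l1.
have dp x : cabs x < r (rk r l).+1 -> 8 * t K <= 1 - cabs x by move=> h; apply: (deep (n := (rk r l).+1)).
have dpl := dp l lr; have rK1 := radii_lt1 hr K.
have rK0 : 0 < r K by have := cabs_ge0 l; lra.
have lK : cabs l < r K by lra.
rewrite (bigD1_seq l) //=; apply: lerD; first exact: pp_le1.
have -> : \sum_(i <- s | i != l) pp l i = \sum_(i <- s') pp l i by rewrite big_filter.
pose S := \sum_(i <- s') pps (r K) l i.
have hp x : x \in s' -> pps (r K) l x <= 1 /\ pp l x <= 3 * pps (r K) l x.
  move=> xs; have x1 := fin_lt1 L1 fs' xs; have := sr x xs; rewrite addn0 => /dp dx.
  have xK : cabs x < r K by lra.
  by split; [apply: pp_le1; exact: cabs_scale_lt1|apply: pp_le_pps].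
apply: (@le_trans _ _ (3 * S)).
  by rewrite mulr_sumr big_seq [leRHS]big_seq; apply: ler_sum => x /hp[].
have := prod_1sub_le (fun x xs (_ : predT x) => (hp x xs).1); rewrite -/S => h.
have S0 : 0 <= S.
  rewrite /S big_seq; apply: sumr_ge0 => x /[dup] xs /hp[_].
  by have := pp_gt0 l1 (fin_lt1 L1 fs' xs); lra.
have QM : 0 <= Q * M by rewrite mulr_ge0 // ltW.
have h2 := le_trans H (ler_wpM2l QM h).
have h3 : 3 / 4 * expR S <= Q * M.
  by have := ler_wpM2r (expR_ge0 S) h2; rewrite -[leRHS]mulrA -expRD addNr expR0 mulr1.
have := expR_ge1Dx S; move: (expR S) h3 => e h3 he; lra.
Qed.

Variable A : R.
Hypothesis HA : CR r L A.

(** [g] is a test function peaked and normalised at z. Subtracting [bl z] times an interpolant of g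
    / bl z removes its values at the points of s and keeps the value 1 at z. Points close to z are
    left out because [bl z] is small there. *)
Lemma peak_zero : exists2 C : R, 0 < C & forall z s, cabs z < 1 -> fin L s ->
  exists h, [/\ wbound r h (C * v z), h z = 1 & forall l, l \in s -> 2^-1 <= cabs (bl l z) -> h l = 0].
Proof.
have [N [c [C [[c0 C0] Hc _ HN _]]]] := test_function hr.
have [B B0 HB] := bessel hr p0 Hp L1 HA.
pose D := C / c; have D0 : 0 < D by rewrite divr_gt0.
exists (2 * (D + M * (4 * (B * D)))).
  by rewrite mulr_gt0 // ltr_wpDr // mulr_ge0 // mulr_ge0 // mulr_ge0 // ltW.
move=> z s z1 fs; have m0 := mm_gt0 z1; have v0 := weight_gt0 r z1.
set n := rk r z; have /andP[zn _] := rkP hr z1; rewrite -/n in zn.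
pose g0 u : R[i] := u ^+ N n * (1 - z^* * u)^-1.
have gz : cabs (g0 z) ^+ 2 = cabs (z ^+ N n) ^+ 2 / mm z ^+ 2.
  by rewrite /g0 cabsM exprMn one_subJ cabsV cabsC ger0_norm ?exprVn // ltW.
have gz0 : c / mm z ^+ 2 <= cabs (g0 z) ^+ 2.
  by rewrite gz ler_pM2r ?invr_gt0 ?exprn_gt0 //; exact: Hc.
have gzp : 0 < cabs (g0 z) ^+ 2 by apply: lt_le_trans gz0; rewrite divr_gt0 ?exprn_gt0.
have gne : g0 z != 0 by rewrite -cabs_eq0 -sqrf_eq0 gt_eqF.
pose g u := (g0 z)^-1 * g0 u.
have Hg : wbound r g (D * v z).
  apply: wbound_mono (wboundZ hr (g0 z)^-1 (HN n z z1)).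
  rewrite [leLHS](_ : _ = (C * 2^-1 ^+ n / mm z) / cabs (g0 z) ^+ 2); last by rewrite cabsV (exprVn (cabs (g0 z))) mulrC.
  rewrite ler_pdivrMr //.
  have q0 : 0 <= D * v z by rewrite mulr_ge0 // ltW.
  apply: le_trans (ler_wpM2l q0 gz0); rewrite /D /weight -/n le_eqVlt; apply/orP; left; apply/eqP.
  by move: (2^-1 ^+ n) => y; field; rewrite !gt_eqF.
have Tg := HB g _ Hg.
pose a l := if (l \in s) && (2^-1 <= cabs (bl l z)) then g l / bl z l else 0.
have Ta : tot r L a (4 * (B * (D * v z))).
  move=> s' fs'; apply: le_trans (ler_wpM2l (ler0n _ 4) (Tg s' fs')).
  rewrite mulr_sumr big_seq [leRHS]big_seq; apply: ler_sum => l ls.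
  have l1 := fin_lt1 L1 fs' ls; have vl := weight_gt0 r l1.
  have q0 : 0 <= 4 * (v l * cabs (g l) ^+ 2) by apply: mulr_ge0 => //; rewrite mulr_ge0 ?sqr_ge0 // ltW.
  rewrite /a; case: ifP => [/andP[_ h]|_]; last by rewrite cabs0 expr0n mulr0.
  rewrite (cabs_blC z1 l1) in h.
  rewrite cabs_div expr_div_n mulrA ler_pdivrMr; last by rewrite exprn_gt0 //; lra.
  have : 1 <= 4 * cabs (bl z l) ^+ 2 by move: h; move: (cabs _) => x h; nra.
  have : 0 <= v l * cabs (g l) ^+ 2 by rewrite mulr_ge0 ?sqr_ge0 // ltW.
  by move: (v l * cabs (g l) ^+ 2) (cabs (bl z l) ^+ 2) => x y x0 y0; nra.
have q0 : 0 <= 4 * (B * (D * v z)).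
  by apply: mulr_ge0 => //; apply: mulr_ge0 => //; apply: mulr_ge0; exact: ltW.
have [F HF FL] := HM q0 Ta.
exists (fun u => g u - bl z u * F u); split.
- have b1 u : cabs u < 1 -> cabs (bl z u) <= 1 by move=> u1; exact: rho_le1.
  have := wboundB hr Hg (wboundM hr HF (analytic_bl z1) b1).
  by apply: wbound_mono; rewrite le_eqVlt; apply/orP; left; apply/eqP; ring.
- by rewrite /g mulVf // bl_ll mul0r subr0.
- move=> l ls h; rewrite FL; last exact: fs.2.
  have l1 := fin_lt1 L1 fs ls; rewrite /a ls h /= mulrC divfK ?subrr //.
  by rewrite -cabs_eq0 -(cabs_blC z1 l1); apply/eqP => e; move: h; rewrite e; lra.
Qed.

Lemma log_sum_drop : exists2 C : R, 0 <= C & forall m z s, (0 < m)%N -> (1 + 3 * p <= m)%N ->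
  cabs z < 1 -> fin L s -> exists2 N, (rk r z + m < N <= rk r z + 2 * m)%N &
    \sum_(l <- s | (2^-1 <= cabs (bl l z)) && (rk r l < N)%N) lg z l <=
    (N - rk r z)%:R * (ln 2 / 2) - ln m%:R / 2 + C.
Proof.
have [C C0 HC] := peak_zero; have A0 := HA.1.
pose E := expR ((24 * p)%:R * A); have E0 : 0 < E := expR_gt0 _.
have K0 : 0 < 4 / 3 * C * E by rewrite mulr_gt0 // mulr_gt0 // divr_gt0.
exists `|ln (4 / 3 * C * E)| => // m z s m0 pm z1 fs.
have [h [Hh hz hs]] := HC z s z1 fs; set n := rk r z.
(* The window starts more than m rings beyond z, which puts z deep inside |u| = r_N. The factor 1 /
   m in the norm becomes the term - ln m / 2. *)
have [N /andP[nN Nm] HN] := pigeonhole Hh (ltn0Sn (n + m)) m0.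
have nN' : (n <= N)%N by apply: leq_trans nN; rewrite ltnW // ltnS leq_addr.
exists N; first by rewrite nN /=; move: Nm; rewrite addSn ltnS -addnA addnn -mul2n.
have /andP[zn zn'] := rkP hr z1; rewrite -/n in zn zn'.
have dpz : 8 * t N <= 1 - cabs z.
  by apply: (deep (n := n.+1)) => //; apply: leq_trans nN; rewrite addSn ltnS leq_add2l; exact: leq_trans (leqnSn _) _.
pose s1 := seq.filter (fun l => 2^-1 <= cabs (bl l z)) s.
have fs1 : fin L s1 := fin_filter _ fs.
pose s2 := seq.filter (fun l => (rk r l < N)%N) s1.
have fs2 : fin L s2 := fin_filter _ fs1.
have s2K l : l \in s2 -> cabs l < r N.
  by rewrite mem_filter => /andP[h1 ls]; rewrite -rk_lt // (fin_lt1 L1 fs1).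
have hz2 l : l \in s2 -> h l = 0.
  by rewrite !mem_filter => /and3P[_ h1 ls]; exact: hs.
have N0 : (0 < N)%N by apply: leq_trans nN.
have := circle_point (K := N) Hh.1 N0 fs2.1 s2K hz2 dpz z1.
rewrite hz cabs1 expr1n mul1r => h1.
have P0 l : l \in s1 -> 0 < cabs (bl l z) by rewrite mem_filter => /andP[? _]; lra.
have h2 : \prod_(l <- s2) (1 - pps (r N) z l) <=
    E * expR (- (2 * \sum_(l <- s1 | (rk r l < N)%N) lg z l)).
  rewrite -(rho2_prod_lg (fun l ls _ => P0 l ls) z1 (fin_lt1 L1 fs1)) big_filter.
  exact: (rho2_prod_scale hr p0 Hp L1 HA).
rewrite (_ : \sum_(l <- s1 | _) lg z l =
  \sum_(l <- s | (2^-1 <= cabs (bl l z)) && (rk r l < N)%N) lg z l) in h2; last by rewrite big_filter_cond.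
set S := \sum_(l <- s | _) _ in h2 *.
have h3 : 0 <= \prod_(l <- s2) (1 - pps (r N) z l).
  have rN0 : 0 < r N by have := cabs_ge0 z; have := radii_lt1 hr N; lra.
  rewrite big_seq; apply: prodr_ge0 => l ls; rewrite subr_ge0; apply: pp_le1; apply: cabs_scale_lt1 => //.
    by have := radii_lt1 hr N; lra.
  exact: s2K.
have h4 := le_trans h1 (ler_wpM2r h3 HN).
have q0 : 0 <= 2 ^+ N * (C * v z / m%:R).
  by apply: mulr_ge0; [rewrite exprn_ge0|apply: divr_ge0 => //; apply: mulr_ge0; apply: ltW => //; exact: weight_gt0].
have {h4} := le_trans h4 (ler_wpM2l q0 h2).
have mz := mm_gt0 z1; have mp : 0 < m%:R :> R by rewrite ltr0n.
rewrite -(subnK nN') exprD /weight -/n expRN.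
have e2 : 2 ^+ (N - n) = expR ((N - n)%:R * ln 2) :> R by rewrite expRM_natl lnK // posrE.
have em : m%:R = expR (ln m%:R) :> R by rewrite lnK // posrE.
rewrite subnK // e2 {1}em => h4.
have {h4} : expR (2 * S) <= 4 / 3 * C * E * (expR ((N - n)%:R * ln 2) / expR (ln m%:R)).
  have := @half_pow R n; have eS := expR_gt0 (2 * S); have el := expR_gt0 (ln m%:R : R).
  move: h4; move: (expR (2 * S)) eS (expR (ln _)) el (expR (_ * _)) (2 ^+ n) (2^-1 ^+ n) => x x0 y y0 q a b h4 ab.
  have {h4} : 3 / 4 * mm z <= q * (C / y) * (E / x) * mm z * (a * b).
    by apply: le_trans h4 _; rewrite le_eqVlt; apply/orP; left; apply/eqP; ring.
  rewrite ab mulr1 ler_pM2r // => h4.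
  have {h4} : 3 / 4 * x <= q * (C / y) * (E / x) * x by rewrite ler_pM2r.
  rewrite (_ : q * (C / y) * (E / x) * x = 3 / 4 * (4 / 3 * C * E * (q / y))); last by field; rewrite !gt_eqF.
  by rewrite ler_pM2l.
have := ler_norm (ln (4 / 3 * C * E)); have := normr_ge0 (ln (4 / 3 * C * E)).
move: `|_| => y y0 hy; rewrite -[4 / 3 * C * E]lnK ?posrE // -expRN -!expRD ler_expR.
by move: (ln (4 / 3 * _ * _)) hy => x hx; rewrite mulrA; lra.
Qed.

(** Induction on the number k of rings, in blocks of at most 2 m. Up to the circle of [log_sum_drop]
    the sum is below its share of beta by enough to pay for the q rings after it; the points further
    out are estimated from that circle. *)
Lemma log_sum_bound : exists (beta C : R), [/\ 0 <= beta, beta < ln 2 / 2, 0 <= C &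
  forall k z s N, cabs z < 1 -> fin L s -> (N <= rk r z + k)%N ->
    \sum_(l <- s | (2^-1 <= cabs (bl l z)) && (rk r l < N)%N) lg z l <= k%:R * beta + C].
Proof.
have [C C0 HC] := log_sum_drop; have A0 := HA.1.
pose q := (1 + 4 * p)%N.
(* ln m / 2 has to absorb C from [log_sum_drop], the q rings skipped beyond N1, and 1, which is the
   excess of (ln 2)/2 over beta accumulated on at most 2 m rings. *)
pose Y := 2 * (C + 2 * (q%:R * A) + 1).
pose m := (maxn (maxn 2 (1 + 3 * p)) (Num.truncn (expR Y)).+1).
have m2 : (2 <= m)%N by rewrite !leq_max leqnn.
have m0 : (0 < m)%N by apply: leq_trans m2.
have mp3 : (1 + 3 * p <= m)%N by rewrite !leq_max leqnn orbT.
have mR : 0 < m%:R :> R by rewrite ltr0n.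
have mR2 : 2 <= m%:R :> R by rewrite ler_nat.
have lm : Y <= ln m%:R.
  rewrite -ler_expR lnK ?posrE //; apply: le_trans (ltW (truncnS_gt _)) _.
  by rewrite ler_nat !leq_max leqnn orbT.
have l2 : 1 / 2 <= ln 2 :> R.
  have := @le_ln1Dx R (- (1 / 2)) ltac:(lra).
  by rewrite (_ : 1 + - (1 / 2) = 2^-1) ?lnV ?posrE //; [lra|field].
pose beta : R := ln 2 / 2 - (2 * m%:R)^-1.
have im : 0 < ((2 * m%:R)^-1 : R) <= 1 / 4.
  by rewrite invr_gt0 mulr_gt0 //= -[leLHS]mul1r ler_pdivrMr ?mulr_gt0 //; lra.
have b0 : 0 <= beta by rewrite /beta; case/andP: im; lra.
pose C1 := 2 * ((16 * p + 2 * m)%:R * A); have C10 : 0 <= C1 by rewrite mulr_ge0 // mulr_ge0.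
exists beta, C1; split=> //; first by rewrite /beta; case/andP: im; lra.
elim/ltn_ind => k IH z s N z1 fs Nk; set n := rk r z in Nk.
have ls1 l : l \in s -> cabs l < 1 := fin_lt1 L1 fs (l := l).
have [km|km] := leqP k (2 * m)%N.
  apply: (@le_trans _ _ C1); last by rewrite lerDr mulr_ge0.
  apply: (@le_trans _ _ (2 * \sum_(l <- s | (rk r l < n + 2 * m)%N) pp z l)).
    rewrite mulr_sumr big_mkcond [leRHS]big_mkcond big_seq [leRHS]big_seq.
    apply: ler_sum => l ls; have pl := pp_gt0 z1 (ls1 l ls).
    case: ifP => [/andP[h1 h2]|_]; last by case: ifP => // _; rewrite mulr_ge0 // ltW.
    rewrite ifT; first by apply: lg_le_pp => //; exact: ls1.
    by apply: leq_trans h2 _; apply: leq_trans Nk _; rewrite leq_add2l.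
  rewrite /C1; apply: ler_wpM2l => //; exact: (CR_total hr p0 Hp L1 HA _ fs z1).
have [N1 /andP[nN1 N1m] H1] := HC m z s m0 mp3 z1 fs; rewrite -/n in nN1 N1m H1.
have nlt : (n < N1)%N by apply: leq_ltn_trans nN1; exact: leq_addr.
pose j := (N1 - n)%N; have jk : (j <= k)%N.
  by rewrite leq_subLR; apply: leq_trans N1m _; rewrite leq_add2l ltnW.
have jm : (j <= 2 * m)%N by rewrite leq_subLR.
have kj : (k - j < k)%N by rewrite -subn_gt0 subKn // subn_gt0.
pose T := seq.filter (fun l => (N1 + q <= rk r l < N)%N) s.
have fT : fin L T := fin_filter _ fs.
(* All of T lies beyond r_(N1 + 1), so the maximum principle moves the estimate from z to |u| =
   r_N1. There the induction hypothesis applies with k - j rings, since T keeps the distance 1/2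
   from u. *)
have hT : \sum_(l <- T) lg z l <= (k - j)%:R * beta + C1. {
  have Tr l : l \in T -> r (N1.+1 + 4 * p)%N <= cabs l < 1.
    rewrite mem_filter => /andP[/andP[h1 _] ls]; rewrite ls1 // andbT.
    have /andP[h2 _] := rkP hr (ls1 l ls); apply: le_trans h2; apply: radii_mono => //.
    by rewrite addSnnS.
  have farT u l : cabs u < r N1.+1 -> l \in T -> 2^-1 <= cabs (bl l u).
    move=> uN lT; have /andP[h1 h2] := Tr l lT; have := pp_far hr Hp uN h1 h2.
    rewrite (_ : 8 * 2^-1 ^+ 4 = 1 / 2 :> R); last by field.
    have := bl_sqr h2 (lt_trans uN (radii_lt1 hr _)); have := cabs_ge0 (bl l u).
    by move: (cabs _) => x x0 e h3; nra.
  apply: (max_lg (N := N1)).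
  - move=> l lT; have /andP[h1 ->] := Tr l lT; rewrite andbT.
    by apply: le_trans h1; apply: radii_mono => //; exact: leq_addr.
  - exact: leq_ltn_trans nlt.
  - by have /andP[_ h] := rkP hr z1; apply: lt_le_trans h _; apply: radii_mono.
  - move=> u uN; have [_ ri _ _] := hr.
  have uN' : cabs u < r N1.+1 by rewrite uN.
  have u1 : cabs u < 1 := lt_trans uN' (radii_lt1 hr _).
  have rku : rk r u = N1 by apply: rk_eq => //; rewrite uN lexx ri.
  have kN : (N <= rk r u + (k - j))%N.
    by rewrite rku; apply: leq_trans Nk _; rewrite addnBA // leq_subRL /j; [|exact: leq_trans jk (leq_addl _ _)]; rewrite addnA subnK // ltnW.
  apply: le_trans (IH _ kj u s N u1 fs kN).
  rewrite big_filter big_mkcond [leRHS]big_mkcond big_seq [leRHS]big_seq.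
  apply: ler_sum => l ls; have l0 := lg_ge0 u1 (ls1 l ls).
  case: ifP => [h|_]; last by case: ifP.
  have lT : l \in T by rewrite mem_filter h ls.
  by rewrite farT //=; case/andP: h => _ ->. }
have hM : \sum_(l <- s | (2^-1 <= cabs (bl l z)) && (N1 <= rk r l < N1 + q)%N) lg z l <= 2 * (q%:R * A).
  apply: (@le_trans _ _ (2 * \sum_(l <- s | (N1 <= rk r l < N1 + q)%N) pp z l)).
    rewrite mulr_sumr big_mkcond [leRHS]big_mkcond big_seq [leRHS]big_seq.
    apply: ler_sum => l ls; have pl := pp_gt0 z1 (ls1 l ls).
    case: ifP => [/andP[h1 h2]|_]; last by case: ifP => // _; rewrite mulr_ge0 // ltW.
    by rewrite h2; apply: lg_le_pp => //; exact: ls1.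
  apply: ler_wpM2l => //; rewrite sum_rings.
  apply: (@le_trans _ _ (\sum_(N1 <= i < N1 + q) A)); first by apply: ler_sum => i _; exact: HA.2.
  by rewrite sumr_const_nat addKn mulr_natl.
have : \sum_(l <- s | (2^-1 <= cabs (bl l z)) && (rk r l < N)%N) lg z l <=
   \sum_(l <- s | (2^-1 <= cabs (bl l z)) && (rk r l < N1)%N) lg z l +
   (\sum_(l <- s | (2^-1 <= cabs (bl l z)) && (N1 <= rk r l < N1 + q)%N) lg z l + \sum_(l <- T) lg z l).
  rewrite big_filter big_mkcond [X in X + (_ + _)]big_mkcond [X in _ + (X + _)]big_mkcond.
  rewrite [X in _ + (_ + X)]big_mkcond -!big_split big_seq [leRHS]big_seq /=.
  apply: ler_sum => l ls; have l0 := lg_ge0 z1 (ls1 l ls).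
  case: (2^-1 <= _) => /=; last by rewrite !add0r; case: ifP.
  exact: split_if.
have ejk : k%:R = j%:R + (k - j)%:R :> R by rewrite -natrD subnKC.
have jb : j%:R * (ln 2 / 2) <= j%:R * beta + 1.
  rewrite (_ : ln 2 / 2 = beta + (2 * m%:R)^-1) ?mulrDr ?lerD2l; last by rewrite /beta subrK.
  by rewrite ler_pdivrMr ?mulr_gt0 // mul1r -natrM ler_nat.
rewrite -/j in H1 => h; have {h} := le_trans h (lerD H1 (lerD hM hT)).
have -> : k%:R * beta = j%:R * beta + (k - j)%:R * beta by rewrite ejk mulrDl.
move: (\sum_(_ <- _ | _) _) lm jb; rewrite /Y.
by move: (j%:R * beta) (j%:R * (ln 2 / 2)) ((k - j)%:R * beta) (q%:R * A) (ln m%:R) => x1 x2 x3 x4 x5 y; lra.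
Qed.

Lemma density_bound : exists2 beta, beta < ln 2 / 2 & upD r L beta.
Proof.
have [beta [C [b0 bl2 C0 H]]] := log_sum_bound; have A0 := HA.1.
(* pp >= 3/4 means rho <= 1/2: these are the points that [log_sum_bound] leaves out, and they
   contribute a constant. *)
have [Cn Cn0 HCn] := CR_near hr p0 Hp L1 HA (ltac:(lra) : 0 < 3 / 4 :> R).
pose kap := ln 2 / 2 - beta; have kap0 : 0 < kap by rewrite subr_gt0.
exists (beta + kap / 2); first by rewrite /kap; lra.
exists (Num.truncn ((Cn + beta + C) / (kap / 2))).+1 => m mm0 z s z1 fs Hs.
have ls1 l : l \in s -> cabs l < 1 := fin_lt1 L1 fs (l := l).
have h1 : \sum_(l <- s) (1 - cabs (bl l z)) <= \sum_(l <- s | 3 / 4 <= pp z l) pp z l +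
   \sum_(l <- s | (2^-1 <= cabs (bl l z)) && (rk r l < rk r z + m.+1)%N) lg z l.
  rewrite [X in _ <= X + _]big_mkcond [X in _ <= _ + X]big_mkcond -big_split big_seq [leRHS]big_seq /=.
  apply: ler_sum => l ls; have l1 := ls1 l ls; have [x0 x1 _] := one_sub_rho z1 l1.
  have -> : (rk r l < rk r z + m.+1)%N.
    rewrite rk_lt //; apply: le_lt_trans (Hs l ls) _; rewrite addnS; by case: hr.
  rewrite andbT; have l0 := lg_ge0 z1 l1; have p1 := pp_gt0 z1 l1.
  have [h|h] := lerP (2^-1) (cabs (bl l z)).
    have := one_sub_rho_lg z1 l1 ltac:(lra); case: ifP => _; lra.
  rewrite ifT; first lra.
  have := bl_sqr l1 z1; have := cabs_ge0 (bl l z); move: (cabs _) h => x h y0 e; nra.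
have h2 := HCn s z fs z1.
have h3 := H m.+1 z s (rk r z + m.+1)%N z1 fs (leqnn _).
have h4 : (Cn + beta + C) <= m%:R * (kap / 2).
  rewrite -ler_pdivrMr ?divr_gt0 //; apply: le_trans (ltW (truncnS_gt _)) _.
  by rewrite ler_nat.
have e1 : m.+1%:R * beta = m%:R * beta + beta by rewrite -natr1 mulrDl mul1r.
have := le_trans h1 (lerD h2 h3); rewrite e1 mulrDr.
by move: (\sum_(_ <- _) _) (m%:R * beta) (m%:R * (kap / 2)) h4 => x1 x2 x3; lra.
Qed.
End duality.
End interpolation_necessity.

(** * Sampling *)

Section sampling_theory.
Context {R : realType}.
Variable r : nat -> R.
Hypothesis hr : radii r.
Variable p : nat.
Hypothesis p0 : (0 < p)%N.
Hypothesis Hp : forall j i, 1 - r (j + i * p)%N <= (1 - r j) * 2^-1 ^+ i.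
Variable L : set R[i].
Hypothesis L1 : forall l, L l -> cabs l < 1.
Implicit Types (z l u : R[i]) (s : seq R[i]).
Local Notation v := (weight r).
Local Notation t k := (1 - r k).

Let ri k : r k < r k.+1. Proof. by case: hr. Qed.

(* The lower density exceeds b iff this holds for some beta > b, see lower_densityP. *)
Definition loD beta := exists m0, forall m, (m0 <= m)%N -> forall z s, cabs z < 1 -> fin L s ->
  (forall l, L l -> cabs l < r (rk r z + m)%N -> l \in s) ->
  m%:R * beta <= \sum_(l <- s | (rk r l < rk r z + m)%N) (1 - cabs (bl l z)).

(** The embedding is tested on u^(M k) / (1 - conj l u) for a point l of ring k; at the points of
    that ring the weighted squared values are comparable with the terms pp l j. *)
Lemma embedding_CR C : 0 <= C -> (forall f B, wbound r f B -> tot r L f (C * B)) -> exists A, CR r L A.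
Proof.
move=> C0 HC; have [M [c [D [[c0 D0] Hc _ HD _]]]] := test_function hr.
exists (32 * (C * D / c)); apply: carl_CR => //; first by rewrite divr_ge0 ?mulr_ge0 // ltW.
move=> s k fs Hk l ls; have l1 := fin_lt1 L1 fs ls; have ml := mm_gt0 l1.
have h2 : 0 < 2^-1 ^+ k :> R by rewrite exprn_gt0.
have := HC _ _ (HD k l l1) s fs => h.
rewrite ler_pdivlMr // -(ler_pM2l h2) -(ler_pM2r ml) -mulrA.
have -> : 2^-1 ^+ k * (C * D) * mm l = C * (D * 2^-1 ^+ k / mm l) * mm l ^+ 2.
  by move: (2^-1 ^+ k) => y; field; rewrite gt_eqF.
apply: (le_trans _ (ler_wpM2r (sqr_ge0 (mm l)) h)).
rewrite !mulr_suml mulr_sumr big_seq [leRHS]big_seq; apply: ler_sum => j js.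
have j1 := fin_lt1 L1 fs js; have mj := mm_gt0 j1; have dj := dd_gt0 j1 l1.
have /andP[hj _] := rkP hr j1; rewrite Hk // in hj; have := Hc k j hj.
rewrite /weight Hk // cabsM exprMn cabsV (exprVn (cabs (1 - _))) -/(dd j l) => hc.
rewrite pp_sym /pp; move: (2^-1 ^+ k) h2 (dd j l) dj => y y0 d d0.
have -> : y * mm j * (cabs (j ^+ M k) ^+ 2 / d) * mm l ^+ 2 =
  cabs (j ^+ M k) ^+ 2 * (y * mm j * mm l ^+ 2 / d) by ring.
have -> : y * (mm j * mm l / d * c * mm l) = c * (y * mm j * mm l ^+ 2 / d) by ring.
apply: ler_wpM2r hc; apply: divr_ge0 (ltW d0); apply: mulr_ge0 (sqr_ge0 _).
by apply: mulr_ge0; exact: ltW.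
Qed.

(** * Necessity of the lower density condition *)

Section necessity.
Variables (A Cl : R).
Hypothesis HA : CR r L A.
Hypothesis Cl0 : 0 <= Cl.
Hypothesis Hlow : forall f B X, wbound r f B -> tot r L f X -> wbound r f (Cl * X).

Let A0 : 0 <= A := HA.1.

Let bk s z u := bprod s u * (1 - z^* * u)^-1.

Let bk_wbound s z : fin L s -> cabs z < 1 -> exists B, wbound r (bk s z) B.
Proof.
move=> fs z1; have s1 := fin_lt1 L1 fs; have mz := mm_gt0 z1; have zJ : cabs z^* < 1 by rewrite cabsJ.
have ak : analytic (fun u : R[i] => (1 - z^* * u)^-1) by apply: analytic_kernel; exact: ltW.
have wk : wbound r (fun u : R[i] => (1 - z^* * u)^-1) (2 * (mm z)^-1).
  split=> // m; have im : 0 <= (mm z)^-1 by rewrite invr_ge0 ltW.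
  apply: (@le_trans _ _ (\sum_(1 <= n < m) 2^-1 ^+ n * (mm z)^-1)).
    apply: ler_sum => n _; rewrite ler_pM2l ?exprn_gt0 //.
    by rewrite /mm -cabsJ; apply: circ2_kernel => //; exact: radii01.
  rewrite -mulr_suml; apply: ler_wpM2r => //; apply: le_trans (@sum_half_le R m).
  case: m => [|m]; first by rewrite !big_geq.
  by rewrite [leRHS]big_ltn // lerDr exprn_ge0.
exists (2 * (mm z)^-1); apply: (@wboundM _ _ hr (fun u => (1 - z^* * u)^-1) (bprod s)) => //.
  exact: analytic_bprod.
move=> u u1; have := bprod_sqr s1 u1.
have /andP[_] : 0 <= \prod_(l <- s) (1 - pp u l) <= 1 := fin_prod01 L1 xpredT fs u1.
by have := cabs_ge0 (bprod s u); nra.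
Qed.

(** The product vanishes at all points below r_N, so the sum starts at ring N and gains 2^-N; the
    kernel factor turns each ring into a Carleson sum at z. *)
Let bk_tot s z N : fin L s -> (forall l, L l -> cabs l < r N -> l \in s) -> cabs z < 1 ->
  tot r L (bk s z) (2 * A * 2^-1 ^+ N / mm z).
Proof.
move=> fs Hs z1 s' fs'; have mz := mm_gt0 z1; have s1 := fin_lt1 L1 fs; have s1' := fin_lt1 L1 fs'.
pose N' := (\max_(l <- s') rk r l).+1.
apply: (@le_trans _ _ (\sum_(l <- s' | (N <= rk r l < N')%N) 2^-1 ^+ rk r l * (pp z l / mm z))).
  rewrite [leRHS]big_mkcond big_seq [leRHS]big_seq; apply: ler_sum => l ls.
  have l1 := s1' l ls; have ml := mm_gt0 l1; have d0 := dd_gt0 l1 z1; have Ll := fs'.2 l ls.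
  have b1 : cabs (bprod s l) ^+ 2 <= 1.
    by rewrite (bprod_sqr s1 l1); case/andP: (fin_prod01 L1 xpredT fs l1).
  have -> : v l * cabs (bk s z l) ^+ 2 = cabs (bprod s l) ^+ 2 * (2^-1 ^+ rk r l * (pp z l / mm z)).
    rewrite /bk cabsM exprMn cabsV (exprVn (cabs (1 - _))) -/(dd l z) /weight pp_sym /pp.
    by move: (2^-1 ^+ _) (cabs _ ^+ 2) (dd l z) d0 => x y d d0; field; rewrite !gt_eqF.
  have q0 : 0 <= 2^-1 ^+ rk r l * (pp z l / mm z).
    by rewrite mulr_ge0 ?exprn_ge0 // divr_ge0 ?ltW // pp_gt0.
  case: ifP => [_|]; first by rewrite -[leRHS]mul1r ler_wpM2r.
  rewrite ltnS leq_bigmax_seq // andbT => /negbT; rewrite -ltnNge rk_lt // => lN.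
  have /eqP e : bprod s l == 0.
    by rewrite /bprod prodf_seq_eq0; apply/hasP; exists l; [exact: Hs|rewrite /= bl_ll].
  by rewrite e cabs0 expr0n mul0r.
rewrite sum_rings; apply: (@le_trans _ _ (\sum_(N <= k < N') 2^-1 ^+ k * (A / mm z))).
  apply: ler_sum => k _.
  rewrite (eq_bigr (fun l => 2^-1 ^+ k * (pp z l / mm z))) => [|l /eqP -> //].
  rewrite -mulr_sumr -mulr_suml ler_pM2l ?exprn_gt0 // ler_pM2r ?invr_gt0 //; exact: HA.2.
rewrite -mulr_suml; have am : 0 <= A / mm z by rewrite divr_ge0 // ltW.
have -> : 2 * A * 2^-1 ^+ N / mm z = 2 * 2^-1 ^+ N * (A / mm z).
  by move: (2^-1 ^+ N) => y; ring.
apply: ler_wpM2r => //; have [NN|NN] := leqP N' N.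
  by rewrite big_geq // mulr_ge0 // exprn_ge0.
rewrite -{1}[N]add0n big_addn (eq_bigr (fun k => 2^-1 ^+ k * 2^-1 ^+ N)) => [|k _]; last by rewrite exprD.
by rewrite -mulr_suml ler_pM2r ?exprn_gt0 //; exact: sum_half_le.
Qed.

(** The lower sampling bound makes the norm of the product small. On the circle r_k it is compared
    with the value at z, and after division the points of the rings from k to N - 1 remain as the
    only small factors, so they must be numerous. *)
Lemma log_sum_rise : exists2 C : R, 0 <= C & forall m z s N, (0 < m)%N -> cabs z < 1 -> fin L s ->
  (forall l, L l -> cabs l < r N -> l \in s) -> (rk r z + 1 + 3 * p + m <= N)%N ->
  exists2 k, (N - m <= k < N)%N & (N - k)%:R * (ln 2 / 2) + ln m%:R / 2 - C <=
    \sum_(l <- s | (k <= rk r l < N)%N) lg z l.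
Proof.
pose E := expR ((24 * p)%:R * A); have E0 : 0 < E := expR_gt0 _.
(* The summand 1 keeps K positive, so that [ln K] is meaningful when [Cl] or [A] vanishes. *)
pose K := 4 / 3 * E * (2 * Cl * A) + 1.
have K0 : 0 < K by rewrite ltr_pwDr // mulr_ge0 // ?mulr_ge0 // ltW // mulr_gt0 // divr_gt0.
exists `|ln K| => // m z s' N m0 z1 fs' Hs' hN.
pose s := seq.filter (fun l => (rk r l < N)%N) s'; have fs : fin L s := fin_filter _ fs'.
have s1 := fin_lt1 L1 fs.
have Hs l : L l -> cabs l < r N -> l \in s.
  by move=> Ll lN; rewrite mem_filter rk_lt ?L1 // lN Hs'.
have [B HB] := bk_wbound fs z1; have Tb := bk_tot fs Hs z1; have Hf := Hlow HB Tb.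
have mN : (m <= N)%N by apply: leq_trans hN; rewrite leq_addl.
have nNm : ((rk r z).+1 + 3 * p <= N - m)%N by rewrite -addn1 leq_subRL // addnC.
have Nm0 : (0 < N - m)%N by apply: leq_trans nNm; rewrite addSn.
have [k /andP[k1 k2] Hk] := pigeonhole hr Hf Nm0 m0; rewrite subnK // in k2.
exists k; first by rewrite k1.
have -> : \sum_(l <- s' | (k <= rk r l < N)%N) lg z l = \sum_(l <- s | (k <= rk r l)%N) lg z l.
  by rewrite big_filter_cond; apply: eq_bigl => l; rewrite andbC.
have nk : ((rk r z).+1 + 3 * p <= k)%N := leq_trans nNm k1.
have mz := mm_gt0 z1; have /andP[_ zr] := rkP hr z1.
have dz : 8 * t k <= 1 - cabs z := deep hr Hp zr nk.
have rk1 := radii_lt1 hr k.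
have zk : cabs z < r k by lra.
have rk0 : 0 < r k by apply: le_lt_trans zk; exact: cabs_ge0.
pose S2 : R[i] := (r k ^+ 2)%:C.
(* On |u| = r_k this factor has the modulus of [bl l u], but for points of the rings below k it has
   no zero inside that circle: their zeros are divided out, the others stay as Blaschke factors. *)
pose F l u := if (rk r l < k)%N then (S2 - l^* * u) * ((r k)%:C * (1 - l^* * u))^-1 else bl l u.
pose g u := \prod_(l <- s | l \in s) F l u * (1 - z^* * u)^-1.
have zJ : cabs z^* <= 1 by rewrite cabsJ ltW.
have rkc : (r k)%:C != 0 :> R[i] by rewrite -cabs_eq0 cabsC ger0_norm ?gt_eqF // ltW.
have aF l : l \in s -> analytic (F l).
  move=> ls; rewrite /F; case lk: (rk r l < k)%N; last exact: analytic_bl (s1 l ls).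
  apply: (analyticM (analyticB (analytic_cst S2) (analyticZ _ analytic_id))).
  apply: analyticV.
    exact: (analyticZ _ (analyticB (analytic_cst 1) (analyticZ _ analytic_id))).
  move=> u u1; rewrite mulf_neq0 // -cabs_gt0; apply: kernel_gt0 => //; exact: ltW (s1 l ls).
have ag : analytic g.
  exact: (analyticM (analytic_prod s (P := fun l => l \in s) aF) (analytic_kernel zJ)).
have rk01 : 0 <= r k < 1 := radii01 hr k.
have h1 : circ2 (r k) g <= circ2 (r k) (bk s z).
  rewrite -[leRHS]mul1r.
  apply: (circ2_le (analytic_ccont ag rk01) (analytic_ccont Hf.1 rk01)) => x; rewrite mul1r.
  set u := on_circle _ _; have uk : cabs u = r k by rewrite cabs_on_circle // ltW.
  have u1 : cabs u < 1 by rewrite uk.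
  rewrite /g /bk /bprod -big_seq !cabsM !cabs_prod le_eqVlt; apply/orP; left; apply/eqP.
  congr ((_ * _) ^+ 2); rewrite big_seq [RHS]big_seq; apply: eq_bigr => l ls; rewrite /F.
  case: ifP => // _; rewrite /bl !cabs_div cabsM cabsC ger0_norm ?(ltW rk0) //.
  have -> : S2 = u^* * u.
    by rewrite /S2 -uk -[RHS](subKr 1) one_subJ rmorphB rmorph1; ring.
  have -> : u^* * u - l^* * u = (u - l)^* * u.
    rewrite -mulrBl; congr (_ * _); move: u l {uk u1 ls} => [a b] [c d].
    by apply: eq_complex_ReIm => //=; rewrite opprD.
  rewrite cabsM uk cabsJ.
  have := kernel_gt0 u1 (ltW (s1 l ls)); move: (cabs (1 - _)) (cabs (u - l)) (r k) rk0 => a b c c0 a0.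
  by field; rewrite !gt_eqF.
have h2 := le_trans h1 Hk.
have rk01' : 0 < r k < 1 by rewrite rk0.
have h3 := le_trans (circ2_point ag rk01' zk) h2.
have h4 : 3 / 4 * mm z <= 1 - (cabs z / r k) ^+ 2.
  have := mm_scale_ge rk0 rk1 zk dz; rewrite /mm cabsM cabsC ger0_norm ?invr_ge0 ?(ltW rk0) //.
  by rewrite [_^-1 * _]mulrC.
pose P1 := \prod_(l <- s | (rk r l < k)%N) cabs (S2 - l^* * z) ^+ 2.
pose P2 := \prod_(l <- s | (rk r l < k)%N) (r k ^+ 2 * dd z l).
pose P3 := \prod_(l <- s | (k <= rk r l)%N) (1 - pp z l).
have P12 : P2 <= E * P1 := dd_prod_scale hr p0 Hp L1 HA fs z1 dz.
have P20 : 0 < P2.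
  rewrite /P2 big_seq_cond; apply: prodr_gt0 => l /andP[ls _].
  by apply: mulr_gt0; [exact: exprn_gt0|exact: (dd_gt0 z1 (s1 l ls))].
have gz : cabs (g z) ^+ 2 = P1 / P2 * P3 / mm z ^+ 2.
  rewrite /g -big_seq cabsM exprMn cabsV exprVn one_subJ cabsC ger0_norm ?(ltW mz) //.
  congr (_ / _); rewrite cabs_prod -prodrXl (bigID (fun l => (rk r l < k)%N)) /=.
  rewrite /P1 /P2 -prodf_div /P3; congr (_ * _).
    rewrite big_seq_cond [RHS]big_seq_cond; apply: eq_bigr => l /andP[ls lk].
    by rewrite /F lk cabs_div cabsM expr_div_n exprMn cabsC ger0_norm // ltW.
  rewrite big_seq_cond [RHS]big_seq_cond; apply: eq_big => [l|l /andP[ls /negPf lk]].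
    by rewrite -leqNgt.
  by rewrite /F lk bl_sqr // s1.
have P30 : 0 <= P3 by case/andP: (fin_prod01 L1 (fun l => (k <= rk r l)%N) fs z1).
have h5 : P3 <= K * (2 ^+ k * 2^-1 ^+ N / m%:R).
  have mp : 0 < m%:R :> R by rewrite ltr0n.
  have e1 : E^-1 <= P1 / P2 by rewrite ler_pdivlMr // mulrC ler_pdivrMr // mulrC.
  have q1 : 0 <= P3 / mm z ^+ 2 by rewrite divr_ge0 // sqr_ge0.
  have q2 : 0 <= cabs (g z) ^+ 2 := sqr_ge0 _.
  have {}h3 := le_trans (ler_wpM2l q2 h4) h3.
  have h6 : E^-1 * (P3 / mm z ^+ 2) <= cabs (g z) ^+ 2 by rewrite gz -mulrA; exact: ler_wpM2r.
  have q3 : 0 <= 3 / 4 * mm z by rewrite mulr_ge0 // ltW.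
  have {h3} := le_trans (ler_wpM2r q3 h6) h3.
  have x0 : 0 <= 2 ^+ k * 2^-1 ^+ N / m%:R :> R by rewrite divr_ge0 // mulr_ge0 // exprn_ge0.
  move: (2 ^+ k) (2^-1 ^+ N) x0 => x y x0 h.
  have q4 : 0 < 4 / 3 * E * mm z by rewrite mulr_gt0 // mulr_gt0.
  have := ler_wpM2l (ltW q4) h.
  have -> : 4 / 3 * E * mm z * (E^-1 * (P3 / mm z ^+ 2) * (3 / 4 * mm z)) = P3.
    by field; rewrite !gt_eqF.
  have -> : 4 / 3 * E * mm z * (x * (Cl * (2 * A * y / mm z) / m%:R)) =
      4 / 3 * E * (2 * Cl * A) * (x * y / m%:R) by field; rewrite !gt_eqF.
  by move=> h'; apply: le_trans h' _; rewrite ler_wpM2r // lerDl.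
have pos l : l \in s -> (k <= rk r l)%N -> 0 < cabs (bl l z).
  move=> ls kl; rewrite cabs_gt0 (bl_eq0 (s1 l ls) z1); apply: contraTneq kl => <-.
  by rewrite -ltnNge; apply: leq_trans nk; rewrite addSn ltnS leq_addr.
rewrite /P3 (rho2_prod_lg pos z1 s1) in h5; set V := \sum_(l <- s | _) _ in h5 *.
have kN : (k <= N)%N := ltnW k2.
have e2 : 2 ^+ k * 2^-1 ^+ N = expR (- ((N - k)%:R * ln 2)) :> R.
  by rewrite -pow2_expR -(subnKC kN) exprD mulrA half_pow mul1r addKn.
have em : (m%:R)^-1 = expR (- ln m%:R) :> R by rewrite expRN lnK // posrE ltr0n.
have eK : K = expR (ln K) by rewrite lnK.
have {h5} : expR (- (2 * V)) <= expR (ln K + (- ((N - k)%:R * ln 2) - ln m%:R)).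
  by rewrite !expRD -eK -e2 -em.
rewrite ler_expR; have := ler_norm (ln K); have := normr_ge0 (ln K); move: (`|ln K|) (ln K) => y x.
rewrite (_ : (N - k)%:R * (ln 2 / 2) = ((N - k)%:R * ln 2) / 2); last by rewrite mulrA.
by move: ((N - k)%:R * ln 2) (ln m%:R) V => a b c; lra.
Qed.

(** Blocks are peeled off from the outside by [log_sum_rise]. By the choice of m the surplus ln m /
    2 - C is at least 1/2, which pays for raising (ln 2)/2 by 1 / (2 m) over the at most m rings of
    a block. The count starts 4 p + 1 rings beyond z, so that all counted points are away from z. *)
Lemma log_sum_lower : exists (beta C : R), [/\ 0 < beta, ln 2 / 2 < beta, 0 <= C &
  forall z s N, cabs z < 1 -> fin L s -> (forall l, L l -> cabs l < r N -> l \in s) ->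
    (N - (rk r z + 1 + 4 * p))%:R * beta <=
      \sum_(l <- s | (rk r z + 1 + 4 * p <= rk r l < N)%N) lg z l + C].
Proof.
have [C C0 HC] := log_sum_rise; pose Y := 2 * C + 1.
pose m := (Num.truncn (expR Y)).+1.
have mR : 0 < m%:R :> R by rewrite ltr0n.
have lm : Y <= ln m%:R by rewrite -ler_expR lnK ?posrE //; exact: ltW (truncnS_gt _).
have l2 : 0 < ln 2 :> R by rewrite ln_gt0 // ltr1n.
pose beta : R := ln 2 / 2 + (2 * m%:R)^-1.
have im : 0 < (2 * m%:R)^-1 :> R by rewrite invr_gt0 mulr_gt0.
have b0 : 0 < beta by rewrite /beta; lra.
exists beta, (m%:R * beta); split=> //; [by rewrite /beta; lra|by rewrite mulr_ge0 // ltW|].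
move=> z s N z1 fs; set k0 := (rk r z + 1 + 4 * p)%N.
have S0 a b : 0 <= \sum_(l <- s | (a <= rk r l < b)%N) lg z l.
  rewrite big_seq_cond; apply: sumr_ge0 => l /andP[ls _]; exact: (lg_ge0 z1 (fin_lt1 L1 fs ls)).
elim/ltn_ind: N => N IH Hs; have [Nm|Nm] := leqP N (k0 + m).
  apply: le_trans (_ : m%:R * beta <= _); last by rewrite lerDr.
  by rewrite ler_pM2r // ler_nat leq_subLR.
have hN : (rk r z + 1 + 3 * p + m <= N)%N.
  apply: leq_trans (ltnW Nm); rewrite leq_add2r leq_add2l; exact: leq_mul.
have [k /andP[k1 k2] Hk] := HC m z s N (ltn0Sn _) z1 fs Hs hN.
have kk : (k0 <= k)%N by apply: leq_trans k1; rewrite leq_subRL ?(leq_trans (leq_addl _ _) (ltnW Nm)) // addnC ltnW.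
have {}IH := IH k k2 (fun l Ll h => Hs l Ll (lt_le_trans h (radii_mono hr (ltnW k2)))).
have -> : \sum_(l <- s | (k0 <= rk r l < N)%N) lg z l = \sum_(l <- s | (k0 <= rk r l < k)%N) lg z l +
   \sum_(l <- s | (k <= rk r l < N)%N) lg z l.
  by rewrite !sum_rings (big_cat_nat _ (n := k)) //= ltnW.
have -> : (N - k0)%:R * beta = (k - k0)%:R * beta + (N - k)%:R * beta.
  by rewrite -mulrDl -natrD; congr (_%:R * _); rewrite addnC addnBA // subnK // ltnW.
have jb : (N - k)%:R * beta <= (N - k)%:R * (ln 2 / 2) + 2^-1.
  rewrite /beta mulrDr lerD2l ler_pdivrMr ?mulr_gt0 //.
  rewrite mulrA mulVf // mul1r ler_nat leq_subLR -leq_subLR; first by rewrite leq_subLR addnC -leq_subLR.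
have := lerD IH Hk; move: lm jb; rewrite /Y; move: (\sum_(_ <- _ | _) _) (\sum_(_ <- _ | _) _).
by move: ((N - k)%:R * beta) ((N - k)%:R * _) (m%:R * beta) (ln m%:R) (_ * beta) => x1 x2 x3 x4 x5 y1 y2; lra.
Qed.

Lemma lower_density_bound : exists2 beta, ln 2 / 2 < beta & loD beta.
Proof.
have [beta [C [b0 bl2 C0 H]]] := log_sum_lower.
(* The excess of beta over (ln 2)/2 is cut in three: one part is kept, one absorbs the constants for
   large m, and one the factor 1 + de / 2 from [lg_sum_le]. *)
have [de [d0 d1 db]] : exists de : R, [/\ 0 < de, de <= 1 & ln 2 / 2 + 3 * de <= beta]. {
  exists (Num.min 1 ((beta - ln 2 / 2) / 3)); split.
  - by rewrite lt_min ltr01 divr_gt0 // subr_gt0.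
  - by rewrite ge_min lexx.
  - have : Num.min 1 ((beta - ln 2 / 2) / 3) <= (beta - ln 2 / 2) / 3 by rewrite ge_min lexx orbT.
    lra. }
have l2 : 0 < (ln 2 : R) <= 1.
  rewrite ln_gt0 ?ltr1n //=; have := @le_ln1Dx R 1 ltac:(lra); by rewrite (_ : 1 + 1 = 2).
have e01 : 0 < de / 2 <= 1 by apply/andP; split; lra.

have [D D0 HD] := lg_sum_le hr p0 Hp L1 HA e01 (ltac:(lra) : 0 < (2^-1 : R) < 1).
exists (ln 2 / 2 + de); first lra.
pose q := (1 + 4 * p)%N.
exists (maxn q (Num.truncn ((q%:R * beta + C + D) / de)).+1) => m; rewrite geq_max => /andP[qm mm0] z s z1 fs Hs.
have h := H z s (rk r z + m)%N z1 fs Hs.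
rewrite -addnA subnDl natrB // mulrBl in h; rewrite -/q in h.
pose P l := (rk r z + q <= rk r l < rk r z + m)%N.
have far l : l \in s -> P l -> 2^-1 <= cabs (bl l z).
  move=> ls /andP[h1 _]; have l1 := fin_lt1 L1 fs ls; have /andP[h2 _] := rkP hr l1.
  have /andP[_ h3] := rkP hr z1; have h4 : r ((rk r z).+1 + 4 * p)%N <= cabs l.
    by apply: le_trans h2; apply: radii_mono => //; rewrite -addn1 -addnA.
  have := pp_far hr Hp h3 h4 l1; rewrite (_ : 8 * 2^-1 ^+ 4 = 1 / 2 :> R); last by field.
  have := bl_sqr l1 z1; have := cabs_ge0 (bl l z); move: (cabs _) => x; nra.
have h1 := HD s P z fs z1 far; rewrite -/P in h.
have S0 : 0 <= \sum_(l <- s | P l) (1 - cabs (bl l z)).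
  rewrite big_seq_cond; apply: sumr_ge0 => l /andP[ls _]; by case: (one_sub_rho z1 (fin_lt1 L1 fs ls)).
have h2 : \sum_(l <- s | P l) (1 - cabs (bl l z)) <= \sum_(l <- s | (rk r l < rk r z + m)%N) (1 - cabs (bl l z)).
  rewrite big_mkcond [leRHS]big_mkcond big_seq [leRHS]big_seq; apply: ler_sum => l ls.
  have [x0 _ _] := one_sub_rho z1 (fin_lt1 L1 fs ls).
  by rewrite /P; case: (_ <= rk r l)%N => //=; case: ifP.
have h3 : q%:R * beta + C + D <= m%:R * de.
  by rewrite -ler_pdivrMr //; apply: le_trans (ltW (truncnS_gt _)) _; rewrite ler_nat.
apply: le_trans h2; move: h h1 S0 h3; move: (\sum_(_ <- _ | _) lg _ _) (\sum_(_ <- _ | _) (1 - _)) => x y h h1 S0 h3.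
have h4 : m%:R * (ln 2 / 2 + 2 * de) <= (1 + de / 2) * y.
  have mb : m%:R * (ln 2 / 2 + 3 * de) <= m%:R * beta by rewrite ler_wpM2l.
  have -> : m%:R * (ln 2 / 2 + 2 * de) = m%:R * (ln 2 / 2 + 3 * de) - m%:R * de by ring.
  lra.
have mR0 : 0 <= m%:R :> R by [].
have d2 : 0 < 1 + de / 2 by lra.
rewrite -(ler_pM2l d2); apply: le_trans h4; rewrite mulrCA ler_wpM2l //.
by case/andP: l2 => l20 l21; nra.
Qed.
End necessity.

(** * Sufficiency of the lower density condition *)

Section sufficiency.
Variables (A beta d : R).
Hypothesis HA : CR r L A.
Hypothesis Hd : sep L d.
Hypothesis Hlo : loD beta.
Hypothesis Hbeta : ln 2 / 2 < beta.

Let A0 : 0 <= A := HA.1.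

Let split_if (x y : R) (i a b : nat) : 0 <= y -> x <= y -> (if (i < b)%N then x else 0) <=
  (if (i < a)%N then y else 0) + (if (a <= i < b)%N then x else 0).
Proof. by case: (ltnP i b) => _; case: (ltnP i a) => _ /=; lra. Qed.

Let shift_sum (F : nat -> R) (M c : nat) : (forall n, 0 <= F n) ->
  \sum_(1 <= n < M) F (n + c)%N <= \sum_(1 <= n < M + c) F n.
Proof.
move=> F0; have -> : \sum_(1 <= n < M) F (n + c)%N = \sum_(1 + c <= n < M + c) F n.
  by rewrite big_addn addnK.
have [h|h] := leqP (1 + c) (M + c); last by rewrite big_geq ?sumr_ge0 // ltnW.
by rewrite [leRHS](big_cat_nat _ (n := (1 + c)%N)) //= lerDr sumr_ge0.
Qed.

(** Only D depends on m; C and q < 1 do not, so m can still be chosen to absorb the second term. The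
    margin of the lower density over (ln 2)/2 produces q, and (ln 2)/2 itself produces the 2^-m that
    balances a shift by m rings in the norm. *)
Lemma ring_growth : exists (q C : R) (m1 : nat), [/\ 0 <= q < 1, 0 <= C & forall m, (m1 <= m)%N ->
  exists2 D, 0 <= D & forall f n s, analytic f -> fin L s ->
    (forall l, L l -> cabs l < r (n + m)%N -> l \in s) ->
    circ2 (r n) f <= D * \sum_(l <- s | (n <= rk r l < n + m)%N) mm l * cabs (f l) ^+ 2 +
      C * (2^-1 ^+ m * q ^+ m) * circ2 (r (n + m + 3 * p)%N) f].
Proof.
have [m0 Hm0] := Hlo; have [d01 sepd] := Hd.
pose E := expR ((24 * p)%:R * A); have E0 : 0 < E := expR_gt0 _.
pose ep := beta - ln 2 / 2; have ep0 : 0 < ep by rewrite subr_gt0.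
(* [E] is the cost of rescaling. The last factor is that of the points inside r_n, which enter the
   lower density but not the product over the m rings. The 4 comes from using |x + y|^2 <= 2 (|x|^2
   + |y|^2) twice. *)
pose C := 4 * E * expR (2 * ((16 * p)%:R * A)); have C0 : 0 < C by rewrite !mulr_gt0 ?expR_gt0.
have e11 : 0 < (1 : R) <= 1 by rewrite ltr01 lexx.
have [C1 C10 HC1] := lg_sum_le hr p0 Hp L1 HA e11 d01.
exists (expR (- (2 * ep))), C, (maxn m0 1); split; [|exact: ltW|].
  by rewrite expR_ge0 expR_lt1 oppr_lt0 mulr_gt0.
move=> m; rewrite geq_max => /andP[mm0 m1].
(* The points of m rings together satisfy the Carleson condition with constant T, and separation
   bounds the products in the interpolation estimate below by 1 / Q, with Q depending on m. *)
pose T := m%:R * A; have T0 : 0 <= T by rewrite mulr_ge0.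
pose Q := expR (2 * (2 * T + C1)); have Q0 : 0 < Q := expR_gt0 _.
pose D := 32 * T * Q; have D0 : 0 <= D by rewrite mulr_ge0 ?mulr_ge0 // ltW.
exists ((2 + C) * D) => [|f n s0 af fs0 Hs0]; first by rewrite mulr_ge0 // addr_ge0 // ltW.
pose s := seq.filter (fun l => (n <= rk r l < n + m)%N) s0.
have fs : fin L s := fin_filter _ fs0; have s1 := fin_lt1 L1 fs.
have sr l : l \in s -> (n <= rk r l < n + m)%N by rewrite mem_filter => /andP[].
pose K := (n + m + 3 * p)%N; pose S := r K.
have nK : (n.+1 + 3 * p <= K)%N by rewrite /K leq_add2r -addn1 leq_add2l.
have S1 : S < 1 := radii_lt1 hr K.
have S0 : 0 < S.
  by apply: le_lt_trans (radii_ge0 hr n) _; apply: lt_le_trans (ri n) _; apply: radii_mono => //; apply: leq_trans nK; exact: leq_addr.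
have dp l : cabs l < r (n + m)%N -> 8 * t K <= 1 - cabs l by move=> h; apply: (deep hr Hp h).
have sm l : l \in s -> cabs l < r (n + m)%N.
  by move=> ls; rewrite -rk_lt ?s1 //; case/andP: (sr l ls).
have sK l : l \in s -> cabs l < S by move=> /sm h; apply: lt_le_trans h _; apply: radii_mono => //; exact: leq_addr.
pose sc z : R[i] := (S^-1)%:C * z.
have sc1 l : l \in s -> cabs (sc l) < 1 by move=> ls; apply: cabs_scale_lt1 => //; exact: sK.
have scK z : S%:C * sc z = z by rewrite /sc mulrA -rmorphM mulfV ?gt_eqF // rmorph1 mul1r.
have sinj : injective sc := can_inj scK.
pose u := [seq sc l | l <- s].
have uu : uniq u by rewrite map_inj_uniq // fs.1.
have u1 x : x \in u -> cabs x < 1 by case/mapP => l ls ->; exact: sc1.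
have ps l j : l \in s -> j \in s -> pp (sc l) (sc j) <= pp l j.
  by move=> ls js; exact: (pps_le S0 S1 (sK l ls) (sK j js)).
have inT l : l \in s -> \sum_(j <- s) pp l j <= T.
  move=> ls; rewrite big_seq (eq_bigl (fun j => (j \in s) && (n <= rk r j < n + m)%N)); last first.
    by move=> j; case js : (j \in s) => //=; rewrite sr.
  rewrite -big_seq_cond sum_rings /T.
  apply: (@le_trans _ _ (\sum_(n <= k < n + m) A)).
    apply: ler_sum => k _; exact: (HA.2 s k l fs (s1 l ls)).
  by rewrite sumr_const_nat addKn mulr_natl.
have cu : carl u T.
  move=> x /mapP[l ls ->]; rewrite big_map; apply: le_trans (inT l ls).
  by rewrite big_seq [leRHS]big_seq; apply: ler_sum => j js; exact: ps.
have lowP l : l \in s -> Q^-1 <= \prod_(i <- s | sc i != sc l) (1 - pp (sc l) (sc i)).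
  move=> ls; have l1 := s1 l ls; rewrite (eq_bigl (fun i => i != l)); last by move=> i; rewrite inj_eq.
  apply: (@le_trans _ _ (\prod_(i <- s | i != l) (1 - pp l i))); last first.
    rewrite [leLHS]big_seq_cond [leRHS]big_seq_cond; apply: ler_prod => i /andP[is' _].
    by rewrite subr_ge0 pp_le1 ?s1 //= lerD2l lerN2 ps.
  have far i : i \in s -> i != l -> d <= cabs (bl i l).
    by move=> is' il; apply: sepd; [exact: fs.2|exact: fs.2|move=> e; rewrite e eqxx in il].
  have dpos i : i \in s -> i != l -> 0 < cabs (bl i l).
    by move=> is' il; case/andP: d01 => h _; apply: lt_le_trans h _; exact: far.
  rewrite (rho2_prod_lg dpos l1 s1) /Q -expRN ler_expR lerN2 ler_pM2l //.
  apply: le_trans (HC1 s (fun i => i != l) l fs l1 far) _; rewrite lerD2r (_ : 1 + 1 = 2 :> R) // ler_pM2l //.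
  apply: le_trans (inT l ls); rewrite big_mkcond big_seq [leRHS]big_seq; apply: ler_sum => i is'.
  have [x0 x1 _] := one_sub_rho l1 (s1 i is'); case: ifP => // _; lra.
have [P [HP Pl _]] := interp (fun z => f (S%:C * z)) uu uu (fun x h => h) u1 T0 cu.
pose Y := \sum_(l <- s0 | (n <= rk r l < n + m)%N) mm l * cabs (f l) ^+ 2.
have GP : 32 * T * \sum_(l <- u) mm l * cabs (f (S%:C * l)) ^+ 2 / \prod_(i <- u | i != l) (1 - pp l i) <= D * Y. {
  rewrite [leRHS](_ : _ = 32 * T * (Q * Y)); last by rewrite /D mulrA.
  apply: ler_wpM2l; first by rewrite mulr_ge0.
  have -> : Y = \sum_(l <- s) mm l * cabs (f l) ^+ 2 by rewrite /s big_filter.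
  rewrite big_map mulr_sumr big_seq [leRHS]big_seq; apply: ler_sum => l ls.
  rewrite big_map scK; have l1 := s1 l ls; have q0 : 0 <= mm l * cabs (f l) ^+ 2.
    by apply: mulr_ge0 (sqr_ge0 _); exact: ltW (mm_gt0 l1).
  have lp := lowP l ls; have Qi : 0 < Q^-1 by rewrite invr_gt0.
  rewrite [leRHS]mulrC; apply: ler_pM.
  - by apply: mulr_ge0 (sqr_ge0 _); exact: ltW (mm_gt0 (sc1 l ls)).
  - by rewrite invr_ge0; apply: le_trans lp; exact: ltW.
  - rewrite ler_wpM2r ?sqr_ge0 // /mm lerD2l lerN2 lerXn2r ?nnegrE ?cabs_ge0 //.
    rewrite cabsM cabsC ger0_norm ?invr_ge0 ?(ltW S0) // ler_peMl ?cabs_ge0 //.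
    by rewrite invf_ge1 // ltW.
  - by rewrite -[leRHS]invrK lef_pV2 ?posrE //; apply: lt_le_trans lp. }
have Y0 : 0 <= Y.
  rewrite /Y big_seq_cond; apply: sumr_ge0 => l /andP[ls _]; apply: mulr_ge0 (sqr_ge0 _).
  exact: ltW (mm_gt0 (fin_lt1 L1 fs0 ls)).
have DY0 : 0 <= D * Y by rewrite mulr_ge0.
have HP' : hardy P (D * Y) by split; [exact: HP.1|move=> rho h; apply: le_trans (HP.2 rho h) GP].
have S01 : 0 <= S < 1 by rewrite ltW.
have hf := hardy_scale af S01; pose Z := circ2 S f; rewrite -/Z in hf.
have hfP : hardy (fun z => f (S%:C * z) - P z) (2 * (Z + D * Y)).
  split=> [|rho rho01]; first exact: (analyticB hf.1 HP'.1).
  have := circ2D (analytic_ccont hf.1 rho01) (analytic_ccont (analyticZ (-1) HP'.1) rho01) => h.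
  have -> : (fun z => f (S%:C * z) - P z) = (fun z => f (S%:C * z) + -1 * P z).
    by apply/funext => z; rewrite mulN1r.
  apply: le_trans h _; rewrite ler_pM2l // lerD ?(hf.2 _ rho01) //.
  apply: le_trans (HP'.2 rho rho01); rewrite -[leRHS]mul1r.
  apply: (circ2_le (analytic_ccont (analyticZ (-1) HP'.1) rho01) (analytic_ccont HP'.1 rho01)) => x.
  by rewrite cabsM cabsN cabs1 !mul1r.
have z0 x : x \in u -> f (S%:C * x) - P x = 0 by move=> xu; rewrite Pl ?subrr.
have [g Hg Eg] := hardy_divide uu u1 hfP z0.
pose rho := r n / S; have nS : r n < S.
  by apply: lt_le_trans (ri n) _; apply: radii_mono => //; apply: leq_trans nK; exact: leq_addr.
have rho01 : 0 <= rho < 1.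
  apply/andP; split; first by rewrite divr_ge0 ?(ltW S0) // radii_ge0.
  by rewrite ltr_pdivrMr // mul1r.
pose b := C / 4 * (2^-1 ^+ m * expR (- (2 * ep)) ^+ m).
have b0 : 0 <= b.
  rewrite mulr_ge0 // ?mulr_ge0 // ?exprn_ge0 ?expR_ge0 // divr_ge0 // ltW //.
have bB z : cabs z = rho -> cabs (bprod u z) ^+ 2 <= b.
  move=> zr; have z1 : cabs z < 1 by rewrite zr; case/andP: rho01.
  pose z' := S%:C * z; have cz : cabs z' = r n.
    by rewrite /z' cabsM cabsC ger0_norm ?(ltW S0) // zr /rho mulrC divfK // gt_eqF.
  have z'1 : cabs z' < 1 by rewrite cz radii_lt1.
  have zs : z = sc z' by rewrite /sc /z' mulrA -rmorphM mulVf ?gt_eqF // rmorph1 mul1r.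
  have rkz : rk r z' = n by apply: rk_eq => //; rewrite cz lexx ri.
  have dz : 8 * t K <= 1 - cabs z' by apply: (deep hr Hp (n := n.+1)) => //; rewrite cz ri.
  rewrite bprod_sqr // big_map.
  have -> : \prod_(l <- s) (1 - pp z (sc l)) = \prod_(l <- s | (rk r l < K)%N) (1 - pps (r K) z' l).
    rewrite zs big_seq [RHS]big_seq_cond; apply: eq_bigl => l; case ls : (l \in s) => //=.
    by rewrite rk_lt ?s1 // sK.
  apply: le_trans (rho2_prod_scale hr p0 Hp L1 HA fs z'1 dz) _.
  have -> : b = E * expR (- (2 * (m%:R * beta - (16 * p)%:R * A))).
    rewrite /b pow2_expR /C -expRM_natl.
    have -> : expR (- (2 * (m%:R * beta - (16 * p)%:R * A))) =
        expR (2 * ((16 * p)%:R * A)) * (expR (- (m%:R * ln 2)) * expR (m%:R * - (2 * ep))).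
      by rewrite -!expRD; congr expR; rewrite /ep; field.
    by field.
  apply: ler_wpM2l; first exact: ltW.
  have hm := Hm0 m mm0 z' s0 z'1 fs0; rewrite rkz in hm; have {}hm := hm Hs0.
  have hi := CR_inner hr p0 Hp L1 HA fs0 z'1; rewrite rkz in hi.
  have split_sum : \sum_(l <- s0 | (rk r l < n + m)%N) (1 - cabs (bl l z')) <=
      \sum_(l <- s0 | (rk r l < n)%N) pp z' l + \sum_(l <- s) (1 - cabs (bl l z')).
    rewrite big_filter big_mkcond [X in _ <= X + _]big_mkcond [X in _ <= _ + X]big_mkcond.
    rewrite -big_split big_seq [leRHS]big_seq /=; apply: ler_sum => l ls.
    have l1 := fin_lt1 L1 fs0 ls; have [x0 x1 _] := one_sub_rho z'1 l1.
    exact: split_if (ltW (pp_gt0 z'1 l1)) x1.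
  apply: (@le_trans _ _ (expR (- (2 * \sum_(l <- s) (1 - cabs (bl l z')))))); last first.
    by rewrite ler_expR lerN2 ler_pM2l //; lra.
  rewrite mulr_sumr -sumrN expR_sum big_seq_cond.
  apply: (@le_trans _ _ (\prod_(l <- s | l \in s) expR (- (2 * (1 - cabs (bl l z')))))); last by rewrite -big_seq.
  rewrite [leLHS](eq_bigl (fun l => l \in s)) => [|l]; last by case ls : (l \in s) => //=; rewrite rk_lt ?s1 // sK.
  apply: ler_prod => l ls; have l1 := s1 l ls; rewrite subr_ge0 pp_le1 //= -bl_sqr //.
  rewrite (_ : - (2 * _) = (cabs (bl l z') - 1) + (cabs (bl l z') - 1)); last by ring.
  rewrite expRD expr2; apply: ler_pM; rewrite ?cabs_ge0 //;
  by apply: le_trans (expR_ge1Dx _); rewrite addrC subrK.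
have cf : circ2 (r n) f = circ2 rho (fun z => f (S%:C * z)).
  by rewrite circ2_scale /rho mulrC divfK // gt_eqF.
have aP : analytic P := HP'.1.
have ag : analytic g := Hg.1.
have aB : analytic (bprod u) := analytic_bprod u1.
have e1 : circ2 rho (fun z => f (S%:C * z)) <= 2 * (circ2 rho P + b * circ2 rho g).
  have aBg : analytic (fun z => bprod u z * g z) := analyticM aB ag.
  have h := circ2D (analytic_ccont aP rho01) (analytic_ccont aBg rho01).
  have h' : circ2 rho (fun z => bprod u z * g z) <= b * circ2 rho g.
    apply: (circ2_le (analytic_ccont aBg rho01) (analytic_ccont ag rho01)) => x.
    rewrite cabsM exprMn ler_wpM2r ?sqr_ge0 // bB // cabs_on_circle //; by case/andP: rho01.
  have -> : circ2 rho (fun z => f (S%:C * z)) = circ2 rho (fun z => P z + bprod u z * g z).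
    have ePg x : cabs (on_circle rho x) < 1 by rewrite cabs_on_circle; case/andP: rho01.
    rewrite /circ2; congr (_ * _); congr (rint _ _ _); apply/funext => x /=.
    by rewrite -Eg // addrC subrK.
  by apply: le_trans h _; rewrite ler_pM2l // lerD2l.
rewrite cf; apply: le_trans e1 _.
have hP := HP'.2 rho rho01; have hg := Hg.2 rho rho01.
have bC : b <= C / 4.
  rewrite /b ler_piMr //; first by rewrite divr_ge0 // ltW.
  apply: mulr_ile1; [exact: exprn_ge0|by apply/exprn_ge0/expR_ge0|apply: exprn_ile1 => //; lra|].
  by apply: exprn_ile1; [exact: expR_ge0|apply/ltW; rewrite expR_lt1 oppr_lt0 mulr_gt0].
have hb := ler_wpM2l b0 hg.
have -> : C * (2^-1 ^+ m * expR (- (2 * ep)) ^+ m) = 4 * b by rewrite /b; field.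
have h4 : b * (D * Y) <= C / 4 * (D * Y) by rewrite ler_wpM2r.
have -> : (2 + C) * D * Y = 2 * (D * Y) + C * (D * Y) by ring.
by move: hP hb h4 DY0 C0 b0 => /=; rewrite -/Z; move: (D * Y) (circ2 rho P) (circ2 rho g) => y x1 x2; nra.
Qed.

(** [step] turns any bound B into one that retains only B / 2, and membership in the space provides
    a finite B to begin with; repeating it drives the share of B to zero. *)
Lemma sampling_lower : exists2 C : R, 0 <= C & forall f B X, 0 <= X -> wbound r f B -> tot r L f X ->
  wbound r f (C * X).
Proof.
have [q [C [m1 [q01 C0 H]]]] := ring_growth; pose c : R := 2 ^+ (3 * p).
(* The constant c = 2^(3 p) restores the weight lost by the extra 3 p rings in [ring_growth], and
   1/2 is the factor with which the norm is absorbed. *)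
have [N HN] := geom_small (C * c) q01 (ltac:(lra) : 0 < (1 / 2 : R)).
pose m := maxn m1 N; have [D D0 HD] := H m (leq_maxl _ _).
have Hq : C * c * q ^+ m <= 1 / 2 by apply: HN; exact: leq_maxr.
pose D' := D * (m%:R * 2 ^+ m); have D'0 : 0 <= D' by rewrite mulr_ge0 // mulr_ge0 // exprn_ge0.
exists (2 * D'); first by rewrite mulr_ge0.
move=> f B X X0 HB HX.
have h0 n : 0 <= 2^-1 ^+ n :> R by rewrite exprn_ge0.
have step B' : wbound r f B' -> wbound r f (D' * X + B' / 2).
  move=> HB'; have [af HW] := HB'; split=> // M.
  have [s0 fs0 Hs0] := CR_finite hr L1 HA (M + m).
  have s1 := fin_lt1 L1 fs0.
  pose Rk k := \sum_(l <- s0 | rk r l == k) mm l * cabs (f l) ^+ 2.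
  pose V k := 2^-1 ^+ k * Rk k.
  have V0 k : 0 <= V k.
    rewrite /V mulr_ge0 // /Rk big_seq_cond; apply: sumr_ge0 => l /andP[ls _].
    by apply: mulr_ge0 (sqr_ge0 _); exact: ltW (mm_gt0 (s1 l ls)).
  have VX M' : \sum_(1 <= k < M') V k <= X.
    have -> : \sum_(1 <= k < M') V k = \sum_(l <- s0 | (1 <= rk r l < M')%N) v l * cabs (f l) ^+ 2.
      rewrite sum_rings; apply: eq_bigr => k _; rewrite /V /Rk mulr_sumr.
      by apply: eq_bigr => l /eqP <-; rewrite /weight mulrA.
    apply: le_trans (HX s0 fs0); rewrite big_mkcond big_seq [leRHS]big_seq; apply: ler_sum => l ls.
    by case: ifP => // _; apply: mulr_ge0 (sqr_ge0 _); exact: ltW (weight_gt0 r (s1 l ls)).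
  pose a n := 2^-1 ^+ n * circ2 (r n) f.
  have a0 n : 0 <= a n by exact: wsum_term_ge0.
  have bd n : (1 <= n < M)%N -> a n <=
      D * \sum_(0 <= i < m) 2 ^+ m * V (n + i)%N + C * c * q ^+ m * a (n + (m + 3 * p))%N.
    move=> /andP[n1 nM]; have Hs l : L l -> cabs l < r (n + m)%N -> l \in s0.
      by move=> Ll h; apply: Hs0 => //; apply: lt_le_trans h _; apply: radii_mono => //; rewrite leq_add2r ltnW.
    have := ler_wpM2l (h0 n) (HD f n s0 af fs0 Hs); rewrite mulrDr => h; apply: le_trans h _.
    apply: lerD; last first.
      rewrite /a (addnA n m) le_eqVlt; apply/orP; left; apply/eqP.
      rewrite (exprD 2^-1 (n + m)) (exprD 2^-1 n) /c.
      have := @half_pow R (3 * p); move: (2 ^+ _) (2^-1 ^+ (3 * p)) => x y e.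
      move: (2^-1 ^+ n) (2^-1 ^+ m) (q ^+ m) (circ2 _ _) => x1 x2 x3 x4.
      by transitivity (C * (x * y) * x3 * x1 * x2 * x4); [rewrite e|]; ring.
    rewrite mulrCA; apply: ler_wpM2l => //.
    have -> : \sum_(l <- s0 | (n <= rk r l < n + m)%N) mm l * cabs (f l) ^+ 2 = \sum_(0 <= i < m) Rk (i + n)%N.
      by rewrite sum_rings -[X in \sum_(X <= _ < _) _]add0n big_addn addKn.
    rewrite mulr_sumr !big_nat; apply: ler_sum => i /andP[_ im].
    rewrite /V (addnC i) mulrA; apply: ler_wpM2r.
      by have := V0 (n + i)%N; rewrite /V pmulr_rge0 ?exprn_gt0.
    have e : 2^-1 ^+ n = 2 ^+ i * 2^-1 ^+ (n + i) :> R.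
      by rewrite exprD mulrCA half_pow mulr1.
    by rewrite e; apply: ler_wpM2r => //; rewrite ler_weXn2l ?ler1n // ltnW.
  apply: (@le_trans _ _ (\sum_(1 <= n < M) (D * \sum_(0 <= i < m) 2 ^+ m * V (n + i)%N +
      C * c * q ^+ m * a (n + (m + 3 * p))%N))).
    by rewrite /wsum !big_nat; apply: ler_sum => n; exact: bd.
  rewrite big_split /= -!mulr_sumr; apply: lerD; last first.
    have hh := le_trans (shift_sum M (m + 3 * p) a0) (HW (M + (m + 3 * p))%N).
    have B0 := wbound_ge0 HB'.
    apply: le_trans (ler_wpM2l _ hh) _; last by rewrite mulrC ler_wpM2l // -[2^-1]mul1r.
    by rewrite mulr_ge0 ?mulr_ge0 ?exprn_ge0 //; case/andP: q01.
  rewrite /D' -mulrA; apply: ler_wpM2l => //; rewrite exchange_big /=.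
  apply: (@le_trans _ _ (\sum_(0 <= i < m) 2 ^+ m * X)).
    apply: ler_sum => i _; rewrite -mulr_sumr; apply: ler_wpM2l; first by rewrite exprn_ge0.
    exact: le_trans (shift_sum M i V0) (VX _).
  by rewrite sumr_const_nat subn0 -[leLHS]mulr_natl mulrA.
have iter k : wbound r f (2 * D' * X + B * 2^-1 ^+ k).
  elim: k => [|k IH].
    by apply: wbound_mono HB; rewrite expr0 mulr1 lerDr mulr_ge0 // mulr_ge0.
  apply: wbound_mono (step _ IH); rewrite exprS; move: (2^-1 ^+ k) => y; lra.
split; first by case: HB.
move=> M; apply/ler_addgt0Pr => e e0.
have [k Hk] := geom_small B (ltac:(lra) : 0 <= (2^-1 : R) < 1) e0.
by apply: le_trans ((iter k).2 M) _; rewrite lerD2l; exact: Hk.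
Qed.
End sufficiency.
End sampling_theory.

(** * Translation to sums and densities over J *)

Section bridge.
Context {R : realType}.
Variable w : R -> R.
Hypothesis hw : admissible w.
Variables (J : set nat) (lam : nat -> R[i]).
Hypothesis hlam : distinct_points_of_disc J lam.
Local Notation r := (radius w).
Local Notation L := (lam @` J).
Local Notation v := (weight r).
Implicit Types (z l : R[i]) (F : R[i] -> R) (s : seq R[i]).

Let hr : radii r := radiiP hw.

Let L1 l : L l -> cabs l < 1.
Proof. by move=> [j Jj <-]; exact: hlam.1. Qed.

(** An [esum] is a supremum over finite sets of indices; injectivity of [lam] on J lets these be
    replaced by duplicate-free lists of points. *)
Lemma esum_le_fin (I : set nat) F (X : R) : I `<=` J -> (forall l, (lam @` I) l -> 0 <= F l) ->
  (\esum_(j in I) (F (lam j))%:E <= X%:E)%E <->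
  (forall s, fin (lam @` I) s -> \sum_(l <- s) F l <= X).
Proof.
move=> IJ F0; have inj : {in I &, injective lam}.
  by move=> i j; rewrite !inE => Ii Ij; apply: hlam.2; rewrite inE; exact: IJ.
rewrite -(esum_image I lam (fun l => (F l)%:E) inj); split.
  move=> H s [us sI]; rewrite -lee_fin -sumEFin; apply: le_trans H.
  rewrite fsbig_seq //; apply: esum_ge; exists [set` s] => //.
  by split; [exact: finite_seq|exact: sI].
move=> H; apply: ge_ereal_sup => _ [A [fA AI] <-].
rewrite fsbig_finite //= sumEFin lee_fin; apply: H; split; first exact: finmap.fset_uniq.
by move=> l; rewrite in_fset_set // inE; exact: AI.
Qed.

Lemma kernel_weight : exists c C : R, [/\ 0 < c, 0 < C &
  forall z, cabs z < 1 -> c * (v z)^-1 <= kernel_diag w z <= C * (v z)^-1].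
Proof.
have [c [C [c0 C0 H]]] := kernel_diag_bounds hw; exists c, (2 * C); split=> // [|z z1].
  by rewrite mulr_gt0.
have := H _ z (rkP hr z1); have v0 := weight_gt0 r z1; have /andP[m1 m2] := mm_le z1.
rewrite ler_pdivrMr // ler_pdivlMr // /weight; have z0 : 0 < 1 - cabs z by rewrite subr_gt0.
have := @half_pow R (rk r z); have h0 : 0 < 2^-1 ^+ rk r z :> R by rewrite exprn_gt0.
have h2 : 0 < 2 ^+ rk r z :> R by rewrite exprn_gt0.
move: (2^-1 ^+ _) (2 ^+ _) (kernel_diag w z) h0 h2 => y x k y0 x0 xy /andP[k1 k2].
have k0 : 0 < k by rewrite -(pmulr_lgt0 _ z0); apply: lt_le_trans k1; rewrite mulr_gt0.
have k1' : c <= k * (1 - cabs z) * y.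
  by have := ler_wpM2r (ltW y0) k1; rewrite -(mulrA c) xy mulr1.
have k2' : k * (1 - cabs z) * y <= C.
  by have := ler_wpM2r (ltW y0) k2; rewrite -(mulrA C) xy mulr1.
have ky : 0 < k * y by rewrite mulr_gt0.
move: (mm z) (1 - cabs z) m1 m2 z0 k1' k2' => m q m1 m2 q0 k1' k2'.
have e1 : k * q * y = k * y * q by ring.
have e2 : k * (y * m) = k * y * m by ring.
rewrite e1 in k1' k2'; rewrite e2; move: (k * y) ky k1' k2' => b b0 k1' k2'.
have := ler_wpM2l (ltW b0) m1; have := ler_wpM2l (ltW b0) m2; lra.
Qed.

Lemma separatedP : separated_points J lam <-> exists d, sep L d.
Proof.
rewrite /separated_points; set S := [set _ | _ in _]; split.
  move=> H; have [d [d0 d1 Hd]] : exists d : R, [/\ 0 < d, d < 1 & (d%:E <= ereal_inf S)%E].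
    (* When the infimum is +oo there are no two distinct points, and any d between 0 and 1
       serves. *)
    case: (ereal_inf S) H => [x| |] //; last by exists (1 / 2); split; [lra|lra|rewrite leey].
    rewrite lte_fin => x0; exists (Num.min x (1 / 2)); rewrite lt_min x0 lee_fin ge_min lexx.
    by split=> //; [lra|rewrite gt_min; apply/orP; right; lra].
  exists d; split; first by rewrite d0.
  move=> _ _ [i Ji <-] [j Jj <-] ij; rewrite -lee_fin; apply: le_trans Hd _.
  by apply: ereal_inf_lbound; exists (i, j) => //=; split=> // e; apply: ij; rewrite e.
move=> [d [/andP[d0 _] Hd]]; apply: (@lt_le_trans _ _ d%:E); first by rewrite lte_fin.
apply: le_ereal_inf_tmp => _ [[i j] /= [Ji Jj ij] <-]; rewrite lee_fin.
apply: Hd; [by exists i|by exists j|].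
by move=> e; apply: ij; apply: hlam.2 => //; rewrite inE.
Qed.

Let rho0 z l : cabs z < 1 -> cabs l < 1 -> 0 <= 1 - cabs (bl l z).
Proof. by move=> z1 l1; case: (one_sub_rho z1 l1). Qed.

Let disc_sup (I : R[i] -> set nat) (m : nat) (b : R) : (0 < m)%N -> (forall z, I z `<=` J) ->
  ((m%:R^-1)%:E * ereal_sup [set \esum_(j in I z) (1 - pseudohyp z (lam j))%:E | z in disc] <= b%:E)%E <->
  (forall z s, cabs z < 1 -> fin (lam @` I z) s -> \sum_(l <- s) (1 - cabs (bl l z)) <= m%:R * b).
Proof.
move=> m0 IJ; have mR : 0 < m%:R :> R by rewrite ltr0n.
have E z : cabs z < 1 -> (\esum_(j in I z) (1 - pseudohyp z (lam j))%:E <= (m%:R * b)%:E)%E <->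
    (forall s, fin (lam @` I z) s -> \sum_(l <- s) (1 - cabs (bl l z)) <= m%:R * b).
  move=> z1; apply: (esum_le_fin (F := fun l => 1 - cabs (bl l z)) _ (IJ z)) => _ [j Ij <-].
  by apply: rho0 => //; apply: L1; exists j => //; exact: IJ Ij.
rewrite muleC lee_pdivrMr // -EFinM mulrC; split.
  move=> H z s z1; apply: (E z z1).1; apply: le_trans H.
  by apply: ereal_sup_ubound; exists z.
by move=> H; apply: ge_ereal_sup => _ [z z1 <-]; apply/(E z z1) => s; exact: H.
Qed.

(** The bound b is extended real in order to cover both (ln 2)/2 and +oo. A strict bound on the
    limit superior is a bound by one beta < b from some m on. *)
Lemma upper_densityP (b : \bar R) : (-oo < b)%E ->
  (upper_density w J lam < b)%E <-> exists2 beta, (beta%:E < b)%E & upD r L beta.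
Proof.
move=> bN; rewrite /upper_density /limn_esup /limf_esup.
set U := fun m : nat => _; pose I m z := [set j | J j /\ (cabs (lam j) <= r (rk r z + m)%N)%R].
have IJ m z : I m z `<=` J by move=> j [].
have finI m z s : fin (lam @` I m z) s <-> fin L s /\ (forall l, l \in s -> cabs l <= r (rk r z + m)%N).
  split=> [[us H]|[[us H1] H2]].
    split; first by split=> // l /H[j [Jj _] <-]; exists j.
    by move=> l /H[j [_ h] <-].
  by split=> // l ls; have [j Jj e] := H1 l ls; exists j => //; split=> //; rewrite e; exact: H2.
split.
  move=> /ereal_inf_lt[_ [V [N _ HN] <-] HV].
  have [beta bb Hb] : exists2 beta : R, (beta%:E < b)%E & (ereal_sup (U @` V) <= beta%:E)%E.
    case: (ereal_sup _) HV => [x||] h; [by exists x|by rewrite ltNge leey in h|].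
    case: b bN h => [y|_ _|] //; first by exists (y - 1); rewrite ?lte_fin ?leNye //; lra.
    by exists 0; rewrite ?leNye // ltry.
  exists beta => //; exists (maxn N 1) => m; rewrite geq_max => /andP[Nm m0] z s z1 fs Hs.
  apply: ((disc_sup beta m0 (IJ m)).1 _ z s z1); last by apply/finI.
  by apply: le_trans Hb; apply: ereal_sup_ubound; exists m => //; exact: HN.
move=> [beta bb [m0 Hm]]; apply: le_lt_trans bb.
apply: (@le_trans _ _ (ereal_sup (U @` [set m | (maxn m0 1 <= m)%N]))).
  by apply: ereal_inf_lbound; exists [set m | (maxn m0 1 <= m)%N] => //; exists (maxn m0 1).
apply: ge_ereal_sup => _ [m /= mm <-]; move: mm; rewrite geq_max => /andP[mm0 m1].
by apply/(disc_sup beta m1 (IJ m)) => z s z1 /finI[fs Hs]; exact: Hm.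
Qed.

(** An upper bound for a sum can be tested on all finite lists, a lower bound cannot. [CR] provides,
    for each radius, one list that contains all the points of L below it, and on it the infinite sum
    is a finite one. *)
Lemma lower_densityP A (b : R) : CR r L A ->
  (b%:E < lower_density w J lam)%E <-> exists2 beta, b < beta & loD r L beta.
Proof.
move=> HA; rewrite /lower_density /limn_einf /limn_esup /limf_esup lteNr.
set U := fun m : nat => _; pose I m z := [set j | J j /\ (cabs (lam j) < r (rk r z + m)%N)%R].
have IJ m z : I m z `<=` J by move=> j [].
pose f z l := 1 - cabs (bl l z).
have E m z (s : seq R[i]) : cabs z < 1 -> fin L s -> (forall l, L l -> cabs l < r (rk r z + m)%N -> l \in s) ->
    \esum_(j in I m z) (1 - pseudohyp z (lam j))%:E = (\sum_(l <- s | (rk r l < rk r z + m)%N) f z l)%:E. {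
  move=> z1 fs Hs; have F0 l : (lam @` I m z) l -> 0 <= f z l.
    by move=> [j [Jj _] <-]; apply: rho0 => //; apply: L1; exists j.
  apply/le_anti/andP; split.
    apply/(esum_le_fin _ (IJ m z) F0) => s' [us' H].
    have ss : {subset s' <= seq.filter (fun l => (rk r l < rk r z + m)%N) s}.
      move=> l /H[j [Jj jr] <-]; have Lj : L (lam j) by exists j.
      by rewrite mem_filter rk_lt ?L1 // jr Hs.
    rewrite -[leRHS]big_filter; have us : uniq (seq.filter (fun l => (rk r l < rk r z + m)%N) s) := filter_uniq _ fs.1.
    rewrite [leRHS](bigID (fun l => l \in s')) /= -[leLHS]addr0; apply: lerD; last first.
      rewrite big_seq_cond; apply: sumr_ge0 => l /andP[]; rewrite mem_filter => /andP[_ ls] _.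
      by apply: rho0 => //; exact: (fin_lt1 L1 fs ls).
    rewrite -[leRHS]big_filter le_eqVlt; apply/orP; left; apply/eqP; apply: perm_big.
    apply: uniq_perm => //; first exact: filter_uniq.
    by move=> l; rewrite mem_filter; case ls : (l \in s') => //=; rewrite ss.
  have := (esum_le_fin (fine (\esum_(j in I m z) (1 - pseudohyp z (lam j))%:E)) (IJ m z) F0).1.
  set S := \esum_(j in _) _; case eS : S => [x| |] H; last 2 first.
  - by rewrite leey.
  - by have := esum_ge0 (fun j (Ij : I m z j) => (F0 _ (ex_intro2 _ _ j Ij erefl) : (0 <= (f z (lam j))%:E)%E)); rewrite -/S eS.
  - rewrite lee_fin -big_filter; apply: H; first exact: lexx.
  split; first exact: filter_uniq fs.1.
  move=> l; rewrite mem_filter => /andP[lr ls]; have Ll := fs.2 l ls.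
  by have [j Jj e] := Ll; exists j => //; split=> //; rewrite e -rk_lt // L1. }
split.
  move=> /ereal_inf_lt[_ [V [N _ HN] <-] HV].
  have [beta bb Hb] : exists2 beta : R, b < beta & (forall m, (N <= m)%N -> U m <= (- beta)%:E)%E.
    have [y {}HV h] : exists2 y : \bar R, (y < - b%:E)%E & forall m, (N <= m)%N -> (U m <= y)%E.
      exists (ereal_sup (U @` V)) => // m Nm; apply: ereal_sup_ubound; exists m => //; exact: HN.
    case: y HV h => [x|//|] HV h.
      exists (- x); first by move: HV; rewrite -EFinN lte_fin; lra.
      by move=> m /h; rewrite opprK.
    exists (b + 1); first lra.
    by move=> m /h h'; apply: le_trans h' _; rewrite leNye.
  exists beta => //; exists (maxn N 1) => m; rewrite geq_max => /andP[Nm m0] z s z1 fs Hs.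
  have mR : 0 < m%:R :> R by rewrite ltr0n.
  have := Hb m Nm; rewrite /U /= EFinN leeN2 muleC lee_pdivlMr // -EFinM => h.
  rewrite -lee_fin mulrC -/(f z) -(E m z s) //; apply: le_trans h _.
  by apply: ereal_inf_lbound; exists z.
move=> [beta bb [m0 Hm]]; apply: (@le_lt_trans _ _ (- beta%:E)%E); last by rewrite lte_fin; lra.
apply: (@le_trans _ _ (ereal_sup (U @` [set m | (maxn m0 1 <= m)%N]))).
  by apply: ereal_inf_lbound; exists [set m | (maxn m0 1 <= m)%N] => //; exists (maxn m0 1).
apply: ge_ereal_sup => _ [m /= mm <-]; move: mm; rewrite geq_max => /andP[mm0 m1].
have mR : 0 < m%:R :> R by rewrite ltr0n.
rewrite /U /= EFinN leeN2 muleC lee_pdivlMr // -EFinM; apply: le_ereal_inf_tmp => _ [z z1 <-].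
have [s fs Hs] := CR_finite hr L1 HA (rk r z + m).
by rewrite (E m z s) // lee_fin mulrC; exact: Hm.
Qed.

Let kdiag_sum : exists c C : R, [/\ 0 < c, 0 < C & forall (a : R[i] -> R[i]),
  (forall X : R, tot r L a X -> (\esum_(j in J) (cabs (a (lam j)) ^+ 2 / kernel_diag w (lam j))%:E <= (C * X)%:E)%E) /\
  (forall X : R, (\esum_(j in J) (cabs (a (lam j)) ^+ 2 / kernel_diag w (lam j))%:E <= X%:E)%E -> tot r L a (c * X))].
Proof.
have [c [C [c0 C0 HK]]] := kernel_weight; exists C, c^-1; split; rewrite ?invr_gt0 // => a.
have K0 l : L l -> 0 < kernel_diag w l.
  move=> Ll; have /andP[h _] := HK l (L1 Ll); apply: lt_le_trans h.
  by rewrite mulr_gt0 // invr_gt0 weight_gt0 // L1.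
have F0 l : L l -> 0 <= cabs (a l) ^+ 2 / kernel_diag w l.
  by move=> Ll; rewrite divr_ge0 ?sqr_ge0 // ltW // K0.
split=> X H.
  apply/(esum_le_fin _ (fun j h => h) F0) => s fs; have := H s fs.
  rewrite -(ler_pM2l (_ : 0 < c^-1)) ?invr_gt0 // => h; apply: le_trans h.
  rewrite mulr_sumr big_seq [leRHS]big_seq; apply: ler_sum => l ls; have Ll := fs.2 l ls.
  have v0 := weight_gt0 r (L1 Ll); have /andP[h _] := HK l (L1 Ll).
  rewrite ler_pdivrMr ?K0 // (_ : c^-1 * _ * _ = cabs (a l) ^+ 2 * (c^-1 * (v l * kernel_diag w l))); last by ring.
  rewrite ler_peMr ?sqr_ge0 // ler_pdivlMl // mulr1 mulrC.
  by rewrite -ler_pdivrMr.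
move=> s fs; have := (esum_le_fin X (fun j h => h) F0).1 H s fs; rewrite -(ler_pM2l C0) => h.
apply: le_trans h; rewrite mulr_sumr big_seq [leRHS]big_seq; apply: ler_sum => l ls; have Ll := fs.2 l ls.
have v0 := weight_gt0 r (L1 Ll); have /andP[_ h] := HK l (L1 Ll).
rewrite (mulrA C) ler_pdivlMr ?K0 // (_ : v l * _ * _ = cabs (a l) ^+ 2 * (v l * kernel_diag w l)); last by ring.
rewrite [leRHS]mulrC; apply: ler_wpM2l; first exact: sqr_ge0.
by rewrite mulrC -ler_pdivlMr.
Qed.

Lemma interpolating_interpolates : interpolating w J lam -> interpolates r L.
Proof.
move=> H a X Ha; have [c [C [c0 C0 HS]]] := kdiag_sum.
have [|f bf Hf] := H (fun j => a (lam j)).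
  exact: le_lt_trans ((HS a).1 X Ha) (ltry _).
have [B HB] := (bergmanP hw f).1 bf.
by exists f, B; split=> // _ [j Jj <-]; exact: Hf.
Qed.

Lemma interpolates_interpolating : (forall a X, 0 <= X -> tot r L a X ->
    exists2 f, (exists B, wbound r f B) & forall l, L l -> f l = a l) -> interpolating w J lam.
Proof.
move=> H a Ha; have [c [C [c0 C0 HS]]] := kdiag_sum.
(* Data are indexed by J but interpolated at points; injectivity of [lam] on J makes [b] agree with
   a. *)
pose b l := a (get [set j | J j /\ lam j = l]).
have bE j : J j -> b (lam j) = a j.
  move=> Jj; rewrite /b; have [Jg eg] : [set i | J i /\ lam i = lam j] (get [set i | J i /\ lam i = lam j]).
    by apply: getPex; exists j.
  by congr a; apply: hlam.2; rewrite ?inE.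
set S := \esum_(j in J) _ in Ha.
have eS : \esum_(j in J) (cabs (b (lam j)) ^+ 2 / kernel_diag w (lam j))%:E = S.
  by apply: eq_esum => j Jj; rewrite bE.
have [X X0 SX] : exists2 X : R, 0 <= X & (S <= X%:E)%E.
  case: (S) Ha => [x| |] // _; last by exists 0; rewrite ?leNye.
  by exists `|x|; rewrite // lee_fin ler_norm.
have := (HS b).2 X; rewrite eS => /(_ SX) Tb.
have [|f bf Hf] := H b _ _ Tb; first by rewrite mulr_ge0 // ltW.
exists f; first exact/(bergmanP hw).
by move=> j Jj; rewrite Hf ?bE //; exists j.
Qed.

Lemma sampling_bounds : sampling w J lam ->
  (exists2 C : R, 0 <= C & forall f B, wbound r f B -> tot r L f (C * B)) /\
  (exists2 C : R, 0 <= C & forall f B X, wbound r f B -> tot r L f X -> wbound r f (C * X)).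
Proof.
move=> [A [B [A0 B0 H]]]; have [c [C [c0 C0 HS]]] := kdiag_sum; split.
  exists (c * B) => [|f X HX]; first by rewrite mulr_ge0 // ltW.
  have bf : bergman w f by apply/(bergmanP hw); exists X.
  have [_ h] := H f bf; rewrite -mulrA; apply: (HS f).2; apply: le_trans h _.
  have := (norm2_le hw X HX.1).2 HX; have [N -> N0] := norm2_fin hw bf.
  by rewrite -EFinM !lee_fin ler_pM2l.
exists (C / A) => [|f B' X HB HX]; first by rewrite divr_ge0 // ltW.
have bf : bergman w f by apply/(bergmanP hw); exists B'.
apply/(norm2_le hw _ HB.1); have [h _] := H f bf; have := le_trans h ((HS f).1 X HX).
have [N -> N0] := norm2_fin hw bf; rewrite -EFinM !lee_fin.
by rewrite mulrAC ler_pdivlMr // mulrC.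
Qed.

Lemma bounds_sampling :
  (exists2 C : R, 0 <= C & forall f B, wbound r f B -> tot r L f (C * B)) ->
  (exists2 C : R, 0 <= C & forall f B X, 0 <= X -> wbound r f B -> tot r L f X -> wbound r f (C * X)) ->
  sampling w J lam.
Proof.
move=> [C1 C10 H1] [C2 C20 H2]; have [c [C [c0 C0 HS]]] := kdiag_sum.
exists (C2 * c + 1)^-1, (C * C1 + 1); split.
- by rewrite invr_gt0 ltr_wpDl // mulr_ge0 // ltW.
- by rewrite ltr_wpDl // mulr_ge0 // ltW.
- move=> f bf S; have [N eN N0] := norm2_fin hw bf; have [B HB] := (bergmanP hw f).1 bf.
have HN : wbound r f N by apply/(norm2_le hw _ HB.1); rewrite eN.
have SC : (S <= (C * (C1 * N))%:E)%E := (HS f).1 _ (H1 f N HN).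
rewrite eN; split; last first.
  apply: le_trans SC _; rewrite -EFinM lee_fin mulrA ler_wpM2r // lerDl //.
have S0 : (0 <= S)%E.
  apply: esum_ge0 => j Jj; rewrite lee_fin divr_ge0 ?sqr_ge0 //.
  have [c' [C' [c'0 _ HK]]] := kernel_weight; have l1 := hlam.1 j Jj.
  have /andP[h _] := HK _ l1; apply: le_trans h; rewrite mulr_ge0 ?invr_ge0 // ltW //; exact: weight_gt0.
case eS : S S0 SC => [x| |] // S0 _; have x0 : 0 <= x by rewrite -lee_fin.
have Tf : tot r L f (c * x) by apply: (HS f).2; rewrite -/S eS.
have cx0 : 0 <= c * x by rewrite mulr_ge0 // ltW.
have := H2 f N _ cx0 HN Tf => /(norm2_le hw _ HB.1); rewrite eN -EFinM !lee_fin => h.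
rewrite mulrC ler_pdivrMr; last by rewrite ltr_wpDl // mulr_ge0 // ltW.
by apply: le_trans h _; rewrite mulrA mulrC ler_wpM2l // lerDl.
Qed.
End bridge.

Theorem theorem2 (R : realType) (w : R -> R) (hw : admissible w)
    (J : set nat) (lam : nat -> R[i]) (hlam : distinct_points_of_disc J lam) :
  (interpolating w J lam <->
     separated_points J lam /\ (upper_density w J lam < (ln 2 / 2)%:E)%E) /\
  (separated_points J lam ->
     (sampling w J lam <->
        (upper_density w J lam < +oo)%E /\
        ((ln 2 / 2)%:E < lower_density w J lam)%E)).
Proof.
have hr := radiiP hw; have L1 l : (lam @` J) l -> cabs l < 1 by move=> [j Jj <-]; exact: hlam.1.
have [p p0 Hp] := radii_halve hr.
split; [split|move=> /(separatedP hlam)[d Hd]; split].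
- move=> /(interpolating_interpolates hw hlam)/(uniform_interpolation hr L1)[M M0 HM].
  have [A HA] := dual_CR hr Hp L1 M0 HM.
  split; first exact/(separatedP hlam)/(dual_separated hr Hp L1 M0 HM).
  have [beta hb Hb] := density_bound hr p0 Hp L1 M0 HM HA.
  by apply/(upper_densityP w hlam); [exact: ltNyr|exists beta; rewrite ?lte_fin].
- move=> [/(separatedP hlam)[d Hd] /(upper_densityP w hlam (ltNyr _))[beta hb Hb]].
  rewrite lte_fin in hb; have [C C0 HC] := interpolation_sufficient hr p0 Hp L1 Hd Hb hb.
  apply: (interpolates_interpolating hw hlam) => a X X0 Ha; have [f Hf fa] := HC a X X0 Ha.
  by exists f => //; exists (C * X).
- move=> /(sampling_bounds hw hlam)[[C C0 HC] [C' C'0 HC']].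
  have [A HA] := embedding_CR hr L1 C0 HC; split.
    apply/(upper_densityP w hlam) => //; exists ((16 * p + 2)%:R * A); rewrite ?ltry //.
    exact: (CR_upD hr p0 Hp L1 HA).
  apply/(lower_densityP hw hlam _ HA).
  exact: (lower_density_bound hr p0 Hp L1 HA C'0 HC').
- have Ny : (-oo < +oo :> \bar R)%E by [].
  move=> [/(upper_densityP w hlam Ny)[B _ HB] Hlow].
  have [A HA] := upD_CR hr L1 HB.
  have [beta hb Hb] := (lower_densityP hw hlam _ HA).1 Hlow.
  apply: (bounds_sampling hw hlam); first exact: (bessel hr p0 Hp L1 HA).
  exact: (sampling_lower hr p0 Hp L1 HA Hd Hb hb).
Qed.
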